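(* Let $w\in C^\infty(\mathbb R)$ be real-valued and compactly supported. Then for each sufficiently small $\varepsilon>0$ and each sufficiently large $N\in\mathbb R$, $N<\infty$, there exist an exact solution $v^{\langle w\rangle}(x,t)$ and an approximate solution $v^{[w]}(x,t)$ of the defocusing modified KdV equation $v_t+v_{xxx}=6v^2v_x$, defined for all $t\ge 2$, with the following properties. The approximate solution takes the form $$v^{[w]}=2\varepsilon N^{-1/2}t^{-1/2}\cos\big(\phi(x,t)\big)\,w(z),$$ where $$z=N^{-1/2}t^{-1}\big(x+3N^2t\big),$$ $$\phi(x,t)=-\Big(\frac{-4x^3}{27t}\Big)^{1/2}+6\varepsilon^2\log(t)\,N^{-1}\Big(\frac{-x}{3t}\Big)^{1/2}w^2(z),$$ and satisfies $$\|v^{[w]}(t)\|_{H^{1/4}}\sim\varepsilon\quad\text{for all }t\ge2.$$ The exact solution $v^{\langle w\rangle}$ is asymptotic to $v^{[w]}$ in the sense that $$\|v^{\langle w\rangle}(t)-v^{[w]}(t)\|_{H^{1/4}}\lesssim\varepsilon t^{-1/2}\quad\text{for all }t\ge2.$$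
   Context: Here $x\in\mathbb R$, and the $H^{1/4}$ norms are the Sobolev norms on $\mathbb R$ in the variable $x$. $A\lesssim B$ means $A\le CB$ for a constant $C$, and $A\sim B$ means $A\lesssim B\lesssim A$; the implicit constants may depend on $w$ but not on $t,\varepsilon,N$. For $N$ sufficiently large (depending on the support of $w$), $x$ is negative wherever $w(z)\ne0$, so the fractional powers are well defined there; $v^{[w]}$ is understood to be $0$ where $w(z)=0$.
   Formalization: The lower bound ε ≲ ‖v^[w](t)‖ in H^{1/4} is asserted only when w is not identically zero, since for w = 0 the approximate solution vanishes and that bound is false; everything else is stated for every w. *)

(* Defs.v *)
From HB Require Import structures.
From mathcomp Require Export all_boot all_order all_algebra.
From mathcomp Require Export all_classical all_reals all_analysis.
Export numFieldNormedType.Exports.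

Set Implicit Arguments.
Unset Strict Implicit.
Unset Printing Implicit Defensive.

Import Order.TTheory GRing.Theory Num.Theory.
Local Open Scope classical_set_scope.
Local Open Scope ring_scope.

Definition smooth (R : realType) (w : R -> R) : Prop :=
  forall (n : nat) (x : R), derivable (derive1n n w) x 1.

Definition compactly_supported (R : realType) (w : R -> R) : Prop :=
  compact (closure [set x | w x != 0]).

(* Real and imaginary parts of
     (2 pi)^(-1/2) \int_(-r)^r f(x) e^(- i x xi) dx
   for a real-valued f. *)
Definition fourier_trunc_re (R : realType) (f : R -> R) (r xi : R) : R :=
  (Num.sqrt (2 * pi))^-1 *
  \int[lebesgue_measure]_(x in `[- r, r]) (f x * cos (x * xi)).

Definition fourier_trunc_im (R : realType) (f : R -> R) (r xi : R) : R :=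
  - ((Num.sqrt (2 * pi))^-1 *
     \int[lebesgue_measure]_(x in `[- r, r]) (f x * sin (x * xi))).

(* f is in L^2(R) and a + i b is (a representative of) its Fourier-Plancherel
   transform, that is, the limit in L^2(R) of the truncated transforms. *)
Definition is_fourier (R : realType) (f a b : R -> R) : Prop :=
  let mu := @lebesgue_measure R in
  [/\ f \in Lfun mu 2%:E,
      a \in Lfun mu 2%:E /\ b \in Lfun mu 2%:E,
      Lnorm mu 2%:E (EFin \o (a \- fourier_trunc_re f r)) @[r --> +oo] --> 0%E
    & Lnorm mu 2%:E (EFin \o (b \- fourier_trunc_im f r)) @[r --> +oo] --> 0%E].

(* For s >= 0, the norm ( \int (1 + xi^2)^s |f^(xi)|^2 dxi )^(1/2) of H^s(R).
   The Fourier transform of f in L^2 is unique almost everywhere, so the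
   infimum is over a single value; if f is not in L^2 it is over the empty set
   and the norm is +oo. *)
Definition Hs_norm (R : realType) (s : R) (f : R -> R) : \bar R :=
  ereal_inf [set M | exists a b : R -> R, is_fourier f a b /\
    M = poweR (\int[lebesgue_measure]_xi
      ((1 + xi ^+ 2) `^ s * (a xi ^+ 2 + b xi ^+ 2))%:E)%E 2^-1].

(* Real-valued solutions v(x, t) of  v_t + v_xxx = 6 v^2 v_x  for t >= T:
   the equation holds pointwise for t > T, all the derivatives of v up to the
   ones it involves are continuous, v is continuous up to t = T, and
   v is in C([T, +oo); H^s(R)). *)
Definition mkdv_solution (R : realType) (s T : R) (v : R -> R -> R) : Prop :=
  let dx k x t := derive1n k (v ^~ t) x in
  let dt x t := derive1 (v x) t in
  [/\ {within [set p : R * R | T <= p.2], continuous (fun p => v p.1 p.2)},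
      forall x t : R, T < t ->
        [/\ forall k, (k < 3)%N -> derivable (derive1n k (v ^~ t)) x 1,
            derivable (v x) t 1,
            forall k, (k <= 3)%N ->
              {for (x, t), continuous (fun p : R * R => dx k p.1 p.2)}
          & {for (x, t), continuous (fun p : R * R => dt p.1 p.2)}],
      forall x t : R, T < t ->
        dt x t + dx 3%N x t = 6 * v x t ^+ 2 * dx 1%N x t
    & forall t0 : R, T <= t0 ->
        (Hs_norm s (v ^~ t0) < +oo)%E /\
        Hs_norm s (fun x => v x t - v x t0)
          @[t --> within `[T, +oo[ (nbhs t0)] --> 0%E].

Definition mkdv_z (R : realType) (N x t : R) : R :=
  N `^ (- 2^-1) * t^-1 * (x + 3 * N ^+ 2 * t).

Definition mkdv_phase (R : realType) (w : R -> R) (eps N x t : R) : R :=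
  - Num.sqrt (- 4 * x ^+ 3 / (27 * t))
  + 6 * eps ^+ 2 * ln t * N^-1 * Num.sqrt (- x / (3 * t))
    * w (mkdv_z N x t) ^+ 2.

(* Num.sqrt is 0 on negative numbers, so this is 0 wherever w(z) = 0,
   whatever the sign of x. *)
Definition mkdv_approx (R : realType) (w : R -> R) (eps N x t : R) : R :=
  2 * eps * N `^ (- 2^-1) * t `^ (- 2^-1)
  * cos (mkdv_phase w eps N x t) * w (mkdv_z N x t).

(* Main.v *)
(* Let Phi(v) = - v_xxx + 6 v^2 v_x and m = eps N^(-1/4). Adding to v^[w] a third harmonic of
   relative size eps^2 N^(-3) / t gives V with ||V_t - Phi(V)||_2 = O(m t^(-15/8)). The solution is a
   limit of flows started from V(T) at time T -> oo and run backwards to time 1. No well-posedness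
   theory is needed: the flow is replaced by explicit Euler steps with centred differences, whose
   consistency error is made negligible by a priori H^8 bounds, and the limit is taken along an
   ultrafilter, derivatives converging pointwise by equicontinuity.

   Everything rests on a bound for u = v - V which is uniform in T. From
     <u, Phi(v) - Phi(V)> = int 6 V V_x u^2 + 2 V_x u^3
   one gets ||u||_2 = O(m t^(-7/8)), provided that u is small in C^1. This smallness follows from
     int (v_xx + N^2 v)^2 + 10 v^2 v_x^2 + 2 v^6 - 2 N^2 v^4,
   a combination of three conserved quantities adapted to the frequency N: it controls
   ||u_xx + N^2 u||_2, hence sup (u_x^2 + N^2 u^2) because (u_x^2 + N^2 u^2)_x = 2 u_x (u_xx + N^2 u).

   The H^(1/4) norms are compared with L^2 norms of f and f_x: the upper bounds split frequencies at
   |xi| = p^2, with p = N^(1/2) t^(3/8) for v - v^[w]; the lower bound for v^[w] uses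
   int f_x^2 + N^2 f^2 <= C (N^(3/2) ||f||_{H^(1/4)}^2 + N^(-2) ||f_xx + N^2 f||_2^2). *)
Require Import Defs.
From Stdlib Require BinInt.
From mathcomp Require Import ssrZ measurable_realfun ring lra zify.

Set Implicit Arguments.
Unset Strict Implicit.
Unset Printing Implicit Defensive.

Import Order.TTheory GRing.Theory Num.Theory.
Local Open Scope classical_set_scope.
Local Open Scope ring_scope.

(** * Smooth functions of bounded support *)

(** The third harmonic is forced by the cubic term: V^2 V_x has L^2 norm of order t^(-1), just not
    integrable. Its resonant part is absorbed by the logarithm in the phase; the part at phase 3 phi
    is not, and the added harmonic cancels it. Run backwards, the powers t^(-k/8) grow, and this
    growth pays for the errors that remain: every bound is a barrier preserved by one Euler step.
    Three kinds of constants must be kept apart. Those of the conclusion ([c], [K], [K1], [k4]) do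
    not depend on N, eps, T. Those that only give compactness ([CN], [L], [a3], [a4], [B4]) may
    depend on N and eps, but not on T. The bounds of order 5 to 8 may depend on T as well, because
    the mesh is chosen after them. A difference step keeps supports bounded, which the exact flow
    does not, so integrations by parts leave no boundary terms. The residual of V is a polynomial in
    a few kinds of atoms, and its cancellations are verified by computation on formal
    polynomials. *)

Notation dx := derive1.
Notation dn := derive1n.

Section smooth_functions.
Context {R : realType}.
Implicit Types f g : R -> R.

Definition dble f := forall x, derivable f x 1.

Lemma smooth_dble f : smooth f -> dble f.
Proof. by move=> h x; exact: (h 0%N x). Qed.

Lemma smooth_der f : smooth f -> smooth (dx f).
Proof. by move=> h n x; have := h n.+1 x; rewrite derive1Sn. Qed.

(** Stands in for formulas for the n-th derivative: to get smoothness it is enough to name a class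
    of differentiable functions closed under one derivation. It serves again for translates,
    primitives and the profiles of the approximate solution. *)
Lemma smooth_stable (P : (R -> R) -> Prop) :
  (forall f, P f -> dble f /\ P (dx f)) -> forall f, P f -> smooth f.
Proof.
move=> h f Pf n; move: f Pf; elim: n => [|n ih] f Pf x.
  by have [/(_ x)] := h f Pf.
by rewrite derive1Sn; apply: ih; have [] := h f Pf.
Qed.

Lemma dbleD f g : dble f -> dble g -> dble (f + g).
Proof. by move=> hf hg x; exact: derivableD. Qed.
Lemma dbleM f g : dble f -> dble g -> dble (f * g).
Proof. by move=> hf hg x; exact: derivableM. Qed.

Lemma dxD f g : dble f -> dble g -> (dx (f + g)) = (dx f) + (dx g).
Proof. by move=> hf hg; apply/funext => x; rewrite derive1E deriveD// -!derive1E. Qed.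

Lemma dxM f g : dble f -> dble g -> (dx (f * g)) = (dx f) * g + f * (dx g).
Proof.
move=> hf hg; apply/funext => x; rewrite derive1E deriveM// -!derive1E /GRing.scale/=.
by rewrite addrC mulrC.
Qed.

Lemma dx_cst c : (dx (cst c : R -> R)) = 0.
Proof. by apply/funext => x; rewrite derive1_cst. Qed.

(** Products of smooth functions alone are not closed under derivation; the ring they generate is,
    so [smooth_stable] applies to it. *)
Inductive sgen : (R -> R) -> Prop :=
| sgen0 f : smooth f -> sgen f
| sgenC c : sgen (cst c)
| sgenD f g : sgen f -> sgen g -> sgen (f + g)
| sgenM f g : sgen f -> sgen g -> sgen (f * g).

Lemma sgen_smooth f : sgen f -> smooth f.
Proof.
move: f; apply: smooth_stable => f; elim=> {f}.
- by move=> f hf; split; [exact: smooth_dble|apply: sgen0; exact: smooth_der].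
- by move=> c; split; [move=> x; exact: derivable_cst|rewrite dx_cst; exact: (sgenC 0)].
- by move=> f g _ [df sf] _ [dg sg]; split; [exact: dbleD|rewrite dxD//; exact: sgenD].
- move=> f g gf [df sf] gg [dg sg]; split; first exact: dbleM.
  by rewrite dxM//; apply: sgenD; exact: sgenM.
Qed.

Lemma smoothD f g : smooth f -> smooth g -> smooth (f + g).
Proof. by move=> *; apply: sgen_smooth; apply: sgenD; exact: sgen0. Qed.
Lemma smoothM f g : smooth f -> smooth g -> smooth (f * g).
Proof. by move=> *; apply: sgen_smooth; apply: sgenM; exact: sgen0. Qed.
Lemma smoothC c : smooth (cst c : R -> R).
Proof. by apply: sgen_smooth; exact: sgenC. Qed.

Lemma is_derive_shift (f : R -> R) (a x : R) :
  derivable f (x + a) 1 -> is_derive x 1 (fun y => f (y + a)) ((dx f) (x + a)).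
Proof.
move=> hf; have df : is_derive (x + a) 1 f ((dx f) (x + a)).
  by rewrite derive1E; exact: derivableP.
have dg : is_derive x (1:R) (fun y : R => y + a) 1.
  by apply: is_derive_eq; rewrite addr0.
have := @is_derive1_comp R f (fun y => y + a) x _ _ df dg.
by rewrite mulr1.
Qed.

Lemma dx_shift f a : dble f -> (dx (fun x => f (x + a))) = (fun x => (dx f) (x + a)).
Proof.
move=> hf; apply/funext => x; rewrite derive1E.
by have [_ ->] := is_derive_shift (hf (x + a)).
Qed.

Lemma smooth_shift f a : smooth f -> smooth (fun x => f (x + a)).
Proof.
move=> hf.
apply: (@smooth_stable (fun h => exists g, smooth g /\ h = fun x => g (x + a))); last by exists f.
move=> _ [g [sg ->]]; split.
  by move=> x; have [] := is_derive_shift (@smooth_dble _ sg (x + a)).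
by exists (dx g); split; [exact: smooth_der|rewrite dx_shift//; exact: smooth_dble].
Qed.

Lemma smooth_cont f : smooth f -> continuous f.
Proof. by move=> h x; apply: differentiable_continuous; apply/derivable1_diffP; exact: smooth_dble. Qed.

(** A radius rather than compactness of the support: the proofs only take maxima of radii and choose
    intervals of integration. The class is stable under derivatives, products and translations,
    hence under every step of the difference scheme. *)
Definition cs f := smooth f /\ exists M : R, forall x, M < `|x| -> f x = 0.

Lemma cs_smooth f : cs f -> smooth f. Proof. by case. Qed.
Lemma cs_dble f : cs f -> dble f. Proof. by move=> /cs_smooth/smooth_dble. Qed.
Lemma cs_cont f : cs f -> continuous f. Proof. by move=> /cs_smooth/smooth_cont. Qed.

Lemma csD f g : cs f -> cs g -> cs (f + g).
Proof.
move=> [sf [M hM]] [sg [K hK]]; split; first exact: smoothD.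
exists (Num.max M K) => x; rewrite gt_max => /andP[h1 h2].
by rewrite -[LHS]/(f x + g x) hM// hK// addr0.
Qed.
Lemma csMl f g : smooth f -> cs g -> cs (f * g).
Proof.
move=> sf [sg [K hK]]; split; first exact: smoothM.
by exists K => x h2; rewrite -[LHS]/(f x * g x) hK// mulr0.
Qed.
Lemma csM f g : cs f -> cs g -> cs (f * g).
Proof. by move=> cf cg; apply: csMl => //; exact: cs_smooth. Qed.
Lemma csZ c f : cs f -> cs (cst c * f).
Proof. by move=> cf; apply: csMl => //; exact: smoothC. Qed.
Lemma csN f : cs f -> cs (- f).
Proof.
move=> cf; have -> : - f = cst (-1) * f by apply/funext => x; rewrite /cst/= -[RHS]/(-1 * f x) mulN1r.
exact: csZ.
Qed.
Lemma csB f g : cs f -> cs g -> cs (f - g).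
Proof. by move=> cf cg; apply: csD => //; exact: csN. Qed.
Lemma cs0 : cs (0 : R -> R).
Proof. by split; [exact: smoothC|by exists 0]. Qed.
Lemma csX f n : cs f -> cs (f ^+ n.+1).
Proof. by move=> cf; elim: n => [//|n ih]; rewrite exprS; exact: csM. Qed.

Lemma cs_shift f a : cs f -> cs (fun x => f (x + a)).
Proof.
move=> [sf [M hM]]; split; first exact: smooth_shift.
exists (M + `|a|) => x hx; apply: hM.
have := ler_normD (x + a) (- a); rewrite normrN addrK => h; lra.
Qed.

Lemma derive1_near0 f (x : R) : (\forall y \near x, f y = 0) -> (dx f) x = 0.
Proof.
move=> h; rewrite derive1E; have -> : 'D_1 f x = 'D_1 (cst 0) x by exact: near_eq_derive.
by rewrite derive_cst.
Qed.

Lemma cs_der f : cs f -> cs (dx f).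
Proof.
move=> [sf [M hM]]; split; first exact: smooth_der.
exists M => x hx; apply: derive1_near0.
have h : \forall y \near x, M < `|y|.
  by move/cvgr_gt : (@norm_continuous _ R x); apply.
by near=> y; apply: hM; near: y; exact: h.
Unshelve. all: by end_near.
Qed.

End smooth_functions.

#[global] Hint Resolve csD csM csB csN csZ csX cs_der cs0 cs_shift : core.

(** * The L^2 pairing on functions of bounded support *)

Section integral.
Context {R : realType}.
Implicit Types f g h : R -> R.
Local Notation mu := (@lebesgue_measure R).

Definition ii f : R := \int[mu]_x f x.
Definition ip f g : R := ii (f * g).
Definition nn f : R := ii (f * f).

Lemma ii_itv f M a b : (forall x, M < `|x| -> f x = 0) -> a < - M -> M < b ->
  ii f = \int[mu]_(x in `[a, b]) f x.
Proof.
move=> hM aM Mb; rewrite /ii [RHS]Rintegral_mkcond; apply: eq_Rintegral => x _.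
rewrite /patch; case: ifPn => // /negP hx.
rewrite hM// ltNge; apply/negP => hle; apply: hx.
rewrite inE/= in_itv/=; move: hle; rewrite ler_norml; lra.
Qed.

Lemma supp_integrable f M : continuous f -> (forall x, M < `|x| -> f x = 0) ->
  mu.-integrable [set: R] (EFin \o f).
Proof.
move=> cf hM.
have h : mu.-integrable `[- M, M] (EFin \o f).
  apply: continuous_compact_integrable; first exact: segment_compact.
  exact: continuous_subspaceT.
move: h; rewrite integrable_mkcond//.
apply: eq_integrable => // x _; rewrite /patch; case: ifPn => // /negP hx.
rewrite /= hM// ltNge; apply/negP => hle; apply: hx.
by rewrite inE/= in_itv/= -ler_norml.
Qed.

Lemma cs_integrable f : cs f -> mu.-integrable [set: R] (EFin \o f).
Proof. by move=> cf; have [sf [M hM]] := cf; apply: supp_integrable hM; exact: smooth_cont. Qed.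

Lemma iiD f g : cs f -> cs g -> ii (f + g) = ii f + ii g.
Proof. by move=> cf cg; rewrite /ii RintegralD//; exact: cs_integrable. Qed.

Lemma iiZ c f : cs f -> ii (cst c * f) = c * ii f.
Proof. by move=> cf; rewrite /ii -RintegralZl//; exact: cs_integrable. Qed.

Lemma iiN f : cs f -> ii (- f) = - ii f.
Proof.
move=> cf; have -> : - f = cst (-1) * f by apply/funext => x; rewrite -[RHS]/(-1 * f x) mulN1r.
by rewrite iiZ// mulN1r.
Qed.

Lemma iiB f g : cs f -> cs g -> ii (f - g) = ii f - ii g.
Proof. by move=> cf cg; rewrite iiD ?iiN//; exact: csN. Qed.

Lemma ii_ge0 f : (forall x, 0 <= f x) -> 0 <= ii f.
Proof. by move=> h; apply: Rintegral_ge0 => x _. Qed.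

Lemma ii_le f g : cs f -> cs g -> (forall x, f x <= g x) -> ii f <= ii g.
Proof. by move=> cf cg h; apply: le_Rintegral => //; exact: cs_integrable. Qed.

Lemma ii_prim f P M a b : continuous f -> (forall x, M < `|x| -> f x = 0) ->
  (forall x : R, is_derive x 1 P (f x)) -> a < - M -> M < b -> a < b ->
  ii f = P b - P a.
Proof.
move=> cf hM hP aM Mb ab.
rewrite (@ii_itv f M a b)//.
have cP : continuous P.
  by move=> x; apply: differentiable_continuous; apply/derivable1_diffP; have [] := hP x.
rewrite /Rintegral (@continuous_FTC2 _ f P)//.
- exact: continuous_subspaceT.
- split; first by move=> x _; have [] := hP x.
  + by apply: cvg_at_right_filter; exact: cP.
  + by apply: cvg_at_left_filter; exact: cP.
- by move=> x _; rewrite derive1E; have [_ ->] := hP x.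
Qed.

Lemma dble_is_derive f (x : R) : dble f -> is_derive x 1 f (dx f x).
Proof. by move=> hf; rewrite derive1E; exact: derivableP. Qed.

Lemma ii_dx f : cs f -> ii (dx f) = 0.
Proof.
move=> cf; have [sf [M hM]] := cf.
have [sf' [K hK]] := cs_der cf.
pose L := `|M| + `|K| + 1.
have h1 := ler_norm M; have h2 := ler_norm K; have h3 := normr_ge0 M; have h4 := normr_ge0 K.
have L0 : 0 < L by rewrite /L; lra.
have hd (x : R) : is_derive x 1 f (dx f x) by apply: dble_is_derive; exact: cs_dble.
have -> : ii (dx f) = f L - f (- L).
  by apply: (ii_prim (smooth_cont sf') hK hd); rewrite /L; lra.
by rewrite hM ?hM ?subr0// ?normrN ger0_norm /L//; lra.
Qed.

Lemma prim_exists f M : continuous f -> (forall x, M < `|x| -> f x = 0) ->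
  exists P : R -> R, forall x : R, is_derive x 1 P (f x).
Proof.
move=> cf hM; exists (fun x => \int[mu]_(t in `]-oo, x]) f t) => x.
have hi : mu.-integrable `]-oo, (x + 1)] (EFin \o f).
  by apply: integrableS (supp_integrable cf hM).
have [] := @continuous_FTC1 R f -oo%O x (x+1) _ hi _ (cf x).
- lra.
- by rewrite ltNyr.
by move=> h1 h2; split; [exact: h1|rewrite -derive1E h2].
Qed.

(** Both integrals are the same increment of one primitive [P] of [f], over an interval that
    contains the support; no change of variables is needed. *)
Lemma ii_shift f a : cs f -> ii (fun x => f (x + a)) = ii f.
Proof.
move=> cf; have [sf [M hM]] := cf; have ctf := smooth_cont sf.
have [P hP] := prim_exists ctf hM.
have h1 := ler_norm M; have h2 := ler_norm a; have h3 := normr_ge0 M; have h4 := normr_ge0 a.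
have h5 := ler_norm (-a); rewrite normrN in h5.
pose L := `|M| + `|a| + 1.
have -> : ii f = P (L + a) - P (- L + a).
  by apply: (ii_prim ctf hM hP); rewrite /L; lra.
have hd (x : R) : is_derive x 1 (fun x => P (x + a)) (f (x + a)).
  by have [h6 h7] := hP (x + a); have := is_derive_shift h6; rewrite derive1E h7.
have hM' x : M + `|a| < `|x| -> f (x + a) = 0.
  by move=> hx; apply: hM; have := ler_normD (x + a) (-a); rewrite normrN addrK; lra.
by apply: (ii_prim (smooth_cont (@smooth_shift _ f a sf)) hM' hd); rewrite /L; lra.
Qed.

Lemma ipC f g : ip f g = ip g f. Proof. by rewrite /ip mulrC. Qed.
Lemma ipDl f g h : cs f -> cs g -> cs h -> ip (f + g) h = ip f h + ip g h.
Proof. by move=> *; rewrite /ip mulrDl iiD//; exact: csM. Qed.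
Lemma ipBl f g h : cs f -> cs g -> cs h -> ip (f - g) h = ip f h - ip g h.
Proof. by move=> *; rewrite /ip mulrBl iiB//; exact: csM. Qed.
Lemma ipZl c f g : cs f -> cs g -> ip (cst c * f) g = c * ip f g.
Proof. by move=> *; rewrite /ip -mulrA iiZ//; exact: csM. Qed.
Lemma ipDr f g h : cs f -> cs g -> cs h -> ip h (f + g) = ip h f + ip h g.
Proof. by move=> *; rewrite ipC ipDl// ipC; congr (_ + _); rewrite ipC. Qed.
Lemma ipBr f g h : cs f -> cs g -> cs h -> ip h (f - g) = ip h f - ip h g.
Proof. by move=> *; rewrite ipC ipBl// ipC; congr (_ - _); rewrite ipC. Qed.
Lemma ipZr c f g : cs f -> cs g -> ip f (cst c * g) = c * ip f g.
Proof. by move=> *; rewrite ipC ipZl// ipC. Qed.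

Lemma ip_dx f g : cs f -> cs g -> ip (dx f) g = - ip f (dx g).
Proof.
move=> cf cg; apply/eqP; rewrite -subr_eq0 opprK; apply/eqP.
rewrite /ip -iiD; [|apply: csM; auto..].
by rewrite -dxM; [apply: ii_dx; exact: csM|exact: cs_dble..].
Qed.

Lemma nn_ge0 f : 0 <= nn f.
Proof. by apply: ii_ge0 => x; rewrite -[X in _ <= X]/(f x * f x) -expr2 sqr_ge0. Qed.

Lemma nnE f : nn f = ip f f. Proof. by []. Qed.

Lemma nnD f g : cs f -> cs g -> nn (f + g) = nn f + 2 * ip f g + nn g.
Proof. move=> cf cg; rewrite !nnE ipDl ?ipDr; auto; rewrite (ipC g f); ring. Qed.
Lemma nnB f g : cs f -> cs g -> nn (f - g) = nn f - 2 * ip f g + nn g.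
Proof. move=> cf cg; rewrite !nnE ipBl ?ipBr; auto; rewrite (ipC g f); ring. Qed.
Lemma nnZ c f : cs f -> nn (cst c * f) = c ^+ 2 * nn f.
Proof. move=> cf; rewrite !nnE ipZl ?ipZr; auto; ring. Qed.

Lemma CS2 f g : cs f -> cs g -> ip f g ^+ 2 <= nn f * nn g.
Proof.
move=> cf cg.
have h c : 0 <= nn f - 2 * c * ip f g + c ^+ 2 * nn g.
  rewrite -nnZ// -mulrA -ipZr// -nnB; auto; exact: nn_ge0.
have := nn_ge0 g; rewrite le_eqVlt => /predU1P[g0|g0].
  have [->|nz] := eqVneq (ip f g) 0; first by rewrite expr0n/= mulr_ge0// nn_ge0.
  (* With [nn g = 0] the quadratic in [c] is affine, and this value makes it negative. *)
  have := h ((nn f + 1) / ip f g); rewrite -g0 mulr0 addr0 -mulrA mulfVK//.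
  by have := nn_ge0 f; lra.
have := h (ip f g / nn g).
have -> : nn f - 2 * (ip f g / nn g) * ip f g + (ip f g / nn g) ^+ 2 * nn g
   = (nn f * nn g - ip f g ^+ 2) / nn g by field; rewrite gt_eqF.
by rewrite pmulr_lge0 ?invr_gt0// subr_ge0.
Qed.

Definition nm f := Num.sqrt (nn f).
Lemma nm_ge0 f : 0 <= nm f. Proof. exact: sqrtr_ge0. Qed.
Lemma nm2 f : nm f ^+ 2 = nn f. Proof. by rewrite sqr_sqrtr// nn_ge0. Qed.

Lemma CS f g : cs f -> cs g -> `|ip f g| <= nm f * nm g.
Proof.
move=> cf cg; rewrite -(@ler_pXn2r _ 2%N)// ?nnegrE ?mulr_ge0 ?nm_ge0//.
by rewrite -normrX ger0_norm ?sqr_ge0// exprMn !nm2; exact: CS2.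
Qed.

Lemma nmD f g : cs f -> cs g -> nm (f + g) <= nm f + nm g.
Proof.
move=> cf cg; rewrite -(@ler_pXn2r _ 2%N)// ?nnegrE ?addr_ge0 ?nm_ge0//.
rewrite nm2 nnD// sqrrD !nm2 mulr2n.
have := CS cf cg; have := ler_norm (ip f g); lra.
Qed.

Lemma nmZ c f : cs f -> nm (cst c * f) = `|c| * nm f.
Proof. by move=> cf; rewrite /nm nnZ// sqrtrM ?sqr_ge0// sqrtr_sqr. Qed.
Lemma nmN f : nm (- f) = nm f.
Proof. by rewrite /nm /nn; congr (Num.sqrt (ii _)); ring. Qed.
Lemma nmB f g : cs f -> cs g -> nm (f - g) <= nm f + nm g.
Proof. by move=> cf cg; rewrite -(nmN g); apply: nmD => //; exact: csN. Qed.

Lemma nm_shift f a : cs f -> nm (fun x => f (x + a)) = nm f.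
Proof. by move=> cf; rewrite /nm /nn -[in RHS](@ii_shift _ a)//; exact: csM. Qed.

Lemma nm_mul f g B : smooth f -> cs g -> 0 <= B -> (forall x, `|f x| <= B) -> nm (f * g) <= B * nm g.
Proof.
move=> cf cg B0 hB; rewrite -(@ler_pXn2r _ 2%N)// ?nnegrE ?mulr_ge0 ?nm_ge0//.
rewrite exprMn !nm2 -nnZ//; apply: ii_le; [apply: csM; exact: csMl|apply: csM; exact: csZ|].
move=> x; rewrite -[X in X <= _]/(f x * g x * (f x * g x)) -[X in _ <= X]/(B * g x * (B * g x)).
rewrite -!expr2 !exprMn; apply: ler_wpM2r; first exact: sqr_ge0.
by rewrite -(ger0_norm (sqr_ge0 (f x))) normrX ler_pXn2r ?nnegrE.
Qed.

Lemma ii_norm_le f g : cs f -> cs g -> (forall x, `|f x| <= g x) -> `|ii f| <= ii g.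
Proof.
move=> cf cg h; rewrite ler_norml -iiN//; apply/andP; split; apply: ii_le; auto => x;
  have := h x; rewrite ler_norml => /andP[].
- by rewrite -[X in X <= _ -> _]/((- g) x).
- by [].
Qed.

End integral.

(** * Pointwise bounds by L^2 norms *)

Section sup_bounds.
Context {R : realType}.
Implicit Types f g h H q : R -> R.

Lemma is_derive_cont H h : (forall x : R, is_derive x 1 H (h x)) -> continuous H.
Proof.
by move=> hH x; apply: differentiable_continuous; apply/derivable1_diffP; have [] := hH x.
Qed.

Lemma mvt H h (a b : R) : (forall x : R, is_derive x 1 H (h x)) -> a <= b ->
  exists c, a <= c <= b /\ H b - H a = h c * (b - a).
Proof.
move=> hH ab; have [c hc e] := @MVT_segment R H h a b ab (fun x _ => hH x) (continuous_subspaceT (is_derive_cont hH)).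
by exists c; split => //; move: hc; rewrite in_itv.
Qed.

Lemma ge0_derive_le H h : (forall x : R, is_derive x 1 H (h x)) -> (forall x, 0 <= h x) ->
  forall a b, a <= b -> H a <= H b.
Proof.
move=> hH h0 a b ab; have [c [_ e]] := mvt hH ab.
by rewrite -subr_ge0 e mulr_ge0// subr_ge0.
Qed.

Lemma is_derive_const_prim H h : (forall x : R, is_derive x 1 H (h x)) ->
  forall a b, a <= b -> (forall x, a <= x <= b -> h x = 0) -> H a = H b.
Proof.
move=> hH a b ab h0; have [c [cab /eqP]] := mvt hH ab.
by rewrite (h0 c cab) mul0r subr_eq0 => /eqP ->.
Qed.

Lemma prim_increment f H M a b : cs f -> (forall x : R, is_derive x 1 H (f x)) ->
  (forall x, M < `|x| -> f x = 0) -> (forall x, 0 <= f x) -> a <= b -> H b - H a <= ii f.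
Proof.
move=> cf hH hM f0 ab.
pose L := `|M| + `|a| + `|b| + 1.
have h1 := ler_norm M; have h2 := ler_norm a; have h3 := ler_norm b.
have h4 := ler_norm (- a); have h5 := ler_norm (- b); have h6 := ler_norm (- M).
rewrite !normrN in h4 h5 h6.
rewrite (ii_prim (smooth_cont (cs_smooth cf)) hM hH (a := - L) (b := L)); rewrite /L; try lra.
have le1 := ge0_derive_le hH f0.
by have := le1 b L; have := le1 (-L) a; rewrite /L; lra.
Qed.

Lemma young_inf (y A B : R) : 0 <= A -> 0 <= B ->
  (forall s, 0 < s -> y <= s * A ^+ 2 + s^-1 * B ^+ 2) -> y <= 2 * (A * B).
Proof.
move=> A0 B0 h; apply/ler_addgt0Pr => e e0.
pose e' := e / (2 * (A + B) + 4 + 2 * e).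
have d0 : 0 < 2 * (A + B) + 4 + 2 * e by lra.
have e'0 : 0 < e' by rewrite divr_gt0.
have e'1 : e' <= 1 by rewrite ler_pdivrMr// mul1r; lra.
have ee : e' * (2 * (A + B) + 4 + 2 * e) = e by rewrite divfK// gt_eqF.
have Ap : 0 < A + e' by lra.
have Bp : 0 < B + e' by lra.
have sp : 0 < (B + e') / (A + e') by rewrite divr_gt0.
have := h _ sp; rewrite invf_div => h1.
have h2 : (B + e') / (A + e') * A ^+ 2 <= (B + e') * (A + e').
  rewrite -mulrA ler_pM2l// ler_pdivrMl//; nra.
have h3 : (A + e') / (B + e') * B ^+ 2 <= (A + e') * (B + e').
  rewrite -mulrA ler_pM2l// ler_pdivrMl//; nra.
have : e' * e' <= e' by rewrite ler_piMl// ltW.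
have : 0 <= e' * e by rewrite mulr_ge0// ltW.
lra.
Qed.

(* Integrating [2 f g <= s f^2 + g^2 / s] from -oo and optimizing over s. *)
Lemma sup_energy q f g x : cs q -> cs f -> cs g ->
  dx q = cst 2 * f * g -> q x <= 2 * (nm f * nm g).
Proof.
move=> cq cf cg dq; apply: young_inf; rewrite ?nm_ge0// => s s0.
rewrite !nm2.
pose h := cst s * (f * f) + cst s^-1 * (g * g).
have ch : cs h by apply: csD; apply: csZ; exact: csM.
have -> : s * nn f + s^-1 * nn g = ii h by rewrite /h iiD ?iiZ //; auto using csM, csZ.
have [_ [M hM]] := ch; have [_ [K hK]] := cq.
have [H hH] := prim_exists (smooth_cont (cs_smooth ch)) hM.
pose L := `|K| + `|x| + 1.
have k1 := ler_norm K; have k2 := normr_ge0 x; have k3 := ler_norm (-x).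
rewrite normrN in k3; have k4 := normr_ge0 K.
have h0 y : 0 <= h y.
  rewrite -[h y]/(s * (f y * f y) + s^-1 * (g y * g y)) -!expr2.
  by rewrite addr_ge0// mulr_ge0// ?sqr_ge0// ?invr_ge0 ltW.
have hd (y : R) : is_derive y 1 (H - q) (h y - dx q y).
  by apply: is_deriveB => //; apply: dble_is_derive; exact: cs_dble.
have hd0 y : 0 <= h y - dx q y.
  rewrite dq -[X in 0 <= X]/(s * (f y * f y) + s^-1 * (g y * g y) - 2 * f y * g y).
  have -> : s * (f y * f y) + s^-1 * (g y * g y) - 2 * f y * g y = (s * f y - g y) ^+ 2 / s.
    by field; rewrite gt_eqF.
  by rewrite divr_ge0 ?sqr_ge0// ltW.
have lx : - L <= x by rewrite /L; lra.
have := ge0_derive_le hd hd0 lx; rewrite -[(H - q) x]/(H x - q x) -[(H - q) (-L)]/(H (-L) - q (-L)).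
have -> : q (-L) = 0 by apply: hK; rewrite normrN ger0_norm /L; lra.
have := prim_increment ch hH hM h0 lx; lra.
Qed.

Lemma sup_nm f x : cs f -> f x ^+ 2 <= 2 * (nm f * nm (dx f)).
Proof.
move=> cf; apply: (@sup_energy (f * f)); auto using csM.
by rewrite dxM; [|exact: cs_dble..]; apply/funext => y; rewrite -[LHS]/(dx f y * f y + f y * dx f y) -[RHS]/(2 * f y * dx f y); ring.
Qed.

(** Cauchy-Schwarz on one interval, kept in terms of a primitive [H] of f_x^2: in the difference
    estimates the increments of [H] are integrated over the position of the interval, which a global
    norm would not allow. *)
Lemma holder_local f H a b : cs f -> (forall x : R, is_derive x 1 H (dx f x ^+ 2)) -> a <= b ->
  (f b - f a) ^+ 2 <= (b - a) * (H b - H a).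
Proof.
move=> cf hH ab.
have H0 : 0 <= H b - H a by rewrite subr_ge0; apply: (ge0_derive_le hH) => // x; exact: sqr_ge0.
(* The two signs give the two halves of the absolute value. In each case s x + H / s - 2 t f is
   nondecreasing, its derivative being (s - t f_x)^2 / s. *)
have key (t : R) : (t = 1) \/ (t = -1) -> t * (f b - f a) <= Num.sqrt (b - a) * Num.sqrt (H b - H a).
  move=> ht; rewrite -(@ler_pM2l _ 2)//; apply: young_inf; rewrite ?sqrtr_ge0// => s s0.
  rewrite !sqr_sqrtr ?subr_ge0//; last by rewrite -subr_ge0.
  have hd (y : R) : is_derive y 1 (cst s * id + cst s^-1 * H - cst (2 * t) * f : R -> R) (s + s^-1 * dx f y ^+ 2 - 2 * t * dx f y).
    have df : is_derive y 1 f (dx f y) by apply: dble_is_derive; exact: cs_dble.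
    have dH := hH y.
    have := is_deriveB (is_deriveD (is_deriveZ s (is_derive_id y (1:R))) (is_deriveZ s^-1 dH)) (is_deriveZ (2 * t) df).
    by move/is_derive_eq; apply; rewrite /GRing.scale/= mulr1.
  have hd0 y : 0 <= s + s^-1 * dx f y ^+ 2 - 2 * t * dx f y.
    have -> : s + s^-1 * dx f y ^+ 2 - 2 * t * dx f y = (s - t * dx f y) ^+ 2 / s.
      by case: ht => ->; field; rewrite gt_eqF.
    by rewrite divr_ge0 ?sqr_ge0// ltW.
  have := ge0_derive_le hd hd0 ab.
  rewrite -[X in X <= _ -> _]/(s * a + s^-1 * H a - 2 * t * f a) -[X in _ <= X -> _]/(s * b + s^-1 * H b - 2 * t * f b).
  lra.
have h1 := key 1 (or_introl erefl); have h2 := key (-1) (or_intror erefl).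
have h3 : `|f b - f a| <= Num.sqrt (b - a) * Num.sqrt (H b - H a) by rewrite ler_norml; lra.
rewrite -(@ger0_norm _ ((f b - f a) ^+ 2)) ?sqr_ge0// normrX.
apply: (le_trans (y := (Num.sqrt (b - a) * Num.sqrt (H b - H a)) ^+ 2)).
  by rewrite ler_pXn2r ?nnegrE// mulr_ge0// sqrtr_ge0.
by rewrite exprMn !sqr_sqrtr ?subr_ge0// -subr_ge0.
Qed.

Lemma holder_nm f a b : cs f -> `|f b - f a| <= Num.sqrt `|b - a| * nm (dx f).
Proof.
move=> cf; wlog ab : a b / a <= b.
  move=> h; have [|ba] := leP a b; first exact: h.
  by rewrite distrC (distrC b); apply: h; exact: ltW.
have c2 : cs (dx f * dx f) by apply: csM; auto.
have [_ [M hM]] := c2.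
have [H hH] := prim_exists (smooth_cont (cs_smooth c2)) hM.
have hH' (x : R) : is_derive x 1 H (dx f x ^+ 2) by rewrite expr2; exact: hH.
have h := holder_local cf hH' ab.
have h2 : H b - H a <= nn (dx f).
  apply: (prim_increment c2 hH hM) => // x; rewrite -[X in 0 <= X]/(dx f x * dx f x) -expr2; exact: sqr_ge0.
rewrite (ger0_norm (_ : 0 <= b - a)) ?subr_ge0//.
rewrite -(@ler_pXn2r _ 2%N)// ?nnegrE ?mulr_ge0 ?nm_ge0 ?sqrtr_ge0//.
rewrite -normrX ger0_norm ?sqr_ge0// exprMn nm2 sqr_sqrtr ?subr_ge0//.
by apply: (le_trans h); apply: ler_wpM2l; rewrite ?subr_ge0.
Qed.

End sup_bounds.

(** * Centred differences *)

Section differences.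
Context {R : realType}.
Implicit Types f g H k : R -> R.

(** Centred, so that it is skew for the pairing like d/dx ([ip_Dh]); the energy identities then
    survive discretization up to commutators. *)
Definition Dh (h : R) f : R -> R := fun x => (f (x + h) - f (x - h)) / (2 * h).

Lemma DhE h f : Dh h f = cst (2 * h)^-1 * ((fun x => f (x + h)) - (fun x => f (x + - h))).
Proof. by apply/funext => x; rewrite /Dh mulrC. Qed.

Lemma cs_Dh h f : cs f -> cs (Dh h f).
Proof. by move=> cf; rewrite DhE; apply: csZ; apply: csB; exact: cs_shift. Qed.

(** [K] is, up to no factor, [k] convolved with the indicator of [-h, h]. Its integral is computed
    without Fubini, from the vanishing integral of the derivative of x K(x), where K' = k(x + h) -
    k(x - h). *)
Lemma window k H (h : R) : cs k -> (forall x : R, is_derive x 1 H (k x)) -> 0 < h ->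
  exists K, [/\ cs K, (forall x, K x = H (x + h) - H (x - h)) & ii K = 2 * h * ii k].
Proof.
move=> ck hH h0.
have dH : dx H = k by apply/funext => x; rewrite derive1E; have [_ ->] := hH x.
have dbH : dble H by move=> x; have [] := hH x.
have sH : smooth H.
  apply: (@smooth_stable R (fun f => f = H \/ smooth f)); last by left.
  move=> f [->|sf]; split; [exact: dbH|by rewrite dH; right; exact: cs_smooth| |].
  - exact: smooth_dble.
  - by right; exact: smooth_der.
pose K := ((fun x => H (x + h)) - (fun x => H (x + - h))).
have cK : cs K.
  split.
    apply: smoothD; first exact: smooth_shift.
    have -> : - (fun x => H (x + - h)) = cst (-1) * (fun x => H (x + - h)).
      by apply/funext => x; rewrite -[RHS]/(-1 * H (x + - h)) mulN1r.
    by apply: smoothM; [exact: smoothC|exact: smooth_shift].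
  have [_ [M hM]] := ck.
  exists (`|M| + h) => x hx; rewrite -[K x]/(H (x + h) - H (x - h)); apply/eqP; rewrite subr_eq0 eq_sym; apply/eqP.
  apply: (is_derive_const_prim hH); first lra.
  move=> y hy; apply: hM; have := ler_norm M.
  have [x0|x0] := leP 0 x; [rewrite (ger0_norm x0) in hx|rewrite (ltr0_norm x0) in hx].
  - have := ler_norm y; lra.
  - have := ler_norm (-y); rewrite normrN; lra.
exists K; split => //.
have dK : dx K = (fun x => k (x + h)) - (fun x => k (x + - h)).
  apply/funext => x; rewrite derive1E.
  have d1 : is_derive x 1 (fun x => H (x + h)) (k (x + h)) by rewrite -dH; apply: is_derive_shift.
  have d2 : is_derive x 1 (fun x => H (x + - h)) (k (x + - h)) by rewrite -dH; apply: is_derive_shift.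
  by have [_ ->] := is_deriveB d1 d2.
have sid : smooth (id : R -> R).
  apply: (@smooth_stable R (fun f => f = id \/ exists c, f = cst c)); last by left.
  move=> f [->|[c ->]]; split.
  - by move=> x; exact: derivable_id.
  - by right; exists 1; apply/funext => x; rewrite derive1_id.
  - by move=> x; exact: derivable_cst.
  - by right; exists 0; rewrite dx_cst.
have c1 : cs (id * K) by apply: csMl.
have := ii_dx c1; rewrite dxM; [|exact: smooth_dble|exact: cs_dble].
have cik : cs (id * k) by exact: csMl.
have cik1 := cs_shift h cik; have cik2 := cs_shift (- h) cik.
have ck1 := cs_shift h ck; have ck2 := cs_shift (- h) ck.
pose A := (fun x => (id * k) (x + h)) - (fun x => (id * k) (x + - h)).
pose B := cst h * ((fun x => k (x + h)) + (fun x => k (x + - h))).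
have cA : cs A by exact: csB.
have cB : cs B by apply: csZ; exact: csD.
have -> : dx id * K + id * dx K = K + (A - B).
  apply/funext => x; rewrite dK.
  rewrite -[LHS]/(dx id x * K x + x * (k (x + h) - k (x - h))) derive1_id.
  rewrite -[RHS]/(K x + (((x + h) * k (x + h) - (x - h) * k (x - h)) - h * (k (x + h) + k (x - h)))).
  ring.
rewrite (iiD cK (csB cA cB)) (iiB cA cB) /A /B (iiB cik1 cik2) (iiZ _ (csD ck1 ck2)) (iiD ck1 ck2).
rewrite !(ii_shift _ cik) !(ii_shift _ ck); lra.
Qed.

(** Integrates a pointwise bound by increments of a primitive of [k]: each point is counted by the
    windows that contain it, which have total length 2 h. *)
Lemma nm_Dh_bound f k h (c : R) : cs f -> cs k -> 0 < h -> 0 <= c -> (forall x, 0 <= k x) ->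
  (forall H, (forall x : R, is_derive x 1 H (k x)) -> forall x, f x ^+ 2 <= c * (H (x + h) - H (x - h))) ->
  nn f <= c * (2 * h * ii k).
Proof.
move=> cf ck h0 c0 k0 hf.
have [_ [M hM]] := ck.
have [H hH] := prim_exists (smooth_cont (cs_smooth ck)) hM.
have [K [cK eK <-]] := window ck hH h0.
rewrite -iiZ//; apply: ii_le; auto using csM, csZ => x.
by rewrite -[X in X <= _]/(f x * f x) -[X in _ <= X]/(c * K x) eK -expr2; exact: hf.
Qed.

Lemma nm_Dh f h : cs f -> 0 < h -> nm (Dh h f) <= nm (dx f).
Proof.
move=> cf h0; rewrite /nm ler_sqrt ?nn_ge0//.
have -> : nn (dx f) = (2 * h)^-1 * (2 * h * ii (dx f * dx f)) by rewrite mulKf// gt_eqF// mulr_gt0.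
apply: nm_Dh_bound; auto using csM, cs_Dh.
- by rewrite invr_ge0; lra.
- by move=> x; rewrite -[X in 0 <= X]/(dx f x * dx f x) -expr2 sqr_ge0.
move=> H hH x; have hH' (y : R) : is_derive y 1 H (dx f y ^+ 2) by rewrite expr2; exact: hH.
have ab : x - h <= x + h by lra.
have := holder_local cf hH' ab.
have -> : x + h - (x - h) = 2 * h by ring.
rewrite /Dh expr_div_n ler_pdivrMr; last by rewrite exprn_gt0//; lra.
have -> : (2 * h)^-1 * (H (x + h) - H (x - h)) * (2 * h) ^+ 2 = 2 * h * (H (x + h) - H (x - h)).
  by field; rewrite gt_eqF.
by rewrite mulrC.
Qed.

(** The quotient equals f_x at some [c] in the window, so its distance to f_x(x) is controlled by
    f_xx on the window. First order in h is enough, since h will be as small as needed. *)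
Lemma nm_Dh_dx f h : cs f -> 0 < h -> nm (Dh h f - dx f) <= 2 * h * nm (dx (dx f)).
Proof.
move=> cf h0; rewrite -(@ler_pXn2r _ 2%N) ?nnegrE ?mulr_ge0 ?nm_ge0//; try lra.
rewrite exprMn !nm2.
apply: (le_trans (y := h * (2 * h * nn (dx (dx f))))); last first.
  by rewrite mulrA; apply: ler_wpM2r; rewrite ?nn_ge0//; nra.
apply: nm_Dh_bound; auto using csM, csB, cs_Dh, cs_der, ltW.
- by move=> x; rewrite -[X in 0 <= X]/(dx (dx f) x * dx (dx f) x) -expr2 sqr_ge0.
move=> H hH x; have hH' (y : R) : is_derive y 1 H (dx (dx f) y ^+ 2) by rewrite expr2; exact: hH.
have ab : x - h <= x + h by lra.
have df (y : R) : is_derive y 1 f (dx f y) by apply: dble_is_derive; exact: cs_dble.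
have [c [cab e]] := mvt df ab.
have -> : (Dh h f - dx f) x = dx f c - dx f x.
  rewrite -[LHS]/(Dh h f x - dx f x) /Dh e; congr (_ - _); field; rewrite gt_eqF//.
have mono := ge0_derive_le hH' (fun x => sqr_ge0 _).
have [cx|xc] := leP c x.
- rewrite -sqrrN opprB; apply: (le_trans (holder_local (cs_der cf) hH' cx)).
  have := mono c x cx; have := mono (x - h) c; have := mono x (x + h); move: cab; nra.
- apply: (le_trans (holder_local (cs_der cf) hH' (ltW xc))).
  have := mono x c (ltW xc); have := mono (x - h) x; have := mono c (x + h); move: cab; nra.
Qed.

(** Without a derivative on the right the price is h^(-1); this only enters the restriction on the
    time step. *)
Lemma nm_Dh_inv f h : cs f -> 0 < h -> nm (Dh h f) <= h^-1 * nm f.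
Proof.
move=> cf h0; rewrite DhE nmZ; last by apply: csB; exact: cs_shift.
have := nmB (cs_shift h cf) (cs_shift (-h) cf); rewrite !nm_shift// => le.
rewrite ger0_norm ?invr_ge0; last lra.
apply: (le_trans (ler_wpM2l _ le)); first by rewrite invr_ge0; lra.
by rewrite le_eqVlt; apply/orP; left; apply/eqP; field; rewrite gt_eqF.
Qed.

Lemma dx_Dh f h : dble f -> dx (Dh h f) = Dh h (dx f).
Proof.
move=> cf; apply/funext => x; rewrite derive1E.
have d1 : is_derive x 1 (fun x => f (x + h)) (dx f (x + h)) by apply: is_derive_shift.
have d2 : is_derive x 1 (fun x => f (x + - h)) (dx f (x + - h)) by apply: is_derive_shift.
have := is_deriveM (is_derive_cst ((2 * h)^-1 : R) x 1) (is_deriveB d1 d2).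
rewrite DhE => -[_ ->]; rewrite /Dh /GRing.scale/=; ring.
Qed.

Lemma ip_Dh f g h : cs f -> cs g -> ip (Dh h f) g = - ip f (Dh h g).
Proof.
move=> cf cg; rewrite !DhE ipZl ?ipZr; auto using csB, cs_shift.
rewrite ipBl ?ipBr; auto using cs_shift.
have e a : ip (fun x => f (x + a)) g = ip f (fun x => g (x + - a)).
  rewrite /ip -[RHS](@ii_shift _ _ a); last by apply: csM => //; exact: cs_shift.
  by congr (ii _); apply/funext => x; rewrite -[RHS]/(f (x + a) * g (x + a - a)) addrK.
by rewrite !e opprK; ring.
Qed.

End differences.

(** * Conserved quantities *)

Ltac csx := repeat match goal with
 | H : cs ?g |- cs ?f => constr_eq f g; exact H
 | |- cs (derive1 _) => refine (@cs_der _ _ _)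
 | |- cs (Dh _ _) => refine (@cs_Dh _ _ _ _)
 | |- cs (- _) => refine (@csN _ _ _)
 | |- cs (_ + _) => refine (@csD _ _ _ _ _)
 | |- cs (_ ^+ _) => refine (@csX _ _ _ _)
 | |- cs (cst _ * _) => refine (@csZ _ _ _ _)
 | |- cs (_ * _) => refine (@csM _ _ _ _ _)
 | |- cs 0 => exact (@cs0 _)
 end.

Section norm_bounds.
Context {R : realDomainType}.
Implicit Types x y X Y : R.
Lemma nbD x y X Y : `|x| <= X -> `|y| <= Y -> `|x + y| <= X + Y.
Proof. by move=> hx hy; apply: (le_trans (ler_normD _ _)); exact: lerD. Qed.
Lemma nbN x X : `|x| <= X -> `|- x| <= X. Proof. by rewrite normrN. Qed.
Lemma nbM x y X Y : `|x| <= X -> `|y| <= Y -> `|x * y| <= X * Y.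
Proof. by move=> hx hy; rewrite normrM; exact: ler_pM. Qed.
Lemma nbX x X n : `|x| <= X -> `|x ^+ n| <= X ^+ n.
Proof. by move=> hx; rewrite normrX lerXn2r ?nnegrE//; exact: le_trans (normr_ge0 _) hx. Qed.
Lemma nbC (n : nat) : `|n%:R : R| <= n%:R. Proof. by rewrite ger0_norm. Qed.
Lemma nb1 : `|1 : R| <= 1. Proof. by rewrite normr1. Qed.
End norm_bounds.

Ltac nb := repeat first [eassumption | exact: nbC | exact: nb1 | apply: nbX | apply: nbN | apply: nbD | apply: nbM].

Section mkdv_functionals.
Context {R : realType}.
Implicit Types f g u v V P : R -> R.

Definition Phi f : R -> R := - dx (dx (dx f)) + cst 6 * (f ^+ 2 * dx f).
(** Annihilates the waves of frequency N, hence V to leading order. Bounds on [Dop N u] replace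
    bounds on u_xx, which would lose powers of N. *)
Definition Dop (N : R) f : R -> R := dx (dx f) + cst (N ^+ 2) * f.

Lemma cs_Phi f : cs f -> cs (Phi f). Proof. by move=> cf; rewrite /Phi; csx. Qed.
Lemma cs_Dop N f : cs f -> cs (Dop N f). Proof. by move=> cf; rewrite /Dop; csx. Qed.

(** Conservation laws are verified by exhibiting the flux [P]; what remains is a polynomial identity
    between derivatives at one point. *)
Lemma ii_mod f g P dP : cs f -> cs g -> cs P -> (forall x : R, is_derive x 1 P (dP x)) ->
  (forall x, f x = g x + dP x) -> ii f = ii g.
Proof.
move=> cf cg cP hP e.
have -> : f = g + dx P.
  by apply/funext => x; rewrite e -[RHS]/(g x + dx P x) derive1E; have [_ ->] := hP x.
by rewrite iiD; [rewrite ii_dx ?addr0|csx..].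
Qed.

Lemma ip_Dop N f g : cs f -> cs g -> ip (Dop N f) g = ip f (Dop N g).
Proof.
move=> cf cg; rewrite /Dop ipDl ?ipDr; try by csx.
rewrite ipZl ?ipZr; try by csx.
by congr (_ + _); rewrite ip_dx ?ip_dx ?opprK; csx.
Qed.

Lemma sup_Dop N u x : cs u -> dx u x ^+ 2 + N ^+ 2 * u x ^+ 2 <= 2 * (nm (dx u) * nm (Dop N u)).
Proof.
move=> cu; have := @sup_energy R ((dx u) ^+ 2 + cst (N ^+ 2) * u ^+ 2) (dx u) (Dop N u) x.
apply; [by csx|by csx|exact: cs_Dop|].
apply/funext => y; rewrite derive1E.
  have d0 : is_derive y 1 u (dx u y) by apply: dble_is_derive; exact: cs_dble.
  have d1 : is_derive y 1 (dx u) (dx (dx u) y) by apply: dble_is_derive; apply: cs_dble; csx.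
  have [_ ->] := is_deriveD (is_deriveX 2 d1) (is_deriveM (is_derive_cst (N ^+ 2) y 1) (is_deriveX 2 d0)).
  by rewrite /Dop !fctE /GRing.scale/=; ring.
Qed.

(** By parts, int u_x^2 = N^2 int u^2 - int u (u_xx + N^2 u). *)
Lemma nn_dx_Dop N u : cs u -> nn (dx u) <= N ^+ 2 * nn u + nm u * nm (Dop N u).
Proof.
move=> cu; have -> : nn (dx u) = N ^+ 2 * nn u - ip u (Dop N u).
  rewrite nnE ip_dx; try by csx.
  by rewrite /Dop ipDr ?ipZr -?nnE; [ring|csx..].
have := CS cu (cs_Dop N cu); have := ler_norm (- ip u (Dop N u)); rewrite normrN; lra.
Qed.

Definition NLd (N : R) f : R -> R :=
  cst 10 * (f ^+ 2 * (dx f) ^+ 2) + cst 2 * f ^+ 6 - cst (2 * N ^+ 2) * f ^+ 4.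
(** This is E_2 - 2 N^2 E_1 + N^4 E_0 with the conserved quantities E_0 = int f^2, E_1 = int f_x^2 +
    f^4 and E_2 = int f_xx^2 + 10 f^2 f_x^2 + 2 f^6. The function [gradI] below is its L^2
    gradient. *)
Definition Ifun (N : R) f : R := nn (Dop N f) + ii (NLd N f).
Definition gradI (N : R) f : R -> R :=
  cst 2 * Dop N (Dop N f) - cst 20 * (f * (dx f) ^+ 2) - cst 20 * (f ^+ 2 * dx (dx f))
  + cst 12 * f ^+ 5 - cst (8 * N ^+ 2) * f ^+ 3.

Lemma cs_NLd N f : cs f -> cs (NLd N f). Proof. by move=> cf; rewrite /NLd; csx. Qed.
Lemma cs_gradI N f : cs f -> cs (gradI N f).
Proof. by move=> cf; rewrite /gradI /Dop; csx. Qed.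

Lemma derives f : cs f -> forall y : R, is_derive y 1 f (dx f y).
Proof. by move=> cf y; apply: dble_is_derive; exact: cs_dble. Qed.

Lemma dx_add f g : cs f -> cs g -> dx (f + g) = dx f + dx g.
Proof. by move=> cf cg; exact: (dxD (cs_dble cf) (cs_dble cg)). Qed.
Lemma dx_mul f g : cs f -> cs g -> dx (f * g) = dx f * g + f * dx g.
Proof. by move=> cf cg; exact: (dxM (cs_dble cf) (cs_dble cg)). Qed.
Lemma dx_opp f : cs f -> dx (- f) = - dx f.
Proof. by move=> cf; apply/funext => x; have [_ e] := is_deriveN (derives cf x); by rewrite derive1E e. Qed.
Lemma dx_scale c f : cs f -> dx (cst c * f) = cst c * dx f.
Proof.
move=> cf; rewrite dxM; [|by move=> y; exact: derivable_cst|exact: (cs_dble cf)].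
by rewrite dx_cst mul0r add0r.
Qed.
Lemma dx_exp n f : cs f -> dx (f ^+ n.+1) = cst n.+1%:R * (f ^+ n * dx f).
Proof.
move=> cf; apply/funext => x; rewrite derive1E; have [_ ->] := is_deriveX n.+1 (derives cf x).
by rewrite /GRing.scale/= -[RHS]/(n.+1%:R * ((f ^+ n) x * dx f x)) mulrA exprfctE.
Qed.
Lemma dx_sqr f : cs f -> dx (f ^+ 2) = cst 2 * (f * dx f).
Proof. by move=> cf; rewrite dx_exp// expr1. Qed.

End mkdv_functionals.

(* Purely syntactic rewriting, to avoid conversion tests between functions. *)
Ltac rw_syn t e := let H := fresh in have H : t = _ := e;
  pattern t; refine (@eq_ind_r _ _ _ _ t H); cbv beta; clear H.
Ltac dxr := repeat match goal with |- context [@derive1 ?K ?V ?h] =>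
  let t := constr:(@derive1 K V h) in
  match h with
  | ?f + ?g => rw_syn t (@dx_add _ f g ltac:(csx) ltac:(csx))
  | - ?f => rw_syn t (@dx_opp _ f ltac:(csx))
  | cst ?c * ?f => rw_syn t (@dx_scale _ c f ltac:(csx))
  | ?f * ?g => rw_syn t (@dx_mul _ f g ltac:(csx) ltac:(csx))
  | ?f ^+ 2 => rw_syn t (@dx_sqr _ f ltac:(csx))
  | ?f ^+ (S (S (S ?n))) => rw_syn t (@dx_exp _ n.+2 f ltac:(csx))
  end end.
Ltac ptw := repeat match goal with
 | |- context [(?f + ?g) ?x] => change ((f + g) x) with (f x + g x)
 | |- context [(- ?f) ?x] => change ((- f) x) with (- f x)
 | |- context [(?f * ?g) ?x] => change ((f * g) x) with (f x * g x)
 | |- context [(?f ^+ ?n) ?x] => change ((f ^+ n) x) with (f x ^+ n)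
 | |- context [(@cst _ _ ?c) ?x] => change (cst c x) with c
 end.

(* Derivatives are generalized first: comparing them as atoms up to conversion is expensive. *)
Ltac gend := repeat match goal with |- context [@derive1 ?R ?V ?f ?x] => generalize (@derive1 R V f x); intro end.
Ltac genii := repeat match goal with
 | |- context [@ii ?R ?f] => generalize (@ii R f); intro
 | |- context [@ip ?R ?f ?g] => generalize (@ip R f g); intro
 | |- context [@nn ?R ?f] => generalize (@nn R f); intro
 end.
Ltac dring := gend; by [ring|field].

Section mkdv_identities.
Context {R : realType}.
Implicit Types f g u v V P : R -> R.

(** [P] collects the fluxes of the three conservation laws, one for each of the powers N^0, N^2,
    N^4. The derivatives are passed as separate functions, so that the final identity is between
    independent letters. *)
Lemma gradI_flux N (f f1 f2 f3 f4 : R -> R) : cs f -> cs f1 -> cs f2 -> cs f3 -> cs f4 ->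
  dx f = f1 -> dx f1 = f2 -> dx f2 = f3 -> dx f3 = f4 ->
  ii ((f4 + cst (2 * N ^+ 2) * f2 + cst (N ^+ 4) * f - cst 10 * (f * f1 ^+ 2) - cst 10 * (f ^+ 2 * f2)
  + cst 6 * f ^+ 5 - cst (4 * N ^+ 2) * f ^+ 3) * (- f3 + cst 6 * (f ^+ 2 * f1))) = 0.
Proof.
move=> c0 c1 c2 c3 c4 e1 e2 e3 e4.
pose P : R -> R := (cst (- 2^-1) * f3 ^+ 2 + cst (2^-1) * f1 ^+ 4 - cst 2 * (f * (f1 ^+ 2 * f2))
  + cst 2 * (f ^+ 2 * f2 ^+ 2) + cst 6 * (f ^+ 2 * (f1 * f3)) - cst 15 * (f ^+ 4 * f1 ^+ 2)
  - cst 6 * (f ^+ 5 * f2) + cst (9 / 2) * f ^+ 8)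
  + cst (N ^+ 2) * (cst 4 * (f ^+ 3 * f2) - f2 ^+ 2 - cst 4 * f ^+ 6)
  + cst (N ^+ 4) * (cst 2^-1 * f1 ^+ 2 - f * f2 + cst (3/2) * f ^+ 4).
have cP : cs P by rewrite /P; csx.
rewrite -(ii_dx cP); congr ii; apply/funext => x; rewrite /P.
by dxr; rewrite e1 e2 e3 e4; ptw; field.
Qed.

Lemma gradI_Phi N f : cs f -> ip (gradI N f) (Phi f) = 0.
Proof.
move=> cf; pose q := gradI N f.
have [c1 c2 c3 c4] : [/\ cs (dx f), cs (dx (dx f)), cs (dx (dx (dx f))) & cs (dx (dx (dx (dx f))))] by split; csx.
have -> : gradI N f = cst 2 * (dx (dx (dx (dx f))) + cst (2 * N ^+ 2) * dx (dx f) + cst (N ^+ 4) * f - cst 10 * (f * (dx f) ^+ 2) - cst 10 * (f ^+ 2 * dx (dx f))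
  + cst 6 * f ^+ 5 - cst (4 * N ^+ 2) * f ^+ 3).
  by rewrite /gradI /Dop; dxr; apply/funext => x; ptw; dring.
rewrite ipZl; [|csx|exact: cs_Phi].
by rewrite /ip /Phi (gradI_flux N cf c1 c2 c3 c4)// mulr0.
Qed.

Lemma Phi_diff u V : cs u -> cs V ->
  ip u (Phi (V + u) - Phi V) = ii (cst 6 * (V * dx V * u ^+ 2) + cst 2 * (dx V * u ^+ 3)).
Proof.
move=> cu cV.
have [c1 c2 c3] : [/\ cs (dx u), cs (dx (dx u)) & cs (dx (dx (dx u)))] by split; csx.
pose P : R -> R := cst 2^-1 * (dx u) ^+ 2 - u * dx (dx u) + cst 3 * (V ^+ 2 * u ^+ 2) + cst 4 * (V * u ^+ 3)
  + cst (3 / 2) * u ^+ 4.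
have cP : cs P by rewrite /P; csx.
have [v1 v2 v3] : [/\ cs (dx V), cs (dx (dx V)) & cs (dx (dx (dx V)))] by split; csx.
apply: (ii_mod _ _ cP (derives cP)); try by rewrite ?/Phi; csx.
by rewrite /Phi /P => x; dxr; ptw; dring.
Qed.

Lemma nn_sqr f : nn f = ii (f ^+ 2). Proof. by rewrite /nn expr2. Qed.

(** In an Euler step of length t the increment is -t g with g close to Phi(f). The first-order term
    is then -t <gradI, Phi> = 0 up to consistency errors, and the quadratic remainder, summed over
    the order of 1 / t steps, stays of order t. *)
Lemma Ifun_taylor N B f g (t : R) : cs f -> cs g -> 1 <= B -> 0 <= t <= 1 ->
  (forall x, [/\ `|f x| <= B, `|dx f x| <= B, `|g x| <= B & `|dx g x| <= B]) ->
  `|Ifun N (f - cst t * g) - Ifun N f + t * ip (gradI N f) g| <=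
    t ^+ 2 * (nn (Dop N g) + (1000 * B ^+ 4 * (1 + N ^+ 2)) * (nn g + nn (dx g))).
Proof.
move=> cf cg B1 /andP[t0 t1] hB.
have cDg := cs_Dop N cg; have cDf := cs_Dop N cf; have cNf := cs_NLd N cf.
have ch : cs (f - cst t * g) by csx.
have cNh := cs_NLd N ch.
have eD : Dop N (f - cst t * g) = Dop N f - cst t * Dop N g.
  by rewrite /Dop; dxr; apply/funext => x; ptw; dring.
pose pa : R -> R := cst 20 * (f * (dx f) ^+ 2) + cst 12 * f ^+ 5 - cst (8 * N ^+ 2) * f ^+ 3.
pose pb : R -> R := cst 20 * (f ^+ 2 * dx f).
have cpa : cs pa by rewrite /pa; csx.
have cpb : cs pb by rewrite /pb; csx.
have eg : ip (gradI N f) g = 2 * ip (Dop N f) (Dop N g) + (ip pa g + ip pb (dx g)).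
  have -> : gradI N f = cst 2 * Dop N (Dop N f) + (pa - dx pb).
    by rewrite /gradI /pa /pb; dxr; apply/funext => x; ptw; dring.
  have cDD := cs_Dop N cDf.
  rewrite (@ipDl _ (cst 2 * _) (pa - _)) ?ipZl ?(@ipBl _ pa); try by csx.
  have := ip_Dop N cDf cg; have := ip_dx cpb cg; rewrite /pb ipZl; try by csx.
  move=> -> ->; ring.
pose r : R -> R := NLd N (f - cst t * g) - NLd N f + cst t * (pa * g + pb * dx g).
have cr : cs r by rewrite /r; csx.
have -> : Ifun N (f - cst t * g) - Ifun N f + t * ip (gradI N f) g = t ^+ 2 * nn (Dop N g) + ii r.
  have cA : cs (pa * g) by csx.
  have cB : cs (pb * dx g) by csx.
  rewrite /r (iiD (csB cNh cNf) (csZ t (csD cA cB))) (iiB cNh cNf) (iiZ t (csD cA cB)) (iiD cA cB).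
  rewrite eg /Ifun eD (nnB cDf (csZ t cDg)) (nnZ t cDg) (ipZr t cDf cDg) /ip.
  by genii; ring.
pose K := 1000 * B ^+ 4 * (1 + N ^+ 2).
have B0 : 0 <= B by lra.
have hr : `|ii r| <= ii (cst (t ^+ 2 * K) * (g ^+ 2 + (dx g) ^+ 2)).
  apply: ii_norm_le => //; first by csx.
  move=> x; rewrite /r /NLd /pa /pb; dxr; ptw; have [h1 h2 h3 h4] := hB x.
  move: (dx f x) (dx g x) h2 h4; gend; move: (f x) (g x) h1 h3 => a s ha hs b q hb hq.
  have ht : `|t| <= 1 by rewrite ger0_norm.
  (* Coefficients of g^2, g_x^2 and g g_x in the remainder divided by t^2; here a, b stand for f,
     f_x and s, q for g, g_x. *)
  pose X := 10 * b ^+ 2 - 20 * t * (b * q) + 10 * t ^+ 2 * q ^+ 2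
    + 2 * (15 * a ^+ 4 - 20 * a ^+ 3 * (t * s) + 15 * a ^+ 2 * (t * s) ^+ 2 - 6 * a * (t * s) ^+ 3 + (t * s) ^+ 4)
    - 2 * N ^+ 2 * (6 * a ^+ 2 - 4 * a * (t * s) + (t * s) ^+ 2).
  pose Y := 10 * a ^+ 2 - 20 * t * (a * s).
  pose Z := 40 * (a * b).
  set L := (X in `|X| <= _); have -> : L = t ^+ 2 * (s ^+ 2 * X + q ^+ 2 * Y + s * q * Z).
    by rewrite /L /X /Y /Z; ring.
  have hN : `|N ^+ 2| <= N ^+ 2 by rewrite ger0_norm ?sqr_ge0.
  have B24 : B ^+ 2 <= B ^+ 4 by rewrite ler_weXn2l.
  have B4N : B ^+ 4 <= B ^+ 4 * (1 + N ^+ 2).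
    by rewrite ler_peMr ?exprn_ge0// lerDl sqr_ge0.
  have BN : N ^+ 2 * B ^+ 2 <= B ^+ 4 * (1 + N ^+ 2).
    have p0 : 0 <= B ^+ 4 by rewrite exprn_ge0.
    by have := ler_wpM2l (sqr_ge0 N) B24; lra.
  have hX : `|X| <= 400 * (B ^+ 4 * (1 + N ^+ 2)).
    apply: le_trans; first by rewrite /X; nb.
    by have p2 : 0 <= B ^+ 2 := exprn_ge0 2 B0; lra.
  have hY : `|Y| <= 30 * (B ^+ 4 * (1 + N ^+ 2)).
    apply: le_trans; first by rewrite /Y; nb.
    lra.
  have hZ : `|Z| <= 40 * (B ^+ 4 * (1 + N ^+ 2)).
    apply: le_trans; first by rewrite /Z; nb.
    lra.
  apply: (le_trans (y := t ^+ 2 * (K * (s ^+ 2 + q ^+ 2)))); last by rewrite mulrA.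
  rewrite normrM ger0_norm ?sqr_ge0//; apply: ler_wpM2l; first exact: sqr_ge0.
  have -> : K = 1000 * (B ^+ 4 * (1 + N ^+ 2)) by rewrite mulrA.
  move: hX hY hZ; set P := B ^+ 4 * (1 + N ^+ 2) => hX hY hZ.
  have P0 : 0 <= P by rewrite mulr_ge0 ?exprn_ge0// addr_ge0// sqr_ge0.
  have hX' : `|s ^+ 2 * X| <= s ^+ 2 * (400 * P) by rewrite normrM (ger0_norm (sqr_ge0 s)) ler_wpM2l ?sqr_ge0.
  have hY' : `|q ^+ 2 * Y| <= q ^+ 2 * (30 * P) by rewrite normrM (ger0_norm (sqr_ge0 q)) ler_wpM2l ?sqr_ge0.
  have sq2 : `|s * q| <= (s ^+ 2 + q ^+ 2) / 2.
    by have := sqr_ge0 (s - q); have := sqr_ge0 (s + q); rewrite ler_norml; lra.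
  have hZ' := nbM sq2 hZ.
  have := nbD (nbD hX' hY') hZ'.
  have := mulr_ge0 (sqr_ge0 s) P0; have := mulr_ge0 (sqr_ge0 q) P0.
  clear; set T := `|_|; move=> h1 h2 h3; lra.
have cg2 : cs (g ^+ 2) by csx.
have cg3 : cs (dx g ^+ 2) by csx.
rewrite (iiZ _ (csD cg2 cg3)) (iiD cg2 cg3) -!nn_sqr in hr.
apply: (le_trans (ler_normD _ _)); rewrite ger0_norm; last by rewrite mulr_ge0 ?sqr_ge0// nn_ge0.
by rewrite mulrDr lerD2l mulrA.
Qed.

End mkdv_identities.

Ltac pos := match goal with
 | |- is_true (0 <= _ + _) => apply: addr_ge0; pos
 | |- is_true (0 <= _ ^+ 2) => exact: sqr_ge0
 | |- is_true (0 <= _ * _) => apply: mulr_ge0; pos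
 | |- is_true (0 <= _ ^+ _) => first [apply: exprn_ge0; pos | by rewrite exprn_even_ge0]
 | |- is_true (0 <= nm _) => exact: nm_ge0
 | |- is_true (0 <= nn _) => exact: nn_ge0
 | |- is_true (0 <= Num.sqrt _) => exact: sqrtr_ge0
 | |- is_true (0 <= `|_|) => exact: normr_ge0
 | |- is_true (0 <= _^-1) => rewrite invr_ge0; pos
 | |- is_true (0 <= _%:R) => exact: ler0n
 | |- is_true (0 <= 1) => exact: ler01
 | |- is_true (0 <= 0) => exact: lexx
 | H : is_true (0 <= ?x) |- is_true (0 <= ?x) => exact: H
 | H : is_true (0 < ?x) |- is_true (0 <= ?x) => exact: (ltW H)
 | |- is_true (0 < _ * _) => apply: mulr_gt0; pos
 | |- is_true (0 < _ ^+ _) => apply: exprn_gt0; pos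
 | |- is_true (0 < _^-1) => rewrite invr_gt0; pos
 | |- is_true (0 < _ + _) => first [apply: addr_gt0; pos | apply: ltr_pwDl; pos | apply: ltr_wpDl; pos]
 | |- is_true (0 < 1) => exact: ltr01
 | H : is_true (0 < ?x) |- is_true (0 < ?x) => exact: H
 | |- is_true (0 < _%:R) => by rewrite ltr0n
 | |- is_true (0 <= _) => first [done | by apply: ltW]
 end.

(** * Bounds on u at a fixed time from the adapted functional *)

Section static.
Context {R : realType}.
Implicit Types u v V : R -> R.

(* [b] stands for t^(-1/8), [rN] for the square root of N, [m] for e N^(-1/4). *)
Record scales (N rN m e b : R) : Prop := Scales {
  sc_N : 1 <= N; sc_rN : 1 <= rN; sc_rN2 : rN ^+ 2 = N; sc_m : 0 < m; sc_rm : rN * m ^+ 2 = e ^+ 2;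
  sc_e0 : 0 < e; sc_e1 : e <= 1; sc_b0 : 0 < b; sc_b1 : b <= 1 }.

(** The essential bound is [vb_DD]: four derivatives of V would cost N^4 m, two applications of
    [Dop N] cost N m. This makes the cross term <Dop Dop V, u> of [nn_Dop_diff] affordable. *)
Record Vbound (c N rN m e b : R) (V : R -> R) : Prop := VBound {
  vb_cs : cs V;
  vb_nm : nm V <= c * m;
  vb_nm2 : nm (dx (dx V)) <= c * (N ^+ 2 * m);
  vb_DD : nm (Dop N (Dop N V)) <= c * (N * m);
  vb_sup : forall x, `|V x| <= c * (e * b ^+ 4 / rN);
  vb_supx : forall x, `|dx V x| <= c * (e * b ^+ 4 * rN) }.

Lemma Dop_add N u V : cs u -> cs V -> Dop N (V + u) = Dop N V + Dop N u.
Proof. by move=> cu cV; rewrite /Dop; dxr; apply/funext => x; ptw; dring. Qed.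

Lemma nn_Dop_diff N u V : cs u -> cs V ->
  nn (Dop N u) = Ifun N (V + u) - Ifun N V - ii (NLd N (V + u)) + ii (NLd N V)
    - 2 * ip (Dop N (Dop N V)) u.
Proof.
move=> cu cV; have c1 := cs_Dop N cu; have c2 := cs_Dop N cV.
by rewrite /Ifun (Dop_add N cu cV) (nnD c2 c1) (ip_Dop N c2 cu); genii; ring.
Qed.

(** Only -2 N^2 v^4 is negative in the density, and its size is at most 2 S v^2. *)
Lemma NLd_ge N v S : cs v -> (forall x, N ^+ 2 * v x ^+ 2 <= S) ->
  - ii (NLd N v) <= (2 * S * nn v : R).
Proof.
move=> cv hS; have cN := cs_NLd N cv.
rewrite -(iiN cN) nn_sqr; have c2 : cs (v ^+ 2) by csx.
rewrite -(iiZ (2 * S) c2); apply: ii_le; [by csx|by csx|] => x; rewrite /NLd; ptw.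
have := hS x; move: (dx v x : R) => b; move: (v x) => a h.
have h1 := ler_wpM2r (sqr_ge0 a) h.
have h2 := sqr_ge0 (a * b).
have h3 := sqr_ge0 (a ^+ 3).
have e4 : a ^+ 4 = a ^+ 2 * a ^+ 2 by rewrite -exprD.
by rewrite e4; lra.
Qed.

Lemma NLd_le N v P Q : cs v -> (forall x, v x ^+ 2 <= P) -> (forall x, dx v x ^+ 2 <= Q) ->
  ii (NLd N v) <= ((10 * Q + 2 * P ^+ 2) * nn v : R).
Proof.
move=> cv hP hQ; have cN := cs_NLd N cv.
rewrite nn_sqr; have c2 : cs (v ^+ 2) by csx.
rewrite -(iiZ _ c2); apply: ii_le; [by csx|by csx|] => x; rewrite /NLd; ptw.
have := hP x; have := hQ x; move: (dx v x : R) => b; move: (v x) => a hb ha.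
have h1 := ler_wpM2r (sqr_ge0 a) hb.
have h0 := sqr_ge0 a.
have h2 : (a ^+ 2) ^+ 2 <= P ^+ 2 by rewrite ler_pXn2r ?nnegrE//; exact: le_trans ha.
have h3 := ler_wpM2r h0 h2.
have h4 := sqr_ge0 (N * a ^+ 2).
have e6 : a ^+ 6 = (a ^+ 2) ^+ 2 * a ^+ 2 by rewrite -exprM -exprD.
by rewrite e6; lra.
Qed.

(* The real inequality behind [static_bound]: [w^2 <= P b^7 + A(w mu + mu^(1/2) w^(3/2))]
   with [mu <= K b^7] forces [w^2 = O(b^7)]. *)
Lemma omega_bound (P A w mu s : R) : 0 <= A -> 0 <= w -> 0 <= mu -> 0 <= s -> 0 <= P ->
  s ^+ 2 = mu * w -> w ^+ 2 <= P + A * (w * (mu + s)) ->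
  w ^+ 2 <= 4 * P + (4 * A ^+ 2 + 256 * A ^+ 4) * mu ^+ 2.
Proof.
move=> A0 w0 mu0 s0 P0 hs h.
have h1 : A * (w * mu) <= 4^-1 * w ^+ 2 + A ^+ 2 * mu ^+ 2.
  by have := sqr_ge0 (2^-1 * w - A * mu); lra.
have q0 : 0 <= A ^+ 4 * mu ^+ 2 by rewrite mulr_ge0 ?sqr_ge0// exprn_ge0.
have [h2|h2] := leP (A * s) (4^-1 * w).
  have := ler_wpM2l w0 h2; have := sqr_ge0 (A * mu); lra.
have h3 : w ^+ 2 <= 16 * A ^+ 2 * (mu * w).
  rewrite -hs; have : (4^-1 * w) ^+ 2 <= (A * s) ^+ 2.
    by rewrite ler_pXn2r ?nnegrE ?mulr_ge0// ltW.
  lra.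
have h4 : w <= 16 * A ^+ 2 * mu.
  have [->|wn] := eqVneq w 0; first by pos.
  have wp : 0 < w by rewrite lt_def wn.
  by rewrite -(ler_pM2r wp) -expr2; move: h3; rewrite mulrA.
have h5 : w ^+ 2 <= (16 * A ^+ 2 * mu) ^+ 2.
  by rewrite ler_pXn2r ?nnegrE ?mulr_ge0 ?sqr_ge0.
have e5 : (16 * A ^+ 2 * mu) ^+ 2 = 256 * (A ^+ 4 * mu ^+ 2) by ring.
rewrite e5 in h5; have := sqr_ge0 (A * mu); lra.
Qed.

Lemma nmM_le (c d : R) v : 0 <= d -> nn v <= d ^+ 2 -> nm v <= d.
Proof. by move=> d0 h; rewrite /nm -(ger0_norm d0) -sqrtr_sqr ler_sqrt// sqr_ge0. Qed.

Lemma sum_sq_bound (N p q d X Y : R) : N ^+ 2 * p ^+ 2 <= X -> d ^+ 2 + N ^+ 2 * q ^+ 2 <= Y ->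
  N ^+ 2 * (p + q) ^+ 2 <= 2 * X + 2 * Y.
Proof.
by move=> h1 h2; have := sqr_ge0 d; have := sqr_ge0 (N * (p - q)); lra.
Qed.

(** Expanding the functional bounds ||Dop u||^2 by the data and the quartic term, whose sup norm is
    again bounded by ||Dop u|| ||u_x||. In normalized form this reads w^2 <= P b^7 + A w (mu + (mu
    w)^(1/2)): the right side has degree 3/2 in [w], so the inequality closes by itself, without
    smallness and without continuity in time. *)
Lemma static_bound (c K K1 : R) : 0 <= c -> 0 <= K -> 0 <= K1 ->
  exists K4 : R, 0 <= K4 /\ forall (N rN m e b : R) u V, scales N rN m e b ->
  Vbound c N rN m e b V -> cs u -> nm u <= K * (m * b ^+ 7) ->
  `|Ifun N (V + u) - Ifun N V| <= K1 * (N * m ^+ 2 * b ^+ 7) ->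
  [/\ nn (dx u) <= K4 * (N ^+ 2 * m ^+ 2 * b ^+ 10), nn (Dop N u) <= K4 * (N * m ^+ 2 * b ^+ 7) &
    forall x, dx u x ^+ 2 + N ^+ 2 * u x ^+ 2 <= K4 * (N * e ^+ 2 * b ^+ 8)].
Proof.
move=> c0 K0 K10.
pose A := 8 * (c + K) ^+ 2.
pose P := K1 + (10 * c ^+ 2 + 2 * c ^+ 4) * c ^+ 2 + 4 * (c + K) ^+ 2 * c ^+ 2 + 2 * c * K.
pose K2 := 4 * P + (4 * A ^+ 2 + 256 * A ^+ 4) * K ^+ 2.
pose K3 := K ^+ 2 + K * (1 + K2).
pose K4 := K2 + 2 * K3 + 2 * ((1 + 2 * K3) * (1 + K2)).
have A0 : 0 <= A by rewrite /A; pos.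
have P0 : 0 <= P by rewrite /P; pos.
have K20 : 0 <= K2 by rewrite /K2; pos.
have K30 : 0 <= K3 by rewrite /K3; pos.
have K40 : 0 <= K4 by rewrite /K4; pos.
exists K4; split => // N rN m e b u V [N1 rN1 rNN m0 rm e0 e1 b0 b1] [cV V0 V2 VD Vs Vsx] cu hU hI.
have rN0 : 0 < rN by lra.
have Npos : 0 < N by lra.
have mb k : 0 < b ^+ k by rewrite exprn_gt0.
have bb k l : (k <= l)%N -> b ^+ l <= b ^+ k by move=> kl; rewrite ler_wiXn2l// ltW.
(* Unknowns scaled by their natural sizes: [mu] for ||u||, [w] for ||Dop u||, and [s] for the
   geometric mean that occurs in ||u_x||. *)
pose mu := nm u / m; pose w := nm (Dop N u) / (rN * m); pose s := Num.sqrt (mu * w).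
have mu0 : 0 <= mu by rewrite /mu; pos.
have w0 : 0 <= w by rewrite /w; pos.
have eU : nm u = m * mu by rewrite /mu mulrC divfK// gt_eqF.
have eW : nm (Dop N u) = rN * m * w by rewrite /w mulrC divfK// gt_eqF// mulr_gt0.
have s0 : 0 <= s by exact: sqrtr_ge0.
have hs : s ^+ 2 = mu * w by rewrite sqr_sqrtr// mulr_ge0.
have muK : mu <= K * b ^+ 7 by rewrite -(ler_pM2l m0) -eU; lra.
have muK' : mu <= K by apply: (le_trans muK); rewrite ler_piMr// exprn_ile1// ltW.
have ux2 : nn (dx u) <= (N * m * (mu + s)) ^+ 2.
  apply: (le_trans (nn_dx_Dop N cu)); rewrite -nm2 eU eW.
  have h1 : rN * (mu * w) <= N ^+ 2 * (mu * w).
    apply: ler_wpM2r; first by pos.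
    by apply: (@le_trans _ _ N); rewrite -?rNN ?ler_eXnr// rNN.
  have -> : m * mu * (rN * m * w) = m ^+ 2 * (rN * (mu * w)) by ring.
  have -> : (N * m * (mu + s)) ^+ 2 = N ^+ 2 * m ^+ 2 * mu ^+ 2 + m ^+ 2 * (N ^+ 2 * (s ^+ 2)) + 2 * (N ^+ 2 * m ^+ 2 * (mu * s)) by ring.
  rewrite hs; have h2 := ler_wpM2l (sqr_ge0 m) h1.
  have h3 : 0 <= 2 * (N ^+ 2 * m ^+ 2 * (mu * s)) by pos.
  clear -h2 h3; lra.
have ux : nm (dx u) <= N * m * (mu + s).
  by apply: nmM_le => //; pos.
have sup x : dx u x ^+ 2 + N ^+ 2 * u x ^+ 2 <= 2 * (N * e ^+ 2) * (w * (mu + s)).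
  apply: (le_trans (sup_Dop N x cu)); rewrite eW -rm.
  have -> : 2 * (N * (rN * m ^+ 2)) * (w * (mu + s)) = 2 * (N * m * (mu + s) * (rN * m * w)) by ring.
  by rewrite ler_pM2l//; apply: ler_wpM2r => //; pos.
have hv : nm (V + u) <= (c + K) * m.
  apply: (le_trans (nmD cV cu)); rewrite eU mulrDl; apply: lerD => //.
  by rewrite mulrC; apply: ler_wpM2r => //; pos.
have cv : cs (V + u) by csx.
have hv2 : nn (V + u) <= (c + K) ^+ 2 * m ^+ 2.
  by rewrite -nm2 -exprMn ler_pXn2r ?nnegrE ?nm_ge0//; pos.
(* Bounds N^2 (V + u)^2: the part of V is given, that of u is [sup], still in terms of [w]. *)
pose S := 2 * (c ^+ 2 * e ^+ 2 * N * b ^+ 8) + 4 * (N * e ^+ 2) * (w * (mu + s)).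
have Vs2 x : N ^+ 2 * V x ^+ 2 <= c ^+ 2 * e ^+ 2 * N * b ^+ 8.
  have := Vs x; rewrite -(@ler_pXn2r _ 2%N) ?nnegrE; [|by []|by pos|by pos].
  rewrite -normrX ger0_norm ?sqr_ge0// => h.
  have := ler_wpM2l (sqr_ge0 N) h.
  have -> : N ^+ 2 * (c * (e * b ^+ 4 / rN)) ^+ 2 = c ^+ 2 * e ^+ 2 * (N ^+ 2 / rN ^+ 2) * b ^+ 8.
    by field; rewrite gt_eqF.
  by rewrite rNN expr2 mulfK// gt_eqF.
have Vx2 x : dx V x ^+ 2 <= c ^+ 2 * e ^+ 2 * N * b ^+ 8.
  have := Vsx x; rewrite -(@ler_pXn2r _ 2%N) ?nnegrE; [|by []|by pos|by pos].
  rewrite -normrX ger0_norm ?sqr_ge0// => h; apply: (le_trans h).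
  by rewrite -rNN le_eqVlt; apply/orP; left; apply/eqP; ring.
have hS x : N ^+ 2 * (V + u) x ^+ 2 <= S.
  rewrite -[(V + u) x]/(V x + u x) /S.
  have := sum_sq_bound (Vs2 x) (sup x); move=> /le_trans; apply.
  by rewrite le_eqVlt; apply/orP; left; apply/eqP; ring.
have NLv := NLd_ge cv hS.
have b8 : b ^+ 8 <= b ^+ 7 by exact: bb.
have b81 : b ^+ 8 <= 1 by rewrite exprn_ile1// ltW.
have e21 : e ^+ 2 <= 1 by rewrite exprn_ile1// ltW.
have hVV : nn V <= c ^+ 2 * m ^+ 2.
  by rewrite -nm2 -exprMn ler_pXn2r ?nnegrE ?nm_ge0//; pos.
pose T := N * m ^+ 2 * b ^+ 7.
have T0 : 0 <= T by rewrite /T; pos.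
have NLV : ii (NLd N V) <= (10 * c ^+ 2 + 2 * c ^+ 4) * c ^+ 2 * T.
  have V2x x : V x ^+ 2 <= c ^+ 2 * b ^+ 4.
    have h := Vs2 x; have h2 : N * (N * V x ^+ 2) <= N * (c ^+ 2 * (e ^+ 2 * b ^+ 8)) by clear -h; lra.
    rewrite ler_pM2l// in h2.
    have h3 : V x ^+ 2 <= N * V x ^+ 2 by rewrite ler_peMl ?sqr_ge0.
    apply: (le_trans h3); apply: (le_trans h2); apply: ler_wpM2l; first by pos.
    have h4 : b ^+ 8 <= b ^+ 4 by exact: bb.
    by apply: le_trans h4; rewrite ler_piMl//; pos.
  have V2x' x : dx V x ^+ 2 <= c ^+ 2 * (N * b ^+ 8).
    apply: (le_trans (Vx2 x)).
    have -> : c ^+ 2 * e ^+ 2 * N * b ^+ 8 = e ^+ 2 * (c ^+ 2 * (N * b ^+ 8)) by ring.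
    by rewrite ler_piMl//; pos.
  have hNL := @NLd_le N V _ _ cV V2x V2x'; apply: (le_trans hNL).
  have h0 : 0 <= 10 * (c ^+ 2 * (N * b ^+ 8)) + 2 * (c ^+ 2 * b ^+ 4) ^+ 2 by pos.
  apply: (le_trans (ler_wpM2l h0 hVV)).
  have h1 : (10 * (c ^+ 2 * (N * b ^+ 8)) + 2 * (c ^+ 2 * b ^+ 4) ^+ 2) <= (10 * c ^+ 2 + 2 * c ^+ 4) * (N * b ^+ 7).
    have hb7 : b ^+ 8 <= N * b ^+ 7 by apply: (le_trans b8); rewrite ler_peMl//; pos.
    have h2 : c ^+ 2 * (N * b ^+ 8) <= c ^+ 2 * (N * b ^+ 7) by rewrite ler_wpM2l ?sqr_ge0// ler_wpM2l//; pos.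
    have h3 : c ^+ 4 * b ^+ 8 <= c ^+ 4 * (N * b ^+ 7) by rewrite ler_wpM2l//; pos.
    have -> : (c ^+ 2 * b ^+ 4) ^+ 2 = c ^+ 4 * b ^+ 8 by ring.
    clear -h2 h3; lra.
  have c0' : 0 <= c ^+ 2 * m ^+ 2 by pos.
  apply: (le_trans (ler_wpM2r c0' h1)); rewrite /T le_eqVlt; apply/orP; left; apply/eqP; ring.
have NLv' : - ii (NLd N (V + u)) <= (4 * (c + K) ^+ 2 * c ^+ 2) * T + A * (N * m ^+ 2) * (w * (mu + s)).
  apply: (le_trans NLv).
  have S0 : 0 <= 2 * S by rewrite /S; pos.
  apply: (le_trans (ler_wpM2l S0 hv2)); rewrite /S /T /A.
  have h1 : e ^+ 2 * b ^+ 8 <= b ^+ 7 by apply: le_trans b8; rewrite ler_piMl//; pos.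
  pose Q := (c + K) ^+ 2 * (N * m ^+ 2); have Q0 : 0 <= Q by rewrite /Q; pos.
  have cQ0 : 0 <= 4 * c ^+ 2 * Q by pos.
  have h2 := ler_wpM2l cQ0 h1.
  have wQ : 0 <= 8 * Q * (w * (mu + s)) by pos.
  have h3 := ler_wpM2l wQ e21.
  rewrite /Q in h2 h3; clear -h2 h3; lra.
have hD : - (2 * ip (Dop N (Dop N V)) u) <= 2 * c * K * T.
  have cDD : cs (Dop N (Dop N V)) by do 2 apply: cs_Dop.
  have h1 := CS cDD cu; have h2 := ler_norm (- ip (Dop N (Dop N V)) u); rewrite normrN in h2.
  have h3 : nm (Dop N (Dop N V)) * nm u <= (c * (N * m)) * (K * (m * b ^+ 7)).
    by apply: ler_pM => //; pos.
  rewrite /T; clear -h1 h2 h3; lra.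
have Nm0 : 0 < N * m ^+ 2 by pos.
have eWW : nn (Dop N u) = N * m ^+ 2 * w ^+ 2 by rewrite -nm2 eW -rNN; ring.
have hW : w ^+ 2 <= P * b ^+ 7 + A * (w * (mu + s)).
  rewrite -(ler_pM2l Nm0) -eWW (nn_Dop_diff N cu cV).
  have := ler_norm (Ifun N (V + u) - Ifun N V).
  move: hI hD NLv' NLV; rewrite /T /P; genii; clear; move=> *; lra.
have hw2 : w ^+ 2 <= K2 * b ^+ 7.
  have h := omega_bound A0 w0 mu0 s0 (_ : 0 <= P * b ^+ 7) hs hW.
  apply: (le_trans (h _)); first by pos.
  have h1 : mu ^+ 2 <= K ^+ 2 * b ^+ 7.
    have -> : mu ^+ 2 = mu * mu by rewrite expr2.
    have -> : K ^+ 2 * b ^+ 7 = K * b ^+ 7 * K by ring.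
    exact: ler_pM.
  have q0 : 0 <= 4 * A ^+ 2 + 256 * A ^+ 4 by pos.
  have h2 := ler_wpM2l q0 h1; rewrite /K2; clear -h2; lra.
(* Half a power of b is given up to stay with integers: b^3 here and b^5 for mu + s multiply to b^8,
   the square of the pointwise decay of V. *)
have hw : w <= (1 + K2) * b ^+ 3.
  rewrite -(@ler_pXn2r _ 2%N) ?nnegrE//; last by pos.
  apply: (le_trans hw2).
  have h1 : b ^+ 7 <= b ^+ 6 by exact: bb.
  have -> : ((1 + K2) * b ^+ 3) ^+ 2 = K2 * b ^+ 6 + (1 + K2 + K2 ^+ 2) * b ^+ 6 by ring.
  have h2 := ler_wpM2l K20 h1; have h3 : 0 <= (1 + K2 + K2 ^+ 2) * b ^+ 6 by pos.
  clear -h2 h3; lra.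
have hms2 : (mu + s) ^+ 2 <= 2 * K3 * b ^+ 10.
  have h1 : mu ^+ 2 <= K ^+ 2 * b ^+ 10.
    have h2 : mu ^+ 2 <= (K * b ^+ 7) ^+ 2 by rewrite ler_pXn2r ?nnegrE//; pos.
    apply: (le_trans h2); rewrite exprMn -exprM; apply: ler_wpM2l; first by pos.
    exact: bb.
  have h2 : mu * w <= K * (1 + K2) * b ^+ 10.
    have := ler_pM mu0 w0 muK hw.
    by have -> : K * b ^+ 7 * ((1 + K2) * b ^+ 3) = K * (1 + K2) * b ^+ 10 by ring.
  have h3 := sqr_ge0 (mu - s); rewrite -hs in h2; rewrite /K3; clear -h1 h2 h3; lra.
have hms : mu + s <= (1 + 2 * K3) * b ^+ 5.
  rewrite -(@ler_pXn2r _ 2%N) ?nnegrE; [|by []|by pos|by pos].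
  apply: (le_trans hms2).
  have -> : ((1 + 2 * K3) * b ^+ 5) ^+ 2 = 2 * K3 * b ^+ 10 + (1 + 2 * K3 + 4 * K3 ^+ 2) * b ^+ 10 by ring.
  by rewrite lerDl; pos.
have hK : [/\ 2 * K3 <= K4, K2 <= K4 & 2 * ((1 + 2 * K3) * (1 + K2)) <= K4].
  have q1 : 0 <= 2 * ((1 + 2 * K3) * (1 + K2)) by pos.
  by rewrite /K4; clear -q1 K20 K30; split; lra.
have [k1 k2 k3] := hK.
split.
- apply: (le_trans ux2).
  have -> : (N * m * (mu + s)) ^+ 2 = N ^+ 2 * m ^+ 2 * (mu + s) ^+ 2 by ring.
  have -> : K4 * (N ^+ 2 * m ^+ 2 * b ^+ 10) = N ^+ 2 * m ^+ 2 * (K4 * b ^+ 10) by ring.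
  apply: ler_wpM2l; first by pos.
  by apply: (le_trans hms2); apply: ler_wpM2r => //; pos.
- rewrite eWW.
  have -> : K4 * (N * m ^+ 2 * b ^+ 7) = N * m ^+ 2 * (K4 * b ^+ 7) by ring.
  apply: ler_wpM2l; first by pos.
  by apply: (le_trans hw2); apply: ler_wpM2r => //; pos.
- move=> x; apply: (le_trans (sup x)).
  have -> : K4 * (N * e ^+ 2 * b ^+ 8) = N * e ^+ 2 * (K4 * b ^+ 8) by ring.
  rewrite [X in X <= _](_ : _ = N * e ^+ 2 * (2 * (w * (mu + s)))); last by ring.
  apply: ler_wpM2l; first by pos.
  have ms0 : 0 <= mu + s by pos.
  have h1 := ler_pM w0 ms0 hw hms.
  have h2 : 2 * ((1 + 2 * K3) * (1 + K2)) * b ^+ 8 <= K4 * b ^+ 8 by apply: ler_wpM2r => //; pos.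
  clear -h1 h2; lra.
Qed.

End static.

(** * Fourier transforms and Sobolev norms *)

Section bounded_measurable.
Context {R : realType}.
Implicit Types (f g : R -> R) (a b c d r L : R).
Let mu := @lebesgue_measure R.

Definition In a b f : R := \int[mu]_(x in `[a, b]) f x.

(** Bounded on bounded sets rather than integrable: the class is closed under products, composition
    and integration over a parameter, so integrability and Fubini on rectangles come without side
    conditions. *)
Definition mb f := measurable_fun [set: R] f /\ forall r, exists M, forall x, `|x| <= r -> `|f x| <= M.

Lemma continuous_mb f : continuous f -> mb f.
Proof.
move=> cf; split; first exact: continuous_measurable_fun.
move=> r; have [r0|r0] := ltP r 0; first by exists 0 => x hx; have := le_lt_trans hx r0; rewrite normr_lt0.
have cK := @segment_compact R (- r) r.
have /compact_bounded[M [_ hM]] := continuous_compact (continuous_subspaceT cf) cK.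
exists (M + 1) => x hx; apply: (hM (M + 1)); first by rewrite ltrDl.
by exists x => //=; rewrite in_itv/= -ler_norml.
Qed.

Lemma mbD f g : mb f -> mb g -> mb (fun x => f x + g x).
Proof.
move=> [mf hf] [mg hg]; split; first exact: measurable_funD.
move=> r; have [M hM] := hf r; have [K hK] := hg r; exists (M + K) => x hx.
by apply: (le_trans (ler_normD _ _)); apply: lerD; auto.
Qed.

Lemma mbM f g : mb f -> mb g -> mb (fun x => f x * g x).
Proof.
move=> [mf hf] [mg hg]; split; first exact: measurable_funM.
move=> r; have [M hM] := hf r; have [K hK] := hg r; exists (M * K) => x hx.
by rewrite normrM; apply: ler_pM; auto.
Qed.

Lemma mbC c : mb (fun=> c).
Proof. by apply: continuous_mb => x; exact: cvg_cst. Qed.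

Lemma mb_integrable a b f : mb f -> mu.-integrable `[a, b] (EFin \o f).
Proof.
move=> [mf hf]; apply: measurable_bounded_integrable => //=.
- by rewrite lebesgue_measure_itv/=; case: ifPn => // _; rewrite -EFinB ltry.
- exact: measurable_funTS.
- have [M hM] := hf (Num.max `|a| `|b|); exists M; split; rewrite ?num_real// => K MK x /=.
  rewrite in_itv/= => /andP[ax xb]; apply: le_trans (ltW MK); apply: hM.
  rewrite ler_norml; apply/andP; split.
    by rewrite lerNl; apply: (le_trans (y := - a)); [rewrite lerN2|rewrite le_max -normrN ler_norm].
  by apply: (le_trans xb); rewrite le_max ler_norm orbT.
Qed.

Lemma In_D a b f g : mb f -> mb g -> In a b (fun x => f x + g x) = In a b f + In a b g.
Proof. by move=> hf hg; apply: RintegralD => //; exact: mb_integrable. Qed.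

Lemma In_Z a b c f : mb f -> In a b (fun x => c * f x) = c * In a b f.
Proof. by move=> hf; apply: RintegralZl => //; exact: mb_integrable. Qed.

Lemma In_N a b f : mb f -> In a b (fun x => - f x) = - In a b f.
Proof. by move=> hf; rewrite -mulN1r -In_Z//; congr In; apply/funext => x; rewrite mulN1r. Qed.

Lemma In_eq a b f g : (forall x, a <= x <= b -> f x = g x) -> In a b f = In a b g.
Proof. by move=> h; apply: eq_Rintegral => x; rewrite inE/= in_itv/=; exact: h. Qed.

Lemma In_le a b f g : mb f -> mb g -> (forall x, a <= x <= b -> f x <= g x) -> In a b f <= In a b g.
Proof.
move=> hf hg h; apply: le_Rintegral => //; [exact: mb_integrable|exact: mb_integrable].
Qed.

Lemma In_ge0 a b f : (forall x, a <= x <= b -> 0 <= f x) -> 0 <= In a b f.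
Proof. by move=> h; apply: Rintegral_ge0 => x /=; rewrite in_itv/=; exact: h. Qed.

Lemma In_cst a b c : a <= b -> In a b (fun=> c) = c * (b - a).
Proof.
move=> ab; rewrite /In Rintegral_cst//= lebesgue_measure_itv/= lte_fin.
by move: ab; rewrite le_eqVlt => /orP[/eqP ->|->//]; rewrite ltxx subrr.
Qed.

Lemma In_prim a b f F : a <= b -> continuous f -> (forall x : R, is_derive x 1 F (f x)) -> In a b f = F b - F a.
Proof.
rewrite le_eqVlt => /orP[/eqP -> _ _|ab cf hF]; first by rewrite /In set_itv1 Rintegral_set1 subrr.
rewrite /In /Rintegral (@continuous_FTC2 R f F)//.
- exact: continuous_subspaceT.
- have cF := is_derive_cont hF; split.
  + by move=> x _; have [] := hF x.
  + exact/cvg_at_right_filter/cF.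
  + exact/cvg_at_left_filter/cF.
- by move=> x _; rewrite derive1E; have [_ ->] := hF x.
Qed.

Lemma In_norm a b f (M : R) : a <= b -> mb f -> (forall x, a <= x <= b -> `|f x| <= M) -> `|In a b f| <= M * (b - a).
Proof.
move=> ab hf h; rewrite ler_norml -(In_cst M ab) -In_N; last exact: mbC.
apply/andP; split; apply: In_le; auto using mbC => x hx.
  by have := h x hx; rewrite ler_norml => /andP[].
by have := h x hx; rewrite ler_norml => /andP[].
Qed.

Definition mb2 (k : R -> R -> R) := measurable_fun [set: R * R] (fun p : R * R => k p.1 p.2) /\
  forall r, exists M, forall x y, `|x| <= r -> `|y| <= r -> `|k x y| <= M.

Lemma mb2D (k l : R -> R -> R) : mb2 k -> mb2 l -> mb2 (fun x y => k x y + l x y).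
Proof.
move=> [mf hf] [mg hg]; split; first exact: measurable_funD.
move=> r; have [M hM] := hf r; have [K hK] := hg r; exists (M + K) => x y hx hy.
by apply: (le_trans (ler_normD _ _)); apply: lerD; auto.
Qed.

Lemma mb2M (k l : R -> R -> R) : mb2 k -> mb2 l -> mb2 (fun x y => k x y * l x y).
Proof.
move=> [mf hf] [mg hg]; split; first exact: measurable_funM.
move=> r; have [M hM] := hf r; have [K hK] := hg r; exists (M * K) => x y hx hy.
by rewrite normrM; apply: ler_pM; auto.
Qed.

Lemma mb2_fst f : mb f -> mb2 (fun x _ => f x).
Proof.
move=> [mf hf]; split; first exact: (measurableT_comp mf measurable_fst).
by move=> r; have [M hM] := hf r; exists M => x y hx _; exact: hM.
Qed.

Lemma mb2_snd f : mb f -> mb2 (fun _ y => f y).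
Proof.
move=> [mf hf]; split; first exact: (measurableT_comp mf measurable_snd).
by move=> r; have [M hM] := hf r; exists M => x y _ hx; exact: hM.
Qed.

Lemma mb2_comp f (k : R -> R -> R) : mb f -> mb2 k -> mb2 (fun x y => f (k x y)).
Proof.
move=> [mf hf] [mk hk]; split; first exact: (measurableT_comp mf mk).
by move=> r; have [M hM] := hk r; have [K hK] := hf M; exists K => x y hx hy; apply: hK; exact: hM.
Qed.

Lemma mb2_swap (k : R -> R -> R) : mb2 k -> mb2 (fun x y => k y x).
Proof.
move=> [mk hk]; split.
  apply: (measurableT_comp mk (_ : measurable_fun setT (fun p : R * R => (p.2, p.1)))).
  by apply: measurable_fun_pair; [exact: measurable_snd|exact: measurable_fst].
by move=> r; have [M hM] := hk r; exists M => x y hx hy; exact: hM.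
Qed.

Lemma mb2_mb (k : R -> R -> R) x : mb2 k -> mb (k x).
Proof.
move=> [mk hk]; split.
  by apply: (measurableT_comp mk (_ : measurable_fun setT (fun y : R => (x, y)))); exact: measurable_pair1.
move=> r; have [M hM] := hk (Num.max r `|x|); exists M => y hy; apply: hM; first by rewrite le_max lexx orbT.
by rewrite le_max hy.
Qed.

Definition box a b c d : set (R * R) := `[a, b]%classic `*` `[c, d]%classic.
Definition bk (k : R -> R -> R) a b c d : R * R -> \bar R := (fun p => (k p.1 p.2)%:E) \_ (box a b c d).

Lemma bk_int k a b c d : mb2 k -> (mu \x mu)%E.-integrable setT (bk k a b c d).
Proof.
move=> [mk hk]; have mB : measurable (box a b c d) by exact: measurableX.
have mkc := @integrable_mkcond _ _ R (mu \x mu)%E (box a b c d) (fun p : R * R => (k p.1 p.2)%:E) mB.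
apply/mkc.
refine (@measurable_bounded_integrable _ _ R (mu \x mu)%E (fun p : R * R => k p.1 p.2) (box a b c d) mB _ _ _).
- have e : (mu \x mu)%E (box a b c d) = (mu `[a, b]%classic * mu `[c, d]%classic)%E by apply: product_measure1E.
  have l : (mu `[a, b]%classic * mu `[c, d]%classic < +oo)%E.
    rewrite /mu !lebesgue_measure_itv/=.
    by case: ifPn => _; case: ifPn => _; rewrite ?mul0e ?mule0// -?EFinB -?EFinM ltry.
  by move: l; rewrite -e.
- exact: measurable_funTS.
- have [M hM] := hk (`|a| + `|b| + `|c| + `|d|); exists M; split; rewrite ?num_real// => K MK [x y] /= [].
  rewrite /= !in_itv/= => /andP[ax xb] /andP[cy yd]; apply: le_trans (ltW MK); apply: hM; rewrite ler_norml.
    have := ler_norm b; have := ler_norm (- a); rewrite normrN; have := normr_ge0 c; have := normr_ge0 d; have := normr_ge0 a; have := normr_ge0 b.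
    by lra.
  have := ler_norm d; have := ler_norm (- c); rewrite normrN; have := normr_ge0 a; have := normr_ge0 b; have := normr_ge0 c; have := normr_ge0 d.
  by lra.
Qed.

Lemma bk1 k a b c d x : mb2 k -> (\int[mu]_y bk k a b c d (x, y))%E = (((\1_(`[a, b])) x * In c d (k x))%:E)%E.
Proof.
move=> hk; have mk := mb2_mb x hk.
rewrite indicE; case: (boolP (x \in `[a, b]%classic)) => hx; last first.
  rewrite mul0r; rewrite integral0_eq// => y _; rewrite /bk patchE ifN//.
  apply/negP; rewrite inE => -[/= hx' _]; move/negP: hx; apply; by rewrite inE.
rewrite mul1r /In /Rintegral fineK; last exact: integrable_fin_num (mb_integrable c d mk).
rewrite [RHS]integral_mkcond; apply: eq_integral => y _; rewrite /bk !patchE.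
have -> : ((x, y) \in box a b c d) = (y \in `[c, d]%classic); last by [].
apply/idP/idP; rewrite !inE; first by case.
by move=> hy; split => //=; rewrite inE in hx.
Qed.

Lemma Fub k a b c d : mb2 k ->
  In a b (fun x => In c d (k x)) = In c d (fun y => In a b (fun x => k x y)).
Proof.
move=> hk; have h := bk_int a b c d hk.
have e := Fubini h.
have hk' := mb2_swap hk.
have e1 : (\int[mu]_x \int[mu]_y bk k a b c d (x, y))%E = (\int[mu]_(x in `[a, b]) (In c d (k x))%:E)%E.
  rewrite [RHS]integral_mkcond; apply: eq_integral => x _; rewrite bk1// patchE indicE.
  by case: ifPn => _; rewrite ?mul1r ?mul0r.
have e2 : (\int[mu]_y \int[mu]_x bk k a b c d (x, y))%E = (\int[mu]_(y in `[c, d]) (In a b (fun x => k x y))%:E)%E.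
  rewrite [RHS]integral_mkcond; apply: eq_integral => y _.
  transitivity ((\int[mu]_x bk (fun x y => k y x) c d a b (y, x))%E).
    apply: eq_integral => x _; rewrite /bk !patchE; have -> : ((x, y) \in box a b c d) = ((y, x) \in box c d a b); last by [].
    by apply/idP/idP; rewrite !inE => -[].
  rewrite bk1// patchE indicE.
  by case: ifPn => _; rewrite ?mul1r ?mul0r.
by rewrite /In /Rintegral; congr fine; rewrite -e1 -e2.
Qed.

Lemma mb_In k c d : c <= d -> mb2 k -> mb (fun x => In c d (k x)).
Proof.
move=> cd hk; split; last first.
  move=> r; have [M hM] := hk.2 (Num.max r (Num.max `|c| `|d|)).
  exists (M * (d - c)) => x hx; apply: In_norm => //; first exact: mb2_mb.
  move=> y /andP[cy yd]; apply: hM; first by rewrite le_max hx.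
  rewrite ler_norml lerNl !le_max; apply/andP; split; last by rewrite (le_trans yd (ler_norm d)) !orbT.
  by have -> : - y <= `|c| by [apply: (le_trans (y := - c)); [rewrite lerN2|rewrite -normrN ler_norm]]; rewrite orbT.
(* Measurability in the parameter comes from Fubini on rectangles of growing width, followed by a
   pointwise limit that is eventually constant. *)
pose h (n : nat) x := \1_(`[- n%:R, n%:R]%classic) x * In c d (k x).
apply: (@measurable_fun_cvg _ _ R setT h) => [n|x _].
  have mF := measurable_fubini_F (bk_int (- n%:R) n%:R c d hk).
  apply/measurable_EFinP; rewrite (_ : EFin \o h n = fubini_F mu (bk k (- n%:R) n%:R c d)); first exact: mF.
  by apply/funext => x; rewrite /fubini_F bk1.
apply: cvg_near_cst; near=> n.
rewrite /h indicE mem_set ?mul1r//= in_itv/= -ler_norml.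
near: n; exact: nbhs_infty_ger.
Unshelve. all: by end_near. Qed.

End bounded_measurable.

(** * The Fejer kernel *)

Section fejer.
Context {R : realType}.
Implicit Types (f g : R -> R) (a b c d r L : R).
Let mu := @lebesgue_measure R.

Lemma mb_comp f g : mb f -> mb g -> mb (fun x => f (g x)).
Proof.
move=> [mf hf] [mg hg]; split; first exact: (measurableT_comp mf mg).
by move=> r; have [M hM] := hg r; have [K hK] := hf M; exists K => x hx; apply: hK; exact: hM.
Qed.

Lemma mb_id : mb (fun x : R => x). Proof. by apply: continuous_mb => x; exact: cvg_id. Qed.
Lemma mb_cos : mb (@cos R). Proof. exact: continuous_mb (@continuous_cos R). Qed.
Lemma mb_sin : mb (@sin R). Proof. exact: continuous_mb (@continuous_sin R). Qed.
Lemma mbN f : mb f -> mb (fun x => - f x).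
Proof.
move=> hf; have -> : (fun x => - f x) = (fun x => (-1) * f x) by apply/funext => x; rewrite mulN1r.
by apply: mbM => //; exact: mbC.
Qed.
Lemma mbB f g : mb f -> mb g -> mb (fun x => f x - g x).
Proof. by move=> hf hg; apply: mbD => //; exact: mbN. Qed.

Lemma In_mono a b c d f : a <= c -> d <= b -> mb f -> (forall x, a <= x <= b -> 0 <= f x) -> In c d f <= In a b f.
Proof.
move=> ac db hf f0.
have sub : `[c, d]%classic `<=` `[a, b]%classic by apply: subset_itv; rewrite bnd_simp.
have i1 := mb_integrable a b hf; have i2 := mb_integrable c d hf.
apply: fine_le; [exact: integrable_fin_num i2|exact: integrable_fin_num i1|].
apply: ge0_subset_integral => //.
by apply: measurable_funTS; apply/measurable_EFinP; exact: hf.1.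
Qed.

(** Transforms over [a, b] without the factor (2 pi)^(-1/2); [fe] below is the squared modulus. *)
Definition Fc a b f (xi : R) : R := In a b (fun x => f x * cos (x * xi)).
Definition Fs a b f (xi : R) : R := In a b (fun x => f x * sin (x * xi)).
Definition fe a b f (xi : R) : R := Fc a b f xi ^+ 2 + Fs a b f xi ^+ 2.
(** The Fejer kernel (1 - cos(L z)) / (L z^2). It is nonnegative and its integral is bounded in L,
    which gives inequalities in both directions between a function and its transform without Fourier
    inversion. *)
Definition Kf L (z : R) : R := In 0 L (fun xi => (1 - xi / L) * cos (z * xi)).

Lemma mb2_cosM : mb2 (fun x y : R => cos (x * y)).
Proof. by apply: mb2_comp; [exact: mb_cos|apply: mb2M; [exact: mb2_fst mb_id|exact: mb2_snd mb_id]]. Qed.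
Lemma mb2_sinM : mb2 (fun x y : R => sin (x * y)).
Proof. by apply: mb2_comp; [exact: mb_sin|apply: mb2M; [exact: mb2_fst mb_id|exact: mb2_snd mb_id]]. Qed.

Lemma mb_cosM c : mb (fun x : R => cos (c * x)). Proof. exact: mb2_mb c mb2_cosM. Qed.
Lemma mb_cosMr c : mb (fun x : R => cos (x * c)). Proof. exact: (@mb2_mb R (fun x y => cos (y * x)) c (mb2_swap mb2_cosM)). Qed.
Lemma mb_sinMr c : mb (fun x : R => sin (x * c)). Proof. exact: (@mb2_mb R (fun x y => sin (y * x)) c (mb2_swap mb2_sinM)). Qed.

Lemma mb_Fc a b f : a <= b -> mb f -> mb (Fc a b f).
Proof.
move=> ab hf; apply: (@mb_In R (fun xi x => f x * cos (x * xi))) => //.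
by apply: mb2M; [exact: mb2_snd|exact: mb2_swap mb2_cosM].
Qed.
Lemma mb_Fs a b f : a <= b -> mb f -> mb (Fs a b f).
Proof.
move=> ab hf; apply: (@mb_In R (fun xi x => f x * sin (x * xi))) => //.
by apply: mb2M; [exact: mb2_snd|exact: mb2_swap mb2_sinM].
Qed.
Lemma mb_fe a b f : a <= b -> mb f -> mb (fe a b f).
Proof.
move=> ab hf; have h1 := mb_Fc ab hf; have h2 := mb_Fs ab hf.
rewrite (_ : fe a b f = fun xi => Fc a b f xi * Fc a b f xi + Fs a b f xi * Fs a b f xi); last by apply/funext => xi; rewrite /fe !expr2.
by apply: mbD; apply: mbM.
Qed.

Lemma mb_weight L : mb (fun xi : R => 1 - xi / L).
Proof. by apply: mbB; [exact: mbC|apply: mbM; [exact: mb_id|exact: mbC]]. Qed.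

Lemma mb_Kf L : 0 <= L -> mb (Kf L).
Proof.
move=> L0; apply: (@mb_In R (fun z xi => (1 - xi / L) * cos (z * xi))) => //.
by apply: mb2M; [exact: mb2_snd (mb_weight L)|exact: mb2_cosM].
Qed.

Lemma mb2_Kf L : 0 <= L -> mb2 (fun x y => Kf L (x - y)).
Proof.
move=> L0; apply: mb2_comp; first exact: mb_Kf.
by apply: mb2D; [exact: mb2_fst mb_id|exact: mb2_snd (mbN mb_id)].
Qed.

(** Each square is a double integral; cos(x xi) cos(y xi) + sin(x xi) sin(y xi) = cos((x - y) xi),
    and the integral over xi produces the kernel. *)
Lemma fejer_id a b f L : a <= b -> 0 < L -> mb f ->
  In 0 L (fun xi => (1 - xi / L) * fe a b f xi) = In a b (fun x => In a b (fun y => f x * f y * Kf L (x - y))).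
Proof.
move=> ab L0 hf; have hFc := mb_Fc ab hf; have hFs := mb_Fs ab hf; have hw := mb_weight L.
pose k1 xi x := (1 - xi / L) * (f x * (cos (x * xi) * Fc a b f xi + sin (x * xi) * Fs a b f xi)).
have mk1 : mb2 k1.
  apply: mb2M; [exact: mb2_fst|apply: mb2M; [exact: mb2_snd|apply: mb2D; apply: mb2M]].
  - exact: mb2_swap mb2_cosM.
  - exact: mb2_fst.
  - exact: mb2_swap mb2_sinM.
  - exact: mb2_fst.
have e1 xi : (1 - xi / L) * fe a b f xi = In a b (k1 xi).
  rewrite In_Z; last first.
    by apply: mbM => //; apply: mbD; apply: mbM; [exact: mb_cosMr|exact: mbC|exact: mb_sinMr|exact: mbC].
  congr (_ * _); rewrite /fe !expr2.
  rewrite -(@In_Z R a b (Fc a b f xi)); last by apply: mbM => //; exact: mb_cosMr.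
  rewrite -(@In_Z R a b (Fs a b f xi)); last by apply: mbM => //; exact: mb_sinMr.
  rewrite -In_D; last 2 first.
  - by apply: mbM; [exact: mbC|apply: mbM => //; exact: mb_cosMr].
  - by apply: mbM; [exact: mbC|apply: mbM => //; exact: mb_sinMr].
  by apply: In_eq => x _; ring.
rewrite (In_eq (g := fun xi => In a b (k1 xi))); last by move=> xi _.
rewrite (Fub _ _ _ _ mk1); apply: In_eq => x _.
pose k2 xi y := (1 - xi / L) * (f x * (f y * cos ((x - y) * xi))).
have mk2 : mb2 k2.
  apply: mb2M; [exact: mb2_fst|apply: mb2M; [exact: mb2_fst (mbC _)|apply: mb2M; [exact: mb2_snd|]]].
  apply: mb2_comp; first exact: mb_cos.
  by apply: mb2M; [exact: mb2_snd (mbB (mbC _) mb_id)|exact: mb2_fst mb_id].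
rewrite (In_eq (g := fun xi => In a b (k2 xi))); last first.
  move=> xi _; rewrite /k1 /k2 In_Z; last first.
    by apply: mbM; [exact: mbC|apply: mbM => //; apply: mb_comp mb_cos (mbM (mbB (mbC _) mb_id) (mbC _))].
  congr (_ * _); rewrite In_Z; last by apply: mbM => //; apply: mb_comp mb_cos (mbM (mbB (mbC _) mb_id) (mbC _)).
  congr (_ * _); rewrite -In_Z; last by apply: mbM => //; exact: mb_cosMr.
  rewrite -In_Z; last by apply: mbM => //; exact: mb_sinMr.
  rewrite -In_D; last 2 first.
  - by apply: mbM; [exact: mbC|apply: mbM => //; exact: mb_cosMr].
  - by apply: mbM; [exact: mbC|apply: mbM => //; exact: mb_sinMr].
  by apply: In_eq => y _; rewrite mulrBl cosB; ring.
rewrite (Fub _ _ _ _ mk2); apply: In_eq => y _.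
rewrite /Kf -In_Z; last by apply: mbM => //; exact: mb_cosM.
by apply: In_eq => xi _; rewrite /k2; ring.
Qed.

Lemma norm_sin_le (v : R) : `|sin v| <= `|v|.
Proof.
wlog v0 : v / 0 <= v.
  move=> h; have [|/ltW v0] := leP 0 v; first exact: h.
  by rewrite -normrN -sinN -(normrN v); apply: h; rewrite oppr_ge0.
have [c [_ e]] := mvt (fun x => is_derive_sin x) v0.
move: e; rewrite sin0 !subr0 => ->; rewrite normrM ler_piMl//.
by rewrite ler_norml cos_geN1 cos_le1.
Qed.

Lemma cos_ge (u : R) : 1 - u ^+ 2 / 2 <= cos u.
Proof.
have e : cos u = 1 - 2 * sin (u / 2) ^+ 2.
  have -> : u = (u / 2) *+ 2 by rewrite mulr2n; field.
  rewrite cos_mulr2n mulr2n; have := cos2Dsin2 (u / 2).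
  rewrite (_ : (u / 2) *+ 2 / 2 = u / 2); last by rewrite mulr2n; field.
  by move=> h; lra.
rewrite e; have h : sin (u / 2) ^+ 2 <= (u / 2) ^+ 2.
  rewrite -(real_normK (num_real (sin _))) -(real_normK (num_real (u / 2))).
  by rewrite lerXn2r ?nnegrE//; exact: norm_sin_le.
by have -> : u ^+ 2 / 2 = 2 * (u / 2) ^+ 2 by [field]; lra.
Qed.

Lemma Kf_formula L (z : R) : 0 < L -> z != 0 -> Kf L z = (1 - cos (L * z)) / (L * z ^+ 2).
Proof.
move=> L0 z0.
pose P xi := (1 - xi / L) * (sin (z * xi) / z) - cos (z * xi) / (L * z ^+ 2).
have L0' : L != 0 by rewrite gt_eqF.
have dP (x : R) : is_derive x 1 P ((1 - x / L) * cos (z * x)).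
  have d1 : is_derive x 1 (fun x => z * x) z by apply: is_derive_eq; rewrite /GRing.scale/= mulr1.
  have d2 := is_derive1_comp (is_derive_sin (z * x)) d1.
  have d3 := is_derive1_comp (is_derive_cos (z * x)) d1.
  have d4 : is_derive x 1 (fun x => 1 - x / L) (- L^-1).
    by apply: is_derive_eq; rewrite /GRing.scale/=; ring.
  apply: is_derive_eq; rewrite /GRing.scale/=; field; by rewrite L0' z0.
rewrite /Kf (In_prim (ltW L0) _ dP); last first.
  move=> x; apply: cvgM; first by apply: cvgB; [exact: cvg_cst|apply: cvgM; [exact: cvg_id|exact: cvg_cst]].
  by apply: (continuous_comp (f := fun x => z * x)); [apply: cvgM; [exact: cvg_cst|exact: cvg_id]|exact: continuous_cos].
by rewrite /P mulr0 sin0 cos0 divff// subrr [z * L]mulrC; field; rewrite L0' z0.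
Qed.

Lemma Kf0 L : 0 < L -> Kf L 0 = L / 2.
Proof.
move=> L0; have L0' : L != 0 by rewrite gt_eqF.
pose P xi := xi - xi ^+ 2 / (2 * L).
have dP (x : R) : is_derive x 1 P ((1 - x / L) * cos (0 * x)).
  rewrite mul0r cos0 mulr1; by apply: is_derive_eq; rewrite /GRing.scale/=; field; exact: L0'.
rewrite /Kf (In_prim (ltW L0) _ dP); last first.
  rewrite (_ : (fun x => (1 - x / L) * cos (0 * x)) = fun x => 1 - x / L); last by apply/funext => y; rewrite mul0r cos0 mulr1.
  by move=> x; apply: cvgB; [exact: cvg_cst|apply: cvgM; [exact: cvg_id|exact: cvg_cst]].
by rewrite /P; field; exact: L0'.
Qed.

(** The second bound is a Cauchy density, integrable uniformly in L; 5/2 = 1/2 + 2 comes from 1 -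
    cos u <= u^2 / 2 and 1 - cos u <= 2. The third serves for Lipschitz differences, where z^2
    compensates the kernel. *)
Lemma Kf_bound L (z : R) : 0 < L -> [/\ 0 <= Kf L z, Kf L z <= 5 / 2 * (L / (1 + (L * z) ^+ 2)) & Kf L z * z ^+ 2 <= 2 / L].
Proof.
move=> L0; have [->|z0] := eqVneq z 0.
  rewrite Kf0// mulr0 !expr0n/= addr0 divr1 mulr0 !divr_ge0 ?(ltW L0)//; split => //; lra.
rewrite Kf_formula//; set u := L * z; have u0 : 0 < u ^+ 2 by rewrite exprn_even_gt0//= mulf_neq0// gt_eqF.
have z2 : 0 < z ^+ 2 by rewrite exprn_even_gt0.
have c1 := cos_le1 u; have c2 := cos_ge u; have c3 := cos_geN1 u.
have d0 : 0 < L * z ^+ 2 by rewrite mulr_gt0.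
have q0 : 0 < 1 + u ^+ 2 by rewrite addr_gt0.
split.
- by rewrite divr_ge0 ?(ltW d0)// subr_ge0.
- rewrite ler_pdivrMr//.
  have -> : 5 / 2 * (L / (1 + u ^+ 2)) * (L * z ^+ 2) = (5 / 2 * u ^+ 2) / (1 + u ^+ 2).
    by rewrite /u; field; rewrite -/u gt_eqF.
  rewrite ler_pdivlMr//.
  by move: c1 c2 c3 u0; move: (cos u) (u ^+ 2); clear => C U; nra.
- have -> : (1 - cos u) / (L * z ^+ 2) * z ^+ 2 = (1 - cos u) / L by field; rewrite z0 gt_eqF.
  by rewrite ler_pM2r ?invr_gt0//; lra.
Qed.

(** For |z| <= 1 / L the cosine under the integral is at least 1/2. *)
Lemma Kf_ge L (z : R) : 0 < L -> L * `|z| <= 1 -> L / 4 <= Kf L z.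
Proof.
move=> L0 h; have L0' : L != 0 by rewrite gt_eqF.
have -> : L / 4 = In 0 L (fun xi => (1 - xi / L) * 2^-1).
  pose P xi := (xi - xi ^+ 2 / (2 * L)) * 2^-1.
  have dP (x : R) : is_derive x 1 P ((1 - x / L) * 2^-1).
    by apply: is_derive_eq; rewrite /GRing.scale/=; field; exact: L0'.
  rewrite (In_prim (ltW L0) _ dP); first by rewrite /P; field; exact: L0'.
  by move=> x; apply: cvgM; [apply: cvgB; [exact: cvg_cst|apply: cvgM; [exact: cvg_id|exact: cvg_cst]]|exact: cvg_cst].
apply: In_le; [apply: mbM; [exact: mb_weight|exact: mbC]|apply: mbM; [exact: mb_weight|exact: mb_cosM]|] => xi /andP[x0 xL].
apply: ler_wpM2l; first by rewrite subr_ge0 ler_pdivrMr// mul1r.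
apply: le_trans (cos_ge _).
have : (z * xi) ^+ 2 <= 1.
  rewrite -(real_normK (num_real _)) expr_le1// normrM (ger0_norm x0).
  by apply: le_trans h; rewrite mulrC ler_wpM2r.
by lra.
Qed.

Lemma mb_cauchy L (z : R) : 0 < L -> mb (fun y => 5 / 2 * (L / (1 + (L * (y - z)) ^+ 2))).
Proof.
move=> L0; apply: continuous_mb => y; apply: cvgM; first exact: cvg_cst.
apply: cvgM; first exact: cvg_cst.
apply: cvgV; first by rewrite gt_eqF// ltr_wpDr ?sqr_ge0.
apply: cvgD; first exact: cvg_cst.
have c1 : L * (x - z) @[x --> y] --> L * (y - z) by apply: cvgM; [exact: cvg_cst|apply: cvgB; [exact: cvg_id|exact: cvg_cst]].
exact: (cvg_comp _ _ c1 (@exprn_continuous _ 2%N _)).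
Qed.

Lemma In_cauchy a b L (z : R) : a <= b -> 0 < L -> In a b (fun y => 5 / 2 * (L / (1 + (L * (y - z)) ^+ 2))) <= 5 / 2 * pi.
Proof.
move=> ab L0.
have dP (y : R) : is_derive y 1 (fun y => 5 / 2 * atan (L * (y - z))) (5 / 2 * (L / (1 + (L * (y - z)) ^+ 2))).
  have d1 : is_derive y 1 (fun y => L * (y - z)) L by apply: is_derive_eq; rewrite /GRing.scale/= subr0 mulr1.
  have d2 := @is_derive1_comp R (@atan R) (fun y => L * (y - z)) y _ _ (is_derive1_atan _) d1.
  by apply: is_derive_eq; rewrite /GRing.scale/= mulrC; ring.
rewrite (In_prim ab _ dP).
  have := atan_ltpi2 (L * (b - z)); have := atan_gtNpi2 (L * (a - z)); lra.
move=> y; apply: cvgM; first exact: cvg_cst.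
apply: cvgM; first exact: cvg_cst.
apply: cvgV; first by rewrite gt_eqF// ltr_wpDr ?sqr_ge0.
apply: cvgD; first exact: cvg_cst.
have c1 : L * (x - z) @[x --> y] --> L * (y - z) by apply: cvgM; [exact: cvg_cst|apply: cvgB; [exact: cvg_id|exact: cvg_cst]].
exact: (cvg_comp _ _ c1 (@exprn_continuous _ 2%N _)).
Qed.

End fejer.

(** * Bessel and Plancherel inequalities up to constants *)

Section bessel.
Context {R : realType}.
Implicit Types (f g : R -> R) (a b c d r L : R).
Let mu := @lebesgue_measure R.

Lemma fe_ge0 a b f xi : 0 <= fe a b f xi.
Proof. by rewrite addr_ge0 ?sqr_ge0. Qed.

Lemma mb_sqr f : mb f -> mb (fun x => f x ^+ 2).
Proof. by move=> h; rewrite (_ : (fun x => f x ^+ 2) = fun x => f x * f x); [exact: mbM|apply/funext => x; rewrite expr2]. Qed.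

Lemma In_Kf_le a b L (x : R) : a <= b -> 0 < L -> In a b (fun y => Kf L (x - y)) <= 5 / 2 * pi.
Proof.
move=> ab L0; apply: le_trans (In_cauchy x ab L0).
apply: In_le; [exact: mb2_mb (mb2_Kf (ltW L0))|exact: mb_cauchy|] => y _.
have [_ h _] := Kf_bound (x - y) L0; apply: (le_trans h).
by rewrite -[(L * (y - x)) ^+ 2]sqrrN -mulrN opprB.
Qed.

Lemma In_Kf_le' a b L (y : R) : a <= b -> 0 < L -> In a b (fun x => Kf L (x - y)) <= 5 / 2 * pi.
Proof.
move=> ab L0; apply: le_trans (In_cauchy y ab L0).
apply: In_le; [exact: (mb2_mb y (mb2_swap (mb2_Kf (ltW L0))))|exact: mb_cauchy|] => x _.
by have [_ h _] := Kf_bound (x - y) L0.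
Qed.

(** Schur's test: f(x) f(y) <= (f(x)^2 + f(y)^2) / 2, and the kernel has bounded integral in each
    variable. *)
Lemma Kf_form_le a b f L : a <= b -> 0 < L -> mb f ->
  In a b (fun x => In a b (fun y => f x * f y * Kf L (x - y))) <= 5 / 2 * pi * In a b (fun x => f x ^+ 2).
Proof.
move=> ab L0 hf; have L0' := ltW L0; have hf2 := mb_sqr hf.
pose k x y := f x * f y * Kf L (x - y).
have mk : mb2 k by apply: mb2M (mb2_Kf L0'); apply: mb2M; [exact: mb2_fst|exact: mb2_snd].
pose k1 x y := 2^-1 * f x ^+ 2 * Kf L (x - y).
pose k2 x y := 2^-1 * f y ^+ 2 * Kf L (x - y).
have m1 : mb (fun x => 2^-1 * f x ^+ 2) by apply: mbM => //; exact: mbC.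
have mk1 : mb2 k1 by apply: mb2M (mb2_Kf L0'); exact: (@mb2_fst R (fun x => 2^-1 * f x ^+ 2)).
have mk2 : mb2 k2 by apply: mb2M (mb2_Kf L0'); exact: (@mb2_snd R (fun x => 2^-1 * f x ^+ 2)).
apply: (le_trans (y := In a b (fun x => In a b (k1 x)) + In a b (fun x => In a b (k2 x)))).
  rewrite -In_D; [|exact: mb_In|exact: mb_In]; apply: In_le; [exact: mb_In|apply: mbD; exact: mb_In|] => x _.
  rewrite -In_D; [|exact: mb2_mb|exact: mb2_mb]; apply: In_le; [exact: (mb2_mb x mk)|apply: mbD; exact: mb2_mb|] => y _.
  have [h _ _] := Kf_bound (x - y) L0.
  rewrite /k1 /k2 -mulrDl; apply: ler_wpM2r => //.
  by have := sqr_ge0 (f x - f y); lra.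
have half : In a b (fun x => 2^-1 * f x ^+ 2 * (5 / 2 * pi)) = 2^-1 * (5 / 2 * pi * In a b (fun x => f x ^+ 2)).
  by rewrite mulrA -In_Z//; apply: In_eq => x _; ring.
have -> : 5 / 2 * pi * In a b (fun x => f x ^+ 2) = In a b (fun x => 2^-1 * f x ^+ 2 * (5 / 2 * pi)) + In a b (fun x => 2^-1 * f x ^+ 2 * (5 / 2 * pi)).
  by rewrite half; field.
rewrite (Fub _ _ _ _ mk2); apply: lerD; apply: In_le.
- exact: mb_In.
- by apply: mbM => //; exact: mbC.
- move=> x _; rewrite /k1 In_Z; last exact: mb2_mb (mb2_Kf L0').
  by apply: ler_wpM2l; [rewrite mulr_ge0 ?sqr_ge0|exact: In_Kf_le].
- exact: (mb_In ab (mb2_swap mk2)).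
- by apply: mbM => //; exact: mbC.
- move=> y _; rewrite /k2 In_Z; last exact: (mb2_mb y (mb2_swap (mb2_Kf L0'))).
  by apply: ler_wpM2l; [rewrite mulr_ge0 ?sqr_ge0|exact: In_Kf_le'].
Qed.

(** With L = 2 M the Fejer weight is at least 1/2 on [0, M]. The sharp constant is pi; the lost
    factor 5 is the one in [transform_exists] and [Hs_le]. *)
Lemma bessel0 a b f (M : R) : a <= b -> 0 < M -> mb f -> In 0 M (fe a b f) <= 5 * pi * In a b (fun x => f x ^+ 2).
Proof.
move=> ab M0 hf; have hfe := mb_fe ab hf.
have L0 : 0 < 2 * M by lra.
have mw : mb (fun xi => (1 - xi / (2 * M)) * fe a b f xi) by apply: mbM => //; exact: mb_weight.
apply: (le_trans (y := 2 * In 0 (2 * M) (fun xi => (1 - xi / (2 * M)) * fe a b f xi))).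
  rewrite -In_Z//; apply: (le_trans (y := In 0 M (fun xi => 2 * ((1 - xi / (2 * M)) * fe a b f xi)))).
    apply: In_le => //; first by apply: mbM => //; exact: mbC.
    move=> xi /andP[x0 xM]; rewrite mulrA ler_peMl ?fe_ge0//.
    have : xi / (2 * M) <= 2^-1 by rewrite ler_pdivrMr//; lra.
    by lra.
  apply: In_mono => //; [lra|by apply: mbM => //; exact: mbC|].
  move=> xi /andP[x0 xM]; rewrite !mulr_ge0 ?fe_ge0// subr_ge0 ler_pdivrMr// mul1r//.
rewrite fejer_id//; have := Kf_form_le ab L0 hf; lra.
Qed.

(** g(x) g(y) = (g(x)^2 + g(y)^2) / 2 - (g(x) - g(y))^2 / 2. The kernel has mass at least 1/2 on |x
    - y| <= 1 / L, and the Lipschitz part is O(1 / L). The margin rho + 1 <= r keeps these windows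
    inside [-r, r]. *)
Lemma fejer_lower g (r rho S L : R) : 1 <= L -> rho + 1 <= r -> 0 <= rho -> mb g -> (forall x, rho < `|x| -> g x = 0) ->
  (forall x y, `|g x - g y| <= S * `|x - y|) ->
  2^-1 * In (- r) r (fun x => g x ^+ 2) - S ^+ 2 * (2 * r) ^+ 2 / L <= In 0 L (fe (- r) r g).
Proof.
move=> L1 rr rho0 hg supp lip; have L0 : 0 < L := lt_le_trans ltr01 L1; have L0' := ltW L0.
have r0 : 0 < r by lra.
have ab : - r <= r by lra.
have hfe := mb_fe ab hg; have hf2 := mb_sqr hg.
apply: (le_trans (y := In 0 L (fun xi => (1 - xi / L) * fe (- r) r g xi))); last first.
  apply: In_le => //; first by apply: mbM => //; exact: mb_weight.
  move=> xi /andP[x0 xL]; rewrite ler_piMl ?fe_ge0// gerBl divr_ge0//.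
rewrite fejer_id//.
pose k x y := g x * g y * Kf L (x - y).
have mk : mb2 k by apply: mb2M (mb2_Kf L0'); apply: mb2M; [exact: mb2_fst|exact: mb2_snd].
pose k1 x y := 2^-1 * g x ^+ 2 * Kf L (x - y).
pose k2 x y := 2^-1 * g y ^+ 2 * Kf L (x - y).
have m1 : mb (fun x => 2^-1 * g x ^+ 2) by apply: mbM => //; exact: mbC.
have mk1 : mb2 k1 by apply: mb2M (mb2_Kf L0'); exact: (@mb2_fst R (fun x => 2^-1 * g x ^+ 2)).
have mk2 : mb2 k2 by apply: mb2M (mb2_Kf L0'); exact: (@mb2_snd R (fun x => 2^-1 * g x ^+ 2)).
pose e := S ^+ 2 / L.
apply: (le_trans (y := In (- r) r (fun x => In (- r) r (k1 x)) + In (- r) r (fun x => In (- r) r (k2 x)) - e * (r - - r) * (r - - r))); last first.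
  rewrite lerBlDr -(In_cst (e * (r - - r)) ab) -In_D; [|exact: mb_In|exact: mb_In].
  rewrite -In_D; [|exact: mb_In|exact: mbC].
  apply: In_le; [apply: mbD; exact: mb_In|apply: mbD; [exact: mb_In|exact: mbC]|] => x _.
  rewrite -(In_cst e ab) -In_D; [|exact: mb2_mb|exact: mb2_mb].
  rewrite -In_D; [|exact: (mb2_mb x mk)|exact: mbC].
  apply: In_le; [apply: mbD; exact: mb2_mb|apply: mbD; [exact: (mb2_mb x mk)|exact: mbC]|] => y _.
  have [h0 _ h2] := Kf_bound (x - y) L0.
  have hl : (g x - g y) ^+ 2 <= S ^+ 2 * (x - y) ^+ 2.
    rewrite -exprMn -(real_normK (num_real (g x - g y))) -(real_normK (num_real (S * _))).
    rewrite lerXn2r ?nnegrE//; apply: (le_trans (lip x y)); rewrite normrM.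
    by apply: ler_wpM2r => //; exact: ler_norm.
  have h3 := ler_wpM2r h0 hl.
  have h4 := ler_wpM2l (sqr_ge0 S) h2.
  by rewrite /k1 /k2 /k /e; move: h3 h4; move: (Kf L _) (g x) (g y) => K p q; clear; lra.
have half : In (- r) r (fun x => 2^-1 * g x ^+ 2 * 2^-1) = 4^-1 * In (- r) r (fun x => g x ^+ 2).
  by rewrite -In_Z//; apply: In_eq => x _; field.
have l1 x : -r <= x <= r -> 2^-1 * g x ^+ 2 * 2^-1 <= 2^-1 * g x ^+ 2 * In (- r) r (fun y => Kf L (x - y)).
  move=> _; have [hx|hx] := ltP rho `|x|; first by rewrite supp// expr0n/= mulr0 !mul0r.
  apply: ler_wpM2l; first by rewrite mulr_ge0 ?sqr_ge0.
  have iL : L^-1 <= 1 by rewrite invf_le1.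
  have iL0 : 0 < L^-1 by rewrite invr_gt0.
  move: hx; rewrite ler_norml => /andP[x1 x2].
  apply: (le_trans (y := In (x - L^-1) (x + L^-1) (fun=> L / 4))).
    rewrite In_cst; [|lra]; rewrite le_eqVlt; apply/orP; left; apply/eqP; field; by rewrite gt_eqF.
  apply: (le_trans (y := In (x - L^-1) (x + L^-1) (fun y => Kf L (x - y)))).
    apply: In_le; [exact: mbC|exact: mb2_mb (mb2_Kf L0')|] => y hy; apply: Kf_ge => //.
    rewrite -ler_pdivlMl// mulr1 ler_norml; lra.
  apply: In_mono; [lra|lra|exact: mb2_mb (mb2_Kf L0')|] => y _.
  by have [] := Kf_bound (x - y) L0.
have l2 y : -r <= y <= r -> 2^-1 * g y ^+ 2 * 2^-1 <= 2^-1 * g y ^+ 2 * In (- r) r (fun x => Kf L (x - y)).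
  move=> _; have [hx|hx] := ltP rho `|y|; first by rewrite supp// expr0n/= mulr0 !mul0r.
  apply: ler_wpM2l; first by rewrite mulr_ge0 ?sqr_ge0.
  have iL : L^-1 <= 1 by rewrite invf_le1.
  have iL0 : 0 < L^-1 by rewrite invr_gt0.
  move: hx; rewrite ler_norml => /andP[x1 x2].
  have mK := mb2_mb y (mb2_swap (mb2_Kf L0')).
  apply: (le_trans (y := In (y - L^-1) (y + L^-1) (fun=> L / 4))).
    rewrite In_cst; [|lra]; rewrite le_eqVlt; apply/orP; left; apply/eqP; field; by rewrite gt_eqF.
  apply: (le_trans (y := In (y - L^-1) (y + L^-1) (fun x => Kf L (x - y)))).
    apply: In_le; [exact: mbC|exact: mK|] => x hx; apply: Kf_ge => //.
    rewrite -ler_pdivlMl// mulr1 ler_norml; lra.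
  apply: In_mono; [lra|lra|exact: mK|] => x _.
  by have [] := Kf_bound (x - y) L0.
have s1 : 4^-1 * In (- r) r (fun x => g x ^+ 2) <= In (- r) r (fun x => In (- r) r (k1 x)).
  rewrite -half; apply: In_le; [by apply: mbM => //; exact: mbC|exact: mb_In|] => x hx.
  rewrite /k1 In_Z; [exact: l1|exact: mb2_mb (mb2_Kf L0')].
have s2 : 4^-1 * In (- r) r (fun x => g x ^+ 2) <= In (- r) r (fun x => In (- r) r (k2 x)).
  rewrite -half (Fub _ _ _ _ mk2); apply: In_le; [by apply: mbM => //; exact: mbC|exact: (mb_In ab (mb2_swap mk2))|] => y hy.
  rewrite /k2 In_Z; [exact: l2|exact: (mb2_mb y (mb2_swap (mb2_Kf L0')))].
have -> : e * (r - - r) * (r - - r) = S ^+ 2 * (2 * r) ^+ 2 / L by rewrite /e; field; rewrite gt_eqF.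
have e4 : 4^-1 + 4^-1 = 2^-1 :> R by field.
by rewrite -e4 mulrDl; exact: (lerB (lerD s1 s2) (lexx _)).
Qed.

Lemma lip_cos (x y : R) : `|cos x - cos y| <= `|x - y|.
Proof.
wlog xy : x y / y <= x.
  by move=> h; have [|/ltW xy] := leP y x; [exact: h|rewrite distrC (distrC x); exact: h].
have [c [_ ->]] := mvt (fun x => is_derive_cos x) xy.
by rewrite normrM ler_piMl// normrN ler_norml sin_geN1 sin_le1.
Qed.
Lemma lip_sin (x y : R) : `|sin x - sin y| <= `|x - y|.
Proof.
wlog xy : x y / y <= x.
  by move=> h; have [|/ltW xy] := leP y x; [exact: h|rewrite distrC (distrC x); exact: h].
have [c [_ ->]] := mvt (fun x => is_derive_sin x) xy.
by rewrite normrM ler_piMl// ler_norml cos_geN1 cos_le1.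
Qed.

Lemma lip_continuous (h : R -> R) (C : R) : (forall x y, `|h x - h y| <= C * `|x - y|) -> continuous h.
Proof.
move=> hC x; apply/cvgrPdist_le => e e0; near=> y.
apply: (le_trans (hC x y)).
have C1 : 0 < `|C| + 1 by rewrite ltr_wpDl.
apply: (le_trans (y := (`|C| + 1) * `|x - y|)); first by rewrite ler_wpM2r// (le_trans (ler_norm C))// lerDl.
rewrite -ler_pdivlMl//; near: y; apply: cvgr_dist_le; last by rewrite mulr_gt0 ?invr_gt0.
exact: cvg_id.
Unshelve. all: by end_near. Qed.

Lemma continuous_Fc a b f : a <= b -> mb f -> continuous (Fc a b f).
Proof.
move=> ab hf; have [M hM] := hf.2 (Num.max `|a| `|b|).
apply: (@lip_continuous _ (M * Num.max `|a| `|b| * (b - a))) => xi eta.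
rewrite /Fc -(@In_N R a b (fun x => f x * cos (x * eta))); last by apply: mbM => //; exact: mb_cosMr.
rewrite -In_D; last 2 first.
- by apply: mbM => //; exact: mb_cosMr.
- by apply: mbN; apply: mbM => //; exact: mb_cosMr.
rewrite mulrAC; apply: In_norm => //.
  by apply: mbD; [|apply: mbN]; apply: mbM => //; exact: mb_cosMr.
move=> x /andP[ax xb]; rewrite -mulrBr normrM -mulrA.
have hx : `|x| <= Num.max `|a| `|b|.
  rewrite ler_norml lerNl !le_max; apply/andP; split; last by rewrite (le_trans xb (ler_norm b)) orbT.
  by rewrite (_ : - x <= `|a|)// (le_trans _ (_ : - a <= _)) ?lerN2// -normrN ler_norm.
apply: ler_pM => //; first exact: hM.
apply: (le_trans (lip_cos _ _)); rewrite -mulrBr normrM; exact: ler_wpM2r.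
Qed.

Lemma continuous_Fs a b f : a <= b -> mb f -> continuous (Fs a b f).
Proof.
move=> ab hf; have [M hM] := hf.2 (Num.max `|a| `|b|).
apply: (@lip_continuous _ (M * Num.max `|a| `|b| * (b - a))) => xi eta.
rewrite /Fs -(@In_N R a b (fun x => f x * sin (x * eta))); last by apply: mbM => //; exact: mb_sinMr.
rewrite -In_D; last 2 first.
- by apply: mbM => //; exact: mb_sinMr.
- by apply: mbN; apply: mbM => //; exact: mb_sinMr.
rewrite mulrAC; apply: In_norm => //.
  by apply: mbD; [|apply: mbN]; apply: mbM => //; exact: mb_sinMr.
move=> x /andP[ax xb]; rewrite -mulrBr normrM -mulrA.
have hx : `|x| <= Num.max `|a| `|b|.
  rewrite ler_norml lerNl !le_max; apply/andP; split; last by rewrite (le_trans xb (ler_norm b)) orbT.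
  by rewrite (_ : - x <= `|a|)// (le_trans _ (_ : - a <= _)) ?lerN2// -normrN ler_norm.
apply: ler_pM => //; first exact: hM.
apply: (le_trans (lip_sin _ _)); rewrite -mulrBr normrM; exact: ler_wpM2r.
Qed.

Lemma continuous_fe a b f : a <= b -> mb f -> continuous (fe a b f).
Proof.
move=> ab hf.
rewrite (_ : fe a b f = fun xi => Fc a b f xi * Fc a b f xi + Fs a b f xi * Fs a b f xi); last by apply/funext => xi; rewrite /fe !expr2.
have h1 := continuous_Fc ab hf; have h2 := continuous_Fs ab hf.
by move=> xi; exact: (cvgD (cvgM (h1 xi) (h1 xi)) (cvgM (h2 xi) (h2 xi))).
Qed.

Lemma feN a b f xi : mb f -> fe a b f (- xi) = fe a b f xi.
Proof.
move=> hf; rewrite /fe /Fc /Fs; congr (_ ^+ 2 + _); first by apply: In_eq => x _; rewrite mulrN cosN.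
rewrite -[RHS]sqrrN -In_N; last by apply: mbM => //; exact: mb_sinMr.
by congr (_ ^+ 2); apply: In_eq => x _; rewrite mulrN sinN mulrN.
Qed.

Lemma integral_fe a b f (C : R) : a <= b -> mb f -> (forall M, 0 < M -> In 0 M (fe a b f) <= C) ->
  (\int[mu]_xi (fe a b f xi)%:E <= (2 * C)%:E)%E.
Proof.
move=> ab hf h; rewrite ge0_symfun_integralT; [|exact: fe_ge0|exact: continuous_fe|by move=> xi; rewrite /= feN].
rewrite EFinM; apply: lee_wpmul2l => //.
have hm := (mb_fe ab hf).1.
rewrite (_ : [set x | 0 <= x] = `[0, +oo[%classic); last by apply/seteqP; split => x /=; rewrite in_itv/= andbT.
apply: (cvge_le _ (ge0_cvgn_integral (fe_ge0 a b f) hm)); near=> n.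
have n0 : 0 < n%:R :> R by near: n; exact: nbhs_infty_gtr.
have := h _ n0; rewrite /In /Rintegral -lee_fin fineK//.
exact: integrable_fin_num (mb_integrable _ _ (mb_fe ab hf)).
Unshelve. all: by end_near. Qed.

Lemma bessel a b f : a <= b -> mb f -> (\int[mu]_xi (fe a b f xi)%:E <= (10 * pi * In a b (fun x => f x ^+ 2))%:E)%E.
Proof.
move=> ab hf; have -> : 10 * pi * In a b (fun x => f x ^+ 2) = 2 * (5 * pi * In a b (fun x => f x ^+ 2)) by ring.
by apply: integral_fe => // M M0; exact: bessel0.
Qed.

(** [fejer_lower] with L so large that the Lipschitz error is below [e]. On the left the sharp
    constant would be 2 pi. *)
Lemma plancherel_lower g (r rho S : R) : rho + 1 <= r -> 0 <= rho -> mb g -> (forall x, rho < `|x| -> g x = 0) ->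
  (forall x y, `|g x - g y| <= S * `|x - y|) ->
  ((In (- r) r (fun x => g x ^+ 2))%:E <= \int[mu]_xi (fe (- r) r g xi)%:E)%E.
Proof.
move=> rr rho0 hg supp lip.
have ab : - r <= r by lra.
have hm := mb_fe ab hg.
rewrite ge0_symfun_integralT; [|exact: fe_ge0|exact: continuous_fe|by move=> xi; rewrite /= feN].
rewrite (_ : [set x | 0 <= x] = `[0, +oo[%classic); last by apply/seteqP; split => x /=; rewrite in_itv/= andbT.
have -> : In (- r) r (fun x => g x ^+ 2) = 2 * (2^-1 * In (- r) r (fun x => g x ^+ 2)) by field.
rewrite [leLHS]EFinM; apply: lee_wpmul2l => //.
apply/lee_addgt0Pr => e e0.
pose Q := S ^+ 2 * (2 * r) ^+ 2; have Q0 : 0 <= Q by rewrite mulr_ge0 ?sqr_ge0.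
pose L := 1 + Q / e; have L1 : 1 <= L by rewrite lerDl divr_ge0// ltW.
have L0 : 0 < L := lt_le_trans ltr01 L1.
have h := fejer_lower L1 rr rho0 hg supp lip.
have QL : Q / L <= e.
  by rewrite ler_pdivrMr// /L mulrDr mulr1 mulrCA divff ?gt_eqF// mulr1 lerDr ltW.
apply: (le_trans (y := (In 0 L (fe (- r) r g) + e)%:E)); first by rewrite lee_fin -/Q in h *; lra.
rewrite EFinD leeD2r// /In /Rintegral fineK; last exact: integrable_fin_num (mb_integrable _ _ hm).
apply: ge0_subset_integral => //=.
- by apply: measurable_funTS; apply/measurable_EFinP; exact: hm.1.
- by move=> x _; rewrite lee_fin fe_ge0.
- by move=> x /=; rewrite !in_itv/= andbT => /andP[].
Qed.

End bessel.

(** * Fatou and Riesz-Fischer *)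

Section square_integrable.
Context {R : realType}.
Implicit Types (f g : R -> R) (a b c d r : R).
Local Notation mu := (@lebesgue_measure R).

Definition I2 g : \bar R := (\int[mu]_x (g x ^+ 2)%:E)%E.

Lemma I2_ge0 g : (0 <= I2 g)%E.
Proof. by apply: integral_ge0 => x _; rewrite lee_fin sqr_ge0. Qed.

Lemma Lnorm2E g : Lnorm mu 2%:E (EFin \o g) = poweR (I2 g) 2^-1.
Proof.
rewrite unlock; congr (_ `^ _)%E; apply: eq_integral => x _.
rewrite -[2%R]/(2%:R) -[(EFin \o g) x]/((g x)%:E) abse_EFin poweR_EFin powR_mulrn//.
by rewrite real_normK// num_real.
Qed.

Lemma Lfun2I g : measurable_fun setT g -> (I2 g < +oo)%E -> g \in Lfun mu 2%:E.
Proof.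
move=> mg hg; rewrite inE; apply/andP; split; first by rewrite inE.
rewrite inE /finite_norm /= Lnorm2E; move: hg (I2_ge0 g); case: (I2 g) => [q| |]// _ _.
by rewrite poweR_EFin ltry.
Qed.

Lemma I2_measurable g : measurable_fun setT g -> measurable_fun setT (fun x => (g x ^+ 2)%:E).
Proof. by move=> mg; apply/measurable_EFinP; exact: measurable_funX. Qed.

Lemma limn_einf_le (u : (\bar R)^nat) (C : \bar R) : (\forall n \near \oo, (u n <= C)%E) -> (limn_einf u <= C)%E.
Proof.
move=> h; rewrite limn_einf_lim; apply: lime_le; first exact: is_cvg_einfs.
near=> n; apply: (@le_trans _ _ (u n)); last by near: n.
by apply: ereal_inf_lbound; exists n => /=.
Unshelve. all: by end_near. Qed.

(** Asks only for convergence almost everywhere, the mode that [riesz_fischer] provides, and for a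
    bound that holds eventually. *)
Lemma fatou_ae (f : nat -> R -> R) g (C : \bar R) :
  (forall k, measurable_fun setT (f k)) -> measurable_fun setT g -> (forall k x, 0 <= f k x) ->
  {ae mu, forall x, f k x @[k --> \oo] --> g x} ->
  (\forall k \near \oo, (\int[mu]_x (f k x)%:E <= C)%E) -> (\int[mu]_x (g x)%:E <= C)%E.
Proof.
move=> mf mg f0 hae hC.
have mF k : measurable_fun setT (fun x => (f k x)%:E) by apply/measurable_EFinP.
have F0 k x : setT x -> (0 <= (f k x)%:E)%E by rewrite lee_fin.
have -> : (\int[mu]_x (g x)%:E = \int[mu]_x limn_einf (fun k => (f k x)%:E))%E.
  apply: ae_eq_integral => //; [exact/measurable_EFinP| |].
    have -> : (fun x => limn_einf (fun k => (f k x)%:E)) = (fun x => - limn_esup (fun k => - (f k x)%:E))%E.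
      apply/funext => x; rewrite -limn_einfN; congr limn_einf; apply/funext => k /=.
      by rewrite /= opprK.
    apply: measurableT_comp; first exact: oppe_measurable.
    apply: (@measurable_fun_limn_esup _ _ R setT (fun k x => - (f k x)%:E)%E) => k.
    exact: measurableT_comp.
  apply: (@filterS _ _ (ae_filter_ringOfSetsType mu) _ _ _ hae) => x hx _.
  have c : (f k x)%:E @[k --> \oo] --> (g x)%:E by apply: cvg_EFin; [exact: nearW|exact: hx].
  by have [-> _] := cvg_limn_einf_sup c.
have hf := fatou mu measurableT mF F0; apply: (le_trans hf); exact: limn_einf_le.
Qed.

(** The squared increments decay like 8^(-k), so they remain summable after multiplication by 4^k;
    where this sum is finite the increments are O(2^(-k)) and the sequence is Cauchy. *)
Lemma riesz_fischer (F : nat -> R -> R) (C : R) : 0 <= C -> (forall k, measurable_fun setT (F k)) ->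
  (forall k, (I2 (fun x => (F k.+1 x - F k x)%R) <= (C / 8 ^+ k)%:E)%E) ->
  exists2 a : R -> R, measurable_fun setT a & {ae mu, forall x, F k x @[k --> \oo] --> a x}.
Proof.
move=> C0 mF hF.
pose D k x : \bar R := (4 ^+ k * (F k.+1 x - F k x) ^+ 2)%:E.
have mD k : measurable_fun setT (D k).
  by apply/measurable_EFinP; apply: measurable_funM; [exact: measurable_cst|apply: measurable_funX; exact: measurable_funB].
have D0 k x : setT x -> (0 <= D k x)%E by move=> _; rewrite lee_fin mulr_ge0 ?sqr_ge0 ?exprn_ge0.
pose h x := (\sum_(k <oo) D k x)%E.
have mh : measurable_fun setT h.
  have := @ge0_emeasurable_sum _ _ R setT D xpredT (fun k x _ _ => D0 k x I) (fun k _ => mD k).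
  by rewrite /h; congr measurable_fun.
have hI : (\int[mu]_x h x <= (2 * C)%:E)%E.
  rewrite /h integral_nneseries//.
  have hk k : (\int[mu]_x D k x <= (2 * C / (2 ^ k.+1)%:R)%:E)%E.
    have -> : (\int[mu]_x D k x = (4 ^+ k)%:E * I2 (fun x => (F k.+1 x - F k x)%R))%E.
      have mk := I2_measurable (measurable_funB (mF k.+1) (mF k)).
      have p0 : forall x, setT x -> (0 <= ((F k.+1 x - F k x) ^+ 2)%:E)%E by move=> x _; rewrite lee_fin sqr_ge0.
      have q0 : (0 <= (4 ^+ k)%:E :> \bar R)%E by rewrite lee_fin exprn_ge0.
      have e := ge0_integralZl mu measurableT mk p0 q0.
      by rewrite /I2; exact: e.
    apply: (le_trans (lee_wpmul2l _ (hF k))); first by rewrite lee_fin exprn_ge0.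
    rewrite -EFinM lee_fin le_eqVlt; apply/orP; left; apply/eqP.
    rewrite natrX exprS (_ : 8 ^+ k = 4 ^+ k * 2 ^+ k :> R); last by rewrite -exprMn; congr (_ ^+ _); ring.
    by field; rewrite !expf_neq0.
  apply: (le_trans (lee_nneseries _ _)); [| |by apply: (@epsilon_trick0 R (2 * C) xpredT); rewrite mulr_ge0].
  - by move=> k _ _; apply: integral_ge0 => x _; exact: D0.
  - by move=> k _; exact: hk.
have ih : mu.-integrable setT h.
  apply/integrableP; split => //; apply: le_lt_trans (ltry (2 * C)); apply: le_trans hI.
  apply: ge0_le_integral => //; first exact: measurableT_comp.
  by move=> x _; rewrite gee0_abs//; apply: nneseries_ge0 => k _ _; exact: D0.
(* The upper limit is measurable everywhere and agrees with the limit where that exists. *)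
exists (fun x => fine (limn_esup (fun k => (F k x)%:E))).
  apply: measurableT_comp; first exact: fine_measurable.
  by apply: (@measurable_fun_limn_esup _ _ R setT (fun k x => (F k x)%:E)) => k; exact/measurable_EFinP.
apply: (@filterS _ _ (ae_filter_ringOfSetsType mu) _ _ _ (integrable_ae measurableT ih)) => x /(_ I) hx.
pose H := fine (h x); have H0 : 0 <= H by apply: fine_ge0; apply: nneseries_ge0 => k _ _; exact: D0.
have hk k : `|F k.+1 x - F k x| <= Num.sqrt H * 2^-1 ^+ k.
  have h1 : (D k x <= h x)%E.
    have := @nneseries_lim_ge R (fun k => D k x) xpredT 0%N k.+1 (fun n _ _ => D0 n x I).
    apply: le_trans; rewrite big_nat_recr//= leeDr// sume_ge0// => i _; exact: D0.
  rewrite -(@fineK _ (h x))// -/H lee_fin in h1.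
  rewrite -(@ler_pXn2r _ 2%N) ?nnegrE ?mulr_ge0 ?sqrtr_ge0 ?exprn_ge0// ?invr_ge0//.
  rewrite exprMn sqr_sqrtr// real_normK ?num_real// -exprM mulnC exprM.
  have -> : (2^-1 ^+ 2) = (4^-1 : R) by field.
  by rewrite exprVn ler_pdivlMr ?exprn_gt0// mulrC.
have cv : cvgn (fun k => F k x).
  have : cvgn (series (telescope (fun k => F k x))).
    apply: normed_cvg; apply: (@series_le_cvg _ _ (geometric (Num.sqrt H) 2^-1)).
    - by move=> k /=.
    - by move=> k /=; rewrite mulr_ge0 ?sqrtr_ge0 ?exprn_ge0// invr_ge0.
    - by move=> k /=; exact: hk.
    - by apply: is_cvg_geometric_series; rewrite ger0_norm; lra.
  rewrite telescopeK => /cvg_ex[l hl]; apply/cvg_ex; exists (l + F 0%N x).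
  rewrite (_ : (fun k => F k x) = (fun k => (F k x - F 0%N x) + F 0%N x)); last by apply/funext => k; rewrite subrK.
  exact: (cvgD hl (cvg_cst (F 0%N x))).
have c : (F k x)%:E @[k --> \oo] --> (limn (fun k => F k x))%:E by apply: cvg_EFin; [exact: nearW|exact: cv].
by have [_ ->] := cvg_limn_einf_sup c.
Qed.

End square_integrable.

(** * Truncated transforms: tails and integration by parts *)

Section transform.
Context {R : realType}.
Implicit Types (f g : R -> R) (a b c d r s : R).
Local Notation mu := (@lebesgue_measure R).

Lemma In_split a b c f : a <= b -> b <= c -> mb f -> In a c f = In a b f + In b c f.
Proof.
move=> ab bc hf; have i1 := mb_integrable a c hf.
have h := @Rintegral_itvB R f (BLeft a) (BRight c) b i1 _ _.
have {}h := h _ _; rewrite !bnd_simp in h; move: (h ab bc) => {}h.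
apply/eqP; rewrite addrC -subr_eq; apply/eqP; rewrite /In h Rintegral_itv_obnd_cbnd//.
apply: (integrableS _ _ _ i1) => //; apply: subset_itv; rewrite bnd_simp//.
Qed.

Lemma int_le f g : measurable_fun setT f -> measurable_fun setT g -> (forall x, 0 <= f x) -> (forall x, f x <= g x) ->
  (\int[mu]_x (f x)%:E <= \int[mu]_x (g x)%:E)%E.
Proof.
move=> mf mg f0 fg; apply: ge0_le_integral; [exact: measurableT|by move=> x _; rewrite lee_fin|exact/measurable_EFinP|exact/measurable_EFinP|by move=> x _; rewrite lee_fin].
Qed.

Lemma I2_add_le g1 g2 : measurable_fun setT g1 -> measurable_fun setT g2 -> (I2 (fun x => (g1 x + g2 x)%R) <= 2%:E * (I2 g1 + I2 g2))%E.
Proof.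
move=> m1 m2; have n1 := I2_measurable m1; have n2 := I2_measurable m2.
have p1 x : setT x -> (0 <= (g1 x ^+ 2)%:E)%E by move=> _; rewrite lee_fin sqr_ge0.
have p2 x : setT x -> (0 <= (g2 x ^+ 2)%:E)%E by move=> _; rewrite lee_fin sqr_ge0.
have p3 x : setT x -> (0 <= (g1 x ^+ 2)%:E + (g2 x ^+ 2)%:E)%E by move=> hx; rewrite adde_ge0; auto.
have e : (2%:E * (I2 g1 + I2 g2) = \int[mu]_x ((2 * (g1 x ^+ 2 + g2 x ^+ 2))%R)%:E)%E.
  have q0 : (0 <= 2%:E :> \bar R)%E by rewrite lee_fin.
  have := ge0_integralZl mu measurableT (emeasurable_funD n1 n2) p3 q0.
  by rewrite (ge0_integralD mu measurableT p1 n1 p2 n2) => <-.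
rewrite e; apply: int_le => [||x|x].
- by apply: measurable_funX; exact: measurable_funD.
- by apply: measurable_funM; [exact: measurable_cst|apply: measurable_funD; exact: measurable_funX].
- exact: sqr_ge0.
- by have := sqr_ge0 (g1 x - g2 x); lra.
Qed.

(** f(x)^2 <= f(y)^2 + int |2 f g| for y in the same unit interval, averaged over y. *)
Lemma sobolev_sup f g (p x : R) : (forall x : R, is_derive x 1 f (g x)) -> continuous g -> p <= x <= p + 1 ->
  f x ^+ 2 <= 2 * In p (p + 1) (fun x => f x ^+ 2) + In p (p + 1) (fun x => g x ^+ 2).
Proof.
move=> df cg /andP[px xp]; have cf := is_derive_cont df.
have mf := continuous_mb cf; have mg := continuous_mb cg.
have mf2 := mb_sqr mf; have mg2 := mb_sqr mg.
pose W := In p (p + 1) (fun x => f x ^+ 2) + In p (p + 1) (fun x => g x ^+ 2).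
have cfg : continuous (fun x => 2 * (f x * g x)) by move=> y; apply: cvgM; [exact: cvg_cst|exact: (cvgM (cf y) (cg y))].
have key a b : p <= a -> a <= b -> b <= p + 1 -> `|f b ^+ 2 - f a ^+ 2| <= W.
  move=> pa ab bp; have d2 (y : R) : is_derive y 1 (fun x => f x ^+ 2) (2 * (f y * g y)).
    by have h := df y; apply: is_derive_eq; rewrite /GRing.scale/=; ring.
  rewrite -(In_prim ab cfg d2) ler_norml.
  have -> : W = In p (p + 1) (fun x => f x ^+ 2 + g x ^+ 2) by rewrite In_D.
  rewrite -In_N; last exact: mbD.
  apply/andP; split.
    apply: (le_trans (y := In a b (fun x => - (f x ^+ 2 + g x ^+ 2)))).
      rewrite !In_N; [|exact: mbD|exact: mbD]; rewrite lerN2; apply: In_mono => //; first exact: mbD.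
      by move=> y _; rewrite addr_ge0 ?sqr_ge0.
    apply: In_le; [apply: mbN; exact: mbD|exact: continuous_mb|] => y _.
    by have := sqr_ge0 (f y + g y); lra.
  apply: (le_trans (y := In a b (fun x => f x ^+ 2 + g x ^+ 2))).
    apply: In_le; [exact: continuous_mb|exact: mbD|] => y _.
    by have := sqr_ge0 (f y - g y); lra.
  by apply: In_mono => //; [exact: mbD|move=> y _; rewrite addr_ge0 ?sqr_ge0].
have p1 : p <= p + 1 by lra.
have e : f x ^+ 2 = In p (p + 1) (fun=> f x ^+ 2) by rewrite In_cst//; ring.
rewrite e; apply: (le_trans (y := In p (p + 1) (fun y => f y ^+ 2 + W))).
  apply: In_le; [exact: mbC|apply: mbD => //; exact: mbC|] => y /andP[py yp].
  have h : `|f x ^+ 2 - f y ^+ 2| <= W.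
    by have [xy|/ltW yx] := leP x y; [rewrite distrC|]; apply: key.
  by have := le_trans (ler_norm _) h; lra.
rewrite In_D//; last exact: mbC.
by rewrite In_cst// /W; lra.
Qed.

Lemma tail_small (S : R -> R) (A : R) : (forall r, 0 < r -> S r <= A) -> (forall r s, 0 < r -> r <= s -> S r <= S s) ->
  forall e, 0 < e -> exists r0, 0 < r0 /\ forall r s, r0 <= r -> r <= s -> S s - S r <= e.
Proof.
move=> hA hS e e0.
pose E := [set S r | r in [set r | 0 < r]].
have hE : has_sup E by split; [exists (S 1); exists 1 => //=|exists A => _ [r /= r0 <-]; exact: hA].
have [_ [r0 /= r00 <-] hr0] := sup_adherent e0 hE.
exists r0; split => // r s r0r rs; have r0' : 0 < r := lt_le_trans r00 r0r.
have h1 : S s <= sup E by apply: sup_ubound; [exact: hE.2|exists s => //=; exact: lt_le_trans rs].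
have h2 : S r0 <= S r by exact: hS.
by lra.
Qed.

Lemma I2_limit f (A : R) : mb f -> (forall r, 0 < r -> In (- r) r (fun x => f x ^+ 2) <= A) -> (I2 f <= A%:E)%E.
Proof.
move=> hf hA; have mf := hf.1.
pose F k x := f x ^+ 2 * \1_(`[- k.+1%:R, k.+1%:R]%classic) x.
have mF k : measurable_fun setT (F k) by apply: measurable_funM; [exact: measurable_funX|exact: measurable_indic].
apply: (@fatou_ae R F (fun x => f x ^+ 2) A%:E mF).
- exact: measurable_funX.
- by move=> k x; rewrite mulr_ge0 ?sqr_ge0// indicE.
- apply: nearW => x; apply: cvg_near_cst; near=> k.
  rewrite /F indicE mem_set ?mulr1//= in_itv/= -ler_norml.
  by apply: (@le_trans _ _ k%:R); [near: k; exact: nbhs_infty_ger|rewrite ler_nat].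
- near=> k; have k0 : 0 < k.+1%:R :> R by rewrite ltr0n.
  have := hA _ k0; rewrite /In /Rintegral -lee_fin fineK; last exact: integrable_fin_num (mb_integrable _ _ (mb_sqr hf)).
  rewrite integral_mkcond; apply: le_trans; rewrite le_eqVlt; apply/orP; left; apply/eqP.
  apply: eq_integral => x _; rewrite patchE /F indicE; case: ifPn => _; by rewrite ?mulr1 ?mulr0.
Unshelve. all: by end_near. Qed.

Lemma Fc_split a b c d f xi : a <= b -> b <= c -> c <= d -> mb f -> Fc a d f xi = Fc a b f xi + Fc b c f xi + Fc c d f xi.
Proof.
move=> ab bc cd hf; have h : mb (fun x => f x * cos (x * xi)) by apply: mbM => //; exact: mb_cosMr.
by rewrite /Fc (In_split (le_trans ab bc) cd h) (In_split ab bc h).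
Qed.
Lemma Fs_split a b c d f xi : a <= b -> b <= c -> c <= d -> mb f -> Fs a d f xi = Fs a b f xi + Fs b c f xi + Fs c d f xi.
Proof.
move=> ab bc cd hf; have h : mb (fun x => f x * sin (x * xi)) by apply: mbM => //; exact: mb_sinMr.
by rewrite /Fs (In_split (le_trans ab bc) cd h) (In_split ab bc h).
Qed.

Lemma I2_Fc_le a b f : a <= b -> mb f -> (I2 (Fc a b f) <= (10 * pi * In a b (fun x => f x ^+ 2))%:E)%E.
Proof.
move=> ab hf; apply: le_trans (bessel ab hf); apply: int_le => [||x|x].
- by apply: measurable_funX; exact: (mb_Fc ab hf).1.
- exact: (mb_fe ab hf).1.
- exact: sqr_ge0.
- by rewrite lerDl sqr_ge0.
Qed.
Lemma I2_Fs_le a b f : a <= b -> mb f -> (I2 (Fs a b f) <= (10 * pi * In a b (fun x => f x ^+ 2))%:E)%E.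
Proof.
move=> ab hf; apply: le_trans (bessel ab hf); apply: int_le => [||x|x].
- by apply: measurable_funX; exact: (mb_Fs ab hf).1.
- exact: (mb_fe ab hf).1.
- exact: sqr_ge0.
- by rewrite lerDr sqr_ge0.
Qed.

Lemma trunc_diff f r s : 0 < r -> r <= s -> mb f ->
  let S r := In (- r) r (fun x => f x ^+ 2) in
  (I2 (fun xi => (Fc (- s) s f xi - Fc (- r) r f xi)%R) <= (20 * pi * (S s - S r))%:E)%E /\
  (I2 (fun xi => (Fs (- s) s f xi - Fs (- r) r f xi)%R) <= (20 * pi * (S s - S r))%:E)%E.
Proof.
move=> r0 rs hf S; have hf2 := mb_sqr hf.
have sr : - s <= - r by rewrite lerN2.
have rr : - r <= r by lra.
have eS : S s - S r = In (- s) (- r) (fun x => f x ^+ 2) + In r s (fun x => f x ^+ 2).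
  by rewrite /S (In_split (le_trans sr rr) rs hf2) (In_split sr rr hf2); ring.
have -> : (20 * pi * (S s - S r))%:E = (2%:E * ((10 * pi * In (- s) (- r) (fun x => f x ^+ 2))%:E + (10 * pi * In r s (fun x => f x ^+ 2))%:E))%E :> \bar R.
  by rewrite eS -EFinD -EFinM; congr EFin; ring.
split.
- have -> : (fun xi => (Fc (- s) s f xi - Fc (- r) r f xi)%R) = (fun xi => (Fc (- s) (- r) f xi + Fc r s f xi)%R).
    by apply/funext => xi; rewrite (Fc_split xi sr rr rs hf); ring.
  apply: le_trans (I2_add_le (mb_Fc sr hf).1 (mb_Fc rs hf).1) _.
  by apply: lee_wpmul2l => //; apply: leeD; exact: I2_Fc_le.
- have -> : (fun xi => (Fs (- s) s f xi - Fs (- r) r f xi)%R) = (fun xi => (Fs (- s) (- r) f xi + Fs r s f xi)%R).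
    by apply/funext => xi; rewrite (Fs_split xi sr rr rs hf); ring.
  apply: le_trans (I2_add_le (mb_Fs sr hf).1 (mb_Fs rs hf).1) _.
  by apply: lee_wpmul2l => //; apply: leeD; exact: I2_Fs_le.
Qed.

Lemma Fc_dx a b f g xi : a <= b -> (forall x : R, is_derive x 1 f (g x)) -> continuous g ->
  Fc a b g xi = f b * cos (b * xi) - f a * cos (a * xi) + xi * Fs a b f xi.
Proof.
move=> ab df cg; have cf := is_derive_cont df; have mf := continuous_mb cf; have mg := continuous_mb cg.
have m1 : mb (fun x => g x * cos (x * xi)) by apply: mbM => //; exact: mb_cosMr.
have m2 : mb (fun x => f x * sin (x * xi)) by apply: mbM => //; exact: mb_sinMr.
have dP (x : R) : is_derive x 1 (fun x => f x * cos (x * xi)) (g x * cos (x * xi) + (- xi) * (f x * sin (x * xi))).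
  have d1 : is_derive x 1 (fun x => x * xi) xi by apply: is_derive_eq; rewrite /GRing.scale/=; ring.
  have d2 := @is_derive1_comp R (@cos R) (fun x => x * xi) x _ _ (is_derive_cos _) d1.
  by have h := df x; apply: is_derive_eq; rewrite /GRing.scale/=; ring.
have cc : continuous (fun x => g x * cos (x * xi) + (- xi) * (f x * sin (x * xi))).
  have k1 : continuous (fun x : R => x * xi) by move=> y; apply: cvgM; [exact: cvg_id|exact: cvg_cst].
  move=> y; have k2 : cos (x * xi) @[x --> y] --> cos (y * xi) by apply: (continuous_comp (k1 y)); exact: continuous_cos.
  have k3 : sin (x * xi) @[x --> y] --> sin (y * xi) by apply: (continuous_comp (k1 y)); exact: continuous_sin.
  by apply: cvgD; [exact: (cvgM (cg y) k2)|apply: cvgM; [exact: cvg_cst|exact: (cvgM (cf y) k3)]].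
rewrite -(In_prim ab cc dP) In_D ?In_Z//; last by apply: mbM => //; exact: mbC.
by rewrite /Fc /Fs; ring.
Qed.

Lemma Fs_dx a b f g xi : a <= b -> (forall x : R, is_derive x 1 f (g x)) -> continuous g ->
  Fs a b g xi = f b * sin (b * xi) - f a * sin (a * xi) - xi * Fc a b f xi.
Proof.
move=> ab df cg; have cf := is_derive_cont df; have mf := continuous_mb cf; have mg := continuous_mb cg.
have m1 : mb (fun x => g x * sin (x * xi)) by apply: mbM => //; exact: mb_sinMr.
have m2 : mb (fun x => f x * cos (x * xi)) by apply: mbM => //; exact: mb_cosMr.
have dP (x : R) : is_derive x 1 (fun x => f x * sin (x * xi)) (g x * sin (x * xi) + xi * (f x * cos (x * xi))).
  have d1 : is_derive x 1 (fun x => x * xi) xi by apply: is_derive_eq; rewrite /GRing.scale/=; ring.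
  have d2 := @is_derive1_comp R (@sin R) (fun x => x * xi) x _ _ (is_derive_sin _) d1.
  by have h := df x; apply: is_derive_eq; rewrite /GRing.scale/=; ring.
have cc : continuous (fun x => g x * sin (x * xi) + xi * (f x * cos (x * xi))).
  have k1 : continuous (fun x : R => x * xi) by move=> y; apply: cvgM; [exact: cvg_id|exact: cvg_cst].
  move=> y; have k2 : cos (x * xi) @[x --> y] --> cos (y * xi) by apply: (continuous_comp (k1 y)); exact: continuous_cos.
  have k3 : sin (x * xi) @[x --> y] --> sin (y * xi) by apply: (continuous_comp (k1 y)); exact: continuous_sin.
  by apply: cvgD; [exact: (cvgM (cg y) k3)|apply: cvgM; [exact: cvg_cst|exact: (cvgM (cf y) k2)]].
rewrite -(In_prim ab cc dP) In_D ?In_Z//; last by apply: mbM => //; exact: mbC.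
by rewrite /Fc /Fs; ring.
Qed.

End transform.

(** * Existence of the Fourier-Plancherel transform on H^1 *)

Section sobolev.
Context {R : realType}.
Implicit Types (f g : R -> R) (r s : R).
Local Notation mu := (@lebesgue_measure R).

(** One sequence of radii for both functions, with tails below 8^(-k) as [riesz_fischer] asks;
    summing the individual radii, each increased by 1, makes it monotone and unbounded. *)
Lemma fast_radii (S1 S2 : R -> R) (A B : R) :
  (forall r, 0 < r -> S1 r <= A) -> (forall r s, 0 < r -> r <= s -> S1 r <= S1 s) ->
  (forall r, 0 < r -> S2 r <= B) -> (forall r s, 0 < r -> r <= s -> S2 r <= S2 s) ->
  exists rr : nat -> R, [/\ forall k, k.+1%:R <= rr k, forall k, rr k <= rr k.+1 &
    forall k s, rr k <= s -> S1 s - S1 (rr k) <= 8^-1 ^+ k /\ S2 s - S2 (rr k) <= 8^-1 ^+ k].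
Proof.
move=> a1 a2 b1 b2.
have h k : exists r0 : R, 0 < r0 /\ forall r s, r0 <= r -> r <= s -> S1 s - S1 r <= 8^-1 ^+ k /\ S2 s - S2 r <= 8^-1 ^+ k.
  have e0 : 0 < 8^-1 ^+ k :> R by rewrite exprn_gt0.
  have [p [p0 hp]] := tail_small a1 a2 e0; have [q [q0 hq]] := tail_small b1 b2 e0.
  exists (p + q); split; first exact: addr_gt0.
  by move=> r s pr rs; split; [apply: hp|apply: hq] => //; lra.
have [rho hrho] := choice h.
pose rr k := \sum_(i < k.+1) (rho i + 1).
have rS k : rr k.+1 = rr k + (rho k.+1 + 1) by rewrite /rr big_ord_recr.
have r1 k : k.+1%:R <= rr k.
  elim: k => [|k ih]; first by rewrite /rr big_ord1; have [h0 _] := hrho 0%N; lra.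
  by rewrite rS -natr1; have [h0 _] := hrho k.+1; lra.
have r2 k : rho k <= rr k.
  case: k => [|k]; first by rewrite /rr big_ord1; lra.
  by rewrite rS; have := r1 k; have : 0 <= k.+1%:R :> R by []; lra.
exists rr; split => //.
- by move=> k; rewrite rS; have [h0 _] := hrho k.+1; lra.
- by move=> k s ks; have [_ hk] := hrho k; exact: hk.
Qed.

Lemma cvg_of_sqr (u : nat -> R) (c : nat -> R) : (forall k, u k ^+ 2 <= c k) -> c k @[k --> \oo] --> 0 -> u k @[k --> \oo] --> 0.
Proof.
move=> h hc; apply/cvgrPdist_le => e e0; near=> k.
rewrite sub0r normrN -(@ler_pXn2r _ 2%N) ?nnegrE ?(ltW e0)// real_normK ?num_real//.
apply: (le_trans (h k)); apply: (le_trans (ler_norm _)).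
near: k; have e2 : 0 < e ^+ 2 by rewrite exprn_gt0.
by apply: (cvgr0_norm_le _ hc); rewrite e2.
Unshelve. all: by end_near. Qed.

Lemma cvg_bounded_mul (u w : nat -> R) : u k @[k --> \oo] --> 0 -> (forall k, `|w k| <= 1) -> u k * w k @[k --> \oo] --> 0.
Proof.
move=> hu hw; apply/cvgrPdist_le => e e0; near=> k.
rewrite sub0r normrN normrM; apply: (le_trans (y := `|u k|)); first by rewrite ler_piMr.
by near: k; apply: (cvgr0_norm_le _ hu).
Unshelve. all: by end_near. Qed.

Lemma cvg_sqrB (u : nat -> R) (l c : R) : u k @[k --> \oo] --> l -> (u k - c) ^+ 2 @[k --> \oo] --> (l - c) ^+ 2.
Proof.
move=> h; have h1 : u k - c @[k --> \oo] --> l - c by apply: cvgB => //; exact: cvg_cst.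
rewrite expr2; under eq_fun do rewrite expr2.
exact: cvgM.
Qed.

Lemma cvg_sqrD (u w : nat -> R) (l m : R) : u k @[k --> \oo] --> l -> w k @[k --> \oo] --> m -> u k ^+ 2 + w k ^+ 2 @[k --> \oo] --> l ^+ 2 + m ^+ 2.
Proof.
move=> h1 h2; rewrite !expr2; under eq_fun do rewrite !expr2.
by apply: cvgD; apply: cvgM.
Qed.

Lemma cvg_boundary (u w u' w' h : nat -> R) (l : R) : u k @[k --> \oo] --> 0 -> u' k @[k --> \oo] --> 0 ->
  (forall k, `|w k| <= 1) -> (forall k, `|w' k| <= 1) -> h k @[k --> \oo] --> l -> u k * w k - u' k * w' k + h k @[k --> \oo] --> l.
Proof.
move=> h1 h2 h3 h4 h5; have e : l = 0 - 0 + l by rewrite subr0 add0r.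
by rewrite e; apply: cvgD => //; apply: cvgB; exact: cvg_bounded_mul.
Qed.

Lemma cancel_2pi (A : R) : (2 * pi)^-1 * (10 * pi * A) = 5 * A.
Proof. by have /lt0r_neq0 := @pi_gt0 R; move: (pi : R) => p h; field. Qed.
Lemma cancel_2pi' (A : R) : (2 * pi)^-1 * (20 * pi * (A / 10)) = A.
Proof. by have /lt0r_neq0 := @pi_gt0 R; move: (pi : R) => p h; field. Qed.

Lemma Lnorm2_le g (C : R) : 0 <= C -> (I2 g <= (C ^+ 2)%:E)%E -> (Lnorm mu 2%:E (EFin \o g) <= C%:E)%E.
Proof.
move=> C0 h; rewrite Lnorm2E; move: h (I2_ge0 g); case: (I2 g) => [q| |]//; rewrite !lee_fin => h q0.
apply: (le_trans (y := (C ^+ 2) `^ 2^-1)).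
  by apply: ge0_ler_powR; rewrite ?nnegrE ?sqr_ge0// invr_ge0.
by rewrite -powR_mulrn// -powRrM (_ : 2%:R * 2^-1 = 1 :> R) ?powRr1//; field.
Qed.

Lemma cvge0_le (F : R -> \bar R) : (forall r, (0 <= F r)%E) -> (forall e, 0 < e -> \forall r \near +oo, (F r <= e%:E)%E) ->
  F r @[r --> +oo] --> 0%E.
Proof.
move=> F0 h; apply/fine_cvgP; split.
  near=> r; rewrite ge0_fin_numE//; apply: le_lt_trans (ltry 1); near: r; exact: h.
apply/cvgrPdist_le => e e0; near=> r.
have hr : (F r <= e%:E)%E by near: r; exact: h.
rewrite sub0r normrN /= ger0_norm ?fine_ge0//; move: hr (F0 r); case: (F r) => [x| |]//.
Unshelve. all: by end_near. Qed.

(** The transform is the limit almost everywhere of truncated ones along fast radii. The bound with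
    xi^2 is Bessel's inequality for g on the same intervals: by parts, its truncated transform tends
    to xi times that of f up to a rotation, since f is small at the radii. *)
Theorem transform_exists f g (A B : R) : (forall x : R, is_derive x 1 f (g x)) -> continuous g ->
  (forall r, 0 < r -> In (- r) r (fun x => f x ^+ 2) <= A) -> (forall r, 0 < r -> In (- r) r (fun x => g x ^+ 2) <= B) ->
  exists a b : R -> R, [/\ measurable_fun setT a, measurable_fun setT b, is_fourier f a b,
    (\int[mu]_xi (a xi ^+ 2 + b xi ^+ 2)%:E <= (5 * A)%:E)%E & (\int[mu]_xi (xi ^+ 2 * (a xi ^+ 2 + b xi ^+ 2))%:E <= (5 * B)%:E)%E].
Proof.
move=> df cg hA hB; have cf := is_derive_cont df.
have mf := continuous_mb cf; have mg := continuous_mb cg; have mf2 := mb_sqr mf; have mg2 := mb_sqr mg.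
pose S1 r := In (- r) r (fun x => f x ^+ 2); pose S2 r := In (- r) r (fun x => g x ^+ 2).
have mono (F : R -> R) : mb F -> (forall x, 0 <= F x) -> forall r s, 0 < r -> r <= s -> In (- r) r F <= In (- s) s F.
  by move=> hF F0 r s r0 rs; apply: In_mono => //; rewrite lerN2.
have m1 : forall r s, 0 < r -> r <= s -> S1 r <= S1 s by apply: mono => // x; exact: sqr_ge0.
have m2 : forall r s, 0 < r -> r <= s -> S2 r <= S2 s by apply: mono => // x; exact: sqr_ge0.
have [rr [rr1 rrS htail]] := fast_radii hA m1 hB m2.
have rr0 k : 0 < rr k by apply: lt_le_trans (rr1 k); rewrite ltr0n.
have rab k : - rr k <= rr k by have := rr0 k; lra.
have p20 : 0 <= 20 * pi :> R by rewrite mulr_ge0// pi_ge0.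
have rf k : (I2 (fun xi => (Fc (- rr k.+1) (rr k.+1) f xi - Fc (- rr k) (rr k) f xi)%R) <= (20 * pi / 8 ^+ k)%:E)%E /\
  (I2 (fun xi => (Fs (- rr k.+1) (rr k.+1) f xi - Fs (- rr k) (rr k) f xi)%R) <= (20 * pi / 8 ^+ k)%:E)%E.
  have [h1 h2] := trunc_diff (rr0 k) (rrS k) mf; have [t _] := htail k _ (rrS k).
  have le : ((20 * pi * (S1 (rr k.+1) - S1 (rr k)))%:E <= (20 * pi / 8 ^+ k)%:E :> \bar R)%E.
    by rewrite lee_fin -exprVn ler_wpM2l.
  by split; [exact: le_trans h1 le|exact: le_trans h2 le].
have [a ma ca] := riesz_fischer p20 (fun k => (mb_Fc (rab k) mf).1) (fun k => (rf k).1).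
have [b mb' cb] := riesz_fischer p20 (fun k => (mb_Fs (rab k) mf).1) (fun k => (rf k).2).
have aeF := ae_filter_ringOfSetsType mu.
have big r : \forall k \near \oo, r <= rr k.
  near=> k; apply: le_trans (rr1 k); apply: (@le_trans _ _ k%:R); last by rewrite ler_nat.
  by near: k; exact: nbhs_infty_ger.
(* The limit along the radii is also the L^2 limit along all r: Fatou in k bounds the distance by
   the tail of [S1]. *)
have distF r e : 0 < r -> (forall s, r <= s -> S1 s - S1 r <= e) ->
  (I2 (fun xi => (a xi - Fc (- r) r f xi)%R) <= (20 * pi * e)%:E)%E /\ (I2 (fun xi => (b xi - Fs (- r) r f xi)%R) <= (20 * pi * e)%:E)%E.
  move=> r0 he; have rr' : - r <= r by lra.
  have hle s : r <= s -> ((20 * pi * (S1 s - S1 r))%:E <= (20 * pi * e)%:E :> \bar R)%E by move=> rs; rewrite lee_fin ler_wpM2l//; exact: he.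
  split.
  - apply: (@fatou_ae R (fun k xi => (Fc (- rr k) (rr k) f xi - Fc (- r) r f xi) ^+ 2)).
    + by move=> k; apply: measurable_funX; apply: measurable_funB; [exact: (mb_Fc (rab k) mf).1|exact: (mb_Fc rr' mf).1].
    + by apply: measurable_funX; apply: measurable_funB; [exact: ma|exact: (mb_Fc rr' mf).1].
    + by move=> k x; exact: sqr_ge0.
    + apply: (@filterS _ _ aeF _ _ _ ca) => x hx; exact: (cvg_sqrB hx).
    + near=> k; have rk : r <= rr k by near: k; exact: big.
      have [h1 _] := trunc_diff r0 rk mf; exact: le_trans h1 (hle _ rk).
  - apply: (@fatou_ae R (fun k xi => (Fs (- rr k) (rr k) f xi - Fs (- r) r f xi) ^+ 2)).
    + by move=> k; apply: measurable_funX; apply: measurable_funB; [exact: (mb_Fs (rab k) mf).1|exact: (mb_Fs rr' mf).1].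
    + by apply: measurable_funX; apply: measurable_funB; [exact: mb'|exact: (mb_Fs rr' mf).1].
    + by move=> k x; exact: sqr_ge0.
    + apply: (@filterS _ _ aeF _ _ _ cb) => x hx; exact: (cvg_sqrB hx).
    + near=> k; have rk : r <= rr k by near: k; exact: big.
      have [_ h1] := trunc_diff r0 rk mf; exact: le_trans h1 (hle _ rk).
have ab2 : (\int[mu]_xi (a xi ^+ 2 + b xi ^+ 2)%:E <= (10 * pi * A)%:E)%E.
  apply: (@fatou_ae R (fun k => fe (- rr k) (rr k) f)).
  + by move=> k; exact: (mb_fe (rab k) mf).1.
  + by apply: measurable_funD; exact: measurable_funX.
  + by move=> k x; exact: fe_ge0.
  + have cab := @filterI _ _ aeF _ _ ca cb; apply: (@filterS _ _ aeF _ _ _ cab) => x [hx hy]; exact: (cvg_sqrD hx hy).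
  + apply: nearW => k; apply: (le_trans (bessel (rab k) mf)); rewrite lee_fin ler_wpM2l ?mulr_ge0 ?pi_ge0//.
    exact: hA.
(* [sobolev_sup] on the unit interval just outside the radius, where both tails are at most 8^(-k):
   2 + 1 = 3. *)
have ends k (x : R) : x = rr k \/ x = - rr k -> f x ^+ 2 <= 3 * 8^-1 ^+ k.
  have kk1 : rr k <= rr k + 1 by lra.
  have [t1 t2] := htail k _ kk1; have r0 := rr0 k.
  have sp1 := In_split (_ : - (rr k + 1) <= - rr k) (_ : - rr k <= rr k + 1) mf2.
  have sp2 := In_split (_ : - rr k <= rr k) (_ : rr k <= rr k + 1) mf2.
  have sp3 := In_split (_ : - (rr k + 1) <= - rr k) (_ : - rr k <= rr k + 1) mg2.
  have sp4 := In_split (_ : - rr k <= rr k) (_ : rr k <= rr k + 1) mg2.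
  have q1 : - (rr k + 1) <= - rr k by clear; lra.
  have q2 : - rr k <= rr k + 1 by clear -r0; lra.
  move: (sp1 q1 q2) (sp3 q1 q2) (sp2 (rab k) kk1) (sp4 (rab k) kk1) => e1 e3 e2 e4.
  move: t1 t2; rewrite /S1 /S2 e1 e3 e2 e4 => t1 t2.
  have n1 := @In_ge0 R (- (rr k + 1)) (- rr k) (fun x => f x ^+ 2) (fun x _ => sqr_ge0 (f x)).
  have n2 := @In_ge0 R (rr k) (rr k + 1) (fun x => f x ^+ 2) (fun x _ => sqr_ge0 (f x)).
  have n3 := @In_ge0 R (- (rr k + 1)) (- rr k) (fun x => g x ^+ 2) (fun x _ => sqr_ge0 (g x)).
  have n4 := @In_ge0 R (rr k) (rr k + 1) (fun x => g x ^+ 2) (fun x _ => sqr_ge0 (g x)).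
  case=> ->.
    have hx : rr k <= rr k <= rr k + 1 by rewrite lexx kk1.
    have := sobolev_sup df cg hx; move: t1 t2 n1 n2 n3 n4; clear; lra.
  have hx : - (rr k + 1) <= - rr k <= - (rr k + 1) + 1 by rewrite q1/= opprD addrNK.
  have := sobolev_sup df cg hx; rewrite (_ : - (rr k + 1) + 1 = - rr k); last by ring.
  by move: t1 t2 n1 n2 n3 n4; clear; lra.
have c8 : 3 * 8^-1 ^+ k @[k --> \oo] --> (0 : R).
  rewrite -(mulr0 3); apply: cvgM; first exact: cvg_cst.
  by apply: cvg_expr; rewrite ger0_norm; lra.
have fp : f (rr k) @[k --> \oo] --> 0 by apply: cvg_of_sqr c8 => k; apply: ends; left.
have fn : f (- rr k) @[k --> \oo] --> 0 by apply: cvg_of_sqr c8 => k; apply: ends; right.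
have xab : (\int[mu]_xi (xi ^+ 2 * (a xi ^+ 2 + b xi ^+ 2))%:E <= (10 * pi * B)%:E)%E.
  apply: (@fatou_ae R (fun k => fe (- rr k) (rr k) g)).
  + by move=> k; exact: (mb_fe (rab k) mg).1.
  + by apply: measurable_funM; [exact: measurable_funX|apply: measurable_funD; exact: measurable_funX].
  + by move=> k x; exact: fe_ge0.
  + have cab := @filterI _ _ aeF _ _ ca cb; apply: (@filterS _ _ aeF _ _ _ cab) => x [hx hy].
    have cos1 (y : R) : `|cos y| <= 1 by rewrite ler_norml cos_geN1 cos_le1.
    have sin1 (y : R) : `|sin y| <= 1 by rewrite ler_norml sin_geN1 sin_le1.
    have h1 : Fc (- rr k) (rr k) g x @[k --> \oo] --> x * b x.
      rewrite (_ : (fun k => Fc (- rr k) (rr k) g x) = (fun k => f (rr k) * cos (rr k * x) - f (- rr k) * cos (- rr k * x) + x * Fs (- rr k) (rr k) f x)); last first.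
        by apply/funext => k; rewrite (Fc_dx x (rab k) df cg).
      by apply: cvg_boundary => //; apply: cvgM; [exact: cvg_cst|exact: hy].
    have h2 : Fs (- rr k) (rr k) g x @[k --> \oo] --> - (x * a x).
      rewrite (_ : (fun k => Fs (- rr k) (rr k) g x) = (fun k => f (rr k) * sin (rr k * x) - f (- rr k) * sin (- rr k * x) - x * Fc (- rr k) (rr k) f x)); last first.
        by apply/funext => k; rewrite (Fs_dx x (rab k) df cg).
      by apply: cvg_boundary => //; apply: cvgN; apply: cvgM; [exact: cvg_cst|exact: hx].
    rewrite (_ : x ^+ 2 * (a x ^+ 2 + b x ^+ 2) = (x * b x) ^+ 2 + (- (x * a x)) ^+ 2); last by ring.
    exact: (cvg_sqrD h1 h2).
  + apply: nearW => k; apply: (le_trans (bessel (rab k) mg)); rewrite lee_fin ler_wpM2l ?mulr_ge0 ?pi_ge0//.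
    exact: hB.
pose q : R := (Num.sqrt (2 * pi))^-1.
have pi0 := @pi_gt0 R.
have q2 : q ^+ 2 = (2 * pi)^-1 by rewrite /q exprVn sqr_sqrtr// mulr_ge0// ltW.
have q20 : 0 <= q ^+ 2 := sqr_ge0 q.
exists (fun xi => q * a xi), (fun xi => - (q * b xi)).
have mqa : measurable_fun setT (fun xi => q * a xi) by apply: measurable_funM; [exact: measurable_cst|exact: ma].
have mqb : measurable_fun setT (fun xi => - (q * b xi)) by apply: measurable_funN; apply: measurable_funM; [exact: measurable_cst|exact: mb'].
have scale (F : R -> R) (C D : R) : measurable_fun setT F -> (forall x, 0 <= F x) -> (\int[mu]_x (F x)%:E <= C%:E)%E -> q ^+ 2 * C = D ->
   (\int[mu]_x (q ^+ 2 * F x)%:E <= D%:E)%E.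
  move=> mF F0 hF <-.
  have mF' : measurable_fun setT (fun x => (F x)%:E) by apply/measurable_EFinP.
  have F0' x : setT x -> (0 <= (F x)%:E)%E by rewrite lee_fin.
  have q0 : (0 <= (q ^+ 2)%:E :> \bar R)%E by rewrite lee_fin.
  have e := ge0_integralZl mu measurableT mF' F0' q0.
  have -> : (\int[mu]_x (q ^+ 2 * F x)%:E = (q ^+ 2)%:E * \int[mu]_x (F x)%:E)%E by exact: e.
  rewrite [X in (_ <= X)%E]EFinM; exact: lee_wpmul2l.
have s1 : (\int[mu]_xi ((q * a xi) ^+ 2 + (- (q * b xi)) ^+ 2)%:E <= (5 * A)%:E)%E.
  have -> : (fun xi => ((q * a xi) ^+ 2 + (- (q * b xi)) ^+ 2)%:E) = (fun xi => (q ^+ 2 * (a xi ^+ 2 + b xi ^+ 2))%:E).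
    by apply/funext => xi; congr EFin; ring.
  apply: (scale _ _ _ _ _ ab2); first by apply: measurable_funD; exact: measurable_funX.
    by move=> x; rewrite addr_ge0 ?sqr_ge0.
  rewrite q2; exact: cancel_2pi.
split => //.
- split.
  + apply: Lfun2I; first exact: mf.1.
    by apply: le_lt_trans (I2_limit mf hA) (ltry _).
  + have bnd (F : R -> R) : measurable_fun setT F -> (forall x, F x ^+ 2 <= (q * a x) ^+ 2 + (- (q * b x)) ^+ 2) -> F \in Lfun mu 2%:E.
      move=> mF hF; apply: Lfun2I => //; apply: le_lt_trans (ltry (5 * A)); apply: le_trans s1.
      apply: int_le => //; [exact: measurable_funX|by apply: measurable_funD; exact: measurable_funX|by move=> x; exact: sqr_ge0].
    by split; apply: bnd => // x; rewrite ?lerDl ?lerDr sqr_ge0.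
  + apply: cvge0_le => [r|e e0]; first exact: Lnorm_ge0.
    (* The factor 10 is 20 pi / (2 pi), from [trunc_diff] and the normalization. *)
    have e1 : 0 < e ^+ 2 / 10 by rewrite divr_gt0// exprn_gt0.
    have [r0 [r00 hr0]] := tail_small hA m1 e1.
    exists r0; split; first exact: num_real.
    move=> r /ltW rr'; have rp : 0 < r := lt_le_trans r00 rr'.
    have [h1 _] := distF _ _ rp (fun s rs => hr0 r s rr' rs).
    apply: Lnorm2_le; first exact: ltW.
    have -> : ((fun xi => q * a xi) \- fourier_trunc_re f r) = (fun x => q * (a x - Fc (- r) r f x)).
      by apply/funext => x; rewrite /fourier_trunc_re /= -/q -mulrBr.
    have rr2 : - r <= r by lra.
    rewrite /I2 (_ : (fun x => ((q * (a x - Fc (- r) r f x)) ^+ 2)%:E) = (fun x => (q ^+ 2 * (a x - Fc (- r) r f x) ^+ 2)%:E)); last by apply/funext => x; rewrite exprMn.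
    apply: (scale _ _ _ _ _ h1); last by rewrite q2 cancel_2pi'.
      by apply: measurable_funX; apply: measurable_funB; [exact: ma|exact: (mb_Fc rr2 mf).1].
    by move=> x; exact: sqr_ge0.
  + apply: cvge0_le => [r|e e0]; first exact: Lnorm_ge0.
    have e1 : 0 < e ^+ 2 / 10 by rewrite divr_gt0// exprn_gt0.
    have [r0 [r00 hr0]] := tail_small hA m1 e1.
    exists r0; split; first exact: num_real.
    move=> r /ltW rr'; have rp : 0 < r := lt_le_trans r00 rr'.
    have [_ h1] := distF _ _ rp (fun s rs => hr0 r s rr' rs).
    apply: Lnorm2_le; first exact: ltW.
    have -> : ((fun xi => - (q * b xi)) \- fourier_trunc_im f r) = (fun x => - (q * (b x - Fs (- r) r f x))).
      by apply/funext => x; rewrite /fourier_trunc_im /= -/q mulrBr opprB opprK addrC.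
    have rr2 : - r <= r by lra.
    rewrite /I2 (_ : (fun x => ((- (q * (b x - Fs (- r) r f x))) ^+ 2)%:E) = (fun x => (q ^+ 2 * (b x - Fs (- r) r f x) ^+ 2)%:E)); last by apply/funext => x; rewrite sqrrN exprMn.
    apply: (scale _ _ _ _ _ h1); last by rewrite q2 cancel_2pi'.
      by apply: measurable_funX; apply: measurable_funB; [exact: mb'|exact: (mb_Fs rr2 mf).1].
    by move=> x; exact: sqr_ge0.
- have -> : (fun xi => (xi ^+ 2 * ((q * a xi) ^+ 2 + (- (q * b xi)) ^+ 2))%:E) = (fun xi => (q ^+ 2 * (xi ^+ 2 * (a xi ^+ 2 + b xi ^+ 2)))%:E).
    by apply/funext => xi; congr EFin; ring.
  apply: (scale _ _ _ _ _ xab).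
  + by apply: measurable_funM; [exact: measurable_funX|apply: measurable_funD; exact: measurable_funX].
  + by move=> x; rewrite mulr_ge0 ?addr_ge0 ?sqr_ge0.
  + rewrite q2; exact: cancel_2pi.
Unshelve. all: by end_near. Qed.

End sobolev.

(** * The H^(1/4) norm against L^2 norms *)

Section sobolev_norm.
Context {R : realType}.
Implicit Types (f g h : R -> R) (r s : R).
Local Notation mu := (@lebesgue_measure R).

Lemma poweR_half_le (I : \bar R) (C : R) : (0 <= I)%E -> 0 <= C -> (I <= (C ^+ 2)%:E)%E -> (poweR I 2^-1 <= C%:E)%E.
Proof.
move=> I0 C0; case: I I0 => [q| |]//; rewrite !lee_fin => q0 h.
apply: (le_trans (y := (C ^+ 2) `^ 2^-1)); first by apply: ge0_ler_powR; rewrite ?nnegrE ?sqr_ge0// invr_ge0.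
by rewrite -powR_mulrn// -powRrM (_ : 2%:R * 2^-1 = 1 :> R) ?powRr1//; field.
Qed.

Lemma poweR_half_ge (I : \bar R) (C : R) : 0 <= C -> ((C ^+ 2)%:E <= I)%E -> (C%:E <= poweR I 2^-1)%E.
Proof.
move=> C0; case: I => [q| |]//; last by rewrite /poweR /=; case: ifP => //; rewrite ?leey// invr_eq0 pnatr_eq0.
rewrite !lee_fin => h.
apply: (le_trans (y := (C ^+ 2) `^ 2^-1)); last by apply: ge0_ler_powR; rewrite ?nnegrE ?sqr_ge0// ?invr_ge0//; exact: le_trans (sqr_ge0 C) h.
by rewrite -powR_mulrn// -powRrM (_ : 2%:R * 2^-1 = 1 :> R) ?powRr1//; field.
Qed.

Lemma quarter_powE (y : R) : 0 <= y -> (y `^ 4^-1) ^+ 4 = y.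
Proof. by move=> y0; rewrite -powR_mulrn ?powR_ge0// -powRrM mulVf ?powRr1. Qed.

(** With q the fourth root of 1 + xi^2, either q <= p or q = q^4 / q^3 <= q^4 / p^3. As the sum
    bounds both cases, the integral itself need not be cut. *)
Lemma quarter_split (p xi : R) : 0 < p -> (1 + xi ^+ 2) `^ 4^-1 <= p + (1 + xi ^+ 2) / p ^+ 3.
Proof.
move=> p0; set y := 1 + xi ^+ 2; have y0 : 0 <= y by rewrite addr_ge0 ?sqr_ge0.
have := quarter_powE y0; set q := y `^ 4^-1; have q0 : 0 <= q by exact: powR_ge0.
move=> e; have p3 : 0 < p ^+ 3 by rewrite exprn_gt0.
have [qp|/ltW pq] := leP q p; first by rewrite (le_trans qp)// lerDl divr_ge0// ltW.
apply: (@le_trans _ _ (y / p ^+ 3)); last by rewrite lerDr ltW.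
rewrite ler_pdivlMr// -e [in leRHS]exprS; apply: ler_wpM2l => //.
by apply: lerXn2r; rewrite // nnegrE ltW.
Qed.

Lemma measurable_weight : measurable_fun [set: R] (fun xi : R => (1 + xi ^+ 2) `^ 4^-1).
Proof.
have h := @measurable_powR R 4^-1; apply: (measurableT_comp h).
by apply: measurable_funD; [exact: measurable_cst|exact: measurable_funX].
Qed.

(** The parameter [p] is left free, to balance p ||f||^2 against ||f_x||^2 / p^3. *)
Theorem Hs_le f g (A B C p : R) : (forall x : R, is_derive x 1 f (g x)) -> continuous g ->
  (forall r, 0 < r -> In (- r) r (fun x => f x ^+ 2) <= A) -> (forall r, 0 < r -> In (- r) r (fun x => g x ^+ 2) <= B) ->
  0 < p -> 0 <= C -> 5 * (p * A + (A + B) / p ^+ 3) <= C ^+ 2 -> (Hs_norm 4^-1 f <= C%:E)%E.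
Proof.
move=> df cg hA hB p0 C0 hC; have [a [b [ma mb' fab hab hxab]]] := transform_exists df cg hA hB.
apply: ereal_inf_le; eexists; first by exists a, b; split; [exact: fab|reflexivity].
have p3 : 0 < p ^+ 3 by rewrite exprn_gt0.
pose u := fun xi => a xi ^+ 2 + b xi ^+ 2.
have u0 xi : 0 <= u xi by rewrite addr_ge0 ?sqr_ge0.
have mu' : measurable_fun setT u by apply: measurable_funD; exact: measurable_funX.
have mxu : measurable_fun setT (fun xi : R => xi ^+ 2 * u xi) by apply: measurable_funM => //; exact: measurable_funX.
apply: poweR_half_le => //; first by apply: integral_ge0 => x _; rewrite lee_fin mulr_ge0 ?powR_ge0//; exact: u0.
have w0 : 0 <= p + (p ^+ 3)^-1 by rewrite addr_ge0 ?invr_ge0 ?ltW.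
have w1 : 0 <= (p ^+ 3)^-1 by rewrite invr_ge0 ltW.
apply: (@le_trans _ _ (\int[mu]_xi ((p + (p ^+ 3)^-1) * u xi + (p ^+ 3)^-1 * (xi ^+ 2 * u xi))%:E)%E).
  apply: int_le => [||x|x].
  - by apply: measurable_funM => //; exact: measurable_weight.
  - by apply: measurable_funD; apply: measurable_funM => //; exact: measurable_cst.
  - by rewrite mulr_ge0 ?powR_ge0//; exact: u0.
  - have := ler_wpM2r (u0 x) (quarter_split x p0); rewrite -/(u x) => /le_trans; apply.
    rewrite le_eqVlt; apply/orP; left; apply/eqP; by ring.
have m1 : measurable_fun setT (fun x => (u x)%:E) by exact/measurable_EFinP.
have m2 : measurable_fun setT (fun x : R => (x ^+ 2 * u x)%:E) by exact/measurable_EFinP.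
have n1 (c : R) : 0 <= c -> measurable_fun setT (fun x : R => (c%:E * (u x)%:E)%E) by move=> c0; apply: emeasurable_funM => //; exact: measurable_cst.
have n2 (c : R) : 0 <= c -> measurable_fun setT (fun x : R => (c%:E * (x ^+ 2 * u x)%:E)%E) by move=> c0; apply: emeasurable_funM => //; exact: measurable_cst.
have z1 x : setT x -> (0 <= (u x)%:E)%E by rewrite lee_fin.
have z2 x : setT x -> (0 <= (x ^+ 2 * u x)%:E)%E by rewrite lee_fin mulr_ge0 ?sqr_ge0.
have v0 : (0 <= (p + (p ^+ 3)^-1)%:E :> \bar R)%E by rewrite lee_fin.
have v1 : (0 <= ((p ^+ 3)^-1)%:E :> \bar R)%E by rewrite lee_fin.
have e : (\int[mu]_xi ((p + (p ^+ 3)^-1) * u xi + (p ^+ 3)^-1 * (xi ^+ 2 * u xi))%:E =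
  (p + (p ^+ 3)^-1)%:E * \int[mu]_x (u x)%:E + ((p ^+ 3)^-1)%:E * \int[mu]_x (x ^+ 2 * u x)%:E)%E.
  rewrite -(ge0_integralZl mu measurableT m1 z1 v0) -(ge0_integralZl mu measurableT m2 z2 v1).
  rewrite -ge0_integralD//.
  - by move=> x _; apply: mule_ge0; [exact: v0|exact: z1].
  - exact: n1.
  - by move=> x _; rewrite mule_ge0//; exact: z2.
  - exact: n2.
rewrite e; apply: (@le_trans _ _ ((p + (p ^+ 3)^-1)%:E * (5 * A)%:E + ((p ^+ 3)^-1)%:E * (5 * B)%:E)%E).
  by apply: leeD; apply: lee_wpmul2l.
by rewrite -!EFinM -EFinD lee_fin; apply: le_trans hC; rewrite le_eqVlt; apply/orP; left; apply/eqP; field; rewrite gt_eqF.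
Qed.

Lemma Lnorm0 g : measurable_fun setT g -> Lnorm mu 2%:E (EFin \o g) = 0%E -> {ae mu, forall x, g x = 0}.
Proof.
move=> mg h; have mg' : measurable_fun setT (EFin \o g) by exact/measurable_EFinP.
have p2 : (0 < 2%:E :> \bar R)%E by rewrite lte_fin.
have := @Lnorm_eq0_eq0 _ _ R mu (EFin \o g) 2%:E mg' p2 h; apply: (@filterS _ _ (ae_filter_ringOfSetsType mu)) => x /(_ I) [] //.
Qed.

(** [n ^+ 2] is the carrier frequency N. Where xi^2 is within a factor 2 of N^2, the weight is at
    least N^(1/2) / 2; elsewhere (xi^2 - N^2)^2 / N^2 dominates xi^2 + N^2. *)
Lemma freq_split (n xi : R) : 1 <= n ->
  xi ^+ 2 + (n ^+ 2) ^+ 2 <= 6 * (n ^+ 3 * (1 + xi ^+ 2) `^ 4^-1) + 6 * ((xi ^+ 2 - (n ^+ 2) ^+ 2) ^+ 2 / (n ^+ 2) ^+ 2).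
Proof.
move=> n1; have y0 : 0 <= 1 + xi ^+ 2 by rewrite addr_ge0 ?sqr_ge0.
have := quarter_powE y0; set q := (1 + xi ^+ 2) `^ 4^-1; have q0 : 0 <= q by exact: powR_ge0.
move=> e; set m := n ^+ 2; have m1 : 1 <= m by rewrite exprn_ege1.
have m2 : 0 < m ^+ 2 by rewrite exprn_gt0//; lra.
have x0 := sqr_ge0 xi; move: x0 e y0; set X := xi ^+ 2 => x0 e y0.
have a0 : 0 <= 6 * (n ^+ 3 * q) by apply: mulr_ge0 => //; apply: mulr_ge0 => //; apply: exprn_ge0; lra.
have b0 : 0 <= (X - m ^+ 2) ^+ 2 / m ^+ 2 by rewrite divr_ge0 ?sqr_ge0// ltW.
have [h1|h1] := ltP (2 * m ^+ 2) X.
  have : X / 2 <= (X - m ^+ 2) ^+ 2 / m ^+ 2.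
    by rewrite ler_pdivlMr//; move: (m ^+ 2) m2 h1 => M M0 h1; nra.
  lra.
have [h2|h2] := ltP X (m ^+ 2 / 2).
  have : m ^+ 2 / 4 <= (X - m ^+ 2) ^+ 2 / m ^+ 2.
    by rewrite ler_pdivlMr//; move: (m ^+ 2) m2 h2 => M M0 h2; nra.
  lra.
suff : n / 2 <= q.
  move=> h; have : n ^+ 3 * (n / 2) <= n ^+ 3 * q by apply: ler_wpM2l => //; rewrite exprn_ge0//; lra.
  by rewrite (_ : n ^+ 3 * (n / 2) = m ^+ 2 / 2); [lra|rewrite /m; field].
rewrite leNgt; apply/negP => h.
have : q ^+ 4 < (n / 2) ^+ 4 by apply: ltrXn2r; rewrite // ?nnegrE; lra.
rewrite e (_ : (n / 2) ^+ 4 = m ^+ 2 / 16); last by rewrite /m; field.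
by lra.
Qed.

Lemma fourier_trunc_stable f (rho r s xi : R) : 0 <= rho -> rho < r -> r <= s -> mb f -> (forall x, rho < `|x| -> f x = 0) ->
  Fc (- s) s f xi = Fc (- r) r f xi /\ Fs (- s) s f xi = Fs (- r) r f xi.
Proof.
move=> r0 rr rs hf supp.
have h1 : - s <= - r by lra.
have h2 : - r <= r by lra.
have z (F : R -> R) c d : c <= d -> (forall x, c <= x <= d -> rho < `|x|) -> (forall x, rho < `|x| -> F x = 0) -> In c d F = 0.
  move=> cd hcd hF; rewrite (@In_eq R c d F (fun=> 0)) ?In_cst ?mul0r// => x hx; exact: hF (hcd x hx).
have z1 x : - s <= x <= - r -> rho < `|x| by move=> /andP[_ a1]; have := ler_norm (- x); rewrite normrN; lra.
have z2 x : r <= x <= s -> rho < `|x| by move=> /andP[a1 _]; have := ler_norm x; lra.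
split; [rewrite (Fc_split xi h1 h2 rs hf)|rewrite (Fs_split xi h1 h2 rs hf)].
  by rewrite /Fc (z _ _ _ h1 z1) ?(z _ _ _ rs z2) ?add0r ?addr0// => x hx; rewrite supp ?mul0r.
by rewrite /Fs (z _ _ _ h1 z1) ?(z _ _ _ rs z2) ?add0r ?addr0// => x hx; rewrite supp ?mul0r.
Qed.

Lemma Lfun_measurable f : f \in Lfun mu 2%:E -> measurable_fun setT f.
Proof. by rewrite inE => /andP[]; rewrite inE => /= h _. Qed.

Lemma cvg_cst_pinfty (F : R -> \bar R) (c : \bar R) (r0 : R) : (forall r, r0 <= r -> F r = c) -> F r @[r --> +oo] --> 0%E -> c = 0%E.
Proof.
move=> h hF; have hc : F r @[r --> +oo] --> c.
  apply: cvg_near_cst; exists r0; split; first exact: num_real.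
  by move=> r /ltW rr; exact: h.
exact: (cvg_unique (@ereal_hausdorff R) hc hF).
Qed.

(** A norm defined as an infimum over transforms is bounded below only by identifying all of them.
    The truncated transforms of a function of bounded support are eventually constant in the radius,
    so an L^2 limit is that constant almost everywhere. *)
Lemma fourier_compact f a b (rho r : R) : mb f -> 0 <= rho -> rho < r -> (forall x, rho < `|x| -> f x = 0) -> is_fourier f a b ->
  {ae mu, forall xi, a xi ^+ 2 + b xi ^+ 2 = (2 * pi)^-1 * fe (- r) r f xi}.
Proof.
move=> hf rho0 rr supp [_ [/Lfun_measurable ma /Lfun_measurable mb'] ca cb].
pose q : R := (Num.sqrt (2 * pi))^-1.
have q2 : q ^+ 2 = (2 * pi)^-1 by rewrite /q exprVn sqr_sqrtr// mulr_ge0// pi_ge0.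
have rab : - r <= r by lra.
have ea s : r <= s -> fourier_trunc_re f s = fun xi => q * Fc (- r) r f xi.
  by move=> rs; apply/funext => xi; rewrite /fourier_trunc_re -/q; have [<- _] := fourier_trunc_stable xi rho0 rr rs hf supp.
have eb s : r <= s -> fourier_trunc_im f s = fun xi => - (q * Fs (- r) r f xi).
  by move=> rs; apply/funext => xi; rewrite /fourier_trunc_im -/q; have [_ <-] := fourier_trunc_stable xi rho0 rr rs hf supp.
have mc : measurable_fun setT (a \- (fun xi => q * Fc (- r) r f xi)).
  by apply: measurable_funB => //; apply: measurable_funM; [exact: measurable_cst|exact: (mb_Fc rab hf).1].
have ms : measurable_fun setT (b \- (fun xi => - (q * Fs (- r) r f xi))).
  by apply: measurable_funB => //; apply: measurable_funN; apply: measurable_funM; [exact: measurable_cst|exact: (mb_Fs rab hf).1].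
have za := Lnorm0 mc (cvg_cst_pinfty (c := Lnorm mu 2%:E (EFin \o (a \- (fun xi => q * Fc (- r) r f xi)))) (fun s rs => congr1 (fun u => Lnorm mu 2%:E (EFin \o (a \- u))) (ea s rs)) ca).
have zb := Lnorm0 ms (cvg_cst_pinfty (c := Lnorm mu 2%:E (EFin \o (b \- (fun xi => - (q * Fs (- r) r f xi))))) (fun s rs => congr1 (fun u => Lnorm mu 2%:E (EFin \o (b \- u))) (eb s rs)) cb).
have aeF := ae_filter_ringOfSetsType mu.
have zab := @filterI _ _ aeF _ _ za zb; apply: (@filterS _ _ aeF _ _ _ zab) => x [/= /eqP + /eqP].
rewrite !subr_eq0 => /eqP -> /eqP ->; rewrite -q2 /fe; ring.
Qed.

Lemma cs_lip f : cs f -> exists S, forall x y, `|f x - f y| <= S * `|x - y|.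
Proof.
move=> cf; have c1 := cs_der cf; pose S := nm (dx f) + nm (dx (dx f)).
have lip x y : x <= y -> `|f x - f y| <= S * `|x - y|.
  move=> xy; have [c [_ e]] := mvt (fun x => dble_is_derive x (cs_dble cf)) xy.
  rewrite distrC e normrM (distrC x) ler_wpM2r//.
  have h := sup_nm c c1; have a1 := nm_ge0 (dx f); have a2 := nm_ge0 (dx (dx f)).
  have h2 : `|dx f c| ^+ 2 <= S ^+ 2.
    rewrite real_normK ?num_real// /S; apply: (le_trans h).
    move: (nm (dx f)) (nm (dx (dx f))) => p q; have := sqr_ge0 p; have := sqr_ge0 q; clear; lra.
  have S0 : 0 <= S by exact: addr_ge0.
  by move: h2; rewrite ler_pXn2r// nnegrE.
exists S => x y; have [xy|/ltW xy] := leP x y; first exact: lip.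
by rewrite distrC (distrC x); exact: lip.
Qed.

Lemma cs_support f : cs f -> exists2 rho, 0 <= rho & forall x, rho < `|x| -> [/\ f x = 0, dx f x = 0 & dx (dx f) x = 0].
Proof.
move=> cf; have [_ [M hM]] := cf; have [_ [M1 hM1]] := cs_der cf; have [_ [M2 hM2]] := cs_der (cs_der cf).
exists (Num.max 0 (Num.max M (Num.max M1 M2))); first by rewrite le_max lexx.
by move=> x; rewrite !gt_max => /and4P[_ h0 h1 h2]; split; auto.
Qed.

(** [freq_split] is integrated against the squared modulus of the transform: the left side is
    bounded below by [plancherel_lower], the last term above by [bessel] for f_xx + N^2 f. Hence 12
    pi = 6 (2 pi) and 60 pi = 6 (10 pi). *)
Theorem Hs_ge f (n C : R) : cs f -> 1 <= n -> 0 <= C ->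
  12 * pi * (n ^+ 3 * C ^+ 2) + 60 * pi * (nn (dx (dx f) + cst ((n ^+ 2) ^+ 2) * f) / (n ^+ 2) ^+ 2) <= nn (dx f) + (n ^+ 2) ^+ 2 * nn f ->
  (C%:E <= Hs_norm 4^-1 f)%E.
Proof.
move=> cf n1 C0 hC; have c1 := cs_der cf; have c2 := cs_der c1.
have [rho rho0 supp] := cs_support cf.
set m := (n ^+ 2) ^+ 2 in hC *; have m0 : 0 < m by rewrite exprn_gt0// exprn_gt0//; lra.
pose r := rho + 2; have rr : rho + 1 <= r by rewrite /r; lra.
have rab : - r <= r by rewrite /r; lra.
have rr' : rho < r by rewrite /r; lra.
pose D := dx (dx f) + cst m * f.
have cD : cs D by apply: csD => //; exact: csZ.
have mf := continuous_mb (cs_cont cf); have mg := continuous_mb (cs_cont c1); have mD := continuous_mb (cs_cont cD).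
have enn (g : R -> R) : (forall x, rho < `|x| -> g x = 0) -> nn g = In (- r) r (fun x => g x ^+ 2).
  move=> hg; rewrite /nn (@ii_itv R _ rho (- r) r) => [|x hx||].
  - by apply: In_eq => x _; rewrite expr2.
  - by rewrite -[LHS]/(g x * g x) hg// mul0r.
  - by rewrite ltrN2.
  - exact: rr'.
have e0 := enn f (fun x hx => let: And3 a _ _ := supp x hx in a).
have e1 := enn (dx f) (fun x hx => let: And3 _ a _ := supp x hx in a).
have e2 : nn D = In (- r) r (fun x => D x ^+ 2).
  by apply: enn => x hx; have [a1 a2 a3] := supp x hx; rewrite -[LHS]/(dx (dx f) x + m * f x) a1 a3 mulr0 addr0.
apply: le_ereal_inf_tmp => _ [a [b [fab ->]]]; apply: poweR_half_ge => //.
have [_ [/Lfun_measurable ma /Lfun_measurable mb'] _ _] := fab.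
have hae := fourier_compact mf rho0 rr' (fun x hx => let: And3 a _ _ := supp x hx in a) fab.
pose W xi : R := (1 + xi ^+ 2) `^ 4^-1; pose F := fe (- r) r f.
have mF : measurable_fun setT F := (mb_fe rab mf).1.
have mW := @measurable_weight.
have F0 x : 0 <= F x := fe_ge0 _ _ _ x.
have p0 : 0 < pi :> R := @pi_gt0 R.
have mWF : measurable_fun setT (fun x => W x * F x) by exact: measurable_funM.
have i1 : (\int[mu]_xi (W xi * (a xi ^+ 2 + b xi ^+ 2))%:E = \int[mu]_xi (W xi * ((2 * pi)^-1 * F xi))%:E)%E.
  apply: ge0_ae_eq_integral => //.
  - by apply/measurable_EFinP; apply: measurable_funM; [exact: mW|apply: measurable_funD; exact: measurable_funX].
  - by apply/measurable_EFinP; apply: measurable_funM; [exact: mW|apply: measurable_funM => //; exact: measurable_cst].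
  - by move=> x _; rewrite lee_fin mulr_ge0 ?powR_ge0// addr_ge0 ?sqr_ge0.
  - by move=> x _; rewrite lee_fin mulr_ge0 ?powR_ge0// mulr_ge0// invr_ge0 mulr_ge0// ltW.
  - apply: (@filterS _ _ (ae_filter_ringOfSetsType mu) _ _ _ hae) => x /= -> _ //.
have Z (k : R) (G : R -> R) : 0 <= k -> measurable_fun setT G -> (forall x, 0 <= G x) -> (\int[mu]_x (k * G x)%:E = k%:E * \int[mu]_x (G x)%:E)%E.
  move=> k0 mG G0; have mG' : measurable_fun setT (fun x => (G x)%:E) by exact/measurable_EFinP.
  have G0' x : setT x -> (0 <= (G x)%:E)%E by rewrite lee_fin.
  have k0' : (0 <= k%:E :> \bar R)%E by rewrite lee_fin.
  exact: (ge0_integralZl mu measurableT mG' G0' k0').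
have A (G H : R -> R) : measurable_fun setT G -> measurable_fun setT H -> (forall x, 0 <= G x) -> (forall x, 0 <= H x) ->
  (\int[mu]_x (G x + H x)%:E = \int[mu]_x (G x)%:E + \int[mu]_x (H x)%:E)%E.
  move=> mG mH G0 H0; have mG' : measurable_fun setT (fun x => (G x)%:E) by exact/measurable_EFinP.
  have mH' : measurable_fun setT (fun x => (H x)%:E) by exact/measurable_EFinP.
  by apply: (ge0_integralD mu measurableT _ mG' _ mH') => x _; rewrite lee_fin.
have q0 : 0 <= (2 * pi)^-1 :> R by rewrite invr_ge0 mulr_ge0// ltW.
have WF0 x : 0 <= W x * F x by rewrite mulr_ge0// powR_ge0.
rewrite i1 (_ : (fun xi => (W xi * ((2 * pi)^-1 * F xi))%:E) = (fun xi => ((2 * pi)^-1 * (W xi * F xi))%:E)); last by apply/funext => x; rewrite mulrCA.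
rewrite Z//; set J := (\int[mu]_x (W x * F x)%:E)%E.
have J0 : (0 <= J)%E by apply: integral_ge0 => x _; rewrite lee_fin.
have f0 x : r <= `|x| -> f x = 0 /\ dx f x = 0 by move=> hx; have [|a1 a2 _] := supp x; first exact: lt_le_trans hx.
have fr : f r = 0 /\ dx f r = 0 by apply: f0; exact: ler_norm.
have fnr : f (- r) = 0 /\ dx f (- r) = 0 by apply: f0; rewrite normrN; exact: ler_norm.
have dF (x : R) : is_derive x 1 f (dx f x) := dble_is_derive x (cs_dble cf).
have dF1 (x : R) : is_derive x 1 (dx f) (dx (dx f) x) := dble_is_derive x (cs_dble c1).
have fe1 xi : fe (- r) r (dx f) xi = xi ^+ 2 * F xi.
  rewrite /F /fe (Fc_dx xi rab dF (cs_cont c1)) (Fs_dx xi rab dF (cs_cont c1)) fr.1 fnr.1; ring.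
have fe2 xi : fe (- r) r D xi = (xi ^+ 2 - m) ^+ 2 * F xi.
  have hc : Fc (- r) r D xi = Fc (- r) r (dx (dx f)) xi + m * Fc (- r) r f xi.
    rewrite /Fc -In_Z; last by apply: mbM => //; exact: mb_cosMr.
    rewrite -In_D; [|by apply: mbM; [exact: continuous_mb (cs_cont c2)|exact: mb_cosMr]|by apply: mbM; [exact: mbC|apply: mbM => //; exact: mb_cosMr]].
    by apply: In_eq => x _; rewrite -[D x]/(dx (dx f) x + m * f x); ring.
  have hs : Fs (- r) r D xi = Fs (- r) r (dx (dx f)) xi + m * Fs (- r) r f xi.
    rewrite /Fs -In_Z; last by apply: mbM => //; exact: mb_sinMr.
    rewrite -In_D; [|by apply: mbM; [exact: continuous_mb (cs_cont c2)|exact: mb_sinMr]|by apply: mbM; [exact: mbC|apply: mbM => //; exact: mb_sinMr]].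
    by apply: In_eq => x _; rewrite -[D x]/(dx (dx f) x + m * f x); ring.
  rewrite /F /fe hc hs (Fc_dx xi rab dF1 (cs_cont c2)) (Fs_dx xi rab dF1 (cs_cont c2)).
  rewrite (Fc_dx xi rab dF (cs_cont c1)) (Fs_dx xi rab dF (cs_cont c1)) fr.1 fnr.1 fr.2 fnr.2; ring.
have [S0 l0] := cs_lip cf; have [S1 l1] := cs_lip c1.
have P0 := plancherel_lower rr rho0 mf (fun x hx => let: And3 a _ _ := supp x hx in a) l0.
have P1 := plancherel_lower rr rho0 mg (fun x hx => let: And3 _ a _ := supp x hx in a) l1.
have P2 := bessel rab mD.
rewrite -e0 in P0; rewrite -e1 in P1; rewrite -e2 in P2.
have mF1 := (mb_fe rab mg).1; have mF2 := (mb_fe rab mD).1.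
have n30 : 0 <= 6 * n ^+ 3 by rewrite mulr_ge0// exprn_ge0//; lra.
have main : ((nn (dx f) + m * nn f)%:E <= (6 * n ^+ 3)%:E * J + (6 / m * (10 * pi * nn D))%:E)%E.
  apply: (@le_trans _ _ (\int[mu]_xi (fe (- r) r (dx f) xi + m * F xi)%:E)%E).
    rewrite A//; last 3 first.
    - by apply: measurable_funM => //; exact: measurable_cst.
    - exact: fe_ge0.
    - by move=> x; rewrite mulr_ge0// ltW.
    by rewrite EFinD Z// ?(ltW m0)//; apply: leeD => //; rewrite EFinM; apply: lee_wpmul2l => //; rewrite lee_fin ltW.
  apply: (@le_trans _ _ (\int[mu]_xi (6 * n ^+ 3 * (W xi * F xi) + 6 / m * fe (- r) r D xi)%:E)%E).
    apply: int_le.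
    - by apply: measurable_funD => //; apply: measurable_funM => //; exact: measurable_cst.
    - by apply: measurable_funD; apply: measurable_funM => //; exact: measurable_cst.
    - by move=> x; rewrite addr_ge0 ?fe_ge0// mulr_ge0// ltW.
    - move=> x; rewrite fe1 fe2; have := ler_wpM2r (F0 x) (freq_split x n1); rewrite -/m -/(W x) -mulrDl => h.
      by apply: (le_trans h); rewrite le_eqVlt; apply/orP; left; apply/eqP; field; rewrite gt_eqF.
  have k0 : 0 <= 6 / m by rewrite divr_ge0// ltW.
  rewrite A; last 4 first.
  - by apply: measurable_funM => //; exact: measurable_cst.
  - by apply: measurable_funM => //; exact: measurable_cst.
  - by move=> x; rewrite mulr_ge0.
  - by move=> x; rewrite mulr_ge0// fe_ge0.
  rewrite Z// Z//; last exact: fe_ge0.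
  by apply: leeD2l; rewrite [X in (_ <= X)%E]EFinM; apply: lee_wpmul2l; rewrite ?lee_fin.
move: main J0; case: J => [j| |]//.
  rewrite -!EFinM -EFinD !lee_fin => main j0.
  have n3 : 0 < n ^+ 3 by rewrite exprn_gt0//; lra.
  rewrite mulrC ler_pdivlMr ?mulr_gt0// -(ler_pM2l (_ : 0 < 6 * n ^+ 3)); last by rewrite mulr_gt0.
  have e3 : 6 / m * (10 * pi * nn D) = 60 * pi * (nn D / m) by field; rewrite gt_eqF.
  rewrite e3 in main; move: main hC; rewrite -/D; move: (60 * pi * (nn D / m)) (nn (dx f) + m * nn f) => u v h1 h2.
  have -> : 6 * n ^+ 3 * (C ^+ 2 * (2 * pi)) = 12 * pi * (n ^+ 3 * C ^+ 2) by ring.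
  lra.
move=> _ _; rewrite gt0_muley ?leey// lte_fin invr_gt0 mulr_gt0//.
Qed.

End sobolev_norm.

(** * Stability of the difference scheme *)

(* The preprocessing of lia is very slow on contexts with many real-valued hypotheses. *)
Ltac nlia := repeat match goal with H : ?T |- _ =>
  lazymatch T with
  | is_true (leq _ _) => fail
  | is_true (negb (@eq_op _ _ _)) => fail
  | @eq ?A _ _ => tryif unify A nat then fail else clear H
  | nat => fail
  | _ => clear H
  end end; lia.

Section sobolev.
Context {R : realType}.
Implicit Types f g v w a : R -> R.

Lemma dnS k f : dn k.+1 f = dx (dn k f). Proof. exact: derive1nS. Qed.
Lemma dnSr k f : dn k.+1 f = dn k (dx f). Proof. exact: derive1Sn. Qed.
Lemma cs_dn k f : cs f -> cs (dn k f).
Proof. by move=> cf; elim: k => [//|k ih]; rewrite dnS; exact: cs_der. Qed.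
Lemma dn_add k f g : cs f -> cs g -> dn k (f + g) = dn k f + dn k g.
Proof. by move=> cf cg; elim: k => [//|k ih]; rewrite !dnS ih dx_add//; exact: cs_dn. Qed.
Lemma dn_opp k f : cs f -> dn k (- f) = - dn k f.
Proof. by move=> cf; elim: k => [//|k ih]; rewrite !dnS ih dx_opp//; exact: cs_dn. Qed.
Lemma dn_scale k c f : cs f -> dn k (cst c * f) = cst c * dn k f.
Proof. by move=> cf; elim: k => [//|k ih]; rewrite !dnS ih dx_scale//; exact: cs_dn. Qed.
Lemma dn_Dh k h f : cs f -> dn k (Dh h f) = Dh h (dn k f).
Proof. by move=> cf; elim: k => [//|k ih]; rewrite !dnS ih dx_Dh//; apply: cs_dble; exact: cs_dn. Qed.
Lemma dn_zero k : dn k (0 : R -> R) = 0.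
Proof. by elim: k => [//|k ih]; rewrite dnS ih; exact: dx_cst. Qed.
Lemma nm_zero : nm (0 : R -> R) = 0.
Proof. by rewrite /nm /nn mul0r (_ : ii 0 = 0) ?sqrtr0// /ii Rintegral_cst// mul0r. Qed.
Lemma dn_mulS k f g : cs f -> cs g -> dn k.+1 (f * g) = dn k (dx f * g) + dn k (f * dx g).
Proof. by move=> cf cg; rewrite dnSr dx_mul// dn_add//; apply: csM => //; exact: cs_der. Qed.

Lemma nm_sup_mul f g S : cs f -> cs g -> 0 <= S -> (forall x, f x ^+ 2 <= S ^+ 2) -> nm (f * g) <= S * nm g.
Proof.
move=> cf cg S0 h; apply: nm_mul => //; first exact: cs_smooth.
by move=> x; rewrite -(@ler_pXn2r _ 2%N) ?nnegrE// -normrX ger0_norm ?sqr_ge0.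
Qed.

Lemma sup_of_nm f A B x : cs f -> nm f <= A -> nm (dx f) <= B -> f x ^+ 2 <= 2 * (A * B).
Proof.
move=> cf hA hB; apply: (le_trans (sup_nm x cf)).
by rewrite ler_pM2l//; apply: ler_pM => //; exact: nm_ge0.
Qed.

(** Leibniz without binomial coefficients: each derivative doubles the number of terms, and every
    term is bounded by the worst distribution. *)
Lemma nm_mul_dn k i j f g (Q : R) : cs f -> cs g ->
  (forall p q, (i <= p)%N -> (j <= q)%N -> (p + q = i + j + k)%N -> nm (dn p f * dn q g) <= Q) ->
  nm (dn k (dn i f * dn j g)) <= 2 ^+ k * Q.
Proof.
move=> cf cg; elim: k i j => [|k ih] i j h; first by rewrite mul1r; apply: h; rewrite ?addn0.
have ci := cs_dn i cf; have cj := cs_dn j cg.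
rewrite dn_mulS//; apply: (le_trans (nmD _ _)); [|by apply: cs_dn; apply: csM => //; exact: cs_der..|].
- by apply: cs_dn; apply: csM => //; exact: cs_der.
rewrite exprS -mulrA mulrDl !mul1r; apply: lerD.
- by rewrite -dnS; apply: ih => p q hp hq e; apply: h; lia.
- by rewrite -dnS; apply: ih => p q hp hq e; apply: h; lia.
Qed.

(** H^K control as one bound for all derivatives, so that it restricts to lower orders and passes to
    sums without square roots. *)
Definition HK (K : nat) (B : R) v := forall j, (j <= K)%N -> nm (dn j v) <= B.

Lemma HK_ge0 K B v : HK K B v -> 0 <= B.
Proof. by move=> h; apply: (le_trans (nm_ge0 v)); exact: (h 0%N). Qed.
Lemma HK_le K L B C v : (L <= K)%N -> B <= C -> HK K B v -> HK L C v.
Proof. by move=> LK BC h j jL; apply: le_trans BC; apply: h; lia. Qed.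
Lemma HK_dx K B v : HK K.+1 B v -> HK K B (dx v).
Proof. by move=> h j jK; rewrite -dnSr; apply: h. Qed.
Lemma HK_add K B C v w : cs v -> cs w -> HK K B v -> HK K C w -> HK K (B + C) (v + w).
Proof.
move=> cv cw h1 h2 j jK; rewrite dn_add//.
by apply: (le_trans (nmD (cs_dn j cv) (cs_dn j cw))); apply: lerD; [exact: h1|exact: h2].
Qed.
Lemma HK_opp K B v : cs v -> HK K B v -> HK K B (- v).
Proof. by move=> cv h j jK; rewrite dn_opp// nmN; exact: h. Qed.
Lemma HK_scale K B c v : cs v -> HK K B v -> HK K (`|c| * B) (cst c * v).
Proof.
move=> cv h j jK; rewrite dn_scale// nmZ; last exact: cs_dn.
by apply: ler_wpM2l => //; exact: h.
Qed.
Lemma HK_scale0 K B c v : cs v -> 0 <= c -> HK K B v -> HK K (c * B) (cst c * v).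
Proof. by move=> cv c0 hv; have := HK_scale c cv hv; rewrite ger0_norm. Qed.
Lemma HK_Dh K B h v : cs v -> 0 < h -> HK K.+1 B v -> HK K B (Dh h v).
Proof.
move=> cv h0 hv j jK; rewrite dn_Dh//; apply: (le_trans (nm_Dh (cs_dn j cv) h0)).
by rewrite -dnS; apply: hv.
Qed.
Lemma HK_Dh_dx K B h v : cs v -> 0 < h -> HK (K + 2) B v -> HK K (2 * h * B) (Dh h v - dx v).
Proof.
move=> cv h0 hv j jK; have cD := cs_Dh h cv; have cd := cs_der cv.
rewrite dn_add ?dn_opp ?dn_Dh//; last exact: csN.
rewrite -dnSr dnS; apply: (le_trans (nm_Dh_dx (cs_dn j cv) h0)).
apply: ler_wpM2l; first by lra.
by rewrite -!dnS; apply: hv; lia.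
Qed.
Lemma HK_sup K B v x : cs v -> HK K.+1 B v -> forall j, (j <= K)%N -> dn j v x ^+ 2 <= 2 * B ^+ 2.
Proof.
move=> cv h j jK; rewrite expr2; apply: sup_of_nm; first exact: cs_dn.
- by apply: h; lia.
- by rewrite -dnS; apply: h.
Qed.
Lemma HK_sup4 K B v x : cs v -> HK K.+1 B v -> forall j, (j <= K)%N -> dn j v x ^+ 2 <= (2 * B) ^+ 2.
Proof.
move=> cv h j jK; apply: (le_trans (HK_sup x cv h jK)).
by rewrite exprMn; apply: ler_wpM2r; [exact: sqr_ge0|lra].
Qed.

(** Algebra property: in each Leibniz term one factor is not differentiated to top order; it is
    taken in sup norm, which costs one derivative more. *)
Lemma HK_mul K B C v w : (0 < K)%N -> cs v -> cs w -> HK K B v -> HK K C w -> HK K (2 ^+ K.+1 * (B * C)) (v * w).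
Proof.
case: K => [//|K] _ cv cw hv hw j jK.
have B0 := HK_ge0 hv; have C0 := HK_ge0 hw.
apply: (le_trans (y := 2 ^+ j * (2 * (B * C)))).
  apply: (@nm_mul_dn j 0%N 0%N v w) => // p q _ _; rewrite !add0n => e.
  have [pK|pK] := leqP p K.
    apply: (le_trans (nm_sup_mul (cs_dn p cv) (cs_dn q cw) _ (fun x => HK_sup4 x cv hv pK))).
      by rewrite mulr_ge0.
    by rewrite mulrA; apply: ler_wpM2l; [rewrite mulr_ge0|apply: hw; lia].
  rewrite mulrC; have qK : (q <= K)%N by lia.
  apply: (le_trans (nm_sup_mul (cs_dn q cw) (cs_dn p cv) _ (fun x => HK_sup4 x cw hw qK))).
    by rewrite mulr_ge0.
  by rewrite -mulrA ler_pM2l// mulrC; apply: ler_wpM2r => //; apply: hv; lia.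
have -> : 2 ^+ j * (2 * (B * C)) = 2 ^+ j.+1 * (B * C) by rewrite exprS; ring.
by apply: ler_wpM2r; [rewrite mulr_ge0|apply: ler_weXn2l => //; lra].
Qed.

Definition Fh (h : R) v : R -> R := - Dh h (Dh h (Dh h v)) + cst 6 * (v ^+ 2 * Dh h v).

Lemma cs_Fh h v : cs v -> cs (Fh h v). Proof. by move=> cv; rewrite /Fh; csx. Qed.

Definition cF (K : nat) (B : R) : R := B + 6 * (2 ^+ K.+1 * ((2 ^+ K.+1 * (B * B)) * B)).

Lemma HK_Fh K B h v : (0 < K)%N -> cs v -> 0 < h -> HK (K + 3) B v -> HK K (cF K B) (Fh h v).
Proof.
move=> K0 cv h0 hv; have cD := cs_Dh h cv.
apply: HK_add; [by csx|by csx| |].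
- apply: HK_opp; first by csx.
  by do 3 (apply: HK_Dh; [by csx|by []|]); apply: HK_le hv; [lia|].
- apply: HK_scale0; [by csx|by []|].
  apply: HK_mul => //; first by csx.
  + by rewrite expr2; apply: HK_mul => //; apply: (HK_le _ _ hv) => //; lia.
  + by apply: HK_Dh => //; apply: HK_le hv; [lia|].
Qed.

Lemma HK_Phi K B v : (0 < K)%N -> cs v -> HK (K + 3) B v -> HK K (cF K B) (Phi v).
Proof.
move=> K0 cv hv.
apply: HK_add; [by csx|by csx| |].
- apply: HK_opp; first by csx.
  by do 3 (apply: HK_dx); apply: HK_le hv; [lia|].
- apply: HK_scale0; [by csx|by []|].
  apply: HK_mul => //; [by csx|by csx| |].
  + by rewrite expr2; apply: HK_mul => //; apply: (HK_le _ _ hv) => //; lia.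
  + by apply: HK_dx => //; apply: HK_le hv; [lia|].
Qed.

Lemma Dh_add h f g : Dh h (f + g) = Dh h f + Dh h g.
Proof. by apply/funext => x; rewrite /Dh; ptw; rewrite -mulrDl; congr (_ / _); ring. Qed.
Lemma Dh_opp h f : Dh h (- f) = - Dh h f.
Proof. by apply/funext => x; rewrite /Dh; ptw; rewrite -mulNr; congr (_ / _); ring. Qed.

(** By telescoping, Dh^3 - d^3 = Dh^2 (Dh - d) + Dh (Dh - d) d + (Dh - d) d^2. As Dh - d costs two
    derivatives, each term uses four in all. *)
Lemma HK_eta K B h v : (0 < K)%N -> cs v -> 0 < h -> HK (K + 4) B v ->
  HK K (h * (6 * B + 12 * (2 ^+ K.+1 * ((2 ^+ K.+1 * (B * B)) * B)))) (Fh h v - Phi v).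
Proof.
move=> K0 cv h0 hv; have cD := cs_Dh h cv; have cd := cs_der cv; have cdd := cs_der cd.
have cP := cs_Phi cv; have cF := cs_Fh h cv.
have B0 := HK_ge0 hv.
pose e0 := Dh h v - dx v; pose e1 := Dh h (dx v) - dx (dx v); pose e2 := Dh h (dx (dx v)) - dx (dx (dx v)).
have [c0 c1 c2] : [/\ cs e0, cs e1 & cs e2] by rewrite /e0 /e1 /e2; split; csx.
have -> : Fh h v - Phi v = (- (Dh h (Dh h e0)) + (- Dh h e1 + - e2)) + cst 6 * (v ^+ 2 * e0).
  rewrite /Fh /Phi /e0 /e1 /e2 !Dh_add !Dh_opp.
  by apply/funext => x; ptw; generalize (Dh h (Dh h (Dh h v)) x) (Dh h (Dh h (dx v)) x) (Dh h (dx (dx v)) x) (Dh h v x); intros; gend; ring.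
have -> : h * (6 * B + 12 * (2 ^+ K.+1 * ((2 ^+ K.+1 * (B * B)) * B))) =
   (2 * h * B + (2 * h * B + 2 * h * B)) + 6 * (2 ^+ K.+1 * ((2 ^+ K.+1 * (B * B)) * (2 * h * B))) by ring.
apply: HK_add; [by csx|by csx| |].
- apply: HK_add; [by csx|by csx| |].
    apply: HK_opp; first by csx.
    by do 2 (apply: HK_Dh; [by csx|by []|]); apply: HK_Dh_dx => //; apply: HK_le hv; [lia|].
  apply: HK_add; [by csx|by csx| |].
    apply: HK_opp; first by csx.
    apply: HK_Dh; [by csx|by []|]; apply: HK_Dh_dx => //; apply: HK_dx; apply: HK_le hv; [lia|by []].
  apply: HK_opp; first by csx.
  by apply: HK_Dh_dx => //; do 2 apply: HK_dx; apply: HK_le hv; [lia|].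
- apply: HK_scale0; [by csx|by []|].
  apply: HK_mul => //; [by csx| |].
  + by rewrite expr2; apply: HK_mul => //; apply: (HK_le _ _ hv) => //; lia.
  + by apply: HK_Dh_dx => //; apply: HK_le hv; [lia|].
Qed.

Lemma ip_Dh3 h g : cs g -> ip g (Dh h (Dh h (Dh h g))) = 0.
Proof.
move=> cg; have c1 := cs_Dh h cg; have c2 := cs_Dh h c1.
have e1 : ip g (Dh h (Dh h (Dh h g))) = - ip (Dh h g) (Dh h (Dh h g)) by rewrite ip_Dh// opprK.
have e2 : ip (Dh h g) (Dh h (Dh h g)) = 0.
  have := ip_Dh h c1 c1; rewrite [X in X = _]ipC; lra.
by rewrite e1 e2 oppr0.
Qed.

(* [Dh] is skew, so only its commutator with multiplication by [a] contributes. *)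
Lemma ip_mul_Dh h a g S : cs a -> cs g -> 0 < h -> 0 <= S -> (forall x, `|dx a x| <= S) ->
  `|ip g (a * Dh h g)| <= S * nn g.
Proof.
move=> ca cg h0 S0 hS.
have cag : cs (a * g) by csx.
have cD := cs_Dh h cg.
have cDa := cs_Dh h cag.
pose q := a * Dh h g - Dh h (a * g).
have cq : cs q by rewrite /q; csx.
have e : ip g (a * Dh h g) = 2^-1 * ip g q.
  rewrite /q ipBr//; last by csx.
  have -> : ip g (a * Dh h g) = ip (a * g) (Dh h g) by rewrite /ip; congr ii; ring.
  have := ip_Dh h cag cg; rewrite (ipC _ g); lra.
have da (y : R) : is_derive y 1 a (dx a y) := derives ca y.
have inc (u z : R) : u <= z -> `|a z - a u| <= S * (z - u).
  move=> uz; have [c [_ ->]] := mvt da uz.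
  by rewrite normrM (ger0_norm (_ : 0 <= z - u)) ?subr_ge0// ler_wpM2r ?subr_ge0.
have cgp := cs_shift h cg; have cgm := cs_shift (- h) cg.
have hq x : q x ^+ 2 <= S ^+ 2 / 2 * (g (x + h) ^+ 2 + g (x - h) ^+ 2).
  have i1 := inc x (x + h) (_ : _); have i2 := inc (x - h) x (_ : _).
  have i1' : `|a (x + h) - a x| <= S * h by rewrite (_ : S * h = S * (x + h - x)); [apply: i1; lra|ring].
  have i2' : `|a x - a (x - h)| <= S * h by rewrite (_ : S * h = S * (x - (x - h))); [apply: i2; lra|ring].
  pose A1 := (a (x + h) - a x) / h; pose A2 := (a x - a (x - h)) / h.
  have hA1 : `|A1| <= S by rewrite normrM normfV (gtr0_norm h0) ler_pdivrMr.
  have hA2 : `|A2| <= S by rewrite normrM normfV (gtr0_norm h0) ler_pdivrMr.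
  have -> : q x = - 2^-1 * (A1 * g (x + h) + A2 * g (x - h)).
    rewrite -[q x]/(a x * ((g (x + h) - g (x - h)) / (2 * h)) - (a (x + h) * g (x + h) - a (x - h) * g (x - h)) / (2 * h)).
    by rewrite /A1 /A2; field; lra.
  have sq (A z : R) : `|A| <= S -> (A * z) ^+ 2 <= S ^+ 2 * z ^+ 2.
    move=> hA; rewrite exprMn ler_wpM2r ?sqr_ge0// -(ger0_norm (sqr_ge0 A)) normrX.
    by rewrite ler_pXn2r ?nnegrE.
  have := sq _ (g (x + h)) hA1; have := sq _ (g (x - h)) hA2.
  have := sqr_ge0 (A1 * g (x + h) - A2 * g (x - h)).
  move: (g (x + h)) (g (x - h)) => g1 g2; clear; move=> *; lra.
have hnq : nm q <= S * nm g.
  rewrite -(@ler_pXn2r _ 2%N) ?nnegrE ?mulr_ge0 ?nm_ge0// exprMn !nm2.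
  have -> : S ^+ 2 * nn g = ii (cst (S ^+ 2 / 2) * ((fun x => g (x + h)) ^+ 2 + (fun x => g (x + - h)) ^+ 2)).
    have c3 : cs ((fun x => g (x + h)) ^+ 2) by csx.
    have c4 : cs ((fun x => g (x + - h)) ^+ 2) by csx.
    rewrite (iiZ _ (csD c3 c4)) (iiD c3 c4).
    have e2 s : ii ((fun x => g (x + s)) ^+ 2) = nn g.
      rewrite /nn -(@ii_shift _ (g * g) s); last by csx.
      by congr ii; apply/funext => x; ptw.
    by rewrite !e2; field.
  rewrite nn_sqr; apply: ii_le; [by csx|by csx|] => x; ptw; exact: hq.
rewrite e normrM; have := CS cg cq; rewrite -nm2.
have := ler_wpM2l (nm_ge0 g) hnq.
rewrite ger0_norm; last by lra.
have : 0 <= S * nm g ^+ 2 by rewrite mulr_ge0 ?sqr_ge0.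
move: (nm g) (nm q) (`|_|) => n1 n2 n3; clear; move=> *; lra.
Qed.

(** Only terms with at least one derivative on [a] occur, so [w] is never differentiated k times. *)
Lemma commutator k (Q : R) a w : cs a -> cs w -> 0 <= Q ->
  (forall p q, (1 <= p)%N -> (p + q = k)%N -> nm (dn p a * dn q w) <= Q) ->
  nm (dn k (a * w) - a * dn k w) <= k%:R * 2 ^+ k * Q.
Proof.
move=> ca cw Q0 h.
have cr l : cs (dn l (a * w) - a * dn l w).
  by apply: csB; [apply: cs_dn|apply: csM => //; apply: cs_dn]; csx.
have key l : (l <= k)%N -> nm (dn (k - l) (dn l (a * w) - a * dn l w)) <= l%:R * 2 ^+ k * Q.
  elim: l => [_|l ih lk].
    by rewrite subn0 subrr dn_zero nm_zero !mul0r.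
  have cl := cs_dn l cw; have cal := cs_dn l (csM ca cw).
  have e : dn l.+1 (a * w) - a * dn l.+1 w = dx (dn l (a * w) - a * dn l w) + dx a * dn l w.
    rewrite !dnS dx_add//; [|by csx]; rewrite dx_opp ?dx_mul//; [ring|by csx].
  have cda := cs_der ca.
  rewrite e dn_add; [|by apply: cs_der|by csx].
  have e2 : (k - l = (k - l.+1).+1)%N by lia.
  have c1 : cs (dn (k - l.+1) (dx (dn l (a * w) - a * dn l w))) by apply: cs_dn; apply: cs_der.
  have c2 : cs (dn (k - l.+1) (dx a * dn l w)) by apply: cs_dn; csx.
  apply: (le_trans (nmD c1 c2)).
  rewrite -[in l.+1%:R]addn1 natrD !mulrDl; apply: lerD.
    by rewrite -dnSr -e2; apply: ih; lia.
  apply: (le_trans (y := 2 ^+ (k - l.+1) * Q)).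
    have -> : dx a = dn 1 a by [].
    apply: nm_mul_dn => // p q hp hq pq; apply: h; [by []|lia].
  rewrite mul1r; apply: ler_wpM2r => //; apply: ler_weXn2l; [lra|lia].
by have := key k (leqnn k); rewrite subnn.
Qed.

Lemma abs_of_sqr (x S : R) : 0 <= S -> x ^+ 2 <= S ^+ 2 -> `|x| <= S.
Proof. by move=> S0 h; rewrite -(@ler_pXn2r _ 2%N) ?nnegrE// -normrX ger0_norm ?sqr_ge0. Qed.

(** Given H^(k-1), the k-th energy obeys a linear inequality: the third difference is skew, v^2
    times the difference of the top derivative contributes only a commutator, and the remaining
    Leibniz terms are at most linear in the top norm. The first bound is uniform in h; the second
    loses h^(-3) and only limits the time step. *)
Lemma top_energy (k : nat) (B : R) : (4 <= k)%N -> 1 <= B -> exists C : R, 0 <= C /\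
  forall h v, cs v -> 0 < h <= 1 -> HK k.-1 B v ->
  `|ip (dn k v) (dn k (Fh h v))| <= C * (1 + nm (dn k v)) ^+ 2 /\
  nm (dn k (Fh h v)) <= C * h ^- 3 * (1 + nm (dn k v)).
Proof.
move=> k4 B1; pose C2 := 2 ^+ k.+1 * (B * (B + 1)).
pose Q0 := C2 * (2 * (B + 1)).
pose C := 1 + 6 * (k%:R * 2 ^+ k * Q0 + 2 * C2).
have B0 : 0 < B by lra.
have C20 : 0 <= C2 by rewrite /C2; pos.
have Q00 : 0 <= Q0 by rewrite /Q0; pos.
have C0 : 0 <= C by rewrite /C; pos.
exists C; split=> // h v cv /andP[h0 h1] hv.
pose n := nm (dn k v); pose M := 1 + n.
have n0 : 0 <= n by exact: nm_ge0.
have M1 : 1 <= M by rewrite /M; lra.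
have M0 : 0 <= M by lra.
have nv q : (q <= k)%N -> nm (dn q v) <= (B + 1) * M.
  move=> qk; have BM : B + n <= (B + 1) * M by rewrite /M; have := mulr_ge0 (ltW B0) n0; lra.
  have [e|q1] := eqVneq q k; first by rewrite e; apply: le_trans BM; rewrite /n; lra.
  by apply: le_trans BM; have : nm (dn q v) <= B := hv q ltac:(nlia); lra.
have sv p x : (p <= k.-2)%N -> dn p v x ^+ 2 <= (2 * B) ^+ 2.
  by move=> hp; apply: (@HK_sup4 k.-2); [by []|apply: HK_le hv; [nlia|by []]|].
pose a := v ^+ 2; have ca : cs a by rewrite /a; csx.
pose w := Dh h v; have cw : cs w by rewrite /w; csx.
have a1 p : (p <= k.-1)%N -> nm (dn p a) <= C2.
  move=> hp; have := @HK_mul k.-1 B B v v ltac:(nlia) cv cv hv hv p hp.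
  rewrite /a expr2 => hle; apply: (le_trans hle); rewrite /C2 mulrDr mulr1.
  have -> : k.-1.+1 = k by nlia.
  rewrite exprS; have p1 : 0 <= 2 ^+ k * (B * B) by pos.
  have p2 : 0 <= 2 ^+ k * B by pos.
  by clear -p1 p2; lra.
have a2 p : (p <= k)%N -> nm (dn p a) <= C2 * M.
  move=> hp; have [pk|pk] := leqP p k.-1.
    by apply: (le_trans (a1 p pk)); rewrite ler_peMr.
  have -> : p = k by nlia.
  rewrite /a expr2; apply: (le_trans (y := 2 ^+ k * (2 * B * ((B + 1) * M)))); last first.
    by rewrite /C2 exprS; rewrite le_eqVlt; apply/orP; left; apply/eqP; ring.
  apply: (@nm_mul_dn k 0%N 0%N v v) => // p' q _ _; rewrite !add0n => e.
  have B20 : 0 <= 2 * B by lra.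
  have [h2|h2] := leqP p' k.-2.
    apply: (le_trans (nm_sup_mul (cs_dn p' cv) (cs_dn q cv) B20 (fun x => sv p' x h2))).
    by apply: ler_wpM2l => //; apply: nv; nlia.
  rewrite mulrC; have h3 : (q <= k.-2)%N by nlia.
  apply: (le_trans (nm_sup_mul (cs_dn q cv) (cs_dn p' cv) B20 (fun x => sv q x h3))).
  by apply: ler_wpM2l => //; apply: nv; nlia.
have sa p x : (p <= k.-2)%N -> `|dn p a x| <= 2 * C2.
  move=> hp; apply: abs_of_sqr; first by lra.
  by apply: (@HK_sup4 k.-2 C2 a x) => // j hj; apply: a1; nlia.
have w1 q : nm (dn q w) <= nm (dn q.+1 v).
  by rewrite /w dn_Dh// dnS; apply: nm_Dh => //; exact: cs_dn.
have w2 q : (q <= k.-1)%N -> nm (dn q w) <= (B + 1) * M.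
  by move=> hq; apply: (le_trans (w1 q)); apply: nv; nlia.
have sw q x : (q <= k.-2)%N -> dn q w x ^+ 2 <= (2 * (B + 1) * M) ^+ 2.
  move=> hq; apply: (le_trans (sup_nm x (cs_dn q cw))); rewrite -dnS.
  have l1 := w2 q ltac:(nlia); have l2 := w2 q.+1 ltac:(nlia).
  have := ler_pM (nm_ge0 _) (nm_ge0 _) l1 l2; have : 0 <= ((B + 1) * M) ^+ 2 by exact: sqr_ge0.
  move: (nm _ * nm _) => z; clear; move=> *; lra.
pose Q := Q0 * M; have Q1 : 0 <= Q by rewrite /Q mulr_ge0.
have BM0 : 0 <= 2 * (B + 1) * M by pos.
have hQ p q : (1 <= p)%N -> (p + q = k)%N -> nm (dn p a * dn q w) <= Q.
  move=> p1 pq; have [e|p2] := eqVneq p 1%N.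
    have e2 x : dn p a x ^+ 2 <= (2 * C2) ^+ 2.
      have sax := sa p x ltac:(nlia).
      rewrite -(ger0_norm (sqr_ge0 (dn p a x))) normrX lerXn2r ?nnegrE//.
      by rewrite mulr_ge0.
    apply: (le_trans (nm_sup_mul (cs_dn p ca) (cs_dn q cw) _ e2)); first lra.
    have -> : Q = 2 * C2 * ((B + 1) * M) by rewrite /Q /Q0; ring.
    by apply: ler_wpM2l; [lra|apply: w2; nlia].
  have [pk|pk] := leqP p k.-1.
    rewrite mulrC; apply: (le_trans (nm_sup_mul (cs_dn q cw) (cs_dn p ca) BM0 (fun x => sw q x ltac:(nlia)))).
    have -> : Q = 2 * (B + 1) * M * C2 by rewrite /Q /Q0; ring.
    by apply: ler_wpM2l => //; apply: a1.
  have -> : p = k by nlia. have -> : q = 0%N by nlia.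
  have s0 x : w x ^+ 2 <= (2 * (B + 1)) ^+ 2.
    have hw0 : HK 1 B w by move=> j hj; apply: (le_trans (w1 j)); apply: hv; nlia.
    apply: (le_trans (HK_sup4 x cw hw0 (leqnn 0))); rewrite lerXn2r ?nnegrE; lra.
  rewrite mulrC; apply: (le_trans (nm_sup_mul cw (cs_dn k ca) _ s0)); first lra.
  have -> : Q = 2 * (B + 1) * (C2 * M) by rewrite /Q /Q0; ring.
  by apply: ler_wpM2l; [lra|apply: a2].
have hrem := commutator ca cw Q1 hQ.
pose g := dn k v; have cg : cs g by exact: cs_dn.
pose rem := dn k (a * w) - a * dn k w.
have crem : cs rem by rewrite /rem; apply: csB; [apply: cs_dn|apply: csM => //; exact: cs_dn]; csx.
have eF : dn k (Fh h v) = - Dh h (Dh h (Dh h g)) + cst 6 * (a * Dh h g + rem).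
  rewrite /Fh dn_add; [|by csx|by csx]; rewrite dn_opp; last by csx.
  rewrite dn_scale; last by csx.
  have e1 : dn k (Dh h (Dh h (Dh h v))) = Dh h (Dh h (Dh h g)) by rewrite !dn_Dh//; csx.
  have e2 : dn k (a * w) = a * Dh h g + rem by rewrite /rem /w dn_Dh// addrC subrK.
  by rewrite e1 -e2.
have cag : cs (a * Dh h g) by csx.
have hagn : `|ip g (a * Dh h g)| <= 2 * C2 * nn g.
  apply: ip_mul_Dh => //; first lra.
  by move=> x; apply: (sa 1%N); nlia.
have nnM : nn g <= M ^+ 2 by rewrite -nm2 lerXn2r ?nnegrE ?nm_ge0// /M /n; lra.
split.
- rewrite eF ipDr; [|by csx|by csx|by csx].
  rewrite (_ : ip g (- _) = 0); last first.
    have -> : - Dh h (Dh h (Dh h g)) = cst (-1) * Dh h (Dh h (Dh h g)).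
      by apply/funext => x; ptw; rewrite mulN1r.
    by rewrite ipZr; [rewrite ip_Dh3// mulr0|by []|by csx].
  rewrite add0r ipZr; [|by []|by csx]; rewrite ipDr//.
  have h3 : `|ip g rem| <= M * (k%:R * 2 ^+ k * Q).
    apply: (le_trans (CS cg crem)); apply: ler_pM => //; try exact: nm_ge0.
    rewrite /M /n /g; lra.
  rewrite normrM (ger0_norm (_ : 0 <= 6))//.
  have h4 := ler_normD (ip g (a * Dh h g)) (ip g rem).
  have h5 := ler_wpM2l (mulr_ge0 (ler0n R 2) C20) nnM.
  have h6 : 0 <= M ^+ 2 by exact: sqr_ge0.
  rewrite -/n -/M /C; rewrite /Q in h3.
  move: (k%:R * 2 ^+ k) h3 => z h3.
  move: hagn h3 h4 h5 h6; move: `|_ + _| `|_| `|_| (nn g) => r1 r2 r3 r4; clear; move=> *; nra.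
- have hi : 1 <= h^-1 by rewrite invf_ge1.
  have hi0 : 0 <= h^-1 by lra.
  have hi3 : h^-1 <= h ^- 3 by rewrite -exprVn; apply: ler_eXnr.
  have hi31 : 1 <= h ^- 3 by lra.
  have D1 f : cs f -> nm (Dh h f) <= h^-1 * nm f by move=> cf; exact: nm_Dh_inv.
  have D3 : nm (- Dh h (Dh h (Dh h g))) <= h ^- 3 * M.
    rewrite nmN -exprVn !exprS expr0 mulr1 -!mulrA.
    apply: (le_trans (D1 _ _)); first by csx.
    apply: ler_wpM2l => //; apply: (le_trans (D1 _ _)); first by csx.
    apply: ler_wpM2l => //; apply: (le_trans (D1 _ cg)); apply: ler_wpM2l => //.
    rewrite /M /n /g; lra.
  have A1 : nm (a * Dh h g) <= 2 * C2 * (h ^- 3 * M).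
    apply: (le_trans (nm_mul (cs_smooth ca) (cs_Dh h cg) _ (fun x => sa 0%N x _))); [lra|nlia|].
    apply: ler_wpM2l; first lra.
    apply: (le_trans (D1 _ cg)); apply: ler_pM; [by []|exact: nm_ge0|by []|].
    by rewrite /M /n /g; lra.
  have R1 : nm rem <= k%:R * 2 ^+ k * Q0 * (h ^- 3 * M).
    apply: (le_trans hrem); rewrite /Q mulrA; apply: ler_wpM2l; first by pos.
    by rewrite ler_peMl.
  rewrite eF; apply: (le_trans (nmD _ _)); [by csx|by csx|].
  rewrite nmZ; last by csx.
  rewrite (ger0_norm (_ : 0 <= 6))//.
  have hh := nmD cag crem.
  rewrite -/n -/M -[C * _ * M]mulrA /C; move: D3 A1 R1 hh.
  set T := h ^- 3 * M; set z := k%:R * 2 ^+ k * Q0.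
  move: (nm (- _)) (nm (a * Dh h g)) (nm rem) (nm (_ + rem)) => r1 r2 r3 r4 q1 q2 q3 q4.
  have := ler_wpM2l (ler0n R 6) q4; have := ler_wpM2l (ler0n R 6) q2; have := ler_wpM2l (ler0n R 6) q3.
  by move: q1; clear; move: T => T *; lra.
Qed.

End sobolev.

(** * Powers of time as barriers *)

Section weights.
Context {R : realType}.

(** In the unit t^(-1/8) all rates of the stability argument are integral powers. *)
Definition bt (t : R) : R := t `^ (- 8^-1).

Lemma bt_gt0 t : 0 < t -> 0 < bt t.
Proof. exact: powR_gt0. Qed.

Lemma bt_le1 t : 1 <= t -> bt t <= 1.
Proof.
move=> t1; rewrite /bt powRN invf_le1; [|by apply: powR_gt0; lra].
rewrite -[X in X <= _](_ : 1 `^ 8^-1 = 1); last by rewrite powR1.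
by apply: ge0_ler_powR; rewrite ?nnegrE; lra.
Qed.

Lemma bt8 t : 0 < t -> bt t ^+ 8 = t^-1.
Proof.
move=> t0; rewrite /bt -powR_mulrn ?powR_ge0// -powRrM.
have -> : - 8^-1 * 8%:R = -1 :> R by field.
by rewrite powR_inv1// ltW.
Qed.

Lemma bt_anti t s : 0 < s -> s <= t -> bt t <= bt s.
Proof.
move=> s0 st; rewrite /bt !powRN lef_pV2 ?posrE ?powR_gt0//; last by lra.
by apply: ge0_ler_powR; rewrite ?nnegrE; lra.
Qed.

(* Convexity of [t^(-k/8)]. *)
Lemma bt_barrier k t s : 0 < s -> s < t ->
  bt t ^+ k * (1 + k%:R / 8 * (s / t)) <= bt (t - s) ^+ k.
Proof.
move=> s0 st; have t0 : 0 < t by lra.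
have ts0 : 0 < t - s by lra.
rewrite /bt -!powR_mulrn ?powR_ge0// -!powRrM /powR !gt_eqF//.
have h1 : ln (t - s) <= ln t - s / t.
  have -> : t - s = t * (1 + - (s / t)) by field; lra.
  have h0 : -1 < - (s / t) by rewrite ltrN2 ltr_pdivrMr// mul1r.
  rewrite lnM ?posrE//; last lra.
  by rewrite lerD2l; exact: le_ln1Dx.
pose q : R := - 8^-1 * k%:R.
have q0 : q <= 0 by rewrite /q; have : 0 <= k%:R :> R := ler0n _ _; lra.
have h2 : q * (ln t - s / t) <= q * ln (t - s) by apply: ler_wnM2l.
apply: (le_trans (y := expR (q * (ln t - s / t)))); last by rewrite ler_expR.
rewrite mulrBr expRD ler_pM2l ?expR_gt0//.
have -> : k%:R / 8 * (s / t) = - (q * (s / t)) by rewrite /q; field; lra.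
exact: expR_ge1Dx.
Qed.

(** One step back in time enlarges the barrier by at least (k/8) s b^(k+8); as b^8 = 1 / t, this is
    s times the rate at which t^(-k/8) decreases. Errors per step below that amount leave the bound
    intact. *)
Lemma bt_step k t s : 0 < s -> s < t -> 
  bt t ^+ k + k%:R / 8 * (s * bt t ^+ (k + 8)) <= bt (t - s) ^+ k.
Proof.
move=> s0 st; apply: le_trans (bt_barrier k s0 st).
rewrite exprD bt8; last by lra.
rewrite le_eqVlt; apply/orP; left; apply/eqP; field; lra.
Qed.

End weights.

(** * Effect of one Euler step on each controlled quantity *)

Section steps.
Context {R : realType}.
Implicit Types u v V y F G : R -> R.

Lemma nn_step u G (s : R) : cs u -> cs G -> nn (u - cst s * G) = nn u - 2 * s * ip u G + s ^+ 2 * nn G.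
Proof. by move=> cu cG; rewrite nnB ?nnZ ?ipZr//; [genii; ring|csx]. Qed.

Lemma nn_le_sqr f (B : R) : nm f <= B -> nn f <= B ^+ 2.
Proof. by move=> h; rewrite -nm2 lerXn2r ?nnegrE ?nm_ge0//; exact: le_trans (nm_ge0 f) h. Qed.

Lemma CS_le f g (A B : R) : cs f -> cs g -> nm f <= A -> nm g <= B -> `|ip f g| <= A * B.
Proof. by move=> cf cg hA hB; apply: (le_trans (CS cf cg)); apply: ler_pM => //; exact: nm_ge0. Qed.

Lemma ii_mul_sqr_le f u (B : R) : cs f -> cs u -> (forall x, `|f x| <= B) -> `|ii (f * u ^+ 2)| <= B * nn u.
Proof.
move=> cf cu hB; have c2 : cs (u ^+ 2) by csx.
rewrite nn_sqr -(iiZ _ c2); apply: ii_norm_le; [by csx|by csx|] => x; ptw.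
by rewrite normrM (ger0_norm (sqr_ge0 (u x))) ler_wpM2r ?sqr_ge0.
Qed.

(** [eta] is the consistency error of the differences and [Rr] the Taylor remainder of V in time. *)
Lemma mul_step (V0 V1 Vt0 v F eta E Rr P0 : R -> R) (s : R) : s != 0 ->
  F = P0 + eta -> Rr = V1 - V0 + cst s * Vt0 ->
  v - cst s * F - V1 = (v - V0) - cst s * ((P0 - Vt0) + (eta + cst s^-1 * Rr)).
Proof. by move=> s0 -> ->; apply/funext => x; ptw; field. Qed.

Lemma err_bound eta Rr (h s C D : R) : cs eta -> cs Rr -> 0 < s <= 1 -> 0 < h <= 1 -> 0 <= C ->
  nm eta <= h * C -> nm Rr <= D * s ^+ 2 -> nm (eta + cst s^-1 * Rr) <= (h + s) * (C + D) /\ nm (eta + cst s^-1 * Rr) <= C + D.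
Proof.
move=> ce cR /andP[s0 s1] /andP[h0 h1] C0 he hR.
have D0 : 0 <= D by rewrite -(pmulr_lge0 _ (exprn_gt0 2 s0)); exact: le_trans (nm_ge0 _) hR.
have h2 : nm (eta + cst s^-1 * Rr) <= h * C + s * D.
  apply: (le_trans (nmD _ _)); [by []|by csx|]; apply: lerD => //.
  have s0' : 0 <= s^-1 by rewrite invr_ge0 ltW.
  rewrite nmZ// (ger0_norm s0') ler_pdivrMl//; apply: (le_trans hR).
  by rewrite le_eqVlt; apply/orP; left; apply/eqP; ring.
by split; apply: (le_trans h2); nra.
Qed.

(** V V_x and V_x u have sup norms of order e^2 b^8; times ||u||^2 this gives b^22, and so does the
    residual b^15 times ||u||. That is the order of the gain in [bt_step] for a quantity of size
    b^14. [Ce] is independent of h, s and the time. *)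
Lemma U_step (c K k4 N rN m e CN B : R) : 0 <= c -> 0 <= K -> 0 <= k4 -> 0 <= CN -> 0 <= B -> 0 < m ->
  exists Ce, 0 <= Ce /\ forall b V0 V1 Vt0 v h s, scales N rN m e b -> Vbound c N rN m e b V0 ->
  cs V1 -> cs Vt0 -> cs v -> 0 < h <= 1 -> 0 < s <= 1 ->
  nm (Vt0 - Phi V0) <= c * (m * b ^+ 15) -> nm Vt0 <= CN -> nm (V1 - V0 + cst s * Vt0) <= CN * s ^+ 2 ->
  HK 5 B v -> nm (v - V0) <= K * (m * b ^+ 7) ->
  (forall x, (v - V0) x ^+ 2 <= (k4 * (e * b ^+ 4 / rN)) ^+ 2) ->
  nn (v - cst s * Fh h v - V1) <= nn (v - V0)
    + s * (m ^+ 2 * b ^+ 22 * (e ^+ 2 * (12 * c ^+ 2 + 4 * c * k4) * K ^+ 2 + 2 * K * c)) + s * ((h + s) * Ce).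
Proof.
move=> c0 K0 k40 CN0 B0 m0.
pose C1 := 6 * B + 12 * (2 ^+ 2 * ((2 ^+ 2 * (B * B)) * B)).
have C10 : 0 <= C1 by rewrite /C1; pos.
pose C2 := cF 1 B + CN; have C20 : 0 <= C2 by rewrite /C2 /cF; pos.
exists (2 * (K * m) * (C1 + CN) + (C2 + (C1 + CN)) ^+ 2); split; first by pos.
move=> b V0 V1 Vt0 v h s [N1 rN1 rNN m0' rm e0 e1 b0 b1] [cV V0n V2 VD Vs Vsx] cV1 cVt cv h01 s01 hE hVt hR hv hU hs.
have [s0 s1] := andP s01; have [h0 h1] := andP h01.
pose u := v - V0; have cu : cs u by rewrite /u; csx.
pose eta := Fh h v - Phi v; have cP := cs_Phi cv; have cF' := cs_Fh h cv; have cPV := cs_Phi cV.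
have ce : cs eta by rewrite /eta; csx.
pose Rr := V1 - V0 + cst s * Vt0; have cR : cs Rr by rewrite /Rr; csx.
pose E := Vt0 - Phi V0; have cE : cs E by rewrite /E; csx.
pose Z := eta + cst s^-1 * Rr; have cZ : cs Z by rewrite /Z; csx.
have he : nm eta <= h * C1.
  by apply: (@HK_eta _ 1%N B h v isT cv h0 _ 0%N) => //; apply: (HK_le _ _ hv).
have [Z1 Z2] := err_bound ce cR s01 h01 C10 he hR.
have eu : v - cst s * Fh h v - V1 = u - cst s * ((Phi v - Vt0) + Z).
  by apply: mul_step => //; [rewrite gt_eqF|rewrite /eta addrC subrK].
have ev : v = V0 + u by rewrite /u addrC subrK.
have e1' : Phi v - Vt0 = (Phi (V0 + u) - Phi V0) - E by rewrite -ev /E; apply/funext => x; ptw; ring.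
rewrite eu nn_step; [|by []|by csx].
have cd : cs (Phi (V0 + u) - Phi V0) by rewrite -ev; csx.
have hip : ip u (Phi v - Vt0 + Z) = ip u (Phi (V0 + u) - Phi V0) - ip u E + ip u Z.
  rewrite ipDr; [|by csx|by []|by []]; rewrite e1' ipBr//.
have hG : nn (Phi v - Vt0 + Z) <= (C2 + (C1 + CN)) ^+ 2.
  apply: nn_le_sqr; apply: (le_trans (nmD _ _)); [by csx|by []|]; apply: lerD => //.
  apply: (le_trans (nmB _ _)) => //; apply: lerD => //.
  by apply: (@HK_Phi _ 1%N B v isT cv _ 0%N) => //; apply: (HK_le _ _ hv).
have rN0 : 0 < rN := lt_le_trans ltr01 rN1.
have su x : `|u x| <= k4 * (e * b ^+ 4 / rN).
  by apply: abs_of_sqr; [pos|exact: hs].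
have hVV : `|ii (cst 6 * (V0 * dx V0 * u ^+ 2) + cst 2 * (dx V0 * u ^+ 3))| <=
   (e ^+ 2 * (6 * c ^+ 2 + 2 * c * k4) * b ^+ 8) * nn u.
  have -> : cst 6 * (V0 * dx V0 * u ^+ 2) + cst 2 * (dx V0 * u ^+ 3) = (cst 6 * (V0 * dx V0) + cst 2 * (dx V0 * u)) * u ^+ 2.
    by apply/funext => x; ptw; dring.
  apply: ii_mul_sqr_le; [by csx|by []|] => x; ptw.
  have h2 := nbM (Vs x) (Vsx x); have h3 := nbM (Vsx x) (su x).
  have h4 := nbD (nbM (@nbC R 6) h2) (nbM (@nbC R 2) h3).
  apply: (le_trans h4); rewrite le_eqVlt; apply/orP; left; apply/eqP.
  have rN0' : rN != 0 by rewrite gt_eqF.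
  by clear -rN0'; field.
have hP := Phi_diff cu cV.
have hE' := CS_le cu cE hU hE.
have hZ' := CS_le cu cZ hU Z1.
have mb7 : K * (m * b ^+ 7) <= K * m.
  by rewrite mulrA ler_piMr//; [pos|apply: exprn_ile1 => //; pos].
have nu : nn u <= (K * (m * b ^+ 7)) ^+ 2 := nn_le_sqr hU.
have q0 : 0 <= e ^+ 2 * (6 * c ^+ 2 + 2 * c * k4) * b ^+ 8 by pos.
have hVV2 := le_trans hVV (ler_wpM2l q0 nu).
have Zs0 : 0 <= (h + s) * (C1 + CN) by pos.
have hZ2 := le_trans hZ' (ler_wpM2r Zs0 mb7).
rewrite hip hP.
move: hVV2 hE' hZ2; rewrite !ler_norml => /andP[a1 a2] /andP[a3 a4] /andP[a5 a6].
have s20 : 0 <= s ^+ 2 by pos.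
have hG2 := ler_wpM2l s20 hG.
have hss : s ^+ 2 * (C2 + (C1 + CN)) ^+ 2 <= s * ((h + s) * (C2 + (C1 + CN)) ^+ 2).
  rewrite expr2 -mulrA ler_pM2l//; apply: ler_wpM2r; [exact: sqr_ge0|by rewrite lerDr ltW].
have t1 : - (ii (cst 6 * (V0 * dx V0 * u ^+ 2) + cst 2 * (dx V0 * u ^+ 3))) + ip u E - ip u Z <=
  e ^+ 2 * (6 * c ^+ 2 + 2 * c * k4) * b ^+ 8 * (K * (m * b ^+ 7)) ^+ 2 + K * (m * b ^+ 7) * (c * (m * b ^+ 15)) + K * m * ((h + s) * (C1 + CN)).
  by clear -a1 a4 a5; lra.
have s2 : 0 <= 2 * s by pos.
have t2 := ler_wpM2l s2 t1.
rewrite -/u; move: t2 hG2 hss; move: (nn u) => q; genii; clear => t2 hG2 hss.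
apply: (le_trans (y := 2 * s * (e ^+ 2 * (6 * c ^+ 2 + 2 * c * k4) * b ^+ 8 * (K * (m * b ^+ 7)) ^+ 2 + K * (m * b ^+ 7) * (c * (m * b ^+ 15)) + K * m * ((h + s) * (C1 + CN)) ) + q + s * ((h + s) * (C2 + (C1 + CN)) ^+ 2))); first by lra.
by rewrite le_eqVlt; apply/orP; left; apply/eqP; ring.
Qed.

End steps.

Section steps.
Context {R : realType}.
Implicit Types u v V y F G : R -> R.

Lemma nm_mul_le f g (S Q : R) : cs f -> cs g -> (forall x, `|f x| <= S) -> nm g <= Q -> nm (f * g) <= S * Q.
Proof.
move=> cf cg hS hQ; have S0 : 0 <= S := le_trans (normr_ge0 _) (hS 0).
apply: (le_trans (y := S * nm g)); last exact: ler_wpM2l.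
by apply: nm_mul => //; exact: cs_smooth.
Qed.

Lemma nm_scale_le f (a Q : R) : cs f -> 0 <= a -> nm f <= Q -> nm (cst a * f) <= a * Q.
Proof. by move=> cf a0 hQ; rewrite nmZ// ger0_norm//; exact: ler_wpM2l. Qed.

Lemma nm_gradI_le N v (s0 s1 n0 n2 nD : R) : cs v -> 0 <= s0 -> 0 <= s1 ->
  (forall x, `|v x| <= s0) -> (forall x, `|dx v x| <= s1) -> nm v <= n0 -> nm (dx (dx v)) <= n2 -> nm (Dop N (Dop N v)) <= nD ->
  nm (gradI N v) <= 2 * nD + 20 * (s1 ^+ 2 * n0) + 20 * (s0 ^+ 2 * n2) + 12 * (s0 ^+ 4 * n0) + 8 * N ^+ 2 * (s0 ^+ 2 * n0).
Proof.
move=> cv s00 s10 hs0 hs1 hn0 hn2 hD.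
have cD := cs_Dop N (cs_Dop N cv).
have cvx := cs_der cv.
have h1 : nm (v * (dx v) ^+ 2) <= s1 ^+ 2 * n0.
  by rewrite [v * _]mulrC; apply: nm_mul_le => //; [by csx|] => x; ptw; exact: nbX.
have h2 : nm (v ^+ 2 * dx (dx v)) <= s0 ^+ 2 * n2.
  by apply: nm_mul_le => //; [by csx|by csx|] => x; ptw; exact: nbX.
have h3 : nm (v ^+ 5) <= s0 ^+ 4 * n0.
  by rewrite exprSr; apply: nm_mul_le => //; [by csx|] => x; ptw; exact: nbX.
have h4 : nm (v ^+ 3) <= s0 ^+ 2 * n0.
  by rewrite exprSr; apply: nm_mul_le => //; [by csx|] => x; ptw; exact: nbX.
rewrite /gradI; apply: (le_trans (nmB _ _)); [by csx|by csx|]; apply: lerD.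
  apply: (le_trans (nmD _ _)); [by csx|by csx|]; apply: lerD.
    apply: (le_trans (nmB _ _)); [by csx|by csx|]; apply: lerD.
      apply: (le_trans (nmB _ _)); [by csx|by csx|]; apply: lerD.
        by apply: nm_scale_le => //.
      by apply: nm_scale_le => //; csx.
    by apply: nm_scale_le => //; csx.
  by apply: nm_scale_le => //; csx.
by apply: nm_scale_le => //; [by csx|by pos].
Qed.

Lemma nm_Dop_le N v (n0 n2 : R) : cs v -> nm v <= n0 -> nm (dx (dx v)) <= n2 -> nm (Dop N v) <= n2 + N ^+ 2 * n0.
Proof.
move=> cv h0 h2; rewrite /Dop; apply: (le_trans (nmD _ _)); [by csx|by csx|]; apply: lerD => //.
by apply: nm_scale_le => //; exact: sqr_ge0.
Qed.

Lemma dx2_Dop N v : cs v -> dx (dx (Dop N v)) = Dop N (dx (dx v)).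
Proof. by move=> cv; rewrite /Dop; dxr. Qed.

Lemma HK_abs K B v x j : cs v -> HK K.+1 B v -> (j <= K)%N -> `|dn j v x| <= 2 * B.
Proof.
move=> cv h jK; apply: abs_of_sqr; first by rewrite mulr_ge0//; exact: HK_ge0 h.
exact: HK_sup4 jK.
Qed.

Lemma nn_Dop_HK N v (B : R) : cs v -> HK 2 B v -> nn (Dop N v) + nn v + nn (dx v) <= (B + N ^+ 2 * B) ^+ 2 + B ^+ 2 + B ^+ 2.
Proof.
move=> cv h; apply: lerD; first apply: lerD.
- by apply: nn_le_sqr; apply: nm_Dop_le => //; [exact: (h 0%N)|exact: (h 2%N)].
- by apply: nn_le_sqr; exact: (h 0%N).
- by apply: nn_le_sqr; exact: (h 1%N).
Qed.

Lemma gradI_HK N (B : R) : 0 <= B -> exists C, 0 <= C /\ forall v, cs v -> HK 4 B v -> nm (gradI N v) <= C.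
Proof.
move=> B0.
exists (2 * ((B + N ^+ 2 * B) + N ^+ 2 * (B + N ^+ 2 * B)) + 20 * ((2 * B) ^+ 2 * B) + 20 * ((2 * B) ^+ 2 * B) + 12 * ((2 * B) ^+ 4 * B) + 8 * N ^+ 2 * ((2 * B) ^+ 2 * B)).
split; first by pos.
move=> v cv h; apply: nm_gradI_le => //; [by pos|by pos| | | | |].
- by move=> x; apply: (@HK_abs 3 B v x 0%N).
- by move=> x; apply: (@HK_abs 3 B v x 1%N).
- exact: (h 0%N).
- exact: (h 2%N).
- apply: nm_Dop_le; first exact: cs_Dop.
    by apply: nm_Dop_le => //; [exact: (h 0%N)|exact: (h 2%N)].
  have cv2 : cs (dx (dx v)) by csx.
  by rewrite dx2_Dop//; apply: nm_Dop_le => //; [exact: (h 2%N)|exact: (h 4%N)].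
Qed.

Lemma Ifun_taylor_HK N (B : R) : 0 <= B -> exists C, 0 <= C /\ forall f g (s : R), cs f -> cs g -> 0 <= s <= 1 ->
  HK 2 B f -> HK 2 B g -> `|Ifun N (f - cst s * g) - Ifun N f + s * ip (gradI N f) g| <= s ^+ 2 * C.
Proof.
move=> B0; pose B1 := 1 + 2 * B; have B11 : 1 <= B1 by rewrite /B1; clear -B0; lra.
pose q := (1000 * B1 ^+ 4 * (1 + N ^+ 2)).
exists ((1 + q) * ((B + N ^+ 2 * B) ^+ 2 + B ^+ 2 + B ^+ 2)).
have q0 : 0 <= q by rewrite /q; have : 0 <= B1 by [apply: le_trans B11]; move=> ?; pos.
split; first by pos.
move=> f g s cf cg s01 hf hg.
have h2 : forall x j F, cs F -> HK 2 B F -> (j <= 1)%N -> `|dn j F x| <= B1.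
  by move=> x j F cF hF j1; apply: (le_trans (HK_abs x cF hF j1)); rewrite /B1; lra.
have hs : forall x, [/\ `|f x| <= B1, `|dx f x| <= B1, `|g x| <= B1 & `|dx g x| <= B1].
  by move=> x; split; [apply: (h2 x 0%N f)|apply: (h2 x 1%N f)|apply: (h2 x 0%N g)|apply: (h2 x 1%N g)].
apply: (le_trans (Ifun_taylor N cf cg B11 s01 hs)); apply: ler_wpM2l; first exact: sqr_ge0.
have hD := nn_Dop_HK N cg hg; have cD := cs_Dop N cg; have cg1 := cs_der cg.
have := nn_ge0 (Dop N g); have := nn_ge0 g; have := nn_ge0 (dx g).
rewrite -/q; move: hD; genii; clear -q0 => hD a b d.
by nra.
Qed.

(** [vb_DD] bounds the linear part by N m; in the nonlinear terms the factors taken in sup norm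
    compensate the powers of N, so they are no larger. *)
Lemma nm_gradI_V (c N rN m e b : R) V : 0 <= c -> scales N rN m e b -> Vbound c N rN m e b V ->
  nm (gradI N V) <= (2 * c + 48 * c ^+ 3 + 12 * c ^+ 5) * (N * m).
Proof.
move=> c0 [N1 rN1 rNN m0 rm e0 e1 b0 b1] [cV V0 V2 VD Vs Vsx].
have rN0 : 0 < rN := lt_le_trans ltr01 rN1.
have N0 : 0 < N := lt_le_trans ltr01 N1.
have e4 : e * b ^+ 4 <= 1.
  by apply: mulr_ile1; rewrite ?exprn_ile1 ?exprn_ge0 ?(ltW e0) ?(ltW b0).
have eb0 : 0 <= e * b ^+ 4 by pos.
have s0 x : `|V x| <= c / rN.
  apply: (le_trans (Vs x)); rewrite ler_wpM2l// ler_piMl// invr_ge0; lra.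
have s1 x : `|dx V x| <= c * rN.
  by apply: (le_trans (Vsx x)); rewrite ler_wpM2l// ler_piMl//; lra.
have c'0 : 0 <= c / rN by rewrite divr_ge0// ltW.
have c''0 : 0 <= c * rN by pos.
apply: (le_trans (nm_gradI_le cV c'0 c''0 s0 s1 V0 V2 VD)).
have rN0' : rN != 0 by rewrite gt_eqF.
have -> : 2 * (c * (N * m)) + 20 * ((c * rN) ^+ 2 * (c * m)) + 20 * ((c / rN) ^+ 2 * (c * (N ^+ 2 * m))) + 12 * ((c / rN) ^+ 4 * (c * m)) + 8 * N ^+ 2 * ((c / rN) ^+ 2 * (c * m)) = (2 * c + 48 * c ^+ 3) * (N * m) + 12 * c ^+ 5 * (m / rN ^+ 4).
  by rewrite -rNN; field.
have -> : (2 * c + 48 * c ^+ 3 + 12 * c ^+ 5) * (N * m) = (2 * c + 48 * c ^+ 3) * (N * m) + 12 * c ^+ 5 * (N * m) by ring.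
rewrite lerD2l ler_wpM2l//; first by pos.
rewrite [N * m]mulrC ler_wpM2l ?(ltW m0)//; apply: le_trans N1; rewrite invf_le1 ?exprn_gt0//.
exact: exprn_ege1.
Qed.

(** [Ifun] is nearly conserved along both v and V: the pairing of [gradI] with Phi vanishes, which
    leaves consistency errors for v and <gradI V, residual> for V. The latter is of order N m times
    m b^15, and 15 = 7 + 8. *)
Lemma I_step (c N m CN B : R) : 0 <= c -> 0 <= N -> 0 <= CN -> 0 <= B ->
  exists Ce, 0 <= Ce /\ forall rN e b V0 V1 Vt0 v h s, scales N rN m e b -> Vbound c N rN m e b V0 ->
  cs V1 -> cs Vt0 -> cs v -> 0 < h <= 1 -> 0 < s <= 1 ->
  nm (Vt0 - Phi V0) <= c * (m * b ^+ 15) -> HK 2 CN Vt0 -> HK 4 CN V0 -> HK 2 (CN * s ^+ 2) (V1 - V0 + cst s * Vt0) ->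
  HK 5 B v ->
  `|Ifun N (v - cst s * Fh h v) - Ifun N V1| <= `|Ifun N v - Ifun N V0|
    + s * ((2 * c + 48 * c ^+ 3 + 12 * c ^+ 5) * c * (N * m ^+ 2 * b ^+ 15)) + s * ((h + s) * Ce).
Proof.
move=> c0 N0 CN0 B0.
pose B1 := B + cF 2 B + CN + CN.
have F0 : 0 <= cF 2 B by rewrite /cF; pos.
have B10 : 0 <= B1 by rewrite /B1; pos.
have [Ct [Ct0 hT]] := Ifun_taylor_HK N B10.
have [Cg [Cg0 hG]] := gradI_HK N B10.
pose C1 := 6 * B + 12 * (2 ^+ 2 * ((2 ^+ 2 * (B * B)) * B)).
have C10 : 0 <= C1 by rewrite /C1; pos.
exists (Ct + Ct + Cg * C1 + Cg * CN); split; first by pos.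
move=> rN e b V0 V1 Vt0 v h s sc Vb cV1 cVt cv h01 s01 hE hVt hV hR hv.
have [s0 s1] := andP s01; have [h0 h1] := andP h01.
have cV := vb_cs Vb; have cPV := cs_Phi cV; have cP := cs_Phi cv; have cFv := cs_Fh h cv.
pose Rr := V1 - V0 + cst s * Vt0; have cR : cs Rr by rewrite /Rr; csx.
have sV0 : 0 <= s^-1 by rewrite invr_ge0 ltW.
(* V is written as an Euler step with increment [g0], so that one Taylor estimate serves v and V. *)
pose g0 := Vt0 - cst s^-1 * Rr; have cg0 : cs g0 by rewrite /g0; csx.
have eV1 : V1 = V0 - cst s * g0.
  by rewrite /g0 /Rr; apply/funext => x; ptw; field; rewrite gt_eqF.
have s02 : 0 <= s <= 1 by rewrite s1 ltW.
have hv1 : HK 4 B1 v by apply: (HK_le _ _ hv) => //; rewrite /B1; clear -F0 CN0; lra.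
have hF1 : HK 2 B1 (Fh h v).
  by apply: (HK_le _ _ (@HK_Fh R 2 B h v isT cv h0 hv)) => //; rewrite /B1; clear -B0 F0 CN0; lra.
have hV1 : HK 4 B1 V0 by apply: (HK_le _ _ hV) => //; rewrite /B1; clear -F0 B0 CN0; lra.
have hRs : HK 2 (s * CN) (cst s^-1 * Rr).
  apply: (HK_le (leqnn 2) _ (HK_scale0 cR sV0 hR)).
  by rewrite le_eqVlt; apply/orP; left; apply/eqP; field; rewrite gt_eqF.
have hg1 : HK 2 B1 g0.
  rewrite /g0; apply: (HK_le (leqnn 2) _ (HK_add _ _ hVt (HK_opp _ hRs))); [|by csx..].
  by rewrite /B1; clear -F0 B0 CN0 s0 s1; nra.
have t1 := hT _ _ _ cv cFv s02 (HK_le (isT : (2 <= 4)%N) (lexx _) hv1) hF1.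
have t2 := hT _ _ _ cV cg0 s02 (HK_le (isT : (2 <= 4)%N) (lexx _) hV1) hg1.
have cGv := cs_gradI N cv; have cGV := cs_gradI N cV.
pose eta := Fh h v - Phi v; have ce : cs eta by rewrite /eta; csx.
have he : nm eta <= h * C1.
  by apply: (@HK_eta _ 1%N B h v isT cv h0 _ 0%N).
have i1 : `|ip (gradI N v) (Fh h v)| <= Cg * (h * C1).
  have -> : Fh h v = Phi v + eta by rewrite /eta addrC subrK.
  rewrite ipDr// gradI_Phi// add0r; apply: CS_le => //; exact: hG.
pose E := Vt0 - Phi V0; have cE : cs E by rewrite /E; csx.
have i2 : `|ip (gradI N V0) g0| <= (2 * c + 48 * c ^+ 3 + 12 * c ^+ 5) * (N * m) * (c * (m * b ^+ 15)) + Cg * (s * CN).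
  have -> : g0 = Phi V0 + (E - cst s^-1 * Rr) by rewrite /g0 /E; apply/funext => x; ptw; ring.
  have cRs : cs (cst s^-1 * Rr) by csx.
  rewrite ipDr//; [|by csx]; rewrite gradI_Phi// add0r ipBr//.
  apply: (le_trans (ler_normB _ _)); apply: lerD; apply: CS_le => //.
  - exact: nm_gradI_V sc Vb.
  - exact: hG.
  - exact: (hRs 0%N).
rewrite -eV1 in t2.
have s00 : 0 <= s := ltW s0.
have j1 := ler_wpM2l s00 i1; have j2 := ler_wpM2l s00 i2.
have sg x : s * `|x| = `|s * x| by rewrite normrM (ger0_norm s00).
move: t1 t2 j1 j2; rewrite !sg => t1 t2 j1 j2.
have -> : Ifun N (v - cst s * Fh h v) - Ifun N V1 = (Ifun N v - Ifun N V0)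
   + ((Ifun N (v - cst s * Fh h v) - Ifun N v + s * ip (gradI N v) (Fh h v)) - s * ip (gradI N v) (Fh h v)
   - (Ifun N V1 - Ifun N V0 + s * ip (gradI N V0) g0) + s * ip (gradI N V0) g0) by ring.
apply: (le_trans (ler_normD _ _)); rewrite -[X in _ <= X]addrA lerD2l.
have tri (x y z t : R) : `|x - y - z + t| <= `|x| + `|y| + `|z| + `|t|.
  by apply: (le_trans (ler_normD _ _)); rewrite lerD2r; apply: (le_trans (ler_normB _ _)); rewrite lerD2r; exact: ler_normB.
apply: (le_trans (tri _ _ _ _)); apply: (le_trans (lerD (lerD (lerD t1 j1) t2) j2)).
have hs2 : s ^+ 2 * Ct <= s * ((h + s) * Ct).
  by rewrite expr2 -mulrA ler_pM2l//; apply: ler_wpM2r; rewrite // lerDr ltW.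
have hs3 : s * (Cg * (s * CN)) <= s * ((h + s) * (Cg * CN)).
  rewrite ler_pM2l// mulrCA; apply: ler_wpM2r; [by pos|by rewrite lerDr ltW].
have hs4 : s * (Cg * (h * C1)) <= s * ((h + s) * (Cg * C1)).
  rewrite ler_pM2l// mulrCA; apply: ler_wpM2r; [by pos|by rewrite lerDl ltW].
clear -hs2 hs3 hs4.
apply: (le_trans (y := s * ((h + s) * Ct) + s * ((h + s) * (Cg * C1)) + s * ((h + s) * Ct) + (s * ((2 * c + 48 * c ^+ 3 + 12 * c ^+ 5) * (N * m) * (c * (m * b ^+ 15))) + s * ((h + s) * (Cg * CN))))).
  by lra.
by rewrite le_eqVlt; apply/orP; left; apply/eqP; ring.
Qed.

End steps.

(** * Energy estimates for the third and fourth derivatives *)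

Section steps.
Context {R : realType}.
Implicit Types u v V y F G : R -> R.

Lemma nm_le_pointwise f (u0 u1 u2 u3 : R -> R) (beta tau : R) : cs f -> cs u0 -> cs u1 -> cs u2 -> cs u3 -> 0 <= beta -> 0 <= tau ->
  (forall x, `|f x| <= beta * (`|u0 x| + `|u1 x| + `|u2 x| + `|u3 x|)) ->
  nm u0 <= tau -> nm u1 <= tau -> nm u2 <= tau -> nm u3 <= tau -> nm f <= 4 * (beta * tau).
Proof.
move=> cf c0 c1 c2 c3 b0 t0 h h0 h1 h2 h3.
apply: (@nmM_le R 0 _ f); first by pos.
apply: (le_trans (y := ii (cst (4 * beta ^+ 2) * (u0 ^+ 2 + u1 ^+ 2 + u2 ^+ 2 + u3 ^+ 2)))).
  rewrite nn_sqr; apply: ii_le; [by csx|by csx|] => x; ptw.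
  have hx : `|f x| ^+ 2 <= (beta * (`|u0 x| + `|u1 x| + `|u2 x| + `|u3 x|)) ^+ 2.
    by rewrite lerXn2r ?nnegrE//; have := h x; apply: le_trans.
  rewrite -(real_normK (num_real (f x))) -(real_normK (num_real (u0 x))) -(real_normK (num_real (u1 x))) -(real_normK (num_real (u2 x))) -(real_normK (num_real (u3 x))).
  apply: (le_trans hx).
  suff hh (p q r t : R) : (p + q + r + t) ^+ 2 <= 4 * (p ^+ 2 + q ^+ 2 + r ^+ 2 + t ^+ 2).
    by rewrite exprMn; apply: (le_trans (ler_wpM2l (sqr_ge0 beta) (hh _ _ _ _))); rewrite le_eqVlt; apply/orP; left; apply/eqP; ring.
  clear.
  have := sqr_ge0 (p - q); have := sqr_ge0 (p - r); have := sqr_ge0 (p - t); have := sqr_ge0 (q - r); have := sqr_ge0 (q - t); have := sqr_ge0 (r - t); lra.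
rewrite iiZ; [|by csx]; rewrite !iiD; [|by csx..]; rewrite -!nn_sqr.
have := nn_le_sqr h0; have := nn_le_sqr h1; have := nn_le_sqr h2; have := nn_le_sqr h3.
have b2 : 0 <= 4 * beta ^+ 2 by pos.
genii; clear -b2 => a1 a2 a3 a4.
apply: (le_trans (y := 4 * beta ^+ 2 * (4 * tau ^+ 2))); last by rewrite le_eqVlt; apply/orP; left; apply/eqP; ring.
by apply: ler_wpM2l => //; clear -a1 a2 a3 a4; lra.
Qed.

Lemma sum4_ge (a b c d : R) : let T := `|a| + `|b| + `|c| + `|d| in [/\ `|a| <= T, `|b| <= T, `|c| <= T & `|d| <= T].
Proof.
have := normr_ge0 a; have := normr_ge0 b; have := normr_ge0 c; have := normr_ge0 d.
by split; lra.
Qed.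

(** The third-order part is skew, and 6 v^2 g_x amounts to -6 v v_x g after integration by parts
    against g. *)
Lemma ip_transport v g (al : R -> R) : cs v -> cs g -> cs al ->
  ip g (- dx (dx (dx g)) + cst 6 * (v ^+ 2 * dx g) + al * g) = ii ((al - cst 6 * (v * dx v)) * g ^+ 2).
Proof.
move=> cv cg ca.
pose P : R -> R := cst 2^-1 * (dx g) ^+ 2 - g * dx (dx g) + cst 3 * (v ^+ 2 * g ^+ 2).
have cP : cs P by rewrite /P; csx.
have c1 : cs (g * (- dx (dx (dx g)) + cst 6 * (v ^+ 2 * dx g) + al * g)) by csx.
have c2 : cs ((al - cst 6 * (v * dx v)) * g ^+ 2) by csx.
apply: (ii_mod c1 c2 cP (derives cP)) => x.
by rewrite /P; dxr; ptw; dring.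
Qed.

(* Gagliardo-Nirenberg, from [(u_x u_xx^3)_x = u_xx^4 + 3 u_x u_xx^2 u_xxx]. *)
Lemma nm_sqr_dx2 u (S : R) : cs u -> 0 <= S -> (forall x, `|dx u x| <= S) ->
  nm ((dx (dx u)) ^+ 2) <= 3 * S * nm (dx (dx (dx u))).
Proof.
move=> cu S0 hS; have c1 := cs_der cu; have c2 := cs_der c1; have c3 := cs_der c2.
set q := (dx (dx u)) ^+ 2; have cq : cs q by rewrite /q; csx.
have e : nn q = - ip (cst 3 * (dx u * q)) (dx (dx (dx u))).
  rewrite /nn /ip -iiN; [|by csx].
  pose P : R -> R := dx u * (dx (dx u)) ^+ 3; have cP : cs P by rewrite /P; csx.
  apply: (@ii_mod _ _ _ P (dx P)); [by csx|by csx|exact: cP|exact: derives|].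
  by move=> x; rewrite /P /q; dxr; ptw; dring.
have h1 : nn q <= 3 * S * nm (dx (dx (dx u))) * nm q.
  rewrite e; apply: (le_trans (ler_norm _)); rewrite normrN.
  apply: (le_trans (CS_le (A := 3 * (S * nm q)) _ _ _ (lexx _))); [by csx|by csx| |].
    by apply: nm_scale_le => //; [by csx|]; apply: nm_mul_le.
  by rewrite le_eqVlt; apply/orP; left; apply/eqP; ring.
have [->|q0] := eqVneq (nm q) 0; first by have := nm_ge0 (dx (dx (dx u))); move=> ?; pos.
have qp : 0 < nm q by rewrite lt_def q0 nm_ge0.
by rewrite -(ler_pM2r qp) -expr2 nm2.
Qed.

(** Besides the transport part and a multiple of v v_x g, the third derivative contains v u_xx^2,
    quadratic in a quantity without sup bound at this level; [nm_sqr_dx2] trades it for sup |u_x|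
    times ||u_xxx||. All else, [f1], has at most two derivatives on u. The constant is 150 = 42 +
    108. *)
Lemma energy3 u V (al a tau n : R) : cs u -> cs V -> 0 <= al -> 0 <= a -> 0 <= tau ->
  (forall x, `|(V + u) x| * `|dx (V + u) x| <= al) ->
  (exists s0 s1, [/\ 0 <= s0, 0 <= s1, s0 * s1 <= al, (forall x, `|(V + u) x| <= s0) & (forall x, `|dx u x| <= s1)]) ->
  (forall x j, (j <= 4)%N -> `|dn j V x| <= a) -> (forall x, `|(V + u) x| <= a) -> (forall x, `|dx (V + u) x| <= a) ->
  (forall j, (j <= 2)%N -> nm (dn j u) <= tau) -> nm (dn 3 u) <= n ->
  - ip (dn 3 u) (dn 3 (Phi (V + u) - Phi V)) <= 150 * al * n ^+ 2 + n * (1728 * (a ^+ 2 * tau)).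
Proof.
move=> cu cV al0 a0 tau0 hvv [s0 [s1 [s00 s10 s01 hs0 hs1]]] hV hv hvx hu hn.
have n0 : 0 <= n := le_trans (nm_ge0 _) hn.
pose v := V + u; have cv : cs v by rewrite /v; csx.
have dnE f : dn 3 f = dx (dx (dx f)) by [].
pose g := dn 3 u; have cg : cs g := cs_dn 3 cu.
pose V1 := dx V; pose V2 := dx V1; pose V3 := dx V2; pose V4 := dx V3.
pose u1 := dx u; pose u2 := dx u1; pose u3 := dx u2.
pose v1 := dx v; 
have [cV1 cV2 cV3 cV4] : [/\ cs V1, cs V2, cs V3 & cs V4] by rewrite /V4 /V3 /V2 /V1; split; csx.
have [cu1 cu2 cu3 cv1] : [/\ cs u1, cs u2, cs u3 & cs v1] by rewrite /v1 /u3 /u2 /u1; split; csx.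
pose f1 : R -> R := cst 2 * (cst 3 * (u * (v + V) * V4) + cst 24 * ((u * v1 + V * u1) * V3)
  + cst 18 * (u * V2 * V2 + cst 2 * (v * V2 * u2)) + cst 36 * (u1 * (v1 + V1) * V2 + v1 * v1 * u2)).
have cf1 : cs f1 by rewrite /f1; csx.
have e : dn 3 (Phi v - Phi V) = - dx (dx (dx g)) + cst 6 * (v ^+ 2 * dx g) + (cst 48 * (v * v1)) * g
   + (f1 + cst 36 * (v * u2 ^+ 2)).
  rewrite /g !dnE /f1 /Phi /v1 /v /V4 /V3 /V2 /V1 /u2 /u1.
  by dxr; apply/funext => x; ptw; dring.
have caa : cs (cst 48 * (v * v1)) by csx.
rewrite -/v -/g e ipDr; [|by csx..]; rewrite ip_transport//; set I := ii _.
have h1 : `|I| <= 42 * al * nn g.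
  apply: ii_mul_sqr_le; [by csx|by []|] => x; ptw.
  have -> : 48 * (v x * v1 x) - 6 * (v x * (dx v x : R)) = 42 * (v x * v1 x) by rewrite /v1; dring.
  by rewrite !normrM (@ger0_norm _ 42)// ler_pM2l//; apply: hvv.
have Vb j x : (j <= 4)%N -> `|dn j V x| <= a by move=> ?; exact: hV.
have b0 x : `|V x| <= a := Vb 0%N x isT.
have b1 x : `|V1 x| <= a := Vb 1%N x isT.
have b2 x : `|V2 x| <= a := Vb 2%N x isT.
have b3 x : `|V3 x| <= a := Vb 3%N x isT.
have b4 x : `|V4 x| <= a := Vb 4%N x isT.
have h2 : nm f1 <= 4 * (432 * a ^+ 2 * tau).
  apply: (@nm_le_pointwise f1 u u1 u2 u) ; [exact: cf1|exact: cu|exact: cu1|exact: cu2|exact: cu|by pos|exact: tau0| |exact: (hu 0%N)|exact: (hu 1%N)|exact: (hu 2%N)|exact: (hu 0%N)].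
  move=> x; rewrite /f1; ptw.
  set T := `|u x| + `|u1 x| + `|u2 x| + `|u x|.
  have [T0 T1 T2 _] := sum4_ge (u x) (u1 x) (u2 x) (u x); rewrite -/T in T0 T1 T2.
  have a1 : `|v x| <= a := hv x.
  have a2 : `|v1 x| <= a := hvx x.
  move: (b0 x) (b1 x) (b2 x) (b3 x) (b4 x) => d0 d1 d2 d3 d4.
  have w1 := nbM (@nbC R 3) (nbM (nbM T0 (nbD a1 d0)) d4).
  have w2 := nbM (@nbC R 24) (nbM (nbD (nbM T0 a2) (nbM d0 T1)) d3).
  have w3 := nbM (@nbC R 18) (nbD (nbM (nbM T0 d2) d2) (nbM (@nbC R 2) (nbM (nbM a1 d2) T2))).
  have w4 := nbM (@nbC R 36) (nbD (nbM (nbM T1 (nbD a2 d1)) d2) (nbM (nbM a2 a2) T2)).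
  apply: (le_trans (nbM (@nbC R 2) (nbD (nbD (nbD w1 w2) w3) w4))).
  by rewrite le_eqVlt; apply/orP; left; apply/eqP; clear; ring.
have h3 : nm (cst 36 * (v * u2 ^+ 2)) <= 36 * (s0 * (3 * s1 * n)).
  apply: nm_scale_le; [by csx|by []|]; apply: nm_mul_le; [by []|by csx|by []|].
  apply: (le_trans (nm_sqr_dx2 cu s10 hs1)); apply: ler_wpM2l; first by pos.
  exact: hn.
have h4 : `|ip g (f1 + cst 36 * (v * u2 ^+ 2))| <= n * (4 * (432 * a ^+ 2 * tau) + 36 * (s0 * (3 * s1 * n))).
  apply: CS_le => //; [by csx|]; apply: (le_trans (nmD _ _)); [by []|by csx|]; exact: lerD.
have h5 := nn_le_sqr hn.
have h6 := ler_wpM2l (mulr_ge0 (ler0n R 42) al0) h5.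
have h7 : n * (36 * (s0 * (3 * s1 * n))) <= 108 * al * n ^+ 2.
  have -> : n * (36 * (s0 * (3 * s1 * n))) = 108 * n ^+ 2 * (s0 * s1) by ring.
  have -> : 108 * al * n ^+ 2 = 108 * n ^+ 2 * al by ring.
  by apply: ler_wpM2l s01; pos.
move: h1 h4 h6 h7; rewrite !ler_norml => /andP[x1 _] /andP[x2 _]; rewrite -/g.
move: x1 x2; clearbody I; genii; clear => x1 x2 h6 h7; lra.
Qed.

(** At this level v_xx has a sup bound and counts as a coefficient, so no exceptional quadratic term
    is left over. *)
Lemma energy4 u V (al a tau n : R) : cs u -> cs V -> 0 <= al -> 0 <= a -> 0 <= tau ->
  (forall x, `|(V + u) x| * `|dx (V + u) x| <= al) ->
  (forall x j, (j <= 5)%N -> `|dn j V x| <= a) -> (forall x j, (j <= 2)%N -> `|dn j (V + u) x| <= a) ->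
  (forall j, (j <= 3)%N -> nm (dn j u) <= tau) -> nm (dn 4 u) <= n ->
  - ip (dn 4 u) (dn 4 (Phi (V + u) - Phi V)) <= 54 * al * n ^+ 2 + n * (5568 * (a ^+ 2 * tau)).
Proof.
move=> cu cV al0 a0 tau0 hvv hV hv hu hn.
have n0 : 0 <= n := le_trans (nm_ge0 _) hn.
pose v := V + u; have cv : cs v by rewrite /v; csx.
have dnE f : dn 4 f = dx (dx (dx (dx f))) by [].
pose g := dn 4 u; have cg : cs g := cs_dn 4 cu.
pose V1 := dx V; pose V2 := dx V1; pose V3 := dx V2; pose V4 := dx V3; pose V5 := dx V4.
pose u1 := dx u; pose u2 := dx u1; pose u3 := dx u2.
pose v1 := dx v; pose v2 := dx v1.
have [cV1 cV2 cV3 cV4 cV5] : [/\ cs V1, cs V2, cs V3, cs V4 & cs V5] by rewrite /V5 /V4 /V3 /V2 /V1; split; csx.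
have [cu1 cu2 cu3 cv1 cv2] : [/\ cs u1, cs u2, cs u3, cs v1 & cs v2] by rewrite /v2 /v1 /u3 /u2 /u1; split; csx.
pose f1 : R -> R := cst 2 * (cst 3 * (u * (v + V) * V5) + cst 30 * ((u * v1 + V * u1) * V4)
  + cst 60 * (u * V3 * V2 + v * (u3 * v2 + V3 * u2)) + cst 60 * (u1 * (v1 + V1) * V3 + v1 * v1 * u3)
  + cst 90 * (u2 * (v2 + V2) * v1 + V2 * V2 * u1)).
have cf1 : cs f1 by rewrite /f1; csx.
have e : dn 4 (Phi v - Phi V) = - dx (dx (dx g)) + cst 6 * (v ^+ 2 * dx g) + (cst 60 * (v * v1)) * g + f1.
  rewrite /g !dnE /f1 /Phi /v2 /v1 /v /V5 /V4 /V3 /V2 /V1 /u3 /u2 /u1.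
  by dxr; apply/funext => x; ptw; dring.
have caa : cs (cst 60 * (v * v1)) by csx.
rewrite -/v -/g e ipDr; [|by csx..]; rewrite ip_transport//; set I := ii _.
have h1 : `|I| <= 54 * al * nn g.
  apply: ii_mul_sqr_le; [by csx|by []|] => x; ptw.
  have -> : 60 * (v x * v1 x) - 6 * (v x * (dx v x : R)) = 54 * (v x * v1 x) by rewrite /v1; dring.
  by rewrite !normrM (@ger0_norm _ 54)// ler_pM2l//; apply: hvv.
have Vb j x : (j <= 5)%N -> `|dn j V x| <= a by move=> ?; exact: hV.
have b0 x : `|V x| <= a := Vb 0%N x isT.
have b1 x : `|V1 x| <= a := Vb 1%N x isT.
have b2 x : `|V2 x| <= a := Vb 2%N x isT.
have b3 x : `|V3 x| <= a := Vb 3%N x isT.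
have b4 x : `|V4 x| <= a := Vb 4%N x isT.
have b5 x : `|V5 x| <= a := Vb 5%N x isT.
have h2 : nm f1 <= 4 * (1392 * a ^+ 2 * tau).
  apply: (@nm_le_pointwise f1 u u1 u2 u3) ; [exact: cf1|exact: cu|exact: cu1|exact: cu2|exact: cu3|by pos|exact: tau0| |exact: (hu 0%N)|exact: (hu 1%N)|exact: (hu 2%N)|exact: (hu 3%N)].
  move=> x; rewrite /f1; ptw.
  set T := `|u x| + `|u1 x| + `|u2 x| + `|u3 x|.
  have [T0 T1 T2 T3] := sum4_ge (u x) (u1 x) (u2 x) (u3 x); rewrite -/T in T0 T1 T2 T3.
  have a1 : `|v x| <= a := hv x 0%N isT.
  have a2 : `|v1 x| <= a := hv x 1%N isT.
  have a3 : `|v2 x| <= a := hv x 2%N isT.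
  move: (b0 x) (b1 x) (b2 x) (b3 x) (b4 x) (b5 x) => d0 d1 d2 d3 d4 d5.
  have w1 := nbM (@nbC R 3) (nbM (nbM T0 (nbD a1 d0)) d5).
  have w2 := nbM (@nbC R 30) (nbM (nbD (nbM T0 a2) (nbM d0 T1)) d4).
  have w3 := nbM (@nbC R 60) (nbD (nbM (nbM T0 d3) d2) (nbM a1 (nbD (nbM T3 a3) (nbM d3 T2)))).
  have w4 := nbM (@nbC R 60) (nbD (nbM (nbM T1 (nbD a2 d1)) d3) (nbM (nbM a2 a2) T3)).
  have w5 := nbM (@nbC R 90) (nbD (nbM (nbM T2 (nbD a3 d2)) a2) (nbM (nbM d2 d2) T1)).
  apply: (le_trans (nbM (@nbC R 2) (nbD (nbD (nbD (nbD w1 w2) w3) w4) w5))).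
  by rewrite le_eqVlt; apply/orP; left; apply/eqP; clear; ring.
have h4 : `|ip g f1| <= n * (4 * (1392 * a ^+ 2 * tau)) by apply: CS_le.
have h5 := nn_le_sqr hn.
have h6 := ler_wpM2l (mulr_ge0 (ler0n R 54) al0) h5.
move: h1 h4 h6; rewrite !ler_norml => /andP[x1 _] /andP[x2 _]; rewrite -/g.
move: x1 x2; clearbody I; genii; clear => x1 x2 h6; lra.
Qed.

Lemma Hk_step (k : nat) (CN B : R) : (0 < k)%N -> 0 <= CN -> 0 <= B ->
  exists Ce, 0 <= Ce /\ forall V0 V1 Vt0 v h s (d : R), cs V0 ->
  cs V1 -> cs Vt0 -> cs v -> 0 < h <= 1 -> 0 < s <= 1 ->
  nm (dn k (Vt0 - Phi V0)) <= d -> HK k CN Vt0 -> HK k CN V0 -> HK k (CN * s ^+ 2) (V1 - V0 + cst s * Vt0) ->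
  HK (k + 4) B v ->
  nn (dn k (v - cst s * Fh h v - V1)) <= nn (dn k (v - V0)) - 2 * s * ip (dn k (v - V0)) (dn k (Phi v - Phi V0))
    + 2 * s * (nm (dn k (v - V0)) * d) + s * ((h + s) * Ce).
Proof.
move=> k0 CN0 B0.
pose C1 := 6 * B + 12 * (2 ^+ k.+1 * ((2 ^+ k.+1 * (B * B)) * B)).
have C10 : 0 <= C1 by rewrite /C1; pos.
have F0 : 0 <= cF k B by rewrite /cF; pos.
pose C2 := cF k B + CN; have C20 : 0 <= C2 by rewrite /C2; pos.
exists (2 * ((B + CN) * (C1 + CN)) + (C2 + (C1 + CN)) ^+ 2); split; first by pos.
move=> V0 V1 Vt0 v h s d cV cV1 cVt cv h01 s01 hE hVt hV hR hv.
have [s0 s1] := andP s01; have [h0 h1] := andP h01.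
pose u := v - V0; have cu : cs u by rewrite /u; csx.
pose eta := Fh h v - Phi v; have cP := cs_Phi cv; have cF' := cs_Fh h cv; have cPV := cs_Phi cV.
have ce : cs eta by rewrite /eta; csx.
pose Rr := V1 - V0 + cst s * Vt0; have cR : cs Rr by rewrite /Rr; csx.
pose E := Vt0 - Phi V0; have cE : cs E by rewrite /E; csx.
pose Z := eta + cst s^-1 * Rr; have cZ : cs Z by rewrite /Z; csx.
have he : nm (dn k eta) <= h * C1 by apply: (@HK_eta _ k B h v k0 cv h0 _ k).
have hRk : nm (dn k Rr) <= CN * s ^+ 2 by exact: hR.
have [Z1 Z2] := err_bound (cs_dn k ce) (cs_dn k cR) s01 h01 C10 he hRk.
have eZ : dn k eta + cst s^-1 * dn k Rr = dn k Z by rewrite /Z dn_add ?dn_scale//; csx.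
rewrite eZ in Z1 Z2.
have eu : v - cst s * Fh h v - V1 = u - cst s * ((Phi v - Vt0) + Z).
  by apply: mul_step => //; [rewrite gt_eqF|rewrite /eta addrC subrK].
have cG : cs (Phi v - Vt0 + Z) by csx.
have cW : cs (Phi v - Phi V0) by csx.
have cgu := cs_dn k cu; have cgE := cs_dn k cE; have cgZ := cs_dn k cZ; have cgW := cs_dn k cW.
have dnB f g : cs f -> cs g -> dn k (f - g) = dn k f - dn k g by move=> *; rewrite dn_add ?dn_opp//; csx.
have eG : dn k (Phi v - Vt0 + Z) = (dn k (Phi v - Phi V0) - dn k E) + dn k Z.
  rewrite dn_add//; last by csx.
  by congr (_ + _); rewrite -dnB//; congr (dn k _); rewrite /E; apply/funext => x; ptw; ring.
have eu2 : dn k (u - cst s * (Phi v - Vt0 + Z)) = dn k u - cst s * dn k (Phi v - Vt0 + Z).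
  by rewrite dnB ?dn_scale//; csx.
rewrite eu eu2 nn_step; [|by []|exact: cs_dn].
have hG : nn (dn k (Phi v - Vt0 + Z)) <= (C2 + (C1 + CN)) ^+ 2.
  apply: nn_le_sqr; rewrite dn_add//; last by csx.
  apply: (le_trans (nmD _ _)); [by apply: cs_dn; csx|by []|]; apply: lerD => //.
  rewrite dnB//; apply: (le_trans (nmB _ _)); [exact: cs_dn..|]; apply: lerD; last exact: hVt.
  apply: (@HK_Phi _ k B v k0 cv _ k) => //; apply: (HK_le _ (lexx _) hv); clear; lia.
have hgu : nm (dn k u) <= B + CN.
  rewrite dnB//; apply: (le_trans (nmB _ _)); [exact: cs_dn..|]; apply: lerD; [|exact: hV].
  by apply: hv; clear; lia.
rewrite eG in hG *; rewrite ipDr//; [|by csx]; rewrite ipBr//.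
have hE' := CS_le cgu cgE (lexx _) hE.
have hZ' := CS_le cgu cgZ hgu Z1.
rewrite -/u.
move: hE' hZ'; rewrite !ler_norml => /andP[a3 a4] /andP[a5 a6].
have s20 : 0 <= s ^+ 2 by pos.
have hG2 := ler_wpM2l s20 hG.
have hss : s ^+ 2 * (C2 + (C1 + CN)) ^+ 2 <= s * ((h + s) * (C2 + (C1 + CN)) ^+ 2).
  rewrite expr2 -mulrA ler_pM2l//; apply: ler_wpM2r; [exact: sqr_ge0|by rewrite lerDr ltW].
have s2 : 0 <= 2 * s by pos.
have t1 := ler_wpM2l s2 a4.
have t2 := ler_wpM2l s2 a5.
move: t1 t2 hG2 hss; genii; clear => t1 t2 hG2 hss; lra.
Qed.

(** An explicit step adds s^2 ||Fh v||^2, of order s^2 h^(-6). For s below [s0], of order h^6, this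
    is within the linear growth, whose constant [C] does not depend on h. *)
Lemma Gk_step (k : nat) (B : R) : (4 <= k)%N -> 1 <= B -> exists C, 0 <= C /\
  forall h, 0 < h <= 1 -> exists s0, 0 < s0 /\ forall s v, 0 < s -> s <= s0 -> cs v -> HK k.-1 B v ->
  1 + nn (dn k (v - cst s * Fh h v)) <= (1 + C * s) * (1 + nn (dn k v)).
Proof.
move=> k4 B1; have [C [C0 hC]] := top_energy k4 B1.
exists (4 * C + 2); split; first by clear -C0; lra.
move=> h h01; have h0 : 0 < h by case/andP: h01.
pose Q := C * h ^- 3; have Q0 : 0 <= Q by rewrite /Q mulr_ge0// invr_ge0 exprn_ge0// ltW.
exists (1 + Q ^+ 2)^-1; have Q1 : 0 < 1 + Q ^+ 2 by have := sqr_ge0 Q; clear; lra.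
split; first by rewrite invr_gt0.
move=> s v s0 ss cv hv; have cF := cs_Fh h cv; have cg := cs_dn k cv; have cgF := cs_dn k cF.
have [e1 e2] := hC h v cv h01 hv.
rewrite dn_add ?dn_opp ?dn_scale//; try by csx.
rewrite nn_step//.
set X := nm (dn k v) in e1 e2; have X0 : 0 <= X := nm_ge0 _.
have eX : nn (dn k v) = X ^+ 2 by rewrite nm2.
have e3 : nn (dn k (Fh h v)) <= (Q * (1 + X)) ^+ 2 by apply: nn_le_sqr.
have hX : (1 + X) ^+ 2 <= 2 * (1 + X ^+ 2) by have := sqr_ge0 (1 - X); clear; lra.
have sQ : s * Q ^+ 2 <= 1.
  apply: (le_trans (y := s * (1 + Q ^+ 2))); first by rewrite ler_pM2l// lerDr.
  by rewrite -ler_pdivlMr// mul1r.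
have s00 := ltW s0.
have e4 : s ^+ 2 * nn (dn k (Fh h v)) <= s * (1 + X) ^+ 2.
  apply: (le_trans (ler_wpM2l (sqr_ge0 s) e3)).
  have -> : s ^+ 2 * (Q * (1 + X)) ^+ 2 = s * (1 + X) ^+ 2 * (s * Q ^+ 2) by ring.
  by rewrite ler_piMr//; pos.
move: e1; rewrite ler_norml => /andP[e5 _].
have e6 := ler_wpM2l (mulr_ge0 (ler0n R 2) s00) e5.
have e7 := ler_wpM2l (mulr_ge0 C0 s00) hX.
have e8 := ler_wpM2l s00 hX.
rewrite eX; move: e4 e6 e7 e8; genii; clear => e4 e6 e7 e8; lra.
Qed.

End steps.

(** * The invariant preserved by the scheme *)

Section invariants.
Context {R : realType}.
Implicit Types u v F G : R -> R.
Implicit Types V Vt : R -> R -> R.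

(** What the stability argument asks of the approximate solution, with [Vt] as its time derivative.
    [c] has to be uniform in N and e; [CN] may depend on both, but not on the time. *)
Record Vdata (c N rN m e CN : R) V Vt : Prop := VData {
  vd_scales : forall b, 0 < b -> b <= 1 -> scales N rN m e b;
  vd_CN : 1 <= CN;
  vd_bound : forall t, 1 <= t -> Vbound c N rN m e (bt t) (V t);
  vd_cst : forall t, 1 <= t -> cs (Vt t);
  vd_E : forall t, 1 <= t -> nm (Vt t - Phi (V t)) <= c * (m * bt t ^+ 15);
  vd_EH : forall t, 1 <= t -> HK 4 (CN * bt t ^+ 15) (Vt t - Phi (V t));
  vd_V8 : forall t, 1 <= t -> HK 8 CN (V t);
  vd_Vt : forall t, 1 <= t -> HK 4 CN (Vt t);
  vd_sup : forall t, 1 <= t -> forall x j, (j <= 5)%N -> `|dn j (V t) x| <= CN * bt t ^+ 4;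
  vd_taylor : forall t s, 0 < s <= 1 -> 1 <= t - s -> HK 4 (CN * s ^+ 2) (V (t - s) - V t + cst s * Vt t) }.

Lemma le2_ind (P : nat -> Prop) : P 0%N -> P 1%N -> P 2%N -> forall j, (j <= 2)%N -> P j.
Proof. by move=> ? ? ?; case=> [|[|[|]]]. Qed.

Lemma le3_ind (P : nat -> Prop) : P 0%N -> P 1%N -> P 2%N -> P 3%N -> forall j, (j <= 3)%N -> P j.
Proof. by move=> ? ? ? ?; case=> [|[|[|[|]]]]. Qed.

Lemma le4_ind (P : nat -> Prop) : P 0%N -> P 1%N -> P 2%N -> P 3%N -> P 4%N -> forall j, (j <= 4)%N -> P j.
Proof. by move=> ? ? ? ? ?; case=> [|[|[|[|[|]]]]]. Qed.

Lemma powb_le (b : R) (i j : nat) : 0 < b -> b <= 1 -> (i <= j)%N -> b ^+ j <= b ^+ i.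
Proof. by move=> b0 b1 ij; rewrite -(subnK ij) exprD ler_piMl ?exprn_ge0 ?exprn_ile1 ?(ltW b0). Qed.

Lemma mul_powb_le (b A B : R) (i j : nat) : 0 < b -> b <= 1 -> (i <= j)%N -> 0 <= A -> A <= B -> A * b ^+ j <= B * b ^+ i.
Proof. by move=> b0 b1 ij A0 AB; apply: ler_pM => //; [rewrite exprn_ge0// ltW|exact: powb_le]. Qed.

(** [static_bound] in linear form. [k4] depends on c, K, K1 only and enters the final constants; [L]
    may depend on the remaining data. *)
Lemma static2 (c K K1 : R) : 0 <= c -> 0 <= K -> 0 <= K1 -> exists k4, 0 <= k4 /\ forall N rN m e CN, scales N rN m e 1 -> 1 <= CN ->
  exists L, CN <= L /\ forall b (V u : R -> R), scales N rN m e b -> Vbound c N rN m e b V ->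
  (forall x j, (j <= 5)%N -> `|dn j V x| <= CN * b ^+ 4) -> cs u -> nm u <= K * (m * b ^+ 7) ->
  `|Ifun N (V + u) - Ifun N V| <= K1 * (N * m ^+ 2 * b ^+ 7) ->
  [/\ (forall x, `|u x| <= k4 * (e * b ^+ 4 / rN)), (forall x, `|dx u x| <= k4 * (e * b ^+ 4 * rN)),
      nm (dx u) <= k4 * (N * m * b ^+ 5), (forall j, (j <= 2)%N -> nm (dn j u) <= L * b ^+ 3) &
      forall x, `|(V + u) x| <= L * b ^+ 4 /\ `|dx (V + u) x| <= L * b ^+ 4].
Proof.
move=> c0 K0 K10; have [K4 [K40 hK4]] := static_bound c0 K0 K10.
exists (K4 + 1); have k40 : 0 <= K4 + 1 by clear -K40; lra.
have k4s : K4 <= (K4 + 1) ^+ 2 by have := sqr_ge0 K4; clear -K40; lra.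
split => // N rN m e CN [N1 rN1 rNN m0 rm e0 e1 _ _] CN1.
have rN0 : 0 < rN := lt_le_trans ltr01 rN1.
have N0 : 0 < N := lt_le_trans ltr01 N1.
have CN0 : 0 <= CN := le_trans ler01 CN1.
have ir0 : 0 <= rN^-1 by rewrite invr_ge0 ltW.
set k4 := K4 + 1 in k40 k4s *.
pose L := CN + k4 * (e / rN) + k4 * (e * rN) + K * m + k4 * (N * m) + N ^+ 2 * (K * m).
have h1 : 0 <= k4 * (e / rN) by pos.
have h2 : 0 <= k4 * (e * rN) by pos.
have h3 : 0 <= K * m by pos.
have h4 : 0 <= k4 * (N * m) by pos.
have h5 : 0 <= N ^+ 2 * (K * m) by pos.
exists L; split; first by rewrite /L; clear -h1 h2 h3 h4 h5; lra.
move=> b V u sc Vb Vs cu hU hI.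
have [_ _ _ _ _ _ _ b0 b1] := sc.
have [q1 q2 q3] := hK4 N rN m e b u V sc Vb cu hU hI.
have p0 n : 0 <= b ^+ n by rewrite exprn_ge0// ltW.
have su x : `|u x| <= k4 * (e * b ^+ 4 / rN).
  apply: abs_of_sqr; first by pos.
  have hx : N ^+ 2 * u x ^+ 2 <= K4 * (N * e ^+ 2 * b ^+ 8).
    by apply: le_trans (q3 x); rewrite lerDr sqr_ge0.
  have N20 : 0 < N ^+ 2 by rewrite exprn_gt0.
  rewrite -(ler_pM2l N20); apply: (le_trans hx).
  have rn0 : rN != 0 by rewrite gt_eqF.
  have -> : N ^+ 2 * (k4 * (e * b ^+ 4 / rN)) ^+ 2 = k4 ^+ 2 * (N * e ^+ 2 * b ^+ 8) by rewrite -rNN; field.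
  by apply: ler_wpM2r => //; pos.
have sux x : `|dx u x| <= k4 * (e * b ^+ 4 * rN).
  apply: abs_of_sqr; first by pos.
  apply: (le_trans (y := K4 * (N * e ^+ 2 * b ^+ 8))).
    by apply: le_trans (q3 x); rewrite lerDl mulr_ge0// sqr_ge0.
  have -> : (k4 * (e * b ^+ 4 * rN)) ^+ 2 = k4 ^+ 2 * (N * e ^+ 2 * b ^+ 8) by rewrite -rNN; ring.
  by apply: ler_wpM2r => //; pos.
have n1 : nm (dx u) <= k4 * (N * m * b ^+ 5).
  apply: (@nmM_le R 0); first by pos.
  have -> : (k4 * (N * m * b ^+ 5)) ^+ 2 = k4 ^+ 2 * (N ^+ 2 * m ^+ 2 * b ^+ 10) by ring.
  apply: (le_trans q1); apply: ler_wpM2r => //; pos.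
have nD : nm (Dop N u) <= k4 * (N * m) * b ^+ 3.
  apply: (@nmM_le R 0); first by pos.
  have -> : (k4 * (N * m) * b ^+ 3) ^+ 2 = k4 ^+ 2 * (N ^+ 2 * m ^+ 2 * b ^+ 6) by ring.
  apply: (le_trans q2); apply: ler_pM => //; first by pos.
  apply: ler_pM; [by pos|by []| |exact: powb_le].
  by apply: ler_wpM2r; [pos|rewrite expr2 ler_peMl// ltW].
have n0' : nm u <= K * m * b ^+ 3.
  by apply: (le_trans hU); rewrite mulrA; apply: mul_powb_le.
have n2 : nm (dx (dx u)) <= L * b ^+ 3.
  have cD := cs_Dop N cu.
  have -> : dx (dx u) = Dop N u - cst (N ^+ 2) * u by rewrite /Dop; apply/funext => x; ptw; ring.
  apply: (le_trans (nmB _ _)); [by []|by csx|].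
  apply: (le_trans (lerD nD (nm_scale_le cu (sqr_ge0 N) n0'))).
  have -> : k4 * (N * m) * b ^+ 3 + N ^+ 2 * (K * m * b ^+ 3) = (k4 * (N * m) + N ^+ 2 * (K * m)) * b ^+ 3 by ring.
  by apply: ler_wpM2r => //; rewrite /L; clear -h1 h2 h3 h4 h5 CN0; lra.
have cV := vb_cs Vb.
split => //.
- apply: le2_ind.
  + apply: (le_trans n0'); apply: ler_wpM2r => //; rewrite /L; clear -h1 h2 h3 h4 h5 CN0; lra.
  + apply: (le_trans n1); rewrite mulrA; apply: mul_powb_le => //; rewrite /L; clear -h1 h2 h3 h4 h5 CN0; lra.
  + exact: n2.
- move=> x; split.
    apply: (le_trans (nbD (Vs x 0%N isT) (su x))).
    have -> : CN * b ^+ 4 + k4 * (e * b ^+ 4 / rN) = (CN + k4 * (e / rN)) * b ^+ 4 by ring.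
    by apply: ler_wpM2r => //; rewrite /L; clear -h1 h2 h3 h4 h5 CN0; lra.
  rewrite dx_add//; ptw; apply: (le_trans (nbD (Vs x 1%N isT) (sux x))).
  have -> : CN * b ^+ 4 + k4 * (e * b ^+ 4 * rN) = (CN + k4 * (e * rN)) * b ^+ 4 by ring.
  by apply: ler_wpM2r => //; rewrite /L; clear -h1 h2 h3 h4 h5 CN0; lra.
Qed.

(** The first two bounds carry the estimate of the theorem; those on the third and fourth
    derivatives only provide compactness. Their low exponents leave room for forcing terms of order
    b^14 and b^10, that is 6 + 8 and 2 + 8. *)
Record inv (N m K K1 a3 a4 : R) (b : R) (V v : R -> R) : Prop := Inv {
  inv_cs : cs v;
  inv_U : nn (v - V) <= (K * m) ^+ 2 * b ^+ 14;
  inv_I : `|Ifun N v - Ifun N V| <= K1 * (N * m ^+ 2) * b ^+ 7;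
  inv_3 : nn (dn 3 (v - V)) <= a3 ^+ 2 * b ^+ 6;
  inv_4 : nn (dn 4 (v - V)) <= a4 ^+ 2 * b ^+ 2 }.

Lemma barrier (k : nat) (t s q q' P X Y kap : R) : 0 < s -> s < t -> 0 <= P ->
  q <= P * bt t ^+ k -> q' <= q + s * X + s * Y -> X + Y <= kap * (P * bt t ^+ (k + 8)) -> kap <= k%:R / 8 ->
  q' <= P * bt (t - s) ^+ k.
Proof.
move=> s0 st P0 hq hq' hXY hk.
have t0 : 0 < t := lt_trans s0 st.
have hb := bt_step k s0 st.
have p0 : 0 <= P * bt t ^+ (k + 8) by rewrite mulr_ge0// exprn_ge0// ltW// bt_gt0.
have h1 := ler_wpM2l P0 hb.
have h2 := ler_wpM2r p0 hk.
have h3 := le_trans hXY h2.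
have s0' := ltW s0.
have h4 := ler_wpM2l s0' h3.
move: hq hq' h1 h4; move: (bt t ^+ (k + 8)) (bt t ^+ k) (bt (t - s) ^+ k) (k%:R : R); clear => *; lra.
Qed.

(** The order of choice avoids circularity: [K] and [K1] beat the residual and depend on c alone;
    [k4] comes from the bounds at fixed time; [e0] makes the quadratic interaction small against the
    barriers; [a3] and [a4] beat the lower-order forcing; last, [h0] makes the discretization error
    negligible on [1, T]. *)
Lemma inv_step (c : R) : 0 <= c -> exists K K1 k4 e0, [/\ 0 < K, 0 < K1, 0 <= k4 & 0 < e0] /\
  forall N rN m e CN V Vt, Vdata c N rN m e CN V Vt -> e <= e0 ->
  exists a3 a4 B4, [/\ 0 < a3, 0 < a4 & 1 <= B4] /\
  (forall t v, 1 <= t -> inv N m K K1 a3 a4 (bt t) (V t) v -> HK 4 B4 v /\ nm (dx (v - V t)) <= k4 * (N * m * bt t ^+ 5)) /\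
  (forall t, 1 <= t -> inv N m K K1 a3 a4 (bt t) (V t) (V t)) /\
  forall B T, 0 <= B -> 1 <= T -> exists h0, 0 < h0 /\ forall h s t v, 0 < h -> h <= h0 -> h <= 1 -> 0 < s -> s <= h -> 1 <= t - s -> t <= T ->
    inv N m K K1 a3 a4 (bt t) (V t) v -> HK 8 B v ->
    inv N m K K1 a3 a4 (bt (t - s)) (V (t - s)) (v - cst s * Fh h v).
Proof.
move=> c0.
pose c5 := 2 * c + 48 * c ^+ 3 + 12 * c ^+ 5.
have c50 : 0 <= c5 by rewrite /c5; pos.
(* With these choices 2 K c <= K^2 and c5 c <= K1 / 2. *)
pose K := 2 * c + 1; pose K1 := 2 * (c5 * c) + 1.
have K0 : 0 < K by rewrite /K; clear -c0; lra.
have c5c : 0 <= c5 * c by pos.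
have K10 : 0 < K1 by rewrite /K1; clear -c5c; lra.
have [k4 [k40 hS]] := static2 c0 (ltW K0) (ltW K10).
pose M := c + k4 + 1; have M1 : 1 <= M by rewrite /M; clear -c0 k40; lra.
(* Gives (e M)^2 <= 10^(-4), while the largest coefficient in front of (e M)^2 below is 300. *)
pose e0 := (100 * M)^-1.
have M0 : 0 < M := lt_le_trans ltr01 M1.
have e00 : 0 < e0 by rewrite /e0 invr_gt0 mulr_gt0.
exists K, K1, k4, e0; split => // N rN m e CN V Vt VD ee.
have CN1 := vd_CN VD; have CN0 : 0 <= CN := le_trans ler01 CN1.
have sc1 := vd_scales VD ltr01 (lexx 1).
have [N1 rN1 rNN m0 rm eg0 eg1 _ _] := sc1.
have rN0 : 0 < rN := lt_le_trans ltr01 rN1.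
have N0 : 0 < N := lt_le_trans ltr01 N1.
have eM : e ^+ 2 * M ^+ 2 <= 10000^-1.
  rewrite -exprMn; have : e * M <= 100^-1.
    apply: (le_trans (ler_wpM2r (ltW M0) ee)); rewrite /e0 invfM -mulrA mulVf ?gt_eqF//; lra.
  have : 0 <= e * M by pos.
  by clear => p q; nra.
have [L [CNL hL]] := hS N rN m e CN sc1 CN1.
have L0 : 0 <= L := le_trans CN0 CNL.
(* Large enough that the terms linear in [a3], together with the discretization error, take up at
   most a3^2 / 8; [a4] is chosen likewise. *)
pose a3 := 32 * (1728 * L ^+ 3 + CN) + 1.
have a30 : 0 < a3 by rewrite /a3; have : 0 <= 1728 * L ^+ 3 + CN by [pos]; clear; lra.
pose L2 := L + CN + (2 * (L + a3)).
have L20 : 0 <= L2 by rewrite /L2; pos.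
have CNL2 : CN <= L2 by rewrite /L2; clear -L0 a30; lra.
have LL2 : L <= L2 by rewrite /L2; clear -L0 a30 CN0; lra.
have a3L2 : a3 <= L2 by rewrite /L2; clear -L0 a30 CN0; lra.
pose a4 := 64 * (5568 * L2 ^+ 3 + CN) + 1.
have a40 : 0 < a4 by rewrite /a4; have : 0 <= 5568 * L2 ^+ 3 + CN by [pos]; clear; lra.
pose B4 := 1 + CN + L2 + a4.
have tt (t : R) : 1 <= t -> 0 < bt t /\ bt t <= 1 by move=> t1; split; [apply: bt_gt0; exact: lt_le_trans t1|exact: bt_le1].
have ST t v : 1 <= t -> inv N m K K1 a3 a4 (bt t) (V t) v ->
  [/\ (forall x, `|(v - V t) x| <= k4 * (e * bt t ^+ 4 / rN)), (forall x, `|dx (v - V t) x| <= k4 * (e * bt t ^+ 4 * rN)),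
      nm (dx (v - V t)) <= k4 * (N * m * bt t ^+ 5), (forall j, (j <= 2)%N -> nm (dn j (v - V t)) <= L * bt t ^+ 3) &
      forall x, `|v x| <= L * bt t ^+ 4 /\ `|dx v x| <= L * bt t ^+ 4] /\
  [/\ nm (v - V t) <= K * (m * bt t ^+ 7), nm (dn 3 (v - V t)) <= a3 * bt t ^+ 3 & nm (dn 4 (v - V t)) <= a4 * bt t].
  move=> t1 [cv hU hI h3 h4]; have [b0 b1] := tt t t1.
  have hU' : nm (v - V t) <= K * (m * bt t ^+ 7).
    apply: (@nmM_le R 0); first by pos.
    by apply: (le_trans hU); rewrite le_eqVlt; apply/orP; left; apply/eqP; ring.
  have cV := vb_cs (vd_bound VD t1); have cu : cs (v - V t) by csx.
  have ev : v = V t + (v - V t) by rewrite addrC subrK.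
  have hI' : `|Ifun N (V t + (v - V t)) - Ifun N (V t)| <= K1 * (N * m ^+ 2 * bt t ^+ 7).
    by rewrite -ev; apply: (le_trans hI); rewrite le_eqVlt; apply/orP; left; apply/eqP; ring.
  have := hL (bt t) (V t) (v - V t) (vd_scales VD b0 b1) (vd_bound VD t1) (vd_sup VD t1) cu hU' hI'.
  rewrite -ev => res; split => //; split => //.
    apply: (@nmM_le R 0); first by pos.
    by apply: (le_trans h3); rewrite le_eqVlt; apply/orP; left; apply/eqP; ring.
  apply: (@nmM_le R 0); first by pos.
  by apply: (le_trans h4); rewrite le_eqVlt; apply/orP; left; apply/eqP; ring.
exists a3, a4, B4; split; first by split => //; rewrite /B4; clear -CN0 L20 a40; lra.
split; last split.
- move=> t v t1 iv; have [[_ _ h1 h2 _] [h0 h3 h4]] := ST t v t1 iv; split => //.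
  have [b0 b1] := tt t t1; have cv := inv_cs iv; have cV := vb_cs (vd_bound VD t1).
  have ev : v = V t + (v - V t) by rewrite addrC subrK.
  have hu : HK 4 (L2 + a4) (v - V t).
    have b31 : bt t ^+ 3 <= 1 by rewrite exprn_ile1// ltW.
    have hx A j : 0 <= A -> A <= L2 -> nm (dn j (v - V t)) <= A * bt t ^+ 3 -> nm (dn j (v - V t)) <= L2 + a4.
      move=> A0 A1 h; apply: (le_trans h); apply: (le_trans (y := A)); first by rewrite ler_piMr.
      by apply: (le_trans A1); rewrite lerDl ltW.
    apply: (@le4_ind (fun j => nm (dn j (v - V t)) <= L2 + a4)).
    + exact: (hx L 0%N L0 LL2 (h2 0%N isT)).
    + exact: (hx L 1%N L0 LL2 (h2 1%N isT)).
    + exact: (hx L 2%N L0 LL2 (h2 2%N isT)).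
    + exact: (hx a3 3%N (ltW a30) a3L2 h3).
    + by apply: (le_trans h4); apply: (le_trans (y := a4)); [rewrite ler_piMr// ltW|rewrite lerDr].
  rewrite ev; apply: (HK_le (leqnn 4) _ (HK_add cV _ (HK_le (isT : (4 <= 8)%N) (lexx _) (vd_V8 VD t1)) hu)); last by csx.
  by rewrite /B4; clear; lra.
- move=> t t1; have [b0 b1] := tt t t1; have cV := vb_cs (vd_bound VD t1).
  have z : V t - V t = 0 by rewrite subrr.
  have nz : nn (0 : R -> R) = 0 by rewrite -nm2 nm_zero expr0n.
  split; rewrite ?z ?dn_zero ?nz//; try by pos.
  by rewrite subrr normr0; pos.
move=> B T B0 T1.
have [CU [CU0 hCU]] := U_step N rN e c0 (ltW K0) k40 CN0 B0 m0.
have [CI [CI0 hCI]] := @I_step R c N m CN B c0 (ltW N0) CN0 B0.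
have [C3 [C30 hC3]] := @Hk_step R 3 CN B isT CN0 B0.
have [C4 [C40 hC4]] := @Hk_step R 4 CN B isT CN0 B0.
have [bT0 bT1] := tt T T1.
(* The error allowed to the discretization in each of the four bounds. As b decreases in t and is at
   most 1, b(T)^22 is below every power of b(t) that occurs for t <= T. *)
pose mu := bt T ^+ 22 * Num.min (Num.min ((K * m) ^+ 2 / 2) (K1 * (N * m ^+ 2) / 4)) 16^-1.
have Km0 : 0 < (K * m) ^+ 2 by rewrite exprn_gt0// mulr_gt0.
have K1m0 : 0 < K1 * (N * m ^+ 2) by rewrite !mulr_gt0// exprn_gt0.
have mu0 : 0 < mu.
  by rewrite /mu mulr_gt0 ?exprn_gt0// !lt_min; apply/andP; split; [apply/andP; split|]; rewrite ?divr_gt0.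
pose Ce := 1 + CU + CI + C3 + C4.
have Ce0 : 0 < Ce by rewrite /Ce; clear -CU0 CI0 C30 C40; lra.
exists (mu / (2 * Ce)); split; first by rewrite divr_gt0// mulr_gt0.
move=> h s t v h0 hh h1 s0 sh ts tT iv hv.
have s1 : s <= 1 := le_trans sh h1.
have h01 : 0 < h <= 1 by rewrite h0.
have s01 : 0 < s <= 1 by rewrite s0.
have t1 : 1 <= t by apply: (le_trans ts); rewrite gerBl ltW.
have st : s < t by rewrite -subr_gt0; exact: lt_le_trans ts.
have [[g1 g2 g3 g4 g5] [u0 u3 u4]] := ST t v t1 iv.
have Vb := vd_bound VD t1; have cV := vb_cs Vb.
have Vb1 := vd_bound VD ts; have cV1 := vb_cs Vb1; have cVt := vd_cst VD t1; have cv := inv_cs iv.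
have cu : cs (v - V t) by csx.
have cF := cs_Fh h cv.
have [b0 b1] := tt t t1.
have sc := vd_scales VD b0 b1.
have bTt : bt T <= bt t by apply: bt_anti => //; exact: lt_le_trans t1.
have hTay := vd_taylor VD s01 ts.
have err C : 0 <= C -> C <= Ce -> (h + s) * C <= mu.
  move=> C0 CC; apply: (le_trans (y := 2 * h * Ce)).
    by apply: ler_pM => //; [rewrite addr_ge0// ltW|clear -sh; lra].
  rewrite (_ : 2 * h * Ce = h * (2 * Ce)); last by ring.
  by rewrite -ler_pdivlMr// mulr_gt0.
have muk k A : (k <= 22)%N -> 0 <= A -> mu <= bt T ^+ 22 * A -> mu <= A * bt t ^+ k.
  move=> k22 A0 hA; apply: (le_trans hA); rewrite mulrC; apply: ler_wpM2l => //.
  apply: (le_trans (powb_le bT0 bT1 k22)); by apply: lerXn2r; rewrite ?nnegrE ?(ltW bT0) ?(ltW b0).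
have p22 : 0 <= bt T ^+ 22 by rewrite exprn_ge0// ltW.
have muU : mu <= (K * m) ^+ 2 / 2 * bt t ^+ 22.
  by apply: muk => //; [by rewrite divr_ge0// ltW|]; rewrite /mu ler_wpM2l// ge_min ge_min lexx.
have muI : mu <= K1 * (N * m ^+ 2) / 4 * bt t ^+ 15.
  by apply: muk => //; [by rewrite divr_ge0// ltW|]; rewrite /mu ler_wpM2l// ge_min ge_min lexx orbT.
have mu3 k : (k <= 22)%N -> mu <= 16^-1 * bt t ^+ k.
  by move=> kk; apply: muk; rewrite ?invr_ge0// /mu ler_wpM2l// ge_min lexx orbT.
have CeU : CU <= Ce by rewrite /Ce; clear -CU0 CI0 C30 C40; lra.
have CeI : CI <= Ce by rewrite /Ce; clear -CU0 CI0 C30 C40; lra.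
have Ce3 : C3 <= Ce by rewrite /Ce; clear -CU0 CI0 C30 C40; lra.
have Ce4 : C4 <= Ce by rewrite /Ce; clear -CU0 CI0 C30 C40; lra.
have ev : v = V t + (v - V t) by rewrite addrC subrK.
pose al := M ^+ 2 * e ^+ 2 * bt t ^+ 8; have al0 : 0 <= al by rewrite /al; pos.
pose s0' := M * (e * bt t ^+ 4 / rN); pose s1' := M * (e * bt t ^+ 4 * rN).
have q4 : 0 <= e * bt t ^+ 4 by pos.
have ir0 : 0 <= rN^-1 by rewrite invr_ge0 ltW.
have s0'0 : 0 <= s0' by rewrite /s0'; pos.
have s1'0 : 0 <= s1' by rewrite /s1'; pos.
have s01' : s0' * s1' = al by rewrite /s0' /s1' /al; field; rewrite gt_eqF.
have vs0 x : `|v x| <= s0'.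
  rewrite ev; apply: (le_trans (nbD (vb_sup Vb x) (g1 x))); rewrite -mulrDl /s0'; apply: ler_wpM2r; first by pos.
  by rewrite /M; clear; lra.
have vs1 x : `|dx v x| <= s1'.
  rewrite {1}ev dx_add//; ptw; apply: (le_trans (nbD (vb_supx Vb x) (g2 x))); rewrite -mulrDl /s1'; apply: ler_wpM2r; first by pos.
  by rewrite /M; clear; lra.
have us1 x : `|dx (v - V t) x| <= s1'.
  apply: (le_trans (g2 x)); apply: ler_wpM2r; first by pos.
  by rewrite /M; clear -c0; lra.
have hal x : `|v x| * `|dx v x| <= al by rewrite -s01'; apply: ler_pM.
have e3 := energy3 cu cV al0 (_ : 0 <= L * bt t ^+ 4) (_ : 0 <= L * bt t ^+ 3).
have e4 := energy4 cu cV al0 (_ : 0 <= L2 * bt t ^+ 3) (_ : 0 <= L2 * bt t ^+ 3).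
rewrite -ev in e3 e4.
split; first by csx.
(* In units of K^2 m^2 b^22, the available 14/8 = 7/4 is used up exactly: 1/4 for the interaction, 1
   for the residual, 1/2 for the discretization. *)
- apply: (@barrier 14 t s (nn (v - V t)) _ _ (m ^+ 2 * bt t ^+ 22 * (e ^+ 2 * (12 * c ^+ 2 + 4 * c * k4) * K ^+ 2 + 2 * K * c)) ((h + s) * CU) (7 / 4)); [exact: s0|exact: st|exact: ltW|exact: inv_U iv| | |by clear; lra].
    apply: (hCU _ _ _ _ _ _ _ sc Vb cV1 cVt cv h01 s01 (vd_E VD t1) _ _ _ u0).
    + exact: (vd_Vt VD t1 (isT : (0 <= 4)%N)).
    + exact: (hTay 0%N).
    + exact: (HK_le (isT : (5 <= 8)%N) (lexx _) hv).
    + move=> x; rewrite -real_normK ?num_real//; apply: lerXn2r; rewrite ?nnegrE; [exact: normr_ge0|by pos|exact: g1].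
  have h1' := le_trans (err _ CU0 CeU) muU.
  have hM : e ^+ 2 * (12 * c ^+ 2 + 4 * c * k4) <= 4^-1.
    apply: (le_trans (y := e ^+ 2 * (12 * M ^+ 2))).
      apply: ler_wpM2l; first exact: sqr_ge0.
      rewrite /M; clear -c0 k40; nra.
    by clear -eM; lra.
  have hK : e ^+ 2 * (12 * c ^+ 2 + 4 * c * k4) * K ^+ 2 + 2 * K * c <= 5 / 4 * K ^+ 2.
    have := ler_wpM2r (sqr_ge0 K) hM.
    have : 2 * K * c <= K ^+ 2 by rewrite expr2 [2 * K]mulrC -mulrA ler_pM2l// /K; clear; lra.
    by clear; lra.
  have pb : 0 <= m ^+ 2 * bt t ^+ 22 by pos.
  have := ler_wpM2l pb hK; move: h1'; clear; lra.
- apply: (@barrier 7 t s `|Ifun N v - Ifun N (V t)| _ _ (c5 * c * (N * m ^+ 2 * bt t ^+ 15)) ((h + s) * CI) (7 / 8)); [exact: s0|exact: st|exact: ltW|exact: inv_I iv| | |by clear; lra].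
    apply: (hCI _ _ _ _ _ _ _ _ _ sc Vb cV1 cVt cv h01 s01 (vd_E VD t1)).
    + exact: (HK_le (isT : (2 <= 4)%N) (lexx _) (vd_Vt VD t1)).
    + exact: (HK_le (isT : (4 <= 8)%N) (lexx _) (vd_V8 VD t1)).
    + exact: (HK_le (isT : (2 <= 4)%N) (lexx _) hTay).
    + exact: (HK_le (isT : (5 <= 8)%N) (lexx _) hv).
  have h1' := le_trans (err _ CI0 CeI) muI.
  have pb : 0 <= N * m ^+ 2 * bt t ^+ 15 by pos.
  have hc : c5 * c <= K1 / 2 by rewrite /K1; clear; lra.
  have := ler_wpM2r pb hc; have : 0 <= K1 * (N * m ^+ 2) * bt t ^+ 15 by pos.
  move: h1'; clear; lra.
- pose X := 2 * (150 * al * (a3 * bt t ^+ 3) ^+ 2 + a3 * bt t ^+ 3 * (1728 * ((L * bt t ^+ 4) ^+ 2 * (L * bt t ^+ 3)))) + 2 * (a3 * bt t ^+ 3 * (CN * bt t ^+ 15)).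
  apply: (@barrier 6 t s (nn (dn 3 (v - V t))) _ _ X ((h + s) * C3) (6 / 8)); [exact: s0|exact: st|exact: sqr_ge0|exact: inv_3 iv| | |by clear; lra].
    apply: (le_trans (hC3 (V t) (V (t - s)) (Vt t) v h s (CN * bt t ^+ 15) cV cV1 cVt cv h01 s01 _ _ _ _ _)).
    + exact: (vd_EH VD t1).
    + exact: (HK_le (isT : (3 <= 4)%N) (lexx _) (vd_Vt VD t1)).
    + exact: (HK_le (isT : (3 <= 8)%N) (lexx _) (vd_V8 VD t1)).
    + exact: (HK_le (isT : (3 <= 4)%N) (lexx _) hTay).
    + exact: (HK_le (isT : (7 <= 8)%N) (lexx _) hv).
    rewrite lerD2r -addrA lerD2l /X mulrDr.
    have e3' : - ip (dn 3 (v - V t)) (dn 3 (Phi v - Phi (V t))) <= 150 * al * (a3 * bt t ^+ 3) ^+ 2 + a3 * bt t ^+ 3 * (1728 * ((L * bt t ^+ 4) ^+ 2 * (L * bt t ^+ 3))).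
      apply: (e3 _ _ _ hal); [by pos|by pos| | | | |exact: g4|exact: u3].
      * by exists s0', s1'; split; [exact: s0'0|exact: s1'0|rewrite s01'|exact: vs0|exact: us1].
      * by move=> x j j4; have j5 : (j <= 5)%N := leqW j4; apply: (le_trans (vd_sup VD t1 x j5)); apply: ler_wpM2r CNL; pos.
      * by move=> x; have [] := g5 x.
      * by move=> x; have [] := g5 x.
    have d0 : 0 <= CN * bt t ^+ 15 by pos.
    have f1 := ler_wpM2r d0 u3.
    have z0 : 0 <= 2 * s by clear -s0; lra.
    have f2 := ler_wpM2l z0 e3'; have f3 := ler_wpM2l z0 f1.
    move: f2 f3; genii; move: (nm _); clear => *; lra.
  have h1' := le_trans (err _ C30 Ce3) (mu3 14%N isT).
  apply: (le_trans (lerD (lexx X) h1')).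
  have -> : X = (300 * (e ^+ 2 * M ^+ 2) * a3 ^+ 2 + 2 * a3 * (1728 * L ^+ 3)) * bt t ^+ 14 + 2 * a3 * CN * (bt t ^+ 18) by rewrite /X /al; ring.
  have pb : 0 <= bt t ^+ 14 by pos.
  have b18 : bt t ^+ 18 <= bt t ^+ 14 by exact: powb_le.
  have aC : 0 <= 2 * a3 * CN by pos.
  have f1 := ler_wpM2l aC b18.
  have a32 : 0 <= a3 ^+ 2 by pos.
  have f2 := ler_wpM2r a32 eM.
  have f3 : 2 * a3 * (1728 * L ^+ 3) + 2 * a3 * CN + 16^-1 <= 1 / 8 * a3 ^+ 2.
    have a31 : 1 <= a3 by rewrite /a3; have : 0 <= 1728 * L ^+ 3 + CN by [pos]; clear; lra.
    have : a3 ^+ 2 = 32 * (a3 * (1728 * L ^+ 3 + CN)) + a3 by rewrite expr2 {2}/a3; ring.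
    by move: a31; clear; nra.
  have f4 : 300 * (e ^+ 2 * M ^+ 2) * a3 ^+ 2 + 2 * a3 * (1728 * L ^+ 3) + 2 * a3 * CN + 16^-1 <= 6 / 8 * a3 ^+ 2.
    by move: f2 f3 a32; clear; lra.
  have := ler_wpM2r pb f4; move: f1; clear; lra.
- pose X := 2 * (54 * al * (a4 * bt t) ^+ 2 + a4 * bt t * (5568 * ((L2 * bt t ^+ 3) ^+ 2 * (L2 * bt t ^+ 3)))) + 2 * (a4 * bt t * (CN * bt t ^+ 15)).
  apply: (@barrier 2 t s (nn (dn 4 (v - V t))) _ _ X ((h + s) * C4) (2 / 8)); [exact: s0|exact: st|exact: sqr_ge0|exact: inv_4 iv| | |by clear; lra].
    apply: (le_trans (hC4 (V t) (V (t - s)) (Vt t) v h s (CN * bt t ^+ 15) cV cV1 cVt cv h01 s01 _ _ _ _ _)).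
    + exact: (vd_EH VD t1).
    + exact: (HK_le (isT : (4 <= 4)%N) (lexx _) (vd_Vt VD t1)).
    + exact: (HK_le (isT : (4 <= 8)%N) (lexx _) (vd_V8 VD t1)).
    + exact: (HK_le (isT : (4 <= 4)%N) (lexx _) hTay).
    + exact: (HK_le (isT : (8 <= 8)%N) (lexx _) hv).
    rewrite lerD2r -addrA lerD2l /X mulrDr.
    have VL x j : (j <= 5)%N -> `|dn j (V t) x| <= CN * bt t ^+ 3.
      by move=> j5; apply: (le_trans (vd_sup VD t1 x j5)); apply: mul_powb_le.
    have e4' : - ip (dn 4 (v - V t)) (dn 4 (Phi v - Phi (V t))) <= 54 * al * (a4 * bt t) ^+ 2 + a4 * bt t * (5568 * ((L2 * bt t ^+ 3) ^+ 2 * (L2 * bt t ^+ 3))).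
      apply: (e4 _ _ _ hal); [by pos|by pos| | | |exact: u4].
      * by move=> x j j5; apply: (le_trans (VL x j j5)); apply: ler_wpM2r CNL2; pos.
      * move=> x; apply: le2_ind.
        - apply: (le_trans (proj1 (g5 x))); exact: mul_powb_le.
        - apply: (le_trans (proj2 (g5 x))); exact: mul_powb_le.
        - rewrite ev dn_add//; apply: (le_trans (nbD (VL x 2%N isT) (_ : _ <= (2 * (L + a3)) * bt t ^+ 3))).
            apply: abs_of_sqr; first by pos.
            apply: (le_trans (sup_of_nm x (cs_dn 2 cu) (g4 2%N isT) u3)).
            have -> : 2 * (L * bt t ^+ 3 * (a3 * bt t ^+ 3)) = (2 * (L * a3)) * (bt t ^+ 6) by ring.
            have -> : (2 * (L + a3) * bt t ^+ 3) ^+ 2 = (4 * (L + a3) ^+ 2) * (bt t ^+ 6) by ring.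
            apply: ler_wpM2r; first by pos.
            have := ltW a30; move: L0; clear => p q; nra.
          by rewrite -mulrDl; apply: ler_wpM2r; [pos|rewrite /L2; clear -L0; lra].
      * apply: le3_ind.
        - by apply: (le_trans (g4 0%N isT)); apply: ler_wpM2r LL2; pos.
        - by apply: (le_trans (g4 1%N isT)); apply: ler_wpM2r LL2; pos.
        - by apply: (le_trans (g4 2%N isT)); apply: ler_wpM2r LL2; pos.
        - by apply: (le_trans u3); apply: ler_wpM2r a3L2; pos.
    have d0 : 0 <= CN * bt t ^+ 15 by pos.
    have f1 := ler_wpM2r d0 u4.
    have z0 : 0 <= 2 * s by clear -s0; lra.
    have f2 := ler_wpM2l z0 e4'; have f3 := ler_wpM2l z0 f1.
    move: f2 f3; genii; move: (nm _); clear => *; lra.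
  have h1' := le_trans (err _ C40 Ce4) (mu3 10%N isT).
  apply: (le_trans (lerD (lexx X) h1')).
  have -> : X = (108 * (e ^+ 2 * M ^+ 2) * a4 ^+ 2 + 2 * a4 * (5568 * L2 ^+ 3)) * bt t ^+ 10 + 2 * a4 * CN * (bt t ^+ 16) by rewrite /X /al; ring.
  have pb : 0 <= bt t ^+ 10 by pos.
  have b18 : bt t ^+ 16 <= bt t ^+ 10 by exact: powb_le.
  have aC : 0 <= 2 * a4 * CN by pos.
  have f1 := ler_wpM2l aC b18.
  have a32 : 0 <= a4 ^+ 2 by pos.
  have f2 := ler_wpM2r a32 eM.
  have f3 : 2 * a4 * (5568 * L2 ^+ 3) + 2 * a4 * CN + 16^-1 <= 1 / 8 * a4 ^+ 2.
    have a41 : 1 <= a4 by rewrite /a4; have : 0 <= 5568 * L2 ^+ 3 + CN by [pos]; clear; lra.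
    have : a4 ^+ 2 = 64 * (a4 * (5568 * L2 ^+ 3 + CN)) + a4 by rewrite expr2 {2}/a4; ring.
    by move: a41; clear; nra.
  have f4 : 108 * (e ^+ 2 * M ^+ 2) * a4 ^+ 2 + 2 * a4 * (5568 * L2 ^+ 3) + 2 * a4 * CN + 16^-1 <= 2 / 8 * a4 ^+ 2.
    by move: f2 f3 a32; clear; lra.
  have := ler_wpM2r pb f4; move: f1; clear; lra.
Qed.

End invariants.

(** * The scheme from T back to time 1 *)

Section approximation.
Context {R : realType}.
Implicit Types u v F G : R -> R.
Implicit Types V Vt : R -> R -> R.

(** The minus sign is there because the scheme runs towards smaller times. *)
Definition euler (h s : R) v : R -> R := v - cst s * Fh h v.

Lemma HK_S k B v : (0 < k)%N -> HK k.-1 B v -> nn (dn k v) <= B ^+ 2 -> 0 <= B -> HK k B v.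
Proof.
move=> k0 h hk B0 j; rewrite leq_eqVlt => /orP[/eqP ->|jk]; first exact: (@nmM_le R 0).
by apply: h; rewrite -ltnS prednK.
Qed.

Lemma growth_step (C Q T t s q q' : R) : 0 <= C -> 0 <= s -> 0 <= Q -> q' <= (1 + C * s) * q -> q <= Q * expR (C * (T - t)) ->
  q' <= Q * expR (C * (T - (t - s))).
Proof.
move=> C0 s0 Q0 h1 h2; apply: (le_trans h1).
have -> : C * (T - (t - s)) = C * s + C * (T - t) by ring.
rewrite expRD mulrCA; have c0 : 0 <= 1 + C * s by rewrite addr_ge0// mulr_ge0.
apply: (le_trans (ler_wpM2l c0 h2)); apply: ler_wpM2r; last exact: expR_ge1Dx.
by rewrite mulr_ge0// expR_ge0.
Qed.

Lemma growth_bound (C Q T t q B B' : R) : 0 <= C -> 1 <= Q -> 1 <= t -> 1 + q <= Q * expR (C * (T - t)) ->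
  1 <= B -> B' = B + Q * expR (C * T) -> q <= B' ^+ 2.
Proof.
move=> C0 Q1 t1 h B1 ->.
have h2 : Q * expR (C * (T - t)) <= Q * expR (C * T).
  by rewrite ler_wpM2l ?(le_trans ler01)// ler_expR ler_wpM2l// gerBl; lra.
have h3 := le_trans h h2.
have := mulr_ge0 (le_trans ler01 Q1) (expR_ge0 (C * T)).
move: h3; move: (Q * _) => z; clear -B1; nra.
Qed.

Lemma HK_weak k B B' v : HK k B v -> B <= B' -> HK k B' v.
Proof. by move=> h BB; apply: HK_le BB h. Qed.

(** The invariant controls H^4 uniformly in T. H^5 to H^8 follow one after the other with growth
    factors e^(C T), where each C depends on the previous bound but not on h. Only then is h chosen
    from the H^8 bound, and s from h. Eight is the four derivatives of the invariant plus the four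
    used by [HK_eta]. *)
Theorem approx (c : R) : 0 <= c -> exists K k4 e0, [/\ 0 < K, 0 <= k4 & 0 < e0] /\
  forall N rN m e CN V Vt, Vdata c N rN m e CN V Vt -> e <= e0 ->
  exists B, 1 <= B /\ forall T eps, 1 <= T -> 0 < eps ->
  exists (s : R) (vv : nat -> R -> R), [/\ 0 < s, s <= eps, vv 0%N = V T,
    (forall j, 1 <= T - j%:R * s -> [/\ cs (vv j), nm (vv j - V (T - j%:R * s)) <= K * (m * bt (T - j%:R * s) ^+ 7),
       nm (dx (vv j - V (T - j%:R * s))) <= k4 * (N * m) & HK 4 B (vv j)]) &
    forall j, 1 <= T - j.+1%:R * s -> HK 1 (s * eps) (vv j.+1 - vv j + cst s * Phi (vv j))].
Proof.
move=> c0; have [K [K1 [k4 [e0 [[K0 K10 k40 e00] hS]]]]] := inv_step c0.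
exists K, k4, e0; split => // N rN m e CN V Vt VD ee.
have [a3 [a4 [B4 [[a30 a40 B41] [hB [hinit hstep]]]]]] := hS _ _ _ _ _ _ _ VD ee.
exists B4; split => // T eps T1 eps0.
have CN1 := vd_CN VD; have CN0 : 0 <= CN := le_trans ler01 CN1.
pose Q := 1 + CN ^+ 2; have Q1 : 1 <= Q by rewrite lerDl sqr_ge0.
have Q0 : 0 <= Q := le_trans ler01 Q1.
have grow B C : 1 <= B -> 0 <= C -> 1 <= B + Q * expR (C * T).
  by move=> B1 C0; apply: (le_trans B1); rewrite lerDl mulr_ge0// expR_ge0.
have [C5 [C50 G5]] := @Gk_step R 5 B4 isT B41.
pose B5 := B4 + Q * expR (C5 * T); have B51 : 1 <= B5 := grow _ _ B41 C50.
have [C6 [C60 G6]] := @Gk_step R 6 B5 isT B51.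
pose B6 := B5 + Q * expR (C6 * T); have B61 : 1 <= B6 := grow _ _ B51 C60.
have [C7 [C70 G7]] := @Gk_step R 7 B6 isT B61.
pose B7 := B6 + Q * expR (C7 * T); have B71 : 1 <= B7 := grow _ _ B61 C70.
have [C8 [C80 G8]] := @Gk_step R 8 B7 isT B71.
pose B8 := B7 + Q * expR (C8 * T); have B81 : 1 <= B8 := grow _ _ B71 C80.
have B80 : 0 <= B8 := le_trans ler01 B81.
have [h0 [h00 hst]] := hstep B8 T B80 T1.
pose C1 := 6 * B8 + 12 * (2 ^+ 2 * ((2 ^+ 2 * (B8 * B8)) * B8)) + 1.
have C10 : 0 < C1 by rewrite /C1 ltr_wpDl//; pos.
pose h := Num.min (Num.min h0 1) (eps / C1).
have hpos : 0 < h by rewrite /h !lt_min h00 ltr01 divr_gt0.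
have hh0 : h <= h0 by rewrite /h !ge_min lexx.
have hh1 : h <= 1 by rewrite /h !ge_min lexx orbT.
have hhe : h * C1 <= eps by rewrite -ler_pdivlMr// /h ge_min lexx orbT.
have h01 : 0 < h <= 1 by rewrite hpos.
clearbody h.
have [s5 [s50 g5]] := G5 h h01; have [s6 [s60 g6]] := G6 h h01.
have [s7 [s70 g7]] := G7 h h01; have [s8 [s80 g8]] := G8 h h01.
pose s := Num.min (Num.min (Num.min s5 s6) (Num.min s7 s8)) (Num.min h eps).
have s0 : 0 < s by rewrite /s !lt_min s50 s60 s70 s80 hpos eps0.
have ss5 : s <= s5 by rewrite /s !ge_min lexx.
have ss6 : s <= s6 by rewrite /s !ge_min lexx ?orbT.
have ss7 : s <= s7 by rewrite /s !ge_min lexx ?orbT.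
have ss8 : s <= s8 by rewrite /s !ge_min lexx ?orbT.
have sh : s <= h by rewrite /s !ge_min lexx ?orbT.
have se : s <= eps by rewrite /s !ge_min lexx ?orbT.
pose vv j := iter j (euler h s) (V T).
pose tj (j : nat) := T - j%:R * s.
have tjS j : tj j.+1 = tj j - s by rewrite /tj -natr1; ring.
have tjT j : tj j <= T by rewrite /tj gerBl mulr_ge0// ltW.
have H8 t v : 1 <= t -> t <= T -> inv N m K K1 a3 a4 (bt t) (V t) v -> 1 + nn (dn 5 v) <= Q * expR (C5 * (T - t)) ->
   1 + nn (dn 6 v) <= Q * expR (C6 * (T - t)) -> 1 + nn (dn 7 v) <= Q * expR (C7 * (T - t)) -> 1 + nn (dn 8 v) <= Q * expR (C8 * (T - t)) ->
   [/\ HK 4 B4 v, HK 5 B5 v, HK 6 B6 v, HK 7 B7 v & HK 8 B8 v].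
  move=> t1 tT iv q5 q6 q7 q8.
  have w (B C : R) : B <= B + Q * expR C by rewrite lerDl mulr_ge0// expR_ge0.
  have k4' : HK 4 B4 v by have [] := hB t v t1 iv.
  have k5 : HK 5 B5 v.
    by apply: HK_S => //; [exact: (HK_weak k4' (w _ _))|exact: (growth_bound C50 Q1 t1 q5 B41)|exact: le_trans B51].
  have k6 : HK 6 B6 v.
    by apply: HK_S => //; [exact: (HK_weak k5 (w _ _))|exact: (growth_bound C60 Q1 t1 q6 B51)|exact: le_trans B61].
  have k7 : HK 7 B7 v.
    by apply: HK_S => //; [exact: (HK_weak k6 (w _ _))|exact: (growth_bound C70 Q1 t1 q7 B61)|exact: le_trans B71].
  have k8 : HK 8 B8 v.
    by apply: HK_S => //; [exact: (HK_weak k7 (w _ _))|exact: (growth_bound C80 Q1 t1 q8 B71)].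
  by [].
have I j : 1 <= tj j -> [/\ inv N m K K1 a3 a4 (bt (tj j)) (V (tj j)) (vv j), 1 + nn (dn 5 (vv j)) <= Q * expR (C5 * (T - tj j)),
   1 + nn (dn 6 (vv j)) <= Q * expR (C6 * (T - tj j)), 1 + nn (dn 7 (vv j)) <= Q * expR (C7 * (T - tj j)) & 1 + nn (dn 8 (vv j)) <= Q * expR (C8 * (T - tj j))].
  elim: j => [|j ih] tj1.
    have t0 : tj 0%N = T by rewrite /tj mul0r subr0.
    have hV k : (k <= 8)%N -> 1 + nn (dn k (V T)) <= Q * 1.
      by move=> k8; rewrite mulr1 lerD2l; apply: nn_le_sqr; exact: (vd_V8 VD T1).
    rewrite t0 subrr !mulr0 expR0; split; [exact: hinit|exact: hV|exact: hV|exact: hV|exact: hV].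
  have tj1' : 1 <= tj j by apply: (le_trans tj1); rewrite tjS gerBl ltW.
  have [iv q5 q6 q7 q8] := ih tj1'.
  have [k4' k5 k6 k7 k8] := H8 _ _ tj1' (tjT j) iv q5 q6 q7 q8.
  have cv := inv_cs iv.
  rewrite tjS in tj1 *; rewrite /vv iterS -/(vv j).
  split.
  - exact: (hst h s (tj j) (vv j)).
  - exact: (growth_step C50 (ltW s0) Q0 (g5 _ _ s0 ss5 cv k4') q5).
  - exact: (growth_step C60 (ltW s0) Q0 (g6 _ _ s0 ss6 cv k5) q6).
  - exact: (growth_step C70 (ltW s0) Q0 (g7 _ _ s0 ss7 cv k6) q7).
  - exact: (growth_step C80 (ltW s0) Q0 (g8 _ _ s0 ss8 cv k7) q8).
exists s, vv; split => //.
- move=> j tj1; have [iv _ _ _ _] := I j tj1.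
  have [h4 hx] := hB _ _ tj1 iv.
  have b0 : 0 < bt (T - j%:R * s) by apply: bt_gt0; exact: lt_le_trans tj1.
  have b1 : bt (T - j%:R * s) <= 1 by exact: bt_le1.
  have [N1 rN1 rNN m0 rm e0' e1 _ _] := vd_scales VD ltr01 (lexx 1).
  split => //; first exact: inv_cs iv.
    apply: (@nmM_le R 0); first by pos.
    apply: (le_trans (inv_U iv)); rewrite le_eqVlt; apply/orP; left; apply/eqP; ring.
  apply: (le_trans hx); apply: ler_wpM2l => //; rewrite ler_piMr ?exprn_ile1// ?(ltW b0)//.
  by rewrite mulr_ge0 ?(ltW m0)// (le_trans ler01).
- move=> j tj1.
  have tj1' : 1 <= tj j by apply: (le_trans tj1); rewrite -/(tj j.+1) tjS gerBl ltW.
  have [iv q5 q6 q7 q8] := I j tj1'; have cv := inv_cs iv.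
  have [_ _ _ _ k8] := H8 _ _ tj1' (tjT j) iv q5 q6 q7 q8.
  have cP := cs_Phi cv; have cF := cs_Fh h cv.
  have -> : vv j.+1 - vv j + cst s * Phi (vv j) = cst s * - (Fh h (vv j) - Phi (vv j)).
    by rewrite /vv iterS -/(vv j) /euler; apply/funext => x; ptw; ring.
  have he : HK 1 (h * (6 * B8 + 12 * (2 ^+ 2 * ((2 ^+ 2 * (B8 * B8)) * B8)))) (Fh h (vv j) - Phi (vv j)).
    by apply: HK_eta => //; exact: (HK_le (isT : (5 <= 8)%N) (lexx _) k8).
  apply: HK_scale0; [by csx|exact: ltW|]; apply: HK_opp; first by csx.
  apply: (HK_weak he); apply: le_trans hhe; apply: ler_wpM2l; first exact: ltW.
  by rewrite /C1 lerDl.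
Qed.

End approximation.

(** * The approximate solution *)

(* Atoms: 0 = N^(-3/2)/6, 1 = eps, 2 = t^(-1/2), 3 = ln t / t, 
   4 = kappa = N^(-1) (-x/3t)^(1/2), 5 = 1/kappa, 6 = z, 7 = cos phi, 8 = sin phi, 9 + i = w^(i)(z). A monomial lists its atoms with repetition. *)
Local Notation Z := BinNums.Z.
Local Notation zp n := (BinInt.Z.of_nat n).
Local Notation zn n := (BinInt.Z.opp (BinInt.Z.of_nat n)).
Definition mono := seq nat.
Definition spoly := seq (Z * mono).

Definition smulm (c : Z) (m : mono) (p : spoly) : spoly := [seq (BinInt.Z.mul c q.1, m ++ q.2) | q <- p].
Definition smul (p q : spoly) : spoly := flatten [seq smulm a.1 a.2 q | a <- p].
Fixpoint dmono (d : nat -> spoly) (m : mono) : spoly :=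
  if m is x :: m' then smulm (zp 1) m' (d x) ++ smulm (zp 1) [:: x] (dmono d m') else [::].
Definition spd (d : nat -> spoly) (p : spoly) : spoly := flatten [seq smulm a.1 [::] (dmono d a.2) | a <- p].

Fixpoint insm (x : nat) (m : mono) : mono := if m is y :: m' then if (x <= y)%N then x :: m else y :: insm x m' else [:: x].
Definition sortm (m : mono) : mono := foldr insm [::] m.
(** [fuel] bounds the number of cancelled pairs; too little of it would leave a monomial less
    reduced, but of the same value. *)
Fixpoint cancelm (x y : nat) (fuel : nat) (m : mono) : mono :=
  if fuel is k.+1 then if (x \in m) && (y \in m) && (x != y) then cancelm x y k (rem y (rem x m)) else m else m.
(* Replaces squares of the atom x by the polynomial q. *)
Fixpoint sqred (x : nat) (q : spoly) (fuel : nat) (c : Z) (m : mono) : spoly :=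
  if fuel is k.+1 then
    if (x \in m) && (x \in rem x m) then flatten [seq sqred x q k a.1 a.2 | a <- smulm c (rem x (rem x m)) q] else [:: (c, m)]
  else [:: (c, m)].
Fixpoint ltm (m n : mono) : bool :=
  match m, n with
  | [::], [::] => false | [::], _ => true | _, [::] => false
  | x :: m', y :: n' => (x < y)%N || ((x == y) && ltm m' n')
  end.
Fixpoint insp (c : Z) (m : mono) (p : spoly) : spoly :=
  if p is (c', m') :: p' then
    if m == m' then let s := BinInt.Z.add c c' in if BinInt.Z.eqb s (zp 0) then p' else (s, m') :: p'
    else if ltm m m' then (c, m) :: p else (c', m') :: insp c m p'
  else [:: (c, m)].
Definition collect (p : spoly) : spoly := foldr (fun a q => insp a.1 (sortm a.2) q) [::] p.
(** Right-hand sides of sin^2 = 1 - cos^2 and, in [kap2], of kappa^2 = 1 - 2 delta z, where delta is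
    the atom 0. *)
Definition sin2 : spoly := [:: (zp 1, [::]); (zn 1, [:: 7; 7])%N].
Definition kap2 : spoly := [:: (zp 1, [::]); (zn 2, [:: 0; 6])%N].
Definition normA (p : spoly) : spoly :=
  collect (flatten [seq sqred 8 sin2 20 a.1 (cancelm 4 5 40 a.2) | a <- p]).
(** The low-order part of the residual cancels identically in kappa, and [normA] is enough for it.
    For [Dop] it is kappa^2 - 1 = -2 delta z that is small, so kappa^2 must be replaced too. *)
Definition normB (p : spoly) : spoly :=
  collect (flatten [seq flatten [seq sqred 8 sin2 20 b.1 b.2 | b <- sqred 4 kap2 20 a.1 (cancelm 4 5 40 a.2)] | a <- p]).

Definition dgm (m : mono) : nat := count (pred1 0%N) m.
(* Weights count the factors t^(-1/16); ln t / t = O(t^(-15/16)). *)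
Definition wta (x : nat) : nat := if x == 2 then 8 else if x == 3 then 15 else 0.
Definition wtm (m : mono) : nat := sumn (map wta m).
Definition hwm (m : mono) : bool := has (leq 9) m.
(* A monomial without a factor w^(i)(z) has no bounded support, so it is not good. *)
Definition goodm a w m := [&& hwm m, (a <= dgm m)%N & (w <= wtm m)%N].
Definition good a w (p : spoly) := all (fun q => goodm a w q.2) p.
Definition pgood a w (p : spoly) := [seq q <- p | goodm a w q.2].
Definition pbad a w (p : spoly) := [seq q <- p | ~~ goodm a w q.2].

(** [kp] and [om] are phi_x / N and phi_t / N^3. With x derivatives measured in units of N and t
    derivatives in units of N^3, N occurs in [dxa] and [dta] only through the small atom 0. *)
Definition kp : spoly := [:: (zp 1, [:: 4]); (zp 72, [:: 0; 1; 1; 3; 4; 9; 10]); (zn 36, [:: 0; 0; 1; 1; 3; 5; 9; 9])].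
Definition om : spoly := [:: (zp 1, [:: 4; 4; 4]); (zp 216, [:: 0; 0; 1; 1; 2; 2; 4; 9; 9]); (zp 216, [:: 0; 1; 1; 3; 4; 4; 4; 9; 10]);
  (zn 108, [:: 0; 0; 1; 1; 3; 4; 9; 9])].
Definition dxa (x : nat) : spoly :=
  match x with
  | 4 => [:: (zn 6, [:: 0; 0; 2; 2; 5])]
  | 5 => [:: (zp 6, [:: 0; 0; 2; 2; 5; 5; 5])]
  | 6 => [:: (zp 6, [:: 0; 2; 2])]
  | 7 => smulm (zn 1) [:: 8]%N kp
  | 8 => smulm (zp 1) [:: 7]%N kp
  | _ => if (9 <= x)%N then [:: (zp 6, [:: 0; 2; 2; x.+1]%N)] else [::]
  end.
Definition dta (x : nat) : spoly :=
  match x with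
  | 2 => [:: (zn 18, [:: 0; 0; 2; 2; 2])]
  | 3 => [:: (zp 36, [:: 0; 0; 2; 2; 2; 2]); (zn 36, [:: 0; 0; 2; 2; 3])]
  | 4 => [:: (zn 18, [:: 0; 0; 2; 2; 4])]
  | 5 => [:: (zp 18, [:: 0; 0; 2; 2; 5])]
  | 6 => [:: (zp 18, [:: 0; 2; 2; 4; 4])]
  | 7 => smulm (zn 1) [:: 8]%N om
  | 8 => smulm (zp 1) [:: 7]%N om
  | _ => if (9 <= x)%N then [:: (zp 18, [:: 0; 2; 2; 4; 4; x.+1]%N)] else [::]
  end.
Notation SX := (spd dxa).
Notation ST := (spd dta).

Definition p_main : spoly := [:: (zp 2, [:: 2; 9; 7]%N)].
(* The third harmonic - a^3 cos(3 phi) / (16 xi^2), where a cos(phi) = v^[w] and xi = N kappa. *)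
Definition p_third : spoly := [:: (zn 72, [:: 1; 1; 0; 0; 2; 2; 2; 9; 9; 9; 5; 5; 7; 7; 7]); (zp 54, [:: 1; 1; 0; 0; 2; 2; 2; 9; 9; 9; 5; 5; 7])].
Definition p_V := p_main ++ p_third.
(** The residual V_t + V_xxx - 6 V^2 V_x in units of eps N^(5/2), where V is eps N^(-1/2) times
    [p_V]; with 216 = 6 (6^2) the factor 6 N^(-3) becomes 216 times the square of atom 0. *)
Definition p_E := ST p_V ++ SX (SX (SX p_V)) ++ smulm (zn 216) [:: 0; 0; 1; 1]%N (smul p_V (smul p_V (SX p_V))).
(** [Dop N] and its square on the main term, in units of N^2 and N^4. *)
Definition p_D := SX (SX p_main) ++ p_main.
Definition p_DD := SX (SX (SX (SX p_main))) ++ smulm (zp 2) [::] (SX (SX p_main)) ++ p_main.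

Local Open Scope ring_scope.

(** * Values of formal polynomials and of their reductions *)

Section evaluation.
Context {R : realType}.
Implicit Types (av : nat -> R).

Definition zv (c : Z) : R := (int_of_Z c)%:~R.
Definition evm av (m : mono) : R := \prod_(i <- m) av i.
Definition ev av (p : spoly) : R := \sum_(q <- p) zv q.1 * evm av q.2.

Lemma zvM c c' : zv (BinInt.Z.mul c c') = zv c * zv c'.
Proof. by rewrite /zv -[BinInt.Z.mul c c']/(c * c')%R rmorphM intrM. Qed.
Lemma zvD c c' : zv (BinInt.Z.add c c') = zv c + zv c'.
Proof. by rewrite /zv -[BinInt.Z.add c c']/(c + c')%R rmorphD intrD. Qed.
Lemma zv_pos n : zv (zp n) = n%:R.
Proof. by rewrite /zv (_ : int_of_Z (zp n) = n%:Z) ?pmulrn//; lia. Qed.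
Lemma zv_neg n : zv (zn n) = - n%:R.
Proof. by rewrite /zv (_ : int_of_Z (zn n) = - n%:Z) ?mulrNz ?pmulrn//; lia. Qed.

Lemma evm_cat av m n : evm av (m ++ n) = evm av m * evm av n.
Proof. exact: big_cat. Qed.
Lemma evm_cons av x m : evm av (x :: m) = av x * evm av m.
Proof. exact: big_cons. Qed.
Lemma evm_nil av : evm av [::] = 1.
Proof. exact: big_nil. Qed.
Lemma ev_cat av p q : ev av (p ++ q) = ev av p + ev av q.
Proof. exact: big_cat. Qed.
Lemma ev_cons av c m p : ev av ((c, m) :: p) = zv c * evm av m + ev av p.
Proof. exact: big_cons. Qed.
Lemma ev_nil av : ev av [::] = 0.
Proof. exact: big_nil. Qed.
Lemma ev_flatten av (T : Type) (F : T -> spoly) (s : seq T) : ev av (flatten [seq F a | a <- s]) = \sum_(a <- s) ev av (F a).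
Proof. by elim: s => [|a s ih]; rewrite ?big_nil ?ev_nil// big_cons /= ev_cat ih. Qed.
Lemma ev_smulm av c m p : ev av (smulm c m p) = zv c * evm av m * ev av p.
Proof.
rewrite /ev /smulm big_map big_distrr /=; apply: eq_bigr => q _.
by rewrite zvM evm_cat; ring.
Qed.
Lemma ev_smul av p q : ev av (smul p q) = ev av p * ev av q.
Proof.
rewrite /smul (ev_flatten av (fun a => smulm a.1 a.2 q)) /(ev av p) big_distrl /=.
by apply: eq_bigr => a _; rewrite ev_smulm.
Qed.

Lemma evm_perm av m n : perm_eq m n -> evm av m = evm av n.
Proof. exact: perm_big. Qed.

Lemma evm_ins av x m : evm av (insm x m) = av x * evm av m.
Proof.
elim: m => [|y m ih] /=; first by rewrite evm_cons.
by case: ifP => _; rewrite !evm_cons// ih; ring.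
Qed.
Lemma evm_sort av m : evm av (sortm m) = evm av m.
Proof. by elim: m => [|x m ih] //=; rewrite evm_ins ih evm_cons. Qed.

Lemma evm_rem av x m : x \in m -> evm av m = av x * evm av (rem x m).
Proof. by move=> /perm_to_rem/evm_perm ->; rewrite evm_cons. Qed.

Lemma evm_cancel av x y k m : av x * av y = 1 -> evm av (cancelm x y k m) = evm av m.
Proof.
move=> xy; elim: k m => [//|k ih] m /=; case: ifP => // /andP[/andP[hx hy] xny]; rewrite ih.
rewrite (evm_rem av hx) (@evm_rem av y (rem x m)); last by have := perm_mem (perm_to_rem hx) y; rewrite hy inE eq_sym (negbTE xny).
by rewrite mulrA xy mul1r.
Qed.

Lemma ev_sqred av x q k c m : av x ^+ 2 = ev av q -> ev av (sqred x q k c m) = zv c * evm av m.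
Proof.
move=> hq; elim: k c m => [|k ih] c m /=; first by rewrite ev_cons ev_nil addr0.
case: ifP => [/andP[h1 h2]|_]; last by rewrite ev_cons ev_nil addr0.
rewrite (ev_flatten av (fun a => sqred x q k a.1 a.2)) (eq_bigr (fun a => zv a.1 * evm av a.2)); last by move=> a _; rewrite ih.
rewrite -/(ev av _) ev_smulm -hq (evm_rem av h1) (evm_rem av h2); ring.
Qed.

Lemma ev_insp av c m p : ev av (insp c m p) = zv c * evm av m + ev av p.
Proof.
elim: p => [|[c' m'] p ih] /=; first by rewrite ev_cons.
case: ifP => [/eqP ->|_].
  case: ifP => [e|_]; rewrite !ev_cons ?zvD; last by ring.
  have : zv (BinInt.Z.add c c') = 0 by move: e => /BinInt.Z.eqb_eq ->; rewrite -[RHS](zv_pos 0).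
  by rewrite zvD => /eqP; rewrite addr_eq0 => /eqP ->; ring.
by case: ifP => _; rewrite !ev_cons// ih; ring.
Qed.
Lemma ev_collect av p : ev av (collect p) = ev av p.
Proof. by elim: p => [|[c m] p ih] //=; rewrite ev_insp evm_sort ih ev_cons. Qed.

Lemma ev_sin2 av : av 7 ^+ 2 + av 8 ^+ 2 = 1 -> av 8 ^+ 2 = ev av sin2.
Proof.
move=> h; rewrite /sin2 !ev_cons ev_nil !evm_cons evm_nil zv_pos zv_neg; move: h; move: (av 7) (av 8) => c s h; have -> : s ^+ 2 = 1 - c ^+ 2 by rewrite -h; ring.
by ring.
Qed.
Lemma ev_kap2 av : av 4 ^+ 2 = 1 - 2 * av 0 * av 6 -> av 4 ^+ 2 = ev av kap2.
Proof. by move=> ->; rewrite /kap2 !ev_cons ev_nil !evm_cons evm_nil zv_pos zv_neg; ring. Qed.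

Lemma ev_normA av p : av 4 * av 5 = 1 -> av 7 ^+ 2 + av 8 ^+ 2 = 1 -> ev av (normA p) = ev av p.
Proof.
move=> h1 /ev_sin2 h2; rewrite ev_collect (ev_flatten av (fun a => sqred 8 sin2 20 a.1 (cancelm 4 5 40 a.2))).
by apply: eq_bigr => a _; rewrite ev_sqred// evm_cancel.
Qed.
Lemma ev_normB av p : av 4 * av 5 = 1 -> av 7 ^+ 2 + av 8 ^+ 2 = 1 -> av 4 ^+ 2 = 1 - 2 * av 0 * av 6 -> ev av (normB p) = ev av p.
Proof.
move=> h1 /ev_sin2 h2 /ev_kap2 h3; rewrite ev_collect.
rewrite (ev_flatten av (fun a => flatten [seq sqred 8 sin2 20 b.1 b.2 | b <- sqred 4 kap2 20 a.1 (cancelm 4 5 40 a.2)])).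
apply: eq_bigr => a _; rewrite (ev_flatten av (fun b => sqred 8 sin2 20 b.1 b.2)).
rewrite (eq_bigr (fun b => zv b.1 * evm av b.2)); last by move=> b _; rewrite ev_sqred.
by rewrite -/(ev av _) ev_sqred// evm_cancel.
Qed.

Lemma ev_split av a w p : ev av p = ev av (pgood a w p) + ev av (pbad a w p).
Proof. by rewrite /ev !big_filter (bigID (fun q => goodm a w q.2)). Qed.
Lemma good_pgood a w p : good a w (pgood a w p).
Proof. exact: filter_all. Qed.
Lemma good_cat a w p q : good a w (p ++ q) = good a w p && good a w q.
Proof. exact: all_cat. Qed.
Lemma good_le a w a' w' p : (a' <= a)%N -> (w' <= w)%N -> good a w p -> good a' w' p.
Proof.
move=> ha hw; apply: sub_all => q /and3P[h1 h2 h3]; apply/and3P; split => //; [exact: leq_trans h2|exact: leq_trans h3].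
Qed.

(** The cancellation on which the construction rests: the logarithmic phase and the third harmonic
    are such that the terms with fewer than two factors delta, or with weight below 38, reduce to
    nothing, which is decided by computation. The weight 38 = 8 + 15 + 15 is that of t^(-1/2) (ln t
    / t)^2. *)
Lemma E_low av : av 4 * av 5 = 1 -> av 7 ^+ 2 + av 8 ^+ 2 = 1 -> ev av p_E = ev av (pgood 2 38 p_E).
Proof.
move=> h1 h2; rewrite (ev_split av 2 38) -(ev_normA (pbad _ _ _) h1 h2).
have -> : normA (pbad 2 38 p_E) = [::] by vm_compute.
by rewrite ev_nil addr0.
Qed.

(** Terms with enough factors delta are kept as they are; the others are reduced with kappa^2 = 1 -
    2 delta z, which brings out the missing factors. *)
Definition q_DD := pgood 2 8 p_DD ++ normB (pbad 2 8 p_DD).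
Definition q_D := pgood 1 8 p_D ++ normB (pbad 1 8 p_D).
Lemma DD_low av : av 4 * av 5 = 1 -> av 7 ^+ 2 + av 8 ^+ 2 = 1 -> av 4 ^+ 2 = 1 - 2 * av 0 * av 6 -> ev av p_DD = ev av q_DD.
Proof. by move=> h1 h2 h3; rewrite (ev_split av 2 8) -(ev_normB (pbad _ _ _) h1 h2 h3) -ev_cat. Qed.
Lemma D_low av : av 4 * av 5 = 1 -> av 7 ^+ 2 + av 8 ^+ 2 = 1 -> av 4 ^+ 2 = 1 - 2 * av 0 * av 6 -> ev av p_D = ev av q_D.
Proof. by move=> h1 h2 h3; rewrite (ev_split av 1 8) -(ev_normB (pbad _ _ _) h1 h2 h3) -ev_cat. Qed.

Lemma good_E : good 2 38 (pgood 2 38 p_E). Proof. exact: good_pgood. Qed.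
Lemma good_qDD : good 2 8 q_DD. Proof. by vm_compute. Qed.
Lemma good_qD : good 1 8 q_D. Proof. by vm_compute. Qed.
Lemma good_V : good 0 8 p_V. Proof. by vm_compute. Qed.
Lemma good_main : good 0 8 p_main. Proof. by vm_compute. Qed.
Lemma good_third : good 2 24 p_third. Proof. by vm_compute. Qed.

(* A derivation that does not lower the weights of the atoms does not lower those of polynomials. *)
Definition mono_le (m n : mono) := [&& hwm m ==> hwm n, (dgm m <= dgm n)%N & (wtm m <= wtm n)%N].

Lemma mono_le_good a w m n : mono_le m n -> goodm a w m -> goodm a w n.
Proof.
case/and3P => [h1 h2 h3] /and3P[g1 g2 g3]; apply/and3P; split; [exact: (implyP h1)|exact: leq_trans h2|exact: leq_trans h3].
Qed.
Lemma mono_le_cat m n m' n' : mono_le m n -> mono_le m' n' -> mono_le (m ++ m') (n ++ n').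
Proof.
case/and3P => [h1 h2 h3] /and3P[g1 g2 g3]; apply/and3P; split.
- by apply/implyP; rewrite /hwm !has_cat => /orP[/(implyP h1)|/(implyP g1)]; rewrite /hwm => ->; rewrite ?orbT.
- by rewrite /dgm !count_cat leq_add.
- by rewrite /wtm !map_cat !sumn_cat leq_add.
Qed.
Lemma mono_le_refl m : mono_le m m.
Proof. by rewrite /mono_le implybb !leqnn. Qed.

Definition mono_dom (m : mono) (p : spoly) := all (fun q => mono_le m q.2) p.
Lemma dom_smulm c n m p : mono_dom m p -> mono_dom (n ++ m) (smulm c n p).
Proof. by rewrite /mono_dom /smulm all_map; apply: sub_all => q /= h; apply: mono_le_cat => //; exact: mono_le_refl. Qed.

Lemma mono_le_perm m m' n : perm_eq m m' -> mono_le m n -> mono_le m' n.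
Proof.
move=> h /and3P[h1 h2 h3]; apply/and3P; split.
- by rewrite /hwm -(perm_has _ h).
- by rewrite /dgm -(permP h).
- by rewrite /wtm -(perm_sumn (perm_map _ h)).
Qed.

Lemma dom_dmono d m : (forall x, mono_dom [:: x] (d x)) -> mono_dom m (dmono d m).
Proof.
move=> hd; elim: m => [//|x m ih] /=; rewrite /mono_dom all_cat; apply/andP; split.
  have := dom_smulm (zp 1) m (hd x); apply: sub_all => q; apply: mono_le_perm; by rewrite perm_catC.
exact: (dom_smulm (zp 1) [:: x] ih).
Qed.

Lemma good_spd d a w p : (forall x, mono_dom [:: x] (d x)) -> good a w p -> good a w (spd d p).
Proof.
move=> hd; rewrite /good /spd; elim: p => [//|[c m] p ih] /= /andP[gm /ih gp]; rewrite all_cat gp andbT.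
have := dom_smulm c [::] (dom_dmono m hd); apply: sub_all => q h; exact: mono_le_good h gm.
Qed.

Lemma dom_dxa x : mono_dom [:: x] (dxa x).
Proof.
do 9! (case: x => [|x]; first by []); rewrite /dxa /=.
by rewrite /mono_dom /mono_le /= /dgm /wtm /wta /=.
Qed.
Lemma dom_dta x : mono_dom [:: x] (dta x).
Proof.
do 9! (case: x => [|x]; first by []); rewrite /dta /=.
by rewrite /mono_dom /mono_le /= /dgm /wtm /wta /=.
Qed.
Lemma good_SX a w p : good a w p -> good a w (SX p). Proof. exact: good_spd dom_dxa. Qed.
Lemma good_ST a w p : good a w p -> good a w (ST p). Proof. exact: good_spd dom_dta. Qed.

End evaluation.

Section derivation_rules.
Context {R : realType}.
Implicit Types (f g : R -> R) (x a b c : R).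

Lemma der_cst x c : is_derive x 1 (fun _ : R => c) 0.
Proof. exact: is_derive_cst. Qed.
Lemma der_id x : is_derive x 1 (fun y : R => y) 1.
Proof. exact: is_derive_id. Qed.
Lemma der_add f g x a b : is_derive x 1 f a -> is_derive x 1 g b -> is_derive x 1 (fun y => f y + g y) (a + b).
Proof. by move=> h1 h2; exact: is_deriveD. Qed.
Lemma der_mul f g x a b : is_derive x 1 f a -> is_derive x 1 g b -> is_derive x 1 (fun y => f y * g y) (a * g x + f x * b).
Proof.
move=> h1 h2; have h := is_deriveM h1 h2; apply: (is_derive_eq h).
by rewrite -![_ *: _]/(_ * _); ring.
Qed.
Lemma der_comp f g x a b : is_derive (g x) 1 f a -> is_derive x 1 g b -> is_derive x 1 (fun y => f (g y)) (a * b).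
Proof. exact: is_derive1_comp. Qed.
Lemma der_inv f x a : f x != 0 -> is_derive x 1 f a -> is_derive x 1 (fun y => (f y)^-1) (- (f x)^-2 * a).
Proof. exact: is_deriveV. Qed.
Lemma der_scale f x a c : is_derive x 1 f a -> is_derive x 1 (fun y => c * f y) (c * a).
Proof. by move=> h; apply: (is_derive_eq (der_mul (der_cst x c) h)); rewrite mul0r add0r. Qed.
Lemma der_exp f x a k : is_derive x 1 f a -> is_derive x 1 (fun y => f y ^+ k.+1) (k.+1%:R * f x ^+ k * a).
Proof.
move=> h; elim: k => [|k ih]; first by apply: (is_derive_eq h); rewrite expr0 mulr1 mul1r.
rewrite (_ : (fun y => f y ^+ k.+2) = (fun y => f y * f y ^+ k.+1)); last by apply/funext => y; rewrite exprS.
by apply: (is_derive_eq (der_mul h ih)); rewrite -[in RHS]natr1 !exprS; ring.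
Qed.
Lemma der_ext f g x a : (forall y, f y = g y) -> is_derive x 1 f a -> is_derive x 1 g a.
Proof. by move=> /funext ->. Qed.
Lemma der_near0 f x : (\forall y \near x, f y = 0) -> is_derive x 1 f 0.
Proof.
move=> h; apply: (near_eq_is_derive (f := cst 0)); rewrite ?oner_neq0//.
by apply: filterS h => y ->.
Qed.

(** Lifts derivatives from the atoms to polynomials; [c] is the unit, N for x and N^3 for t. *)
Lemma der_ev (F : R -> nat -> R) (d : nat -> spoly) x c p :
  (forall i, is_derive x 1 (fun s => F s i) (c * ev (F x) (d i))) ->
  is_derive x 1 (fun s => ev (F s) p) (c * ev (F x) (spd d p)).
Proof.
move=> h; have hm m : is_derive x 1 (fun s => evm (F s) m) (c * ev (F x) (dmono d m)).
  elim: m => [|i m ih].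
    apply: (is_derive_eq (f' := 0)); last by rewrite /= ev_nil mulr0.
    by rewrite (_ : (fun s => evm (F s) [::]) = fun=> 1) ; [exact: der_cst|apply/funext => s; rewrite evm_nil].
  rewrite (_ : (fun s => evm (F s) (i :: m)) = (fun s => F s i * evm (F s) m)); last by apply/funext => s; rewrite evm_cons.
  apply: (is_derive_eq (der_mul (h i) ih)).
  rewrite -[dmono d (i :: m)]/(smulm (BinInt.Z.of_nat 1) m (d i) ++ smulm (BinInt.Z.of_nat 1) [:: i] (dmono d m)).
  by rewrite ev_cat !ev_smulm evm_cons evm_nil zv_pos; ring.
elim: p => [|[k m] p ih].
  apply: (is_derive_eq (f' := 0)); last by rewrite /spd /= ev_nil mulr0.
  by rewrite (_ : (fun s => ev (F s) [::]) = fun=> 0); [exact: der_cst|apply/funext => s; rewrite ev_nil].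
rewrite (_ : (fun s => ev (F s) ((k, m) :: p)) = (fun s => zv k * evm (F s) m + ev (F s) p)); last by apply/funext => s; rewrite ev_cons.
apply: (is_derive_eq (der_add (der_scale (zv k) (hm m)) ih)).
by rewrite /spd /= ev_cat ev_smulm evm_nil; ring.
Qed.

End derivation_rules.

(** * The atoms as functions, and their derivatives *)

Section profile.
Context {R : realType} (w : R -> R) (Z : R) (sw : smooth w) (Z1 : 1 <= Z) (hw : forall y, Z < `|y| -> w y = 0).
Implicit Types (n e t x : R) (p : spoly).

(** From here on [n] is the square root of N. With kappa = [kk] one has -x = 3 N^2 t kappa^2, which
    turns the roots of the phase into 2 N^3 t kappa^3 and N kappa. *)
Definition dd n : R := (6 * n ^+ 3)^-1.
Definition zz n t x : R := (x + 3 * n ^+ 4 * t) / (n * t).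
Definition kk n t x : R := Num.sqrt (1 - 2 * dd n * zz n t x).
Definition ph n e t x : R := - 2 * n ^+ 6 * t * kk n t x ^+ 3 + 6 * e ^+ 2 * ln t * kk n t x * w (zz n t x) ^+ 2.
Definition avl n e t x (i : nat) : R :=
  match i with
  | 0 => dd n | 1 => e | 2 => (Num.sqrt t)^-1 | 3 => ln t / t | 4 => kk n t x | 5 => (kk n t x)^-1 | 6 => zz n t x
  | 7 => cos (ph n e t x) | 8 => sin (ph n e t x) | i.+4.+4.+1 => dn i w (zz n t x)
  end.
Notation EV n e t x p := (ev (avl n e t x) p).

Lemma zz_dx n t x : 0 < n -> 0 < t -> is_derive x 1 (zz n t) (n * t)^-1.
Proof.
move=> n0 t0; have h := der_mul (der_add (der_id x) (der_cst x (3 * n ^+ 4 * t))) (der_cst x (n * t)^-1).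
by apply: (is_derive_eq h); ring.
Qed.
Lemma zz_dt n t x : 0 < n -> 0 < t -> is_derive t 1 (fun s => zz n s x) (- x / (n * t ^+ 2)).
Proof.
move=> n0 t0; have nt : n * t != 0 by rewrite gt_eqF// mulr_gt0.
have h := der_mul (der_add (der_cst t x) (der_scale (3 * n ^+ 4) (der_id t))) (der_inv nt (der_scale n (der_id t))).
apply: (is_derive_eq h); field; by rewrite !gt_eqF.
Qed.

Lemma kk_der (F : R -> R) n (s : R) (F' : R) : 0 < n -> 0 < 1 - 2 * dd n * F s -> is_derive s 1 F F' ->
  is_derive s 1 (fun y => Num.sqrt (1 - 2 * dd n * F y)) (- dd n * F' / Num.sqrt (1 - 2 * dd n * F s)).
Proof.
move=> n0 pos dF.
have h1 : is_derive s 1 (fun y => 1 - 2 * dd n * F y) (- 2 * dd n * F').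
  apply: (@der_ext R (fun y => 1 + (- 2 * dd n) * F y)); first by move=> y; ring.
  by apply: (is_derive_eq (der_add (der_cst s 1) (der_scale (- 2 * dd n) dF))); ring.
have h := @der_comp R Num.sqrt (fun y => 1 - 2 * dd n * F y) s _ _ (is_derive1_sqrt pos) h1; apply: (is_derive_eq h).
by field; rewrite gt_eqF// sqrtr_gt0.
Qed.

Lemma dn_der i (F : R -> R) (s F' : R) : is_derive s 1 F F' -> is_derive s 1 (fun y => dn i w (F y)) (dn i.+1 w (F s) * F').
Proof.
move=> dF; have h : is_derive (F s) 1 (dn i w) (dn i.+1 w (F s)) by rewrite derive1nS; apply: dble_is_derive; exact: sw.
exact: der_comp h dF.
Qed.

Definition pos_at n t x := 0 < 1 - 2 * dd n * zz n t x.

(** Stated at t = q^2, so that the square root of t is the letter [q] and [field] applies. *)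
Lemma avl_dx_sqr n e q x i : 0 < n -> 0 < q -> pos_at n (q ^+ 2) x ->
  is_derive x 1 (fun y => avl n e (q ^+ 2) y i) (n ^+ 2 * EV n e (q ^+ 2) x (dxa i)).
Proof.
move=> n0 q0 px; have t0 : 0 < q ^+ 2 by rewrite exprn_gt0.
have k0 : 0 < kk n (q ^+ 2) x by rewrite sqrtr_gt0.
have dz := zz_dx x n0 t0; have dk := kk_der n0 px dz; rewrite -/(kk n (q ^+ 2) x) in dk.
have dw := dn_der 0 dz.
have dph : is_derive x 1 (ph n e (q ^+ 2)) (n ^+ 2 * EV n e (q ^+ 2) x kp).
  have h := der_add (der_scale (- 2 * n ^+ 6 * q ^+ 2) (der_exp 2 dk)) (der_mul (der_scale (6 * e ^+ 2 * ln (q ^+ 2)) dk) (der_exp 1 dw)).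
  apply: (is_derive_eq h); rewrite /kp !ev_cons ev_nil !evm_cons evm_nil !zv_pos zv_neg /= -/(kk n (q ^+ 2) x).
  move: (kk n (q ^+ 2) x) k0 (dx w _) (w _) (ln (q ^+ 2)) => k k0 W1 W0 L; rewrite /dd; field; by rewrite !gt_eqF.
have er : Num.sqrt (q ^+ 2) = q by rewrite sqrtr_sqr gtr0_norm.
do 4! (case: i => [|i]; first by rewrite /= ev_nil mulr0; exact: der_cst).
case: i => [|i].
  apply: (is_derive_eq dk); rewrite /= !ev_cons ev_nil !evm_cons evm_nil -[BinNums.Zneg _]/(BinInt.Z.opp (BinInt.Z.of_nat 6)) zv_neg /= er.
  move: (kk n (q ^+ 2) x) k0 => k k0; rewrite /dd; field; by rewrite !gt_eqF.
case: i => [|i].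
  apply: (is_derive_eq (der_inv _ dk)); first by rewrite gt_eqF.
  rewrite /= !ev_cons ev_nil !evm_cons evm_nil -[BinNums.Zpos _]/((BinInt.Z.of_nat 6)) zv_pos /= er -/(kk n (q ^+ 2) x).
  move: (kk n (q ^+ 2) x) k0 => k k0; rewrite /dd; field; by rewrite !gt_eqF.
case: i => [|i].
  apply: (is_derive_eq dz).
  rewrite /= !ev_cons ev_nil !evm_cons evm_nil -[BinNums.Zpos _]/((BinInt.Z.of_nat 6)) zv_pos /= er.
  rewrite /dd; field; by rewrite !gt_eqF.
case: i => [|i].
  apply: (is_derive_eq (der_comp (is_derive_cos _) dph)).
  rewrite -[dxa 7]/(smulm (BinInt.Z.opp (BinInt.Z.of_nat 1)) [:: 8%N] kp) ev_smulm zv_neg evm_cons evm_nil /=; ring.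
case: i => [|i].
  apply: (is_derive_eq (der_comp (is_derive_sin _) dph)).
  rewrite -[dxa 8]/(smulm (BinInt.Z.of_nat 1) [:: 7%N] kp) ev_smulm zv_pos evm_cons evm_nil /=; ring.
apply: (is_derive_eq (dn_der i dz)).
rewrite -[dxa i.+4.+4.+1]/[:: (BinInt.Z.of_nat 6, [:: 0; 2; 2; i.+4.+4.+2]%N)] ev_cons ev_nil !evm_cons evm_nil zv_pos.
rewrite -[avl _ _ _ _ i.+4.+4.+2]/(dn i.+1 w (zz n (q ^+ 2) x)) /= er.
move: (dx (dn i w) _) => W; rewrite /dd; field; by rewrite !gt_eqF.
Qed.

Lemma avl_dt_sqr n e q x i : 0 < n -> 0 < q -> pos_at n (q ^+ 2) x ->
  is_derive (q ^+ 2) 1 (fun s => avl n e s x i) (n ^+ 6 * EV n e (q ^+ 2) x (dta i)).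
Proof.
move=> n0 q0 px; have t0 : 0 < q ^+ 2 by rewrite exprn_gt0.
have k0 : 0 < kk n (q ^+ 2) x by rewrite sqrtr_gt0.
have k2 : kk n (q ^+ 2) x ^+ 2 = 1 - 2 * dd n * zz n (q ^+ 2) x by rewrite sqr_sqrtr// ltW.
have ez : - x / (n * (q ^+ 2) ^+ 2) = 3 * n ^+ 3 * kk n (q ^+ 2) x ^+ 2 / q ^+ 2.
  by rewrite k2 /zz /dd; field; rewrite !gt_eqF.
have dz := zz_dt x n0 t0; rewrite ez in dz.
have dk := @kk_der (fun s => zz n s x) n (q ^+ 2) _ n0 px dz; rewrite -/(kk n (q ^+ 2) x) in dk.
have dw := dn_der 0 dz; have dL := is_derive1_ln t0.
have dph : is_derive (q ^+ 2) 1 (fun s => ph n e s x) (n ^+ 6 * EV n e (q ^+ 2) x om).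
  have h := der_add (der_mul (der_scale (- 2 * n ^+ 6) (der_id (q ^+ 2))) (der_exp 2 dk)) (der_mul (der_mul (der_scale (6 * e ^+ 2) dL) dk) (der_exp 1 dw)).
  apply: (is_derive_eq h); rewrite /om !ev_cons ev_nil !evm_cons evm_nil !zv_pos zv_neg /= -/(kk n (q ^+ 2) x).
  have -> : Num.sqrt (q ^+ 2) = q by rewrite sqrtr_sqr gtr0_norm.
  move: (kk n (q ^+ 2) x) k0 (dx w _) (w _) (ln (q ^+ 2)) => k k0 W1 W0 L; rewrite /dd; field; by rewrite !gt_eqF.
have er : Num.sqrt (q ^+ 2) = q by rewrite sqrtr_sqr gtr0_norm.
do 2! (case: i => [|i]; first by rewrite /= ev_nil mulr0; exact: der_cst).
case: i => [|i].
  have sq0 : Num.sqrt (q ^+ 2) != 0 by rewrite er gt_eqF.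
  apply: (is_derive_eq (der_inv sq0 (is_derive1_sqrt t0))).
  rewrite /= !ev_cons ev_nil !evm_cons evm_nil -[BinNums.Zneg _]/(BinInt.Z.opp (BinInt.Z.of_nat 18)) zv_neg /= er.
  by rewrite /dd; field; rewrite !gt_eqF.
case: i => [|i].
  apply: (is_derive_eq (der_mul dL (@der_inv R (fun y => y) _ _ (lt0r_neq0 t0) (der_id _)))).
  rewrite /= !ev_cons ev_nil !evm_cons evm_nil -[BinNums.Zneg _]/(BinInt.Z.opp (BinInt.Z.of_nat 36)) -[BinNums.Zpos _]/((BinInt.Z.of_nat 36)) zv_neg zv_pos /= er.
  by move: (ln _) => L; rewrite /dd; field; rewrite !gt_eqF.
case: i => [|i].
  apply: (is_derive_eq dk); rewrite /= !ev_cons ev_nil !evm_cons evm_nil -[BinNums.Zneg _]/(BinInt.Z.opp (BinInt.Z.of_nat 18)) zv_neg /= er.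
  move: (kk n (q ^+ 2) x) k0 => k k0; rewrite /dd; field; by rewrite !gt_eqF.
case: i => [|i].
  apply: (is_derive_eq (der_inv _ dk)); first by rewrite gt_eqF.
  rewrite /= !ev_cons ev_nil !evm_cons evm_nil -[BinNums.Zpos _]/((BinInt.Z.of_nat 18)) zv_pos /= er -/(kk n (q ^+ 2) x).
  move: (kk n (q ^+ 2) x) k0 => k k0; rewrite /dd; field; by rewrite !gt_eqF.
case: i => [|i].
  apply: (is_derive_eq dz).
  rewrite /= !ev_cons ev_nil !evm_cons evm_nil -[BinNums.Zpos _]/((BinInt.Z.of_nat 18)) zv_pos /= er.
  move: (kk n (q ^+ 2) x) k0 => k k0; rewrite /dd; field; by rewrite !gt_eqF.
case: i => [|i].
  apply: (is_derive_eq (der_comp (is_derive_cos _) dph)).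
  rewrite -[dta 7]/(smulm (BinInt.Z.opp (BinInt.Z.of_nat 1)) [:: 8%N] om) ev_smulm zv_neg evm_cons evm_nil /=; ring.
case: i => [|i].
  apply: (is_derive_eq (der_comp (is_derive_sin _) dph)).
  rewrite -[dta 8]/(smulm (BinInt.Z.of_nat 1) [:: 7%N] om) ev_smulm zv_pos evm_cons evm_nil /=; ring.
apply: (is_derive_eq (dn_der i dz)).
rewrite -[dta i.+4.+4.+1]/[:: (BinInt.Z.of_nat 18, [:: 0; 2; 2; 4; 4; i.+4.+4.+2]%N)] ev_cons ev_nil !evm_cons evm_nil zv_pos.
rewrite -[avl _ _ _ _ i.+4.+4.+2]/(dn i.+1 w (zz n (q ^+ 2) x)) /= er.
move: (dx (dn i w) _) (kk n (q ^+ 2) x) k0 => W k k0; rewrite /dd; field; by rewrite !gt_eqF.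
Qed.

Lemma avl_dx n e t x i : 0 < n -> 0 < t -> pos_at n t x -> is_derive x 1 (fun y => avl n e t y i) (n ^+ 2 * EV n e t x (dxa i)).
Proof.
move=> n0 t0; have -> : t = Num.sqrt t ^+ 2 by rewrite sqr_sqrtr// ltW.
by apply: avl_dx_sqr => //; rewrite sqrtr_gt0.
Qed.
Lemma avl_dt n e t x i : 0 < n -> 0 < t -> pos_at n t x -> is_derive t 1 (fun s => avl n e s x i) (n ^+ 6 * EV n e t x (dta i)).
Proof.
move=> n0 t0; have -> : t = Num.sqrt t ^+ 2 by rewrite sqr_sqrtr// ltW.
by apply: avl_dt_sqr => //; rewrite sqrtr_gt0.
Qed.

End profile.

Section support_bounds.
Context {R : realType}.
Implicit Types (f : R -> R).

Lemma cs_sup f x : cs f -> `|f x| <= nm f + nm (dx f).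
Proof.
move=> cf; have h := sup_nm x cf; have a1 := nm_ge0 f; have a2 := nm_ge0 (dx f).
have h2 : `|f x| ^+ 2 <= (nm f + nm (dx f)) ^+ 2.
  rewrite real_normK ?num_real//; apply: (le_trans h).
  move: (nm f) (nm (dx f)) => p q; have := sqr_ge0 p; have := sqr_ge0 q; clear; lra.
have S0 : 0 <= nm f + nm (dx f) by exact: addr_ge0.
by move: h2; rewrite ler_pXn2r// nnegrE.
Qed.

Lemma nm_supp f (p L B : R) : cs f -> 1 <= L -> 0 <= B -> (forall x, `|f x| <= B) -> (forall x, L < `|x - p| -> f x = 0) ->
  nm f <= 2 * B * Num.sqrt L.
Proof.
move=> cf L1 B0 hB hL; rewrite -(nm_shift p cf).
have cg : cs (fun x => f (x + p)) by exact: cs_shift.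
have hg x : L < `|x| -> f (x + p) = 0 by move=> hx; apply: hL; rewrite addrK.
have L0 : 0 <= L by lra.
rewrite -(@ler_pXn2r _ 2%N)// ?nnegrE ?nm_ge0 ?mulr_ge0 ?sqrtr_ge0// nm2.
rewrite /nn (@ii_itv R _ L (- (L + 1)) (L + 1)) => [|x hx||]; [|by rewrite -[LHS]/(f (x + p) * f (x + p)) hg// mul0r|by rewrite ltrN2; lra|by lra].
rewrite (_ : \int[_]_(x in _) _ = In (- (L + 1)) (L + 1) (fun x => f (x + p) ^+ 2)); last by apply: In_eq => x _; rewrite expr2.
have mg : mb (fun x => f (x + p)) := continuous_mb (cs_cont cg).
apply: (@le_trans _ _ (In (- (L + 1)) (L + 1) (fun=> B ^+ 2))).
  apply: In_le; [exact: (mbM mg mg)|exact: mbC|] => x _.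
  by rewrite -[leLHS]real_normK ?num_real//; apply: lerXn2r; rewrite ?nnegrE.
rewrite In_cst; last by lra.
rewrite !exprMn sqr_sqrtr//; have := sqr_ge0 B; move: (B ^+ 2) => b b0; nra.
Qed.

End support_bounds.

(** * From formal weights to bounds uniform in N, eps and t *)

Section profile_bounds.
Context {R : realType} (w : R -> R) (Z : R) (sw : smooth w) (Z1 : 1 <= Z) (hw : forall y, Z < `|y| -> w y = 0).
Implicit Types (n e t x : R) (p : spoly).
Notation EV n e t x p := (ev (avl w n e t x) p).

Lemma cs_profile : cs w. Proof. by split => //; exists Z. Qed.

Lemma dn_out i y : Z < `|y| -> dn i w y = 0.
Proof.
elim: i y => [|i ih] y hy; first exact: hw.
rewrite derive1nS; apply: derive1_near0.
have : \forall u \near y, Z < `|u| by apply: (cvgr_gt _ (@norm_continuous _ _ y)).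
by apply: filterS => u; exact: ih.
Qed.

(** The margin Z + 1 <= n makes 2 delta |z| <= 1/3 for |z| < Z + 1, so kappa stays away from 0 on a
    neighbourhood of the support. *)
Record env n e : Prop := Env { env_n : 1 <= n; env_Z : Z + 1 <= n; env_e0 : 0 < e; env_e1 : e <= 1 }.

Lemma env_n0 n e : env n e -> 0 < n.
Proof. by case=> h _ _ _; lra. Qed.

Lemma dd_bounds n e : env n e -> 0 < dd n /\ dd n <= 1.
Proof.
move=> [n1 _ _ _]; have n3 : 1 <= n ^+ 3 by rewrite exprn_ege1.
have n30 : 0 < 6 * n ^+ 3 by lra.
split; first by rewrite /dd invr_gt0.
by rewrite /dd invf_le1//; lra.
Qed.

Lemma dd_zz n e t x : env n e -> `|zz n t x| < Z + 1 -> `|2 * dd n * zz n t x| <= 3^-1.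
Proof.
move=> E hz; have [n1 nZ _ _] := E; have [d0 d1] := dd_bounds E.
have n3 : n <= n ^+ 3 by rewrite -[leLHS]expr1; apply: ler_weXn2l.
rewrite normrM ger0_norm ?mulr_ge0 ?(ltW d0)//.
apply: (@le_trans _ _ (2 * dd n * n ^+ 3)).
  by apply: ler_wpM2l; [rewrite mulr_ge0// ltW|lra].
by rewrite /dd le_eqVlt; apply/orP; left; apply/eqP; field; rewrite gt_eqF//; lra.
Qed.

Lemma in_region n e t x : env n e -> `|zz n t x| < Z + 1 -> pos_at n t x /\ 2 / 3 <= kk n t x ^+ 2 <= 4 / 3.
Proof.
move=> E hz; have := dd_zz E hz; rewrite ler_norml => /andP[h1 h2].
have p0 : pos_at n t x by rewrite /pos_at; lra.
by split=> //; rewrite /kk sqr_sqrtr ?(ltW p0)//; apply/andP; split; lra.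
Qed.

Lemma ev_out av p : good 0 0 p -> (forall i, av i.+4.+4.+1 = 0) -> ev av p = 0 :> R.
Proof.
move=> gp h; apply: big1_seq => -[c m] /= hm.
have /and3P[/hasP[i im i9] _ _] := allP gp _ hm.
have -> : evm av m = 0; last by rewrite mulr0.
rewrite (evm_rem av im); have -> : i = (i - 9).+4.+4.+1 by lia.
by rewrite h mul0r.
Qed.

Lemma EV_out n e t x p : good 0 0 p -> Z < `|zz n t x| -> EV n e t x p = 0.
Proof. by move=> gp hz; apply: ev_out => // i; exact: dn_out. Qed.

Lemma zz_near_x n t x : 0 < n -> 0 < t -> Z < `|zz n t x| -> \forall y \near x, Z < `|zz n t y|.
Proof.
move=> n0 t0 hz; have c : {for x, continuous (zz n t)}.
  by apply: differentiable_continuous; apply/derivable1_diffP; have [] := zz_dx x n0 t0.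
have c2 : {for x, continuous (fun y => `|zz n t y|)} by apply: continuous_comp => //; exact: norm_continuous.
exact: (cvgr_gt _ c2).
Qed.
Lemma zz_near_t n t x : 0 < n -> 0 < t -> Z < `|zz n t x| -> \forall s \near t, Z < `|zz n s x|.
Proof.
move=> n0 t0 hz; have c : {for t, continuous (fun s => zz n s x)}.
  by apply: differentiable_continuous; apply/derivable1_diffP; have [] := zz_dt x n0 t0.
have c2 : {for t, continuous (fun s => `|zz n s x|)} by apply: (continuous_comp (f := fun s => zz n s x) (g := fun y => `|y|)) => //; exact: norm_continuous.
exact: (cvgr_gt _ c2).
Qed.

(** Two overlapping regions: for |z| < Z + 1 the atoms are differentiable, for |z| > Z the
    polynomial vanishes nearby, whatever value [kk] has there. *)
Lemma EV_dx n e t x p : env n e -> 0 < t -> good 0 0 p -> is_derive x 1 (fun y => EV n e t y p) (n ^+ 2 * EV n e t x (SX p)).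
Proof.
move=> E t0 gp; have n0 := env_n0 E; have [hz|hz] := ltP `|zz n t x| (Z + 1).
  have [px _] := in_region E hz.
  by apply: (@der_ev R (fun y => avl w n e t y)) => i; exact: avl_dx.
have hz' : Z < `|zz n t x| by lra.
rewrite EV_out//; last exact: good_SX.
rewrite mulr0; apply: der_near0; have := zz_near_x n0 t0 hz'.
by apply: filterS => y; exact: EV_out.
Qed.
Lemma EV_dt n e t x p : env n e -> 0 < t -> good 0 0 p -> is_derive t 1 (fun s => EV n e s x p) (n ^+ 6 * EV n e t x (ST p)).
Proof.
move=> E t0 gp; have n0 := env_n0 E; have [hz|hz] := ltP `|zz n t x| (Z + 1).
  have [px _] := in_region E hz.
  by apply: (@der_ev R (fun s => avl w n e s x)) => i; exact: avl_dt.
have hz' : Z < `|zz n t x| by lra.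
rewrite EV_out//; last exact: good_ST.
rewrite mulr0; apply: der_near0; have := zz_near_t n0 t0 hz'.
by apply: filterS => s; exact: EV_out.
Qed.

Definition EVf n e t p : R -> R := fun x => EV n e t x p.

Lemma dx_EV n e t p : env n e -> 0 < t -> good 0 0 p -> dx (EVf n e t p) = cst (n ^+ 2) * EVf n e t (SX p).
Proof. by move=> E t0 gp; apply/funext => x; rewrite derive1E; have [_ ->] := EV_dx x E t0 gp. Qed.

Lemma smooth_EV n e t p : env n e -> 0 < t -> good 0 0 p -> smooth (EVf n e t p).
Proof.
move=> E t0 gp; pose P (f : R -> R) := exists c q, good 0 0 q /\ f = cst c * EVf n e t q.
have hP f : P f -> dble f /\ P (dx f).
  case=> c [q [gq ->]]; have dq : dble (EVf n e t q) by move=> x; have [] := EV_dx x E t0 gq.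
  have dc : dble (cst c : R -> R) by move=> x; exact: derivable_cst.
  have dcq : dble (cst c * EVf n e t q) := dbleM dc dq.
  split => //; exists (c * n ^+ 2), (SX q); split; first exact: good_SX.
  rewrite (dxM dc dq) dx_cst dx_EV//; apply/funext => x.
  by rewrite -[LHS]/(0 * EVf n e t q x + c * (n ^+ 2 * EVf n e t (SX q) x)) -[RHS]/(c * n ^+ 2 * EVf n e t (SX q) x); ring.
apply: (smooth_stable hP); exists 1, p; split => //.
by apply/funext => x; rewrite -[RHS]/(1 * EVf n e t p x) mul1r.
Qed.

Lemma EV_support n e t x : env n e -> 0 < t -> Z * n * t < `|x - (- (3 * n ^+ 4 * t))| -> Z < `|zz n t x|.
Proof.
move=> E t0; have n0 := env_n0 E; have nt : 0 < n * t by exact: mulr_gt0.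
by rewrite opprK /zz normrM [ `|(n * t)^-1|]gtr0_norm ?invr_gt0// ltr_pdivlMr// [Z * (n * t)]mulrA.
Qed.

Lemma cs_EV n e t p : env n e -> 0 < t -> good 0 0 p -> cs (EVf n e t p).
Proof.
move=> E t0 gp; split; first exact: smooth_EV.
exists (Z * n * t + 3 * n ^+ 4 * t) => x hx; apply: EV_out => //; apply: (EV_support E t0).
have n0 := env_n0 E.
have a0 : 0 <= 3 * n ^+ 4 * t by rewrite !mulr_ge0 ?exprn_ge0 ?ltW.
by have := ler_normB x (- (3 * n ^+ 4 * t)); have := ler_normB (x - (- (3 * n ^+ 4 * t))) (- (- (3 * n ^+ 4 * t))); rewrite !normrN (ger0_norm a0) !opprK addrK; lra.
Qed.

Lemma good00 a k p : good a k p -> good 0 0 p.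
Proof. exact: good_le. Qed.

Lemma good_iter a k p j : good a k p -> good a k (iter j SX p).
Proof. by move=> gp; elim: j => [//|j ih] /=; exact: good_SX. Qed.

Lemma dn_EV n e t p j : env n e -> 0 < t -> good 0 0 p -> dn j (EVf n e t p) = cst ((n ^+ 2) ^+ j) * EVf n e t (iter j SX p).
Proof.
move=> E t0 gp; elim: j => [|j ih]; first by apply/funext => x; rewrite -[RHS]/(1 * EVf n e t p x) mul1r.
have gj := good_iter j gp; have cj := cs_EV E t0 gj.
rewrite derive1nS ih dxM; [|by move=> x; exact: derivable_cst|exact: cs_dble].
rewrite dx_cst dx_EV//; apply/funext => x.
rewrite -[LHS]/(0 * EVf n e t (iter j SX p) x + (n ^+ 2) ^+ j * (n ^+ 2 * EVf n e t (SX (iter j SX p)) x)) -[RHS]/((n ^+ 2) ^+ j.+1 * EVf n e t (SX (iter j SX p)) x).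
by rewrite [(n ^+ 2) ^+ j.+1]exprS; ring.
Qed.

(** t^(-1/16), the unit of the weights [wta]. *)
Definition bq t : R := Num.sqrt (bt t).
Lemma bq_gt0 t : 0 < t -> 0 < bq t.
Proof. by move=> t0; rewrite sqrtr_gt0 bt_gt0. Qed.
Lemma bq_le1 t : 1 <= t -> bq t <= 1.
Proof. by move=> t1; rewrite -sqrtr1 ler_sqrt// bt_le1. Qed.
Lemma bq2 t : 0 < t -> bq t ^+ 2 = bt t.
Proof. by move=> t0; rewrite sqr_sqrtr// ltW// bt_gt0. Qed.
Lemma bq8 t : 0 < t -> bq t ^+ 8 = (Num.sqrt t)^-1.
Proof.
move=> t0; have b0 := bq_gt0 t0; have s0 : 0 < (Num.sqrt t)^-1 by rewrite invr_gt0 sqrtr_gt0.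
have e1 : (bq t ^+ 8) ^+ 2 = ((Num.sqrt t)^-1) ^+ 2.
  by rewrite exprVn sqr_sqrtr ?ltW// -exprM (_ : (8 * 2 = 2 * 8)%N)// exprM bq2// bt8.
by apply/eqP; rewrite -(@eqrXn2 _ 2%N) ?exprn_ge0 ?ltW//; apply/eqP.
Qed.

(** ln t = 16 ln t^(1/16) <= 16 t^(1/16), whence the weight 15 instead of 16. *)
Lemma lnt_bound t : 1 <= t -> 0 <= ln t / t <= 16 * bq t ^+ 15.
Proof.
move=> t1; have t0 : 0 < t by lra.
have b0 := bq_gt0 t0; have b1 := bq_le1 t1.
have e16 : t = (bq t)^-1 ^+ 16 by rewrite exprVn (_ : 16%N = (2 * 8)%N)// exprM bq2// bt8// invrK.
have L0 : 0 <= ln t by exact: ln_ge0.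
have y1 : 1 <= (bq t)^-1 by rewrite invf_ge1.
have Lb : ln t <= 16 * (bq t)^-1.
  have -> : ln t = 16 * ln (bq t)^-1 by rewrite mulr_natl -lnXn ?invr_gt0// -e16.
  rewrite ler_wpM2l//.
  have := @le_ln1Dx R ((bq t)^-1 - 1); rewrite (_ : 1 + ((bq t)^-1 - 1) = (bq t)^-1); last by ring.
  move=> h.
  by apply: (le_trans (h _)); lra.
apply/andP; split; first by rewrite divr_ge0// ltW.
rewrite {2}e16 exprVn invrK (_ : 16 * bq t ^+ 15 = 16 * (bq t)^-1 * bq t ^+ 16); last by rewrite [in RHS]exprS; field; rewrite gt_eqF.
by apply: ler_wpM2r => //; rewrite exprn_ge0// ltW.
Qed.

Definition Bat (i : nat) : R :=
  match i with 0 | 1 | 2 => 1 | 3 => 16 | 4 | 5 => 2 | 6 => Z + 1 | 7 | 8 => 1 | i.+4.+4.+1 => nm (dn i w) + nm (dn i.+1 w) end.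

Lemma Bat_ge0 i : 0 <= Bat i.
Proof.
have z1 := Z1; do 9! (case: i => [|i]; first by rewrite /=; lra).
by rewrite /= addr_ge0// nm_ge0.
Qed.

Lemma avl_bound n e t x i : env n e -> 1 <= t -> `|zz n t x| < Z + 1 ->
  `|avl w n e t x i| <= Bat i * (dd n ^+ (i == 0%N) * bq t ^+ wta i).
Proof.
move=> E t1 hz; have t0 : 0 < t by lra.
have [px /andP[k1 k2]] := in_region E hz; have [_ _ e0 e1] := E.
have k0 : 0 < kk n t x by rewrite sqrtr_gt0.
have [d0 d1] := dd_bounds E.
case: i => [|i]; first by rewrite /= expr1 expr0 mulr1 mul1r ger0_norm// ltW.
case: i => [|i]; first by rewrite /= !expr0 !mulr1 ger0_norm// ltW.
case: i => [|i]; first by rewrite [wta _]/= /= expr0 !mul1r bq8// ger0_norm// invr_ge0 sqrtr_ge0.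
case: i => [|i].
  by rewrite [wta _]/= /= expr0 !mul1r; have /andP[l1 l2] := lnt_bound t1; rewrite ger0_norm.
case: i => [|i].
  rewrite [wta _]/= /= !expr0 !mulr1 gtr0_norm// -(@ler_pXn2r _ 2%N) ?nnegrE ?(ltW k0)//; move: k2; lra.
case: i => [|i].
  rewrite [wta _]/= /= !expr0 !mulr1 gtr0_norm ?invr_gt0// -(@ler_pXn2r _ 2%N) ?nnegrE ?invr_ge0 ?(ltW k0)// exprVn.
  rewrite invf_ple ?posrE ?exprn_gt0//; apply: le_trans k1; lra.
case: i => [|i]; first by rewrite [wta _]/= /= !expr0 !mulr1 ltW.
case: i => [|i]; first by rewrite [wta _]/= /= !expr0 !mulr1 ler_norml cos_geN1 cos_le1.
case: i => [|i]; first by rewrite [wta _]/= /= !expr0 !mulr1 ler_norml sin_geN1 sin_le1.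
rewrite [wta _]/= [_ == _]/= !expr0 !mulr1.
exact: (cs_sup _ (cs_dn i cs_profile)).
Qed.

Lemma evm_bound n e t x m : env n e -> 1 <= t -> `|zz n t x| < Z + 1 ->
  `|evm (avl w n e t x) m| <= evm Bat m * (dd n ^+ dgm m * bq t ^+ wtm m).
Proof.
move=> E t1 hz; elim: m => [|i m ih]; first by rewrite !evm_nil normr1 !mulr1.
rewrite !evm_cons normrM; apply: (le_trans (ler_pM _ _ (avl_bound i E t1 hz) ih)) => //.
by rewrite /dgm /wtm /= !exprD; rewrite le_eqVlt; apply/orP; left; apply/eqP; ring.
Qed.

(** Each atom is bounded by a constant depending on w and Z only, times its formal weight; so [C] is
    read off the coefficients and serves all n, e, t. *)
Lemma EV_bound a k p : good a k p -> exists C, 0 <= C /\ forall n e t x, env n e -> 1 <= t ->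
  `|EV n e t x p| <= C * (dd n ^+ a * bq t ^+ k).
Proof.
move=> gp; pose C : R := \sum_(q <- p) `|zv q.1| * evm Bat q.2.
have B0 m : 0 <= evm Bat m by apply: prodr_ge0 => i _; exact: Bat_ge0.
have C0 : 0 <= C by apply: sumr_ge0 => q _; rewrite mulr_ge0.
exists C; split => // n e t x E t1; have [d0 d1] := dd_bounds E; have t0 : 0 < t by lra.
have b0 := bq_gt0 t0; have b1 := bq_le1 t1.
have r0 : 0 <= dd n ^+ a * bq t ^+ k by rewrite mulr_ge0// exprn_ge0// ltW.
have [hz|hz] := ltP `|zz n t x| (Z + 1); last first.
  have hz' : Z < `|zz n t x| by move: hz; clear; lra.
  by rewrite (EV_out _ (good00 gp) hz') normr0 mulr_ge0.
rewrite /ev /C mulr_suml; apply: (le_trans (ler_norm_sum _ _ _)).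
rewrite big_seq [leRHS]big_seq; apply: ler_sum => -[c m] hm; have /and3P[_ h1 h2] := allP gp _ hm.
rewrite normrM -mulrA ler_wpM2l//; apply: (le_trans (evm_bound m E t1 hz)); rewrite ler_wpM2l//.
by apply: ler_pM; rewrite ?exprn_ge0 ?(ltW d0) ?(ltW b0)//; apply: ler_wiXn2l; rewrite // ltW.
Qed.

(** The support has length of order n t; the root of t uses up 8 units of weight, the root of n
    stays. *)
Lemma nm_EV a k p : good a (k + 8) p -> exists C, 0 <= C /\ forall n e t, env n e -> 1 <= t ->
  nm (EVf n e t p) <= C * (dd n ^+ a * bq t ^+ k * Num.sqrt n).
Proof.
move=> gp; have [C [C0 hC]] := EV_bound gp; exists (2 * C * Num.sqrt Z); split.
  by rewrite !mulr_ge0// sqrtr_ge0.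
move=> n e t E t1; have t0 : 0 < t by lra.
have n0 := env_n0 E; have [n1 _ _ _] := E.
have [d0 d1] := dd_bounds E; have b0 := bq_gt0 t0.
have L1 : 1 <= Z * n * t by rewrite mulr_ege1// mulr_ege1//; exact: Z1.
have B0 : 0 <= C * (dd n ^+ a * bq t ^+ (k + 8)) by rewrite !mulr_ge0// exprn_ge0// ltW.
apply: (le_trans (nm_supp (p := - (3 * n ^+ 4 * t)) (cs_EV E t0 (good00 gp)) L1 B0 _ _)).
- by move=> x; exact: hC.
- by move=> x hx; apply: EV_out (good00 gp) _; exact: (EV_support E).
have Z0 : 0 <= Z by have := Z1; lra.
have Zn : 0 <= Z * n by rewrite mulr_ge0// ltW.
rewrite exprD bq8// (sqrtrM t Zn) (sqrtrM n Z0).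
rewrite le_eqVlt; apply/orP; left; apply/eqP; field.
by rewrite gt_eqF// sqrtr_gt0.
Qed.

End profile_bounds.

Section commutation.
Context {R : realType} (av : nat -> R).
Implicit Types (d : nat -> spoly) (p q : spoly).

Lemma spd_cat d p q : spd d (p ++ q) = spd d p ++ spd d q.
Proof. by rewrite /spd map_cat flatten_cat. Qed.

Lemma ev_dmono_cons d i m : ev av (dmono d (i :: m)) = ev av (d i) * evm av m + av i * ev av (dmono d m).
Proof.
rewrite -[dmono d (i :: m)]/(smulm (BinInt.Z.of_nat 1) m (d i) ++ smulm (BinInt.Z.of_nat 1) [:: i] (dmono d m)).
by rewrite ev_cat !ev_smulm evm_cons evm_nil zv_pos; ring.
Qed.
Lemma ev_dmono_cat d m n : ev av (dmono d (m ++ n)) = ev av (dmono d m) * evm av n + evm av m * ev av (dmono d n).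
Proof.
elim: m => [|i m ih]; first by rewrite /= ev_nil evm_nil; ring.
by rewrite cat_cons !ev_dmono_cons ih evm_cat evm_cons; ring.
Qed.
Lemma ev_spd_cons d c m p : ev av (spd d ((c, m) :: p)) = zv c * ev av (dmono d m) + ev av (spd d p).
Proof. by rewrite /spd /= ev_cat ev_smulm evm_nil mulr1. Qed.
Lemma ev_spd_smulm d c m p : ev av (spd d (smulm c m p)) = zv c * (ev av (dmono d m) * ev av p + evm av m * ev av (spd d p)).
Proof.
elim: p => [|[k n] p ih]; first by rewrite /smulm /spd /= !ev_nil; ring.
rewrite -[smulm c m ((k, n) :: p)]/((BinInt.Z.mul c k, m ++ n) :: smulm c m p).
by rewrite !ev_spd_cons ih zvM ev_dmono_cat ev_cons; ring.
Qed.

Lemma spd_comm d1 d2 p : (forall i, ev av (spd d1 (d2 i)) = ev av (spd d2 (d1 i))) -> ev av (spd d1 (spd d2 p)) = ev av (spd d2 (spd d1 p)).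
Proof.
move=> h; have hm m : ev av (spd d1 (dmono d2 m)) = ev av (spd d2 (dmono d1 m)).
  elim: m => [//|i m ih].
  rewrite -[dmono d1 (i :: m)]/(smulm (BinInt.Z.of_nat 1) m (d1 i) ++ smulm (BinInt.Z.of_nat 1) [:: i] (dmono d1 m)).
  rewrite -[dmono d2 (i :: m)]/(smulm (BinInt.Z.of_nat 1) m (d2 i) ++ smulm (BinInt.Z.of_nat 1) [:: i] (dmono d2 m)).
  rewrite !spd_cat !ev_cat !ev_spd_smulm !ev_dmono_cons !evm_cons !evm_nil !zv_pos h ih /= !ev_nil; ring.
elim: p => [//|[c m] p ih].
rewrite -[spd d1 ((c, m) :: p)]/(smulm c [::] (dmono d1 m) ++ spd d1 p) -[spd d2 ((c, m) :: p)]/(smulm c [::] (dmono d2 m) ++ spd d2 p).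
by rewrite !spd_cat !ev_cat ih !ev_spd_smulm hm /= !ev_nil evm_nil; ring.
Qed.

(** Needed to differentiate the x derivatives of V in time. Derivations that commute on atoms
    commute on polynomials; the first nine atoms are settled by reduction, the derivatives of w by
    one identity for all orders. *)
Lemma SX_ST_comm p : av 4 * av 5 = 1 -> av 7 ^+ 2 + av 8 ^+ 2 = 1 -> ev av (SX (ST p)) = ev av (ST (SX p)).
Proof.
move=> h1 h2; apply: spd_comm => i; apply/eqP; rewrite -subr_eq0; apply/eqP.
have e q1 q2 : ev av q1 - ev av q2 = ev av (normA (q1 ++ smulm (BinInt.Z.opp (BinInt.Z.of_nat 1)) [::] q2)).
  by rewrite ev_normA// ev_cat ev_smulm zv_neg evm_nil; ring.
do 9! (case: i => [|i]; first by rewrite e (_ : normA _ = [::]) ?ev_nil//; vm_compute).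
rewrite -[dta _]/[:: (BinInt.Z.of_nat 18, [:: 0; 2; 2; 4; 4; i.+4.+4.+2]%N)] -[dxa i.+4.+4.+1]/[:: (BinInt.Z.of_nat 6, [:: 0; 2; 2; i.+4.+4.+2]%N)].
rewrite !ev_spd_cons !ev_dmono_cons !evm_cons !evm_nil !zv_pos.
rewrite -[dxa i.+4.+4.+2]/[:: (BinInt.Z.of_nat 6, [:: 0; 2; 2; i.+4.+4.+3]%N)] -[dta i.+4.+4.+2]/[:: (BinInt.Z.of_nat 18, [:: 0; 2; 2; 4; 4; i.+4.+4.+3]%N)].
rewrite -[dxa 4]/[:: (BinInt.Z.opp (BinInt.Z.of_nat 6), [:: 0; 0; 2; 2; 5]%N)] -[dta 2]/[:: (BinInt.Z.opp (BinInt.Z.of_nat 18), [:: 0; 0; 2; 2; 2]%N)].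
rewrite -[dxa 0]/(Nil (BinNums.Z * mono)) -[dxa 2]/(Nil (BinNums.Z * mono)) -[dta 0]/(Nil (BinNums.Z * mono)).
rewrite -[spd dxa [::]]/(Nil (BinNums.Z * mono)) -[spd dta [::]]/(Nil (BinNums.Z * mono)) -[dmono dxa [::]]/(Nil (BinNums.Z * mono)) -[dmono dta [::]]/(Nil (BinNums.Z * mono)).
rewrite !ev_cons !ev_nil !evm_cons !evm_nil !zv_pos !zv_neg.
have -> : av 5 = (av 4)^-1 by apply: (mulfI (x := av 4)); rewrite ?h1 ?divff//; apply/eqP => z; move: h1; rewrite z mul0r => /esym/eqP; rewrite oner_eq0.
have n4 : av 4 != 0 by apply/eqP => z; move: h1; rewrite z mul0r => /esym/eqP; rewrite oner_eq0.
by field.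
Qed.

End commutation.

Lemma good_smulm a k c p : good a k p -> good a k (smulm c [::] p).
Proof. by rewrite /good /smulm all_map; apply: sub_all => q. Qed.
Lemma good_catI a k p q : good a k p -> good a k q -> good a k (p ++ q).
Proof. by move=> hp hq; rewrite good_cat hp hq. Qed.

#[local] Opaque spd good pgood p_main p_third q_DD.
Section approximate_solution.
Context {R : realType} (w : R -> R) (Z : R) (sw : smooth w) (Z1 : 1 <= Z) (hw : forall y, Z < `|y| -> w y = 0).
Implicit Types (n e t x : R) (p : spoly).
Notation EV n e t x p := (ev (avl w n e t x) p).
Notation EVf := (EVf w).
Notation env := (env Z).

Lemma avl_rel n e t x : env n e -> `|zz n t x| < Z + 1 ->
  [/\ avl w n e t x 4 * avl w n e t x 5 = 1, avl w n e t x 7 ^+ 2 + avl w n e t x 8 ^+ 2 = 1 &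
   avl w n e t x 4 ^+ 2 = 1 - 2 * avl w n e t x 0 * avl w n e t x 6].
Proof.
move=> E hz; have [px _] := in_region E hz; have k0 : 0 < kk n t x by rewrite sqrtr_gt0.
split; [by rewrite /= divff// gt_eqF|by rewrite /= cos2Dsin2|by rewrite /= sqr_sqrtr// ltW].
Qed.

Lemma EV_eq n e t p q : env n e -> good 0 0 p -> good 0 0 q ->
  (forall x, `|zz n t x| < Z + 1 -> EV n e t x p = EV n e t x q) -> EVf n e t p = EVf n e t q.
Proof.
move=> E gp gq h; apply/funext => x; have [hz|hz] := ltP `|zz n t x| (Z + 1); first exact: h.
have hz' : Z < `|zz n t x| by move: hz; clear; lra.
by rewrite /EVf (EV_out Z1 hw _ gp hz') (EV_out Z1 hw _ gq hz').
Qed.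

Lemma SX_ST_EV n e t p : env n e -> good 0 0 p -> EVf n e t (SX (ST p)) = EVf n e t (ST (SX p)).
Proof.
move=> E gp; apply: (EV_eq E) => [||x hz]; [by apply/good_SX/good_ST|by apply/good_ST/good_SX|].
by have [h1 h2 _] := avl_rel E hz; exact: SX_ST_comm.
Qed.

Lemma iter_SX_ST n e t p j : env n e -> 0 < t -> good 0 0 p -> EVf n e t (iter j SX (ST p)) = EVf n e t (ST (iter j SX p)).
Proof.
move=> E t0 gp; elim: j => [//|j ih]; rewrite !iterS -(SX_ST_EV t E (good_iter j gp)).
have h1 := dx_EV sw Z1 hw E t0 (good_iter j (good_ST gp)); have h2 := dx_EV sw Z1 hw E t0 (good_ST (good_iter j gp)).
rewrite ih h2 in h1; apply/funext => x; have := congr1 (fun f => f x) h1.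
rewrite -[_ x]/(n ^+ 2 * EVf n e t (SX (ST (iter j SX p))) x) -[RHS]/(n ^+ 2 * EVf n e t (SX (iter j SX (ST p))) x).
by move/mulfI => ->//; rewrite expf_neq0// gt_eqF// (env_n0 E).
Qed.

Lemma nm_cEV c n e t p B : env n e -> 0 < t -> good 0 0 p -> 0 <= c -> nm (EVf n e t p) <= B -> nm (cst c * EVf n e t p) <= c * B.
Proof. by move=> E t0 gp c0 h; apply: nm_scale_le; [exact: (cs_EV sw Z1 hw)|exact: c0|exact: h]. Qed.

(** Here the constant may depend on n, since these bounds only feed [CN]. *)
Lemma HK_EV K a k p : good a (k + 8) p -> forall n e, env n e -> exists C, 0 <= C /\ forall t, 1 <= t -> HK K (C * bq t ^+ k) (EVf n e t p).
Proof.
move=> gp n e E; elim: K => [|K [C [C0 hC]]].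
  have [C [C0 hC]] := nm_EV sw Z1 hw gp; have [d0 d1] := dd_bounds E.
  exists (C * (dd n ^+ a * Num.sqrt n)); split; first by rewrite !mulr_ge0 ?exprn_ge0 ?sqrtr_ge0// ltW.
  move=> t t1 [|//] _; rewrite /=; apply: (le_trans (hC n e t E t1)); rewrite le_eqVlt; apply/orP; left; apply/eqP; ring.
have [C' [C'0 hC']] := nm_EV sw Z1 hw (good_iter K.+1 gp); have [d0 d1] := dd_bounds E.
have n0 := env_n0 E.
pose D := (n ^+ 2) ^+ K.+1 * (C' * (dd n ^+ a * Num.sqrt n)).
have D0 : 0 <= D by rewrite !mulr_ge0 ?exprn_ge0 ?sqrtr_ge0// ltW.
exists (C + D); split; first exact: addr_ge0.
move=> t t1 j; have t0 : 0 < t by lra.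
have b0 := bq_gt0 t0; have bk : 0 <= bq t ^+ k by rewrite exprn_ge0// ltW.
rewrite leq_eqVlt => /orP[/eqP ->|jK]; last first.
  by apply: (le_trans (hC t t1 j jK)); rewrite mulrDl lerDl mulr_ge0.
rewrite (dn_EV sw Z1 hw _ E t0 (good00 gp)).
apply: (le_trans (nm_cEV E t0 (good_iter K.+1 (good00 gp)) _ (hC' n e t E t1))); first by rewrite exprn_ge0// exprn_ge0// ltW.
rewrite mulrDl; apply: (@le_trans _ _ (D * bq t ^+ k)); last by rewrite lerDr mulr_ge0.
by rewrite /D le_eqVlt; apply/orP; left; apply/eqP; ring.
Qed.

Lemma sup_EV K a k p : good a k p -> forall n e, env n e -> exists C, 0 <= C /\ forall t, 1 <= t -> forall x j, (j <= K)%N -> `|dn j (EVf n e t p) x| <= C * bq t ^+ k.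
Proof.
move=> gp n e E; elim: K => [|K [C [C0 hC]]].
  have [C [C0 hC]] := EV_bound sw Z1 hw gp; have [d0 d1] := dd_bounds E.
  exists (C * dd n ^+ a); split; first by rewrite !mulr_ge0 ?exprn_ge0// ltW.
  by move=> t t1 x [|//] _; rewrite /= -mulrA; exact: hC.
have [C' [C'0 hC']] := EV_bound sw Z1 hw (good_iter K.+1 gp); have [d0 d1] := dd_bounds E.
have n0 := env_n0 E.
pose D := (n ^+ 2) ^+ K.+1 * (C' * dd n ^+ a).
have D0 : 0 <= D by rewrite !mulr_ge0 ?exprn_ge0// ltW.
exists (C + D); split; first exact: addr_ge0.
move=> t t1 x j; have t0 : 0 < t by lra.
have b0 := bq_gt0 t0; have bk : 0 <= bq t ^+ k by rewrite exprn_ge0// ltW.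
rewrite leq_eqVlt => /orP[/eqP ->|jK]; last first.
  by apply: (le_trans (hC t t1 x j jK)); rewrite mulrDl lerDl mulr_ge0.
rewrite (dn_EV sw Z1 hw _ E t0 (good00 gp)) -[(cst _ * _) x]/((n ^+ 2) ^+ K.+1 * EV n e t x (iter K.+1 SX p)).
rewrite normrM ger0_norm ?exprn_ge0 ?exprn_ge0 ?(ltW n0)// mulrDl; apply: (@le_trans _ _ (D * bq t ^+ k)); last by rewrite lerDr mulr_ge0.
rewrite /D -!mulrA; apply: ler_wpM2l; [by rewrite exprn_ge0// exprn_ge0// ltW|exact: hC'].
Qed.

Definition app_V n e t : R -> R := cst (e / n) * EVf n e t p_V.
Definition app_Vt n e t : R -> R := cst (e * n ^+ 5) * EVf n e t (ST p_V).
Lemma gV0 : good 0 0 p_V. Proof. by vm_compute. Qed.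
Lemma gE0 : good 0 0 p_E. Proof. by vm_compute. Qed.

Lemma dx_cEV c n e t p : env n e -> 0 < t -> good 0 0 p -> dx (cst c * EVf n e t p) = cst (c * n ^+ 2) * EVf n e t (SX p).
Proof.
move=> E t0 gp; have dc : dble (cst c : R -> R) by move=> x; exact: derivable_cst.
rewrite (dxM dc (cs_dble (cs_EV sw Z1 hw E t0 gp))) dx_cst (dx_EV sw Z1 hw)//; apply/funext => x.
by rewrite -[LHS]/(0 * EVf n e t p x + c * (n ^+ 2 * EVf n e t (SX p) x)) -[RHS]/(c * n ^+ 2 * EVf n e t (SX p) x); ring.
Qed.

Definition DDp p := SX (SX (SX (SX p))) ++ smulm (BinInt.Z.of_nat 2) [::] (SX (SX p)) ++ p.
Lemma ev_DDp (av : nat -> R) p q : ev av (DDp (p ++ q)) = ev av (DDp p) + ev av (DDp q).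
Proof. by rewrite /DDp !spd_cat !ev_cat !ev_smulm !ev_cat; ring. Qed.
Lemma good_DDp a k p : good a k p -> good a k (DDp p).
Proof.
move=> gp; have g2 := good_SX (good_SX gp); apply: good_catI; first exact: (good_SX (good_SX g2)).
by apply: (good_catI _ gp); exact: good_smulm.
Qed.
(** The third harmonic carries delta^2 already, so its image needs no reduction. *)
Definition q_all := q_DD ++ DDp p_third.
Lemma good_q_all : good 2 8 q_all.
Proof.
have g3 : good 2 8 p_third by vm_compute.
exact: (good_catI good_qDD (good_DDp g3)).
Qed.

Lemma Dop_Dop_EV n e t p : env n e -> 0 < t -> good 0 0 p ->
  Dop (n ^+ 2) (Dop (n ^+ 2) (cst (e / n) * EVf n e t p)) = cst (e * n ^+ 7) * EVf n e t (DDp p).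
Proof.
move=> E t0 gp; have n0 := env_n0 E.
have g1 := good_SX gp; have g2 := good_SX g1; have g3 := good_SX g2; have g4 := good_SX g3.
have d0 c := dx_cEV c E t0 gp; have d1 c := dx_cEV c E t0 g1; have d2 c := dx_cEV c E t0 g2; have d3 c := dx_cEV c E t0 g3.
have ca : cs (cst (e / n * n ^+ 2 * n ^+ 2) * EVf n e t (SX (SX p))) by apply: csZ; exact: (cs_EV sw Z1 hw E t0 g2).
have cb : cs (cst (e / n) * EVf n e t p) by apply: csZ; exact: (cs_EV sw Z1 hw E t0 gp).
have c1 : cs (cst ((n ^+ 2) ^+ 2) * (cst (e / n) * EVf n e t p)) by exact: csZ.
have eq1 : Dop (n ^+ 2) (cst (e / n) * EVf n e t p) = cst (e / n * n ^+ 2 * n ^+ 2) * EVf n e t (SX (SX p)) + cst ((n ^+ 2) ^+ 2) * (cst (e / n) * EVf n e t p).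
  by rewrite /Dop d0 d1.
rewrite eq1 Dop_add // /Dop d2 d3.
have -> : cst ((n ^+ 2) ^+ 2) * (cst (e / n) * EVf n e t p) = cst ((n ^+ 2) ^+ 2 * (e / n)) * EVf n e t p.
  by apply/funext => x; rewrite -[LHS]/((n ^+ 2) ^+ 2 * (e / n * EVf n e t p x)) mulrA.
rewrite d0 d1; apply/funext => x.
have -> : (cst (e * n ^+ 7) * EVf n e t (DDp p)) x = e * n ^+ 7 * (EVf n e t (SX (SX (SX (SX p)))) x + (2 * EVf n e t (SX (SX p)) x + EVf n e t p x)).
  by rewrite -[LHS]/(e * n ^+ 7 * EV n e t x (DDp p)) /DDp !ev_cat ev_smulm evm_nil zv_pos mulr1.
move: (EVf n e t p) (EVf n e t (SX (SX p))) (EVf n e t (SX (SX (SX (SX p))))) => a b c.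
ptw; by field; rewrite gt_eqF.
Qed.

Lemma q_all_EV n e t : env n e -> EVf n e t q_all = EVf n e t (DDp p_V).
Proof.
move=> E; apply: (EV_eq E) => [||x hz]; [exact: good00 good_q_all|exact: good_DDp gV0|].
have [h1 h2 h3] := avl_rel E hz.
have e1 : EV n e t x q_all = EV n e t x q_DD + EV n e t x (DDp p_third) := ev_cat _ _ _.
have e2 := ev_DDp (avl w n e t x) p_main p_third.
have e3 : EV n e t x (DDp p_main) = EV n e t x q_DD := DD_low h1 h2 h3.
have -> : p_V = p_main ++ p_third by reflexivity.
exact: (etrans e1 (etrans (esym (congr1 (fun u => u + EV n e t x (DDp p_third)) e3)) (esym e2))).
Qed.

Definition resp p := ST p ++ SX (SX (SX p)) ++ smulm (BinInt.Z.opp (BinInt.Z.of_nat 216)) [:: 0; 0; 1; 1]%N (smul p (smul p (SX p))).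

Lemma residual_EV n e t p : env n e -> 0 < t -> good 0 0 p ->
  cst (e * n ^+ 5) * EVf n e t (ST p) - Phi (cst (e / n) * EVf n e t p) = cst (e * n ^+ 5) * EVf n e t (resp p).
Proof.
move=> E t0 gp; have n0 := env_n0 E.
have g1 := good_SX gp; have g2 := good_SX g1; have g3 := good_SX g2.
have d0 c := dx_cEV c E t0 gp; have d1 c := dx_cEV c E t0 g1; have d2 c := dx_cEV c E t0 g2.
rewrite /Phi d0 d1 d2; apply/funext => x.
have -> : (cst (e * n ^+ 5) * EVf n e t (resp p)) x = e * n ^+ 5 * (EVf n e t (ST p) x + (EVf n e t (SX (SX (SX p))) x - 216 * (dd n * (dd n * (e * e))) * (EVf n e t p x * (EVf n e t p x * EVf n e t (SX p) x)))).
  rewrite -[LHS]/(e * n ^+ 5 * EV n e t x (resp p)) /resp !ev_cat ev_smulm !ev_smul !evm_cons evm_nil zv_neg.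
  by rewrite -[avl _ _ _ _ _ 0]/(dd n) -[avl _ _ _ _ _ 1]/e !mulr1 !mulNr.
rewrite /dd; move: (EVf n e t (ST p)) (EVf n e t (SX (SX (SX p)))) (EVf n e t (SX p)) (EVf n e t p) => a b c d.
ptw; by field; rewrite gt_eqF.
Qed.

Lemma resp_EV n e t : env n e -> EVf n e t (resp p_V) = EVf n e t (pgood 2 38 p_E).
Proof.
move=> E; apply: (EV_eq E) => [||x hz]; [exact: gE0|exact: good00 good_E|].
have [h1 h2 h3] := avl_rel E hz; exact: (E_low h1 h2).
Qed.

End approximate_solution.

#[local] Opaque spd good pgood p_main p_third q_DD.

Section approximate_data.
Context {R : realType} (w : R -> R) (Z : R) (sw : smooth w) (Z1 : 1 <= Z) (hw : forall y, Z < `|y| -> w y = 0).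
Implicit Types (n e t x : R) (p : spoly).
Notation EV n e t x p := (ev (avl w n e t x) p).
Notation EVf := (EVf w).
Notation env := (env Z).

Lemma taylor2 (h h1 h2 : R -> R) (t s M : R) : 0 < s -> 1 <= t - s ->
  (forall y : R, 0 < y -> is_derive y 1 h (h1 y)) -> (forall y : R, 0 < y -> is_derive y 1 h1 (h2 y)) ->
  (forall y : R, t - s <= y <= t -> `|h2 y| <= M) -> `|h (t - s) - h t + s * h1 t| <= s ^+ 2 * M.
Proof.
move=> s0 ts d1 d2 hM.
have ts' : t - s < t by lra.
have cont (f f' : R -> R) a b : 0 < a -> (forall y : R, 0 < y -> is_derive y 1 f (f' y)) -> {within `[a, b], continuous f}.
  move=> a0 df; apply: derivable_within_continuous => y; rewrite in_itv/= => /andP[ay _].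
  by have [] := df y (lt_le_trans a0 ay).
have ts0 : 0 < t - s by lra.
have in0 (a b y : R) : 0 < a -> y \in `]a, b[ -> 0 < y by move=> a0; rewrite in_itv/= => /andP[ay _]; lra.
have [c hc e1] := MVT ts' (fun y hy => d1 y (in0 _ _ _ ts0 hy)) (cont h h1 (t - s) t ts0 d1).
have /andP[c1 c2] : t - s < c < t by move: hc; rewrite in_itv.
have c0 : 0 < c by lra.
have [c' hc' e2] := MVT c2 (fun y hy => d2 y (in0 _ _ _ c0 hy)) (cont h1 h2 c t c0 d2).
have /andP[c3 c4] : c < c' < t by move: hc'; rewrite in_itv.
have -> : h (t - s) - h t + s * h1 t = s * ((t - c) * h2 c').
  have -> : h (t - s) = h t - h1 c * s by move: e1; rewrite (_ : t - (t - s) = s); [lra|ring].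
  have -> : h1 t = h1 c + h2 c' * (t - c) by move: e2; lra.
  ring.
have tc : 0 <= t - c by lra.
have hM' : `|h2 c'| <= M by apply: hM; apply/andP; split; lra.
rewrite !normrM (gtr0_norm s0) (ger0_norm tc) expr2 -mulrA; apply: ler_wpM2l; first exact: ltW.
by apply: ler_pM => //; lra.
Qed.

(** The x derivatives are first moved onto the polynomial, then Taylor's formula is used in t at
    fixed x. The support moves with speed 3 n^4, so the functions at both times are supported in one
    interval of length of order t. *)
Lemma taylor_EV_nm k j p n e : good 0 8 p -> env n e -> 0 <= k -> exists C, 0 <= C /\ forall t s, 0 < s <= 1 -> 1 <= t - s ->
  nm (dn j (cst k * EVf n e (t - s) p - cst k * EVf n e t p + cst s * (cst (k * n ^+ 6) * EVf n e t (ST p)))) <= C * s ^+ 2.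
Proof.
move=> gp E k0; have n0 := env_n0 E; have n1 : 1 <= n by case: E.
pose q := iter j SX p; have gq : good 0 8 q := good_iter j gp.
have gq2 : good 0 8 (ST (ST q)) := good_ST (good_ST gq).
have [M [M0 hM]] := EV_bound sw Z1 hw gq2.
pose L0 := Z * n + 3 * n ^+ 4.
have n41 : 1 <= n ^+ 4 by rewrite exprn_ege1.
have Z0 : 0 <= Z by have := Z1; lra.
have Zn : 0 <= Z * n by rewrite mulr_ge0// ltW.
have L01 : 1 <= L0 by rewrite /L0; lra.
pose D := k * (n ^+ 2) ^+ j * (n ^+ 6 * n ^+ 6 * M).
have D0 : 0 <= D by rewrite !mulr_ge0 ?exprn_ge0// ltW.
exists (4 * D * Num.sqrt L0); split; first by apply: mulr_ge0; [exact: mulr_ge0|exact: sqrtr_ge0].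
move=> t s /andP[s0 s1] ts; have t0 : 0 < t by lra.
have ts0 : 0 < t - s by lra.
have g0 := good00 gp; have gq0 := good00 gq.
have cA : cs (cst k * EVf n e (t - s) p) by apply: csZ; exact: (cs_EV sw Z1 hw E ts0 g0).
have cB : cs (cst k * EVf n e t p) by apply: csZ; exact: (cs_EV sw Z1 hw E t0 g0).
have cC0 : cs (cst (k * n ^+ 6) * EVf n e t (ST p)) by apply: csZ; exact: (cs_EV sw Z1 hw E t0 (good_ST g0)).
have cC : cs (cst s * (cst (k * n ^+ 6) * EVf n e t (ST p))) by exact: csZ.
set F := (X in dn j X); have cF : cs F := csD (csB cA cB) cC.
have eF x : dn j F x = k * (n ^+ 2) ^+ j * (EV n e (t - s) x q - EV n e t x q + s * (n ^+ 6 * EV n e t x (ST q))).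
  rewrite /F (dn_add j (csB cA cB) cC) (dn_add j cA (csN cB)) (dn_opp j cB) (dn_scale j s cC0).
  rewrite (dn_scale j k (cs_EV sw Z1 hw E ts0 g0)) (dn_scale j k (cs_EV sw Z1 hw E t0 g0)) (dn_scale j _ (cs_EV sw Z1 hw E t0 (good_ST g0))).
  rewrite (dn_EV sw Z1 hw j E ts0 g0) (dn_EV sw Z1 hw j E t0 g0) (dn_EV sw Z1 hw j E t0 (good_ST g0)) (iter_SX_ST sw Z1 hw j E t0 g0) -/q.
  by rewrite -[LHS]/(k * ((n ^+ 2) ^+ j * EV n e (t - s) x q) - k * ((n ^+ 2) ^+ j * EV n e t x q) + s * (k * n ^+ 6 * ((n ^+ 2) ^+ j * EV n e t x (ST q)))); ring.
apply: (le_trans (nm_supp (p := - (3 * n ^+ 4 * t)) (L := L0 * t) (B := D * s ^+ 2 * (Num.sqrt (t - s))^-1) (cs_dn j cF) _ _ _ _)).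
- by rewrite mulr_ege1//; lra.
- by apply: mulr_ge0; [apply: mulr_ge0 => //; exact: sqr_ge0|rewrite invr_ge0 sqrtr_ge0].
- move=> x; rewrite eF.
  have h := @taylor2 (fun y => EV n e y x q) (fun y => n ^+ 6 * EV n e y x (ST q)) (fun y => n ^+ 6 * (n ^+ 6 * EV n e y x (ST (ST q)))) t s (n ^+ 6 * n ^+ 6 * M * (Num.sqrt (t - s))^-1) s0 ts.
  rewrite normrM ger0_norm; last by rewrite mulr_ge0// exprn_ge0// exprn_ge0// ltW.
  apply: (@le_trans _ _ (k * (n ^+ 2) ^+ j * (s ^+ 2 * (n ^+ 6 * n ^+ 6 * M * (Num.sqrt (t - s))^-1)))); last by rewrite /D le_eqVlt; apply/orP; left; apply/eqP; ring.
  apply: ler_wpM2l; first by rewrite mulr_ge0// exprn_ge0// exprn_ge0// ltW.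
  apply: h.
  + by move=> y y0; exact: (EV_dt sw Z1 hw x E y0 gq0).
  + by move=> y y0; apply: der_scale; exact: (EV_dt sw Z1 hw x E y0 (good_ST gq0)).
  + move=> y /andP[y1 y2]; have y0 : 0 < y by lra.
    have y11 : 1 <= y by lra.
    have N60 : 0 <= n ^+ 6 by apply: exprn_ge0; exact: ltW.
    move: (n ^+ 6) N60 => N6 N60; rewrite normrM normrM ger0_norm//.
    rewrite (_ : N6 * N6 * M / _ = N6 * (N6 * (M / Num.sqrt (t - s)))); last by ring.
    do 2! (apply: ler_wpM2l => //).
    apply: (le_trans (hM n e y x E y11)); rewrite expr0 mul1r bq8//; apply: ler_wpM2l => //.
    have sy : Num.sqrt (t - s) <= Num.sqrt y := ler_wsqrtr y1.
    have st0 : 0 < Num.sqrt (t - s) by rewrite sqrtr_gt0.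
    by rewrite lef_pV2// posrE; exact: lt_le_trans st0 sy.
- move=> x hx; rewrite eF.
  have h1 : Z < `|zz n t x|.
    apply: (EV_support E t0); apply: le_lt_trans hx; rewrite /L0 mulrDl lerDl.
    by rewrite !mulr_ge0 ?exprn_ge0// ltW.
  have h2 : Z < `|zz n (t - s) x|.
    apply: (EV_support E ts0).
    have a0 : 0 <= n ^+ 4 by rewrite exprn_ge0// ltW.
    have := ler_normD (x - - (3 * n ^+ 4 * (t - s))) (3 * n ^+ 4 * s).
    rewrite (_ : x - - (3 * n ^+ 4 * (t - s)) + 3 * n ^+ 4 * s = x - - (3 * n ^+ 4 * t)); last by ring.
    rewrite (ger0_norm (_ : 0 <= 3 * n ^+ 4 * s)); last by rewrite !mulr_ge0// ltW.
    move: hx; rewrite /L0; set X1 := `|_|; set X2 := `|_|; clearbody X1 X2 => hx hX.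
    have b1 : Z * n * (t - s) <= Z * n * t by apply: ler_wpM2l; [rewrite mulr_ge0 ?(ltW n0)//; have := Z1; lra|lra].
    have b2 : n ^+ 4 * s <= n ^+ 4 * t by apply: ler_wpM2l => //; lra.
    move: hx hX b1 b2; clear; lra.
  rewrite (EV_out Z1 hw e gq0 h1) (EV_out Z1 hw e gq0 h2) (EV_out Z1 hw e (good_ST gq0) h1); ring.
rewrite sqrtrM; last by lra.
have st : Num.sqrt t <= 2 * Num.sqrt (t - s).
  rewrite -(@ler_pXn2r _ 2%N) ?nnegrE ?mulr_ge0 ?sqrtr_ge0// exprMn !sqr_sqrtr ?(ltW t0) ?(ltW ts0)//; lra.
have q0 : 0 < Num.sqrt (t - s) by rewrite sqrtr_gt0.
have K0 : 0 <= 2 * D * s ^+ 2 * Num.sqrt L0 by apply: mulr_ge0; [apply: mulr_ge0; [exact: mulr_ge0|exact: sqr_ge0]|exact: sqrtr_ge0].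
have -> : 2 * (D * s ^+ 2 / Num.sqrt (t - s)) * (Num.sqrt L0 * Num.sqrt t) = 2 * D * s ^+ 2 * Num.sqrt L0 * (Num.sqrt t / Num.sqrt (t - s)) by ring.
have -> : 4 * D * Num.sqrt L0 * s ^+ 2 = 2 * D * s ^+ 2 * Num.sqrt L0 * 2 by ring.
by apply: ler_wpM2l => //; rewrite ler_pdivrMr.
Qed.

Lemma HK_all (T : Type) (P : T -> Prop) (F : T -> R -> R) (G : T -> R) K : (forall a, P a -> 0 <= G a) ->
  (forall j, exists C, 0 <= C /\ forall a, P a -> nm (dn j (F a)) <= C * G a) ->
  exists C, 0 <= C /\ forall a, P a -> HK K (C * G a) (F a).
Proof.
move=> G0 h; elim: K => [|K [C [C0 hC]]].
  by have [C [C0 hC]] := h 0%N; exists C; split => // a Pa [|//] _; exact: hC.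
have [D [D0 hD]] := h K.+1; exists (C + D); split; first exact: addr_ge0.
move=> a Pa j; have Ga := G0 a Pa; rewrite leq_eqVlt => /orP[/eqP ->|jK].
  by apply: (le_trans (hD a Pa)); rewrite mulrDl lerDr mulr_ge0.
by apply: (le_trans (hC a Pa j jK)); rewrite mulrDl lerDl mulr_ge0.
Qed.

Lemma taylor_EV K k p n e : good 0 8 p -> env n e -> 0 <= k -> exists C, 0 <= C /\ forall t s, 0 < s <= 1 -> 1 <= t - s ->
  HK K (C * s ^+ 2) (cst k * EVf n e (t - s) p - cst k * EVf n e t p + cst s * (cst (k * n ^+ 6) * EVf n e t (ST p))).
Proof.
move=> gp E k0.
pose F (a : R * R) := cst k * EVf n e (a.1 - a.2) p - cst k * EVf n e a.1 p + cst a.2 * (cst (k * n ^+ 6) * EVf n e a.1 (ST p)).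
have hj j : exists C, 0 <= C /\ forall a : R * R, 0 < a.2 <= 1 /\ 1 <= a.1 - a.2 -> nm (dn j (F a)) <= C * a.2 ^+ 2.
  by have [C [C0 h]] := taylor_EV_nm j gp E k0; exists C; split => // -[t s] /= [hs ts]; exact: h.
have [C [C0 hC]] := HK_all K (fun (a : R * R) _ => sqr_ge0 a.2) hj.
by exists C; split => // t s hs ts; exact: (hC (t, s) (conj hs ts)).
Qed.

(** [c] adds up the constants of [nm_EV] and [EV_bound], which are uniform; [CN] is built afterwards
    and depends on n and e. The powers of n match through N = n^2, m = e / n^(1/2) and delta =
    n^(-3) / 6; for the residual, e n^5 delta^2 n^(1/2) = m / 36. *)
Theorem approximate_Vdata : exists c, 0 <= c /\ forall n e, env n e -> exists CN,
  Vdata c (n ^+ 2) n (e / Num.sqrt n) e CN (app_V w n e) (app_Vt w n e).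
Proof.
have [C1 [C10 h1]] := nm_EV (a := 0) (k := 0) sw Z1 hw good_V.
have [C2 [C20 h2]] := nm_EV (a := 0) (k := 0) sw Z1 hw (good_SX (good_SX good_V)).
have [C3 [C30 h3]] := nm_EV (a := 2) (k := 0) sw Z1 hw good_q_all.
have [C4 [C40 h4]] := EV_bound sw Z1 hw good_V.
have [C5 [C50 h5]] := EV_bound sw Z1 hw (good_SX good_V).
have [C6 [C60 h6]] := nm_EV (a := 2) (k := 30) sw Z1 hw good_E.
pose c := C1 + C2 + C3 + C4 + C5 + C6.
have [q1 q2 q3 q4 [q5 q6]] : [/\ C1 <= c, C2 <= c, C3 <= c, C4 <= c & C5 <= c /\ C6 <= c].
  by rewrite /c; split; [| | | |split]; lra.
exists c; split; first by rewrite /c; lra.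
move=> n e E; have [n1 nZ e0 e1] := E; have n0 := env_n0 E.
have k0 : 0 <= e / n by rewrite divr_ge0// ltW.
have pw k : 0 <= n ^+ k := exprn_ge0 k (ltW n0).
have bw t k : 0 < t -> 0 <= bt t ^+ k by move=> t0; exact: exprn_ge0 (ltW (bt_gt0 t0)).
have k1 : 0 <= e * n ^+ 5 by exact: mulr_ge0 (ltW e0) (pw 5%N).
have s0 : 0 < Num.sqrt n by rewrite sqrtr_gt0.
have s2 : Num.sqrt n ^+ 2 = n by rewrite sqr_sqrtr// ltW.
have [T [T0 hT]] := taylor_EV 4 good_V E k0.
have [A1 [A10 a1]] := HK_EV sw Z1 hw 4 (k := 30) good_E E.
have [A2 [A20 a2]] := HK_EV sw Z1 hw 8 (k := 0) good_V E.
have [A3 [A30 a3]] := HK_EV sw Z1 hw 4 (k := 0) (good_ST good_V) E.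
have [A4 [A40 a4]] := sup_EV sw Z1 hw 5 good_V E.
have g0 := gV0.
have g1 := good_SX g0; have g2 := good_SX g1.
have l1 : 0 <= e * n ^+ 5 * A1 by exact: mulr_ge0.
have l2 : 0 <= e / n * A2 by exact: mulr_ge0.
have l3 : 0 <= e * n ^+ 5 * A3 by exact: mulr_ge0.
have l4 : 0 <= e / n * A4 by exact: mulr_ge0.
pose CN := 1 + e * n ^+ 5 * A1 + e / n * A2 + e * n ^+ 5 * A3 + e / n * A4 + T.
have [r1 r2 r3 r4 r5] : [/\ e * n ^+ 5 * A1 <= CN, e / n * A2 <= CN, e * n ^+ 5 * A3 <= CN, e / n * A4 <= CN & T <= CN].
  by move: l1 l2 l3 l4 T0; rewrite /CN; move: (e * n ^+ 5 * A1) (e / n * A2) (e * n ^+ 5 * A3) (e / n * A4) => *; split; lra.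
have CN1 : 1 <= CN.
  by move: l1 l2 l3 l4 T0; rewrite /CN; move: (e * n ^+ 5 * A1) (e / n * A2) (e * n ^+ 5 * A3) (e / n * A4) => *; lra.
have b8 t : 0 < t -> bq t ^+ 8 = bt t ^+ 4 by move=> t0; rewrite (_ : 8 = 2 * 4)%N// exprM bq2.
have b30 t : 0 < t -> bq t ^+ 30 = bt t ^+ 15 by move=> t0; rewrite (_ : 30 = 2 * 15)%N// exprM bq2.
have en : e / n * Num.sqrt n = e / Num.sqrt n by rewrite -{1}s2; field; rewrite gt_eqF.
have cV t (t0 : 0 < t) : cs (EVf n e t p_V) := cs_EV sw Z1 hw E t0 g0.
have cE t (t0 : 0 < t) : cs (EVf n e t (pgood 2 38 p_E)) := cs_EV sw Z1 hw E t0 (good00 good_E).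
have cT t (t0 : 0 < t) : cs (EVf n e t (ST p_V)) := cs_EV sw Z1 hw E t0 (good_ST g0).
have resE t : 0 < t -> app_Vt w n e t - Phi (app_V w n e t) = cst (e * n ^+ 5) * EVf n e t (pgood 2 38 p_E).
  by move=> t0; rewrite (residual_EV sw Z1 hw E t0 g0) (resp_EV Z1 hw).
exists CN; split.
- move=> b b0 b1; split => //; first by rewrite exprn_ege1.
    by rewrite divr_gt0.
  by rewrite expr_div_n s2; field; rewrite gt_eqF.
- exact: CN1.
- move=> t t1; have t0 : 0 < t by lra.
  have b0 := bt_gt0 t0.
  have m0 : 0 <= e / Num.sqrt n by rewrite divr_ge0// ltW.
  split.
  + by apply: csZ; exact: cV.
  + apply: (le_trans (nm_cEV sw Z1 hw E t0 g0 k0 (h1 n e t E t1))).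
    rewrite !expr0 !mul1r mulrCA en; exact: ler_wpM2r.
  + rewrite /app_V (dx_cEV sw Z1 hw _ E t0 g0) (dx_cEV sw Z1 hw _ E t0 g1).
    have kk0 : 0 <= e / n * n ^+ 2 * n ^+ 2 by exact: mulr_ge0 (mulr_ge0 k0 (pw 2%N)) (pw 2%N).
    apply: (le_trans (nm_cEV sw Z1 hw E t0 g2 kk0 (h2 n e t E t1))).
    rewrite !expr0 !mul1r (_ : _ * (C2 * _) = C2 * ((n ^+ 2) ^+ 2 * (e / n * Num.sqrt n))); last by ring.
    by rewrite en; exact: (ler_wpM2r (mulr_ge0 (exprn_ge0 2%N (pw 2%N)) m0) q2).
  + rewrite /app_V (Dop_Dop_EV sw Z1 hw E t0 g0) -(q_all_EV Z1 hw t E).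
    have kk0 : 0 <= e * n ^+ 7 by exact: mulr_ge0 (ltW e0) (pw 7%N).
    apply: (le_trans (nm_cEV sw Z1 hw E t0 (good00 good_q_all) kk0 (h3 n e t E t1))).
    rewrite expr0 mulr1 /dd (_ : e * n ^+ 7 * _ = 36^-1 * (C3 * (n ^+ 2 * (e / n * Num.sqrt n)))); last by field; rewrite gt_eqF.
    have x0 : 0 <= n ^+ 2 * (e / n * Num.sqrt n) by rewrite en mulr_ge0// exprn_ge0// ltW.
    rewrite -en; have := ler_wpM2r x0 q3; have := mulr_ge0 C30 x0; move: (n ^+ 2 * _) => X; clear; lra.
  + move=> x; rewrite -[app_V w n e t x]/(e / n * EV n e t x p_V) normrM (ger0_norm k0).
    apply: (le_trans (ler_wpM2l k0 (h4 n e t x E t1))); rewrite expr0 mul1r b8//.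
    rewrite (_ : e / n * (C4 * bt t ^+ 4) = C4 * (e * bt t ^+ 4 / n)); last by ring.
    exact: (ler_wpM2r (divr_ge0 (mulr_ge0 (ltW e0) (bw t 4%N t0)) (ltW n0)) q4).
  + move=> x; rewrite /app_V (dx_cEV sw Z1 hw _ E t0 g0) -[(cst _ * _) x]/(e / n * n ^+ 2 * EV n e t x (SX p_V)).
    have kk0 : 0 <= e / n * n ^+ 2 by exact: mulr_ge0 k0 (pw 2%N).
    rewrite normrM (ger0_norm kk0); apply: (le_trans (ler_wpM2l kk0 (h5 n e t x E t1))); rewrite expr0 mul1r b8//.
    rewrite (_ : e / n * n ^+ 2 * (C5 * bt t ^+ 4) = C5 * (e * bt t ^+ 4 * n)); last by field; rewrite gt_eqF.
    exact: (ler_wpM2r (mulr_ge0 (mulr_ge0 (ltW e0) (bw t 4%N t0)) (ltW n0)) q5).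
- by move=> t t1; have t0 : 0 < t by [lra]; apply: csZ; exact: cT.
- move=> t t1; have t0 : 0 < t by lra.
  have b0 := bt_gt0 t0.
  rewrite resE//; apply: (le_trans (nm_cEV sw Z1 hw E t0 (good00 good_E) k1 (h6 n e t E t1))).
  rewrite b30// /dd (_ : e * n ^+ 5 * _ = 36^-1 * (C6 * (e / n * Num.sqrt n * bt t ^+ 15))); last by field; rewrite gt_eqF.
  have x0 : 0 <= e / n * Num.sqrt n * bt t ^+ 15 by exact: mulr_ge0 (mulr_ge0 k0 (ltW s0)) (bw t 15%N t0).
  rewrite -en; have := ler_wpM2r x0 q6; have := mulr_ge0 C60 x0; move: (_ * bt t ^+ 15) => X; clear; lra.
- move=> t t1; have t0 : 0 < t by lra.
  rewrite resE//; apply: (HK_le (leqnn 4) _ (HK_scale0 (cE t t0) k1 (a1 t t1))).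
  by rewrite b30// mulrA; apply: ler_wpM2r => //; rewrite exprn_ge0// ltW// bt_gt0.
- move=> t t1; have t0 : 0 < t by lra.
  apply: (HK_le (leqnn 8) _ (HK_scale0 (cV t t0) k0 (a2 t t1))).
  by rewrite expr0 mulr1.
- move=> t t1; have t0 : 0 < t by lra.
  apply: (HK_le (leqnn 4) _ (HK_scale0 (cT t t0) k1 (a3 t t1))).
  by rewrite expr0 mulr1.
- move=> t t1 x j j5; have t0 : 0 < t by lra.
  rewrite /app_V dn_scale//; last exact: cV.
  rewrite -[(cst _ * _) x]/(e / n * dn j (EVf n e t p_V) x) normrM (ger0_norm k0).
  apply: (le_trans (ler_wpM2l k0 (a4 t t1 x j j5))); rewrite b8// mulrA.
  by apply: ler_wpM2r => //; rewrite exprn_ge0// ltW// bt_gt0.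
- move=> t s hs ts; have /andP[s0' s1] := hs.
  have e5 : e * n ^+ 5 = e / n * n ^+ 6 by field; rewrite gt_eqF.
  rewrite /app_Vt e5; apply: (HK_le (leqnn 4) _ (hT t s hs ts)).
  by apply: ler_wpM2r => //; exact: sqr_ge0.
Qed.

End approximate_data.

#[local] Transparent p_main.
#[local] Opaque spd good pgood p_third q_DD q_D.

(** * Size of v^[w] in H^(1/4) *)

Section main_term.
Context {R : realType} (w : R -> R) (Z : R) (sw : smooth w) (Z1 : 1 <= Z) (hw : forall y, Z < `|y| -> w y = 0).
Implicit Types (n e t x : R) (p : spoly) (f : R -> R).
Notation EV n e t x p := (ev (avl w n e t x) p).
Notation EVf := (EVf w).
Notation env := (env Z).

Lemma ii_In f (L : R) : cs f -> exists r, L <= r /\ ii f = In (- r) r f.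
Proof.
move=> [sf [M hM]]; pose r := `|L| + `|M| + 1.
have a1 := ler_norm L; have a2 := ler_norm M; have a3 := normr_ge0 L; have a4 := normr_ge0 M.
exists r; split; first by rewrite /r; lra.
by apply: (ii_itv hM); rewrite /r; lra.
Qed.

Lemma In_nn f r : cs f -> In (- r) r (fun x => f x ^+ 2) <= nn f.
Proof.
move=> cf; have [s [rs es]] := ii_In r (csM cf cf).
rewrite /nn es (_ : In (- s) s (f * f) = In (- s) s (fun x => f x ^+ 2)); last by apply: In_eq => x _; rewrite expr2.
have mf := continuous_mb (cs_cont cf).
apply: In_mono; [by rewrite lerN2|exact: rs|exact: mb_sqr|by move=> x _; exact: sqr_ge0].
Qed.

Definition main_f n e t : R -> R := cst (e / n) * EVf n e t p_main.
Lemma gM0 : good 0 0 p_main. Proof. by vm_compute. Qed.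

(** The two phases are only compared for |z| < Z + 1; farther out they may differ, which the factor
    w(z) = 0 hides. *)
Lemma mkdv_approxE N e t : env (Num.sqrt N) e -> 1 <= t -> (fun x => mkdv_approx w e N x t) = main_f (Num.sqrt N) e t.
Proof.
move=> E t1; have t0 : 0 < t by lra.
have n0 := env_n0 E; set n := Num.sqrt N in E n0 *.
have N0 : 0 < N by rewrite -sqrtr_gt0.
have en : n ^+ 2 = N by rewrite sqr_sqrtr// ltW.
have p1 : N `^ (- 2^-1) = n^-1 by rewrite powRN powR12_sqrt// ltW.
have p2 : t `^ (- 2^-1) = (Num.sqrt t)^-1 by rewrite powRN powR12_sqrt// ltW.
apply/funext => x; rewrite /mkdv_approx p1 p2.
have ez : mkdv_z N x t = zz n t x.
  by rewrite /mkdv_z p1 -en /zz; field; rewrite !gt_eqF.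
rewrite ez -[RHS]/(e / n * EV n e t x p_main) /p_main ev_cons ev_nil !evm_cons evm_nil zv_pos.
rewrite -[avl _ _ _ _ _ 2]/((Num.sqrt t)^-1) -[avl _ _ _ _ _ 9]/(w (zz n t x)) -[avl _ _ _ _ _ 7]/(cos (ph w n e t x)).
have [hz|hz] := ltP `|zz n t x| (Z + 1); last first.
  have -> : w (zz n t x) = 0 by apply: hw; move: hz; clear; lra.
  ring.
have -> : mkdv_phase w e N x t = ph w n e t x; last by ring.
have [px _] := in_region E hz.
have k0 : 0 < kk n t x by rewrite sqrtr_gt0.
have k2 : kk n t x ^+ 2 = 1 - 2 * dd n * zz n t x by rewrite sqr_sqrtr// ltW.
have ex : - x = 3 * N ^+ 2 * t * kk n t x ^+ 2 by rewrite k2 -en /zz /dd; field; rewrite !gt_eqF.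
rewrite /mkdv_phase ez /ph.
have -> : - 4 * x ^+ 3 / (27 * t) = (2 * n ^+ 6 * t * kk n t x ^+ 3) ^+ 2.
  have -> : - 4 * x ^+ 3 / (27 * t) = 4 * (- x) ^+ 3 / (27 * t) by rewrite exprNn; field; rewrite gt_eqF.
  by rewrite ex -en; field; rewrite gt_eqF.
have -> : - x / (3 * t) = (N * kk n t x) ^+ 2 by rewrite ex; field; rewrite gt_eqF.
rewrite !sqrtr_sqr !ger0_norm; last 2 first.
- by rewrite mulr_ge0// ltW.
- by rewrite !mulr_ge0 ?exprn_ge0// ltW.
by rewrite -/n; field; rewrite gt_eqF.
Qed.

Lemma main_cs n e t : env n e -> 0 < t -> cs (main_f n e t).
Proof. by move=> E t0; apply: csZ; exact: (cs_EV sw Z1 hw E t0 gM0). Qed.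

Lemma sqrt_n n e : env n e -> e / n * Num.sqrt n = e / Num.sqrt n.
Proof.
move=> E; have n0 := env_n0 E; have s0 : 0 < Num.sqrt n by rewrite sqrtr_gt0.
have s2 : Num.sqrt n ^+ 2 = n by rewrite sqr_sqrtr// ltW.
by rewrite -{1}s2; field; rewrite gt_eqF.
Qed.

Lemma cEV_nm a k p : good a (k + 8) p -> exists C, 0 <= C /\ forall n e t, env n e -> 1 <= t ->
  nm (cst (e / n) * EVf n e t p) <= C * (dd n ^+ a * bq t ^+ k * (e / Num.sqrt n)) /\
  nm (dx (cst (e / n) * EVf n e t p)) <= C * (dd n ^+ a * bq t ^+ k * (n ^+ 2 * (e / Num.sqrt n))).
Proof.
move=> gp; have [C [C0 hC]] := nm_EV sw Z1 hw gp; have [D [D0 hD]] := nm_EV sw Z1 hw (good_SX gp).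
exists (C + D); split; first exact: addr_ge0.
move=> n e t E t1; have t0 : 0 < t by lra.
have n0 := env_n0 E; have [_ _ e0 _] := E; have g0 := good00 gp.
have k0 : 0 <= e / n by rewrite divr_ge0// ltW.
have [d0 _] := dd_bounds E.
have s0 : 0 < Num.sqrt n by rewrite sqrtr_gt0.
have u0 : 0 <= dd n ^+ a * bq t ^+ k * (e / Num.sqrt n).
  by apply: mulr_ge0; [apply: mulr_ge0; apply: exprn_ge0; [exact: ltW|exact: sqrtr_ge0]|apply: divr_ge0; exact: ltW].
have u1 : 0 <= n ^+ 2 * (dd n ^+ a * bq t ^+ k * (e / Num.sqrt n)) by apply: mulr_ge0 => //; exact: sqr_ge0.
split.
  apply: (le_trans (nm_cEV sw Z1 hw E t0 g0 k0 (hC n e t E t1))).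
  rewrite (_ : e / n * _ = C * (dd n ^+ a * bq t ^+ k * (e / n * Num.sqrt n))); last by ring.
  rewrite (sqrt_n E) mulrDl lerDl; exact: mulr_ge0.
rewrite (dx_cEV sw Z1 hw _ E t0 g0).
have k1 : 0 <= e / n * n ^+ 2 by apply: mulr_ge0 => //; exact: sqr_ge0.
apply: (le_trans (nm_cEV sw Z1 hw E t0 (good_SX g0) k1 (hD n e t E t1))).
rewrite (_ : e / n * n ^+ 2 * _ = D * (n ^+ 2 * (dd n ^+ a * bq t ^+ k * (e / n * Num.sqrt n)))); last by ring.
rewrite (sqrt_n E) (_ : dd n ^+ a * bq t ^+ k * (n ^+ 2 * _) = n ^+ 2 * (dd n ^+ a * bq t ^+ k * (e / Num.sqrt n))); last by ring.
by rewrite mulrDl lerDr; exact: mulr_ge0.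
Qed.

Lemma app_V_main n e t : app_V w n e t - main_f n e t = cst (e / n) * EVf n e t p_third.
Proof.
apply/funext => x; rewrite -[LHS]/(e / n * EV n e t x (p_main ++ p_third) - e / n * EV n e t x p_main) ev_cat.
by rewrite -[RHS]/(e / n * EV n e t x p_third); ring.
Qed.

(** With p = n in [Hs_le], that is with frequencies split at N, both parts are of order e^2. *)
Lemma main_Hs_le : exists C, 0 < C /\ forall n e t, env n e -> 1 <= t -> (Hs_norm 4^-1 (main_f n e t) <= (C * e)%:E)%E.
Proof.
have [C [C0 hC]] := cEV_nm (a := 0) (k := 0) good_main.
exists (15 * (C + 1)); split; first by lra.
move=> n e t E t1; have t0 : 0 < t by lra.
have n0 := env_n0 E; have [n1 _ e0 _] := E; have [h1 h2] := hC n e t E t1.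
have s0 : 0 < Num.sqrt n by rewrite sqrtr_gt0.
have s2 : Num.sqrt n ^+ 2 = n by rewrite sqr_sqrtr// ltW.
have cm := main_cs E t0; have m0 : 0 <= e / Num.sqrt n by apply: divr_ge0; exact: ltW.
rewrite expr0 mulr1 !mul1r in h1 h2.
have em : (e / Num.sqrt n) ^+ 2 = e ^+ 2 / n by rewrite expr_div_n s2.
have A1 : nn (main_f n e t) <= C ^+ 2 * (e ^+ 2 / n).
  rewrite -nm2 -em -exprMn; apply: lerXn2r => //; rewrite nnegrE; [exact: nm_ge0|exact: mulr_ge0].
have A2 : nn (dx (main_f n e t)) <= C ^+ 2 * (n ^+ 4 * (e ^+ 2 / n)).
  rewrite -nm2 (_ : C ^+ 2 * _ = (C * (n ^+ 2 * (e / Num.sqrt n))) ^+ 2); last by rewrite -em; ring.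
  apply: lerXn2r => //; rewrite nnegrE; [exact: nm_ge0|].
  by apply: mulr_ge0 => //; apply: mulr_ge0 => //; exact: sqr_ge0.
apply: (@Hs_le R (main_f n e t) (dx (main_f n e t)) (C ^+ 2 * (e ^+ 2 / n)) (C ^+ 2 * (n ^+ 4 * (e ^+ 2 / n))) _ n).
- by move=> x; exact: dble_is_derive (cs_dble cm).
- exact: cs_cont (cs_der cm).
- by move=> r _; exact: le_trans (In_nn r cm) A1.
- by move=> r _; exact: le_trans (In_nn r (cs_der cm)) A2.
- exact: n0.
- by apply: mulr_ge0; [lra|exact: ltW].
have -> : 5 * (n * (C ^+ 2 * (e ^+ 2 / n)) + (C ^+ 2 * (e ^+ 2 / n) + C ^+ 2 * (n ^+ 4 * (e ^+ 2 / n))) / n ^+ 3)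
  = C ^+ 2 * e ^+ 2 * (10 + 5 * (n ^+ 4)^-1) by field; rewrite gt_eqF.
have n4 : (n ^+ 4)^-1 <= 1 by rewrite invf_le1 ?exprn_gt0// exprn_ege1.
have q0 : 0 <= C ^+ 2 * e ^+ 2 by apply: mulr_ge0; exact: sqr_ge0.
apply: (@le_trans _ _ (C ^+ 2 * e ^+ 2 * 15)); first by apply: ler_wpM2l => //; lra.
have -> : (15 * (C + 1) * e) ^+ 2 = (C ^+ 2 + 2 * C + 1) * e ^+ 2 * 225 by ring.
have c1 : C ^+ 2 * e ^+ 2 <= (C ^+ 2 + 2 * C + 1) * e ^+ 2 by apply: ler_wpM2r; [exact: sqr_ge0|lra].
by move: c1 q0; move: (C ^+ 2 * e ^+ 2) ((C ^+ 2 + 2 * C + 1) * e ^+ 2) => a b; lra.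
Qed.

(** The part of v_x due to the slow variation of amplitude and phase correction; unlike the carrier
    term found in [drift_split], it has a factor delta. *)
Definition p_drift := pgood 1 8 (SX p_main).
Definition p_w2 : spoly := [:: (BinInt.Z.of_nat 1, [:: 2; 2; 9; 9]%N)].
Lemma good_drift : good 1 8 p_drift. Proof. exact: good_pgood. Qed.
Lemma good_w2 : good 0 0 p_w2. Proof. by vm_compute. Qed.
Lemma drift_split : normA (pbad 1 8 (SX p_main)) = [:: (BinInt.Z.opp (BinInt.Z.of_nat 2), [:: 2; 4; 8; 9]%N)].
Proof. by vm_compute. Qed.

(** Sine and cosine do not vanish together, and kappa^2 >= 2/3 preserves the sine in v_x: the
    squares of v and v_x / N together see the whole amplitude, up to the drift. *)
Lemma main_pointwise n e t x : env n e -> EV n e t x p_w2 <= EV n e t x (SX p_main) ^+ 2 + EV n e t x p_main ^+ 2 + EV n e t x p_drift ^+ 2.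
Proof.
move=> E; have [hz|hz] := ltP `|zz n t x| (Z + 1); last first.
  have hz' : Z < `|zz n t x| by move: hz; clear; lra.
  by rewrite (EV_out Z1 hw e good_w2 hz'); apply: addr_ge0; [apply: addr_ge0|]; exact: sqr_ge0.
have [h1 h2 h3] := avl_rel w E hz; have [_ /andP[k1 _]] := in_region E hz.
have eA : EV n e t x (SX p_main) = EV n e t x p_drift + EV n e t x [:: (BinInt.Z.opp (BinInt.Z.of_nat 2), [:: 2; 4; 8; 9]%N)].
  exact: (etrans (ev_split _ 1 8 _) (congr1 (fun u => EV n e t x p_drift + u) (etrans (esym (ev_normA _ h1 h2)) (congr1 (ev (avl w n e t x)) drift_split)))).
have eS : EV n e t x [:: (BinInt.Z.opp (BinInt.Z.of_nat 2), [:: 2; 4; 8; 9]%N)] = - 2 * (avl w n e t x 2 * (avl w n e t x 4 * (avl w n e t x 8 * (avl w n e t x 9 * 1)))) + 0.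
  by rewrite ev_cons ev_nil !evm_cons evm_nil zv_neg.
rewrite eS in eA.
have eB : EV n e t x p_main = 2 * (avl w n e t x 2 * (avl w n e t x 9 * avl w n e t x 7)).
  by rewrite /p_main ev_cons ev_nil !evm_cons evm_nil zv_pos mulr1 addr0.
have eC : EV n e t x p_w2 = (avl w n e t x 2 * avl w n e t x 9) ^+ 2.
  by rewrite /p_w2 ev_cons ev_nil !evm_cons evm_nil zv_pos; ring.
rewrite eA eB eC; move: h2 k1; rewrite -[avl _ _ _ _ _ 4]/(kk n t x).
move: (avl w n e t x 7) (avl w n e t x 8) (avl w n e t x 2) (avl w n e t x 9) (kk n t x) (EV n e t x p_drift) => c s r W k D h2 k1.
have -> : D + (- 2 * (r * (k * (s * (W * 1)))) + 0) = D - 2 * (r * W) * (k * s) by ring.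
have -> : 2 * (r * (W * c)) = 2 * (r * W) * c by ring.
move: (r * W) => a.
have a2 := sqr_ge0 a; have e1 := sqr_ge0 (2 * D - 2 * a * (k * s)).
have s1 : c ^+ 2 = 1 - s ^+ 2 by rewrite -h2; ring.
have k2 : 2 / 3 * (a ^+ 2 * s ^+ 2) <= a ^+ 2 * s ^+ 2 * k ^+ 2.
  by rewrite mulrC; apply: ler_wpM2l => //; apply: mulr_ge0; exact: sqr_ge0.
have s2 : a ^+ 2 * s ^+ 2 <= a ^+ 2.
  by rewrite -[leRHS]mulr1; apply: ler_wpM2l => //; have := sqr_ge0 c; lra.
have -> : (D - 2 * a * (k * s)) ^+ 2 + (2 * a * c) ^+ 2 + D ^+ 2 = 2^-1 * (2 * D - 2 * a * (k * s)) ^+ 2 + 2 * (a ^+ 2 * s ^+ 2 * k ^+ 2) + 4 * a ^+ 2 * c ^+ 2 by field.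
rewrite s1; move: e1 k2 s2 a2; rewrite (_ : 4 * a ^+ 2 * (1 - s ^+ 2) = 4 * a ^+ 2 - 4 * (a ^+ 2 * s ^+ 2)); last by ring.
move: (a ^+ 2 * s ^+ 2) (a ^+ 2 * s ^+ 2 * k ^+ 2) (a ^+ 2) ((2 * D - 2 * a * (k * s)) ^+ 2) => u v b q; lra.
Qed.

(** The substitution x = n t z - 3 n^4 t has Jacobian n t, and for |z - y0| <= rho the integrand is
    at least om / t. *)
Lemma w2_integral n e t (y0 rho om : R) : env n e -> 1 <= t -> 0 < rho -> (forall y, `|y - y0| <= rho -> om <= w y ^+ 2) ->
  2 * om * rho * n <= ii (EVf n e t p_w2).
Proof.
move=> E t1 r0 hom; have t0 : 0 < t by lra.
have n0 := env_n0 E; have nt : 0 < n * t by exact: mulr_gt0.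
have cf : cs (EVf n e t p_w2) := cs_EV sw Z1 hw E t0 good_w2.
have ef x : EVf n e t p_w2 x = t^-1 * w (zz n t x) ^+ 2.
  rewrite -[LHS]/(EV n e t x p_w2) /p_w2 ev_cons ev_nil !evm_cons evm_nil zv_pos.
  rewrite -[avl _ _ _ _ _ 2]/((Num.sqrt t)^-1) -[avl _ _ _ _ _ 9]/(w (zz n t x)).
  have -> : t^-1 = (Num.sqrt t)^-1 * (Num.sqrt t)^-1 by rewrite -invfM -expr2 sqr_sqrtr// ltW.
  ring.
pose c := n * t * (y0 - rho) - 3 * n ^+ 4 * t; pose d := n * t * (y0 + rho) - 3 * n ^+ 4 * t.
have cd : d - c = n * t * (2 * rho) by rewrite /c /d; ring.
have cd' : c <= d by rewrite -subr_ge0 cd; apply: mulr_ge0; [exact: ltW|lra].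
have [r [rL er]] := ii_In (`|c| + `|d|) cf.
have mf : mb (EVf n e t p_w2) := continuous_mb (cs_cont cf).
have inr : forall x, c <= x <= d -> om / t <= EVf n e t p_w2 x.
  move=> x /andP[cx xd]; rewrite ef [leRHS]mulrC; apply: ler_wpM2r; first by rewrite invr_ge0 ltW.
  apply: hom; rewrite ler_norml; apply/andP; split.
    rewrite lerBrDr addrC /zz ler_pdivlMr//; move: cx; rewrite /c; lra.
  rewrite lerBlDr addrC /zz ler_pdivrMr//; move: xd; rewrite /d; lra.
rewrite er; apply: (@le_trans _ _ (In c d (EVf n e t p_w2))).
  apply: (@le_trans _ _ (In c d (fun=> om / t))).
    by rewrite In_cst// cd le_eqVlt; apply/orP; left; apply/eqP; field; rewrite gt_eqF.
  apply: In_le => //; exact: mbC.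
have a1 := ler_norm (- c); have a2 := ler_norm d; have a3 := normr_ge0 c; have a4 := normr_ge0 d; rewrite normrN in a1.
apply: In_mono => //; [lra|lra|].
move=> x _; rewrite ef; apply: mulr_ge0; [by rewrite invr_ge0 ltW|exact: sqr_ge0].
Qed.

(** The mass 2 q n given by [w2_integral] has to beat the drift and [Dop] of the main term. Both are
    bounded, since delta^2 n <= 1/36, so large n is enough. *)
Lemma main_Hs_ge : (exists y, w y != 0) -> exists C n1, [/\ 0 < C, 1 <= n1 & forall n e t, env n e -> n1 <= n -> 1 <= t ->
  ((C * e)%:E <= Hs_norm 4^-1 (main_f n e t))%E].
Proof.
move=> [y0 wy0].
have [rho [r0 hom]] : exists rho, 0 < rho /\ forall y, `|y - y0| <= rho -> w y0 ^+ 2 / 2 <= w y ^+ 2.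
  have w2 : 0 < w y0 ^+ 2 by rewrite exprn_even_gt0.
  have h : \forall y \near y0, w y0 ^+ 2 / 2 < (w * w) y.
    have c0 : {for y0, continuous (w * w)} := @smooth_cont R _ (smoothM sw sw) y0.
    apply: (cvgr_gt _ c0).
    by rewrite -[(w * w) y0]/(w y0 * w y0) -expr2; lra.
  have [rho /= r0 hr] := h; exists (rho / 2); split; first lra.
  by move=> y hy; apply/ltW/hr; rewrite /= distrC; lra.
set om := w y0 ^+ 2 / 2 in hom; have om0 : 0 < om by rewrite /om divr_gt0// exprn_even_gt0.
have [C1 [C10 h1]] := nm_EV (a := 1) (k := 0) sw Z1 hw good_drift.
have [C2 [C20 h2]] := nm_EV (a := 1) (k := 0) sw Z1 hw good_qD.
pose q := om * rho; have q0 : 0 < q by exact: mulr_gt0.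
have p0 : 0 < pi :> R := @pi_gt0 R.
pose C := Num.sqrt (q / (24 * pi)).
have Cp : 0 < q / (24 * pi) by apply: divr_gt0 => //; lra.
have C2e : C ^+ 2 = q / (24 * pi) by rewrite sqr_sqrtr// ltW.
pose S := C1 ^+ 2 + 60 * pi * C2 ^+ 2; have S0 : 0 <= S.
  by apply: addr_ge0; [exact: sqr_ge0|apply: mulr_ge0; [lra|exact: sqr_ge0]].
(* For n beyond this value S <= q n, which absorbs both errors; C^2 = q / (24 pi) uses q n / 2. *)
exists C, (1 + S / q); split; first by rewrite sqrtr_gt0.
  by rewrite lerDl divr_ge0// ltW.
move=> n e t E nn1 t1; have t0 : 0 < t by lra.
have n0 := env_n0 E; have [n1 _ e0 _] := E; have [d0 _] := dd_bounds E.
have s0 : 0 < Num.sqrt n by rewrite sqrtr_gt0.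
have s2 : Num.sqrt n ^+ 2 = n by rewrite sqr_sqrtr// ltW.
have Sq : S <= q * n by rewrite mulrC -ler_pdivrMr//; lra.
have gS := good_SX gM0.
have cA : cs (EVf n e t (SX p_main)) := cs_EV sw Z1 hw E t0 gS.
have cB : cs (EVf n e t p_main) := cs_EV sw Z1 hw E t0 gM0.
have cD : cs (EVf n e t p_drift) := cs_EV sw Z1 hw E t0 (good00 good_drift).
have cW : cs (EVf n e t p_w2) := cs_EV sw Z1 hw E t0 good_w2.
have cQ : cs (EVf n e t q_D) := cs_EV sw Z1 hw E t0 (good00 good_qD).
have nd : nn (EVf n e t p_drift) <= C1 ^+ 2 * (dd n ^+ 2 * n).
  rewrite -nm2 (_ : C1 ^+ 2 * _ = (C1 * (dd n * Num.sqrt n)) ^+ 2); last by rewrite !exprMn s2.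
  have := h1 n e t E t1; rewrite expr1 expr0 mulr1 => h; apply: lerXn2r => //; rewrite nnegrE ?nm_ge0//.
  by apply: mulr_ge0 => //; apply: mulr_ge0; exact: ltW.
have nq : nn (EVf n e t q_D) <= C2 ^+ 2 * (dd n ^+ 2 * n).
  rewrite -nm2 (_ : C2 ^+ 2 * _ = (C2 * (dd n * Num.sqrt n)) ^+ 2); last by rewrite !exprMn s2.
  have := h2 n e t E t1; rewrite expr1 expr0 mulr1 => h; apply: lerXn2r => //; rewrite nnegrE ?nm_ge0//.
  by apply: mulr_ge0 => //; apply: mulr_ge0; exact: ltW.
have low : 2 * q * n <= nn (EVf n e t (SX p_main)) + nn (EVf n e t p_main) + nn (EVf n e t p_drift).
  have := w2_integral E t1 r0 hom; rewrite (_ : 2 * om * rho * n = 2 * q * n); last by rewrite /q; ring.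
  move=> h; apply: (le_trans h).
  have e2 := iiD (csM cA cA) (csM cB cB); have e3 := iiD (csD (csM cA cA) (csM cB cB)) (csM cD cD).
  rewrite /nn -e2 -e3.
  apply: ii_le; [exact: cW|exact: (csD (csD (csM cA cA) (csM cB cB)) (csM cD cD))|].
  move=> x; have := main_pointwise t x E; rewrite !expr2; exact.
have eD : dx (dx (main_f n e t)) + cst ((n ^+ 2) ^+ 2) * main_f n e t = cst (e * n ^+ 3) * EVf n e t q_D.
  rewrite /main_f (dx_cEV sw Z1 hw _ E t0 gM0) (dx_cEV sw Z1 hw _ E t0 gS).
  have -> : EVf n e t q_D = EVf n e t p_D.
    apply: (EV_eq Z1 hw E) => [||x hz]; [exact: good00 good_qD|by vm_compute|].
    by have [a1 a2 a3] := avl_rel w E hz; rewrite (D_low a1 a2 a3).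
  apply/funext => x; rewrite -[RHS]/(e * n ^+ 3 * EV n e t x (SX (SX p_main) ++ p_main)) ev_cat.
  rewrite -[LHS]/(e / n * n ^+ 2 * n ^+ 2 * EV n e t x (SX (SX p_main)) + (n ^+ 2) ^+ 2 * (e / n * EV n e t x p_main)).
  by move: (EV n e t x (SX (SX p_main))) (EV n e t x p_main) => a b; field; rewrite gt_eqF.
apply: (@Hs_ge R (main_f n e t) n (C * e)).
- exact: main_cs.
- exact: n1.
- by apply: mulr_ge0; [exact: sqrtr_ge0|exact: ltW].
rewrite eD nnZ// {1}/main_f (dx_cEV sw Z1 hw _ E t0 gM0) nnZ// /main_f nnZ//.
have -> : (e / n * n ^+ 2) ^+ 2 * nn (EVf n e t (SX p_main)) + (n ^+ 2) ^+ 2 * ((e / n) ^+ 2 * nn (EVf n e t p_main)) = e ^+ 2 * n ^+ 2 * (nn (EVf n e t (SX p_main)) + nn (EVf n e t p_main)).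
  by field; rewrite gt_eqF.
rewrite exprMn C2e.
have -> : 12 * pi * (n ^+ 3 * (q / (24 * pi) * e ^+ 2)) = e ^+ 2 * n ^+ 2 * (q * n / 2).
  by move: p0; move: (pi : R) => p p0; field; rewrite gt_eqF.
have -> : 60 * pi * ((e * n ^+ 3) ^+ 2 * nn (EVf n e t q_D) / (n ^+ 2) ^+ 2) = e ^+ 2 * n ^+ 2 * (60 * pi * nn (EVf n e t q_D)) by field; rewrite gt_eqF.
rewrite -mulrDr; apply: ler_wpM2l; first by apply: mulr_ge0; exact: sqr_ge0.
have n6 : dd n ^+ 2 * n <= 36^-1.
  rewrite /dd exprVn exprMn (_ : (6 ^+ 2 * (n ^+ 3) ^+ 2)^-1 * n = 36^-1 * (n ^+ 5)^-1); last by field; rewrite gt_eqF.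
  rewrite -[leRHS]mulr1; apply: ler_wpM2l => //; rewrite invf_le1 ?exprn_gt0//; exact: exprn_ege1.
have u1 : C1 ^+ 2 * (dd n ^+ 2 * n) <= C1 ^+ 2 / 36 by apply: ler_wpM2l => //; exact: sqr_ge0.
have u2 : 60 * pi * (C2 ^+ 2 * (dd n ^+ 2 * n)) <= 60 * pi * (C2 ^+ 2 / 36).
  by apply: ler_wpM2l; [lra|apply: ler_wpM2l => //; exact: sqr_ge0].
have u3 : 60 * pi * nn (EVf n e t q_D) <= 60 * pi * (C2 ^+ 2 * (dd n ^+ 2 * n)) by apply: ler_wpM2l; [lra|].
have u4 : C1 ^+ 2 / 36 + 60 * pi * (C2 ^+ 2 / 36) <= q * n / 36.
  by move: Sq; rewrite /S; move: (60 * pi) (C2 ^+ 2) (C1 ^+ 2) (q * n) => a b c d; lra.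
have qn : 0 <= q * n by apply: mulr_ge0; exact: ltW.
move: low nd u1 u2 u3 u4 qn; rewrite -[2 * q * n]mulrA.
move: (q * n) (nn (EVf n e t (SX p_main))) (nn (EVf n e t p_main)) (nn (EVf n e t p_drift)) (60 * pi * nn (EVf n e t q_D)) (60 * pi * (C2 ^+ 2 * (dd n ^+ 2 * n))) (C1 ^+ 2 * (dd n ^+ 2 * n)) (C1 ^+ 2 / 36) (60 * pi * (C2 ^+ 2 / 36)).
by clear; intros; lra.
Qed.

End main_term.

(** * Passage to the limit *)

Section discrete_family.
Context {R : realType}.
Implicit Types (f g : R -> R) (x t T s B : R).

Lemma nm_interp g k : cs g -> nm (dn k.+1 g) ^+ 2 <= nm (dn k g) * nm (dn k.+2 g).
Proof.
move=> cg; have ck := cs_dn k cg; have c1 := cs_der ck; have c2 := cs_der c1.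
rewrite nm2 nnE !dnS ip_dx//.
by apply: le_trans (CS ck c2); rewrite -normrN; exact: ler_norm.
Qed.

(** Log-convexity of the norms of successive derivatives: smallness in H^1 climbs to the second and
    third derivative at the cost of the H^4 bound, and passes from there to sup norms. *)
Lemma interp B : 1 <= B -> forall d, 0 < d -> exists r, 0 < r /\ forall g, cs g -> HK 4 B g -> HK 1 r g -> forall k x, (k <= 3)%N -> `|dn k g x| <= d.
Proof.
move=> B1 d d0; have B0 : 0 < B by lra.
have step k (e : R) : 0 < e -> exists r, 0 < r /\ forall g, cs g -> nm (dn k.+2 g) <= B -> nm (dn k g) <= r -> nm (dn k.+1 g) <= e.
  move=> e0; exists (e ^+ 2 / B); split; first by rewrite divr_gt0// exprn_gt0.
  move=> g cg h2 h0; have h := nm_interp k cg.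
  rewrite -(@ler_pXn2r _ 2%N) ?nnegrE ?nm_ge0 ?(ltW e0)//; apply: (le_trans h).
  rewrite (_ : e ^+ 2 = e ^+ 2 / B * B); last by field; rewrite gt_eqF.
  by apply: ler_pM => //; exact: nm_ge0.
pose e := d ^+ 2 / (2 * B); have e0 : 0 < e by rewrite divr_gt0 ?exprn_gt0// mulr_gt0.
have [r3 [r30 h3]] := step 2%N e e0.
have m0 : 0 < Num.min r3 e by rewrite lt_min r30.
have [r2 [r20 h2]] := step 1%N (Num.min r3 e) m0.
exists (Num.min r2 e); split; first by rewrite lt_min r20.
move=> g cg hB hr k x k3.
have n0 : nm (dn 0 g) <= e by apply: (le_trans (hr 0%N isT)); rewrite ge_min lexx orbT.
have n1 : nm (dn 1 g) <= Num.min r2 e by exact: (hr 1%N isT).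
have n2 : nm (dn 2 g) <= Num.min r3 e.
  by apply: h2 => //; [exact: hB|apply: (le_trans n1); rewrite ge_min lexx].
have n3 : nm (dn 3 g) <= e.
  by apply: h3 => //; [exact: hB|apply: (le_trans n2); rewrite ge_min lexx].
have nk : nm (dn k g) <= e.
  have n1' : nm (dn 1 g) <= e by apply: (le_trans n1); rewrite ge_min lexx orbT.
  have n2' : nm (dn 2 g) <= e by apply: (le_trans n2); rewrite ge_min lexx orbT.
  exact: (@le3_ind (fun k => nm (dn k g) <= e) n0 n1' n2' n3 k k3).
have := sup_nm x (cs_dn k cg); rewrite -dnS => h.
rewrite -(@ler_pXn2r _ 2%N) ?nnegrE ?(ltW d0)// real_normK ?num_real//; apply: (le_trans h).
rewrite (_ : d ^+ 2 = 2 * (e * B)); last by rewrite /e; field; rewrite gt_eqF.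
apply: ler_wpM2l => //; apply: ler_pM => //; [exact: nm_ge0|exact: nm_ge0|by apply: hB].
Qed.

Lemma HK1_sup B g x : cs g -> HK 1 B g -> `|g x| <= 2 * B.
Proof.
move=> cg h; have B0 := HK_ge0 h.
rewrite -(@ler_pXn2r _ 2%N) ?nnegrE ?mulr_ge0// real_normK ?num_real//.
exact: (HK_sup4 x cg h (leqnn 0)).
Qed.

Section family.
Context (T s eps B : R) (vv : nat -> R -> R).
Context (s0 : 0 < s) (s1 : s <= 1) (e0 : 0 < eps) (e1 : eps <= 1) (B1 : 1 <= B)
  (hcs : forall j, 1 <= T - j%:R * s -> cs (vv j)) (hB : forall j, 1 <= T - j%:R * s -> HK 4 B (vv j))
  (hstep : forall j, 1 <= T - j.+1%:R * s -> HK 1 (s * eps) (vv j.+1 - vv j + cst s * Phi (vv j))).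

(** Grid times T - j s decrease with j; this is the index of the last one that is not below t. *)
Definition jt t : nat := Num.truncn ((T - t) / s).
Definition interpolant t : R -> R := vv (jt t).

Lemma jt_itv t : t <= T -> (jt t)%:R * s <= T - t /\ T - t < (jt t)%:R * s + s.
Proof.
move=> tT; have h : 0 <= (T - t) / s by rewrite divr_ge0 ?subr_ge0// ltW.
have /andP[h1 h2] := truncn_itv h; split; first by rewrite -ler_pdivlMr.
by move: h2; rewrite ltr_pdivrMr// -natr1 mulrDl mul1r.
Qed.

Lemma jt_time t : t <= T -> t <= T - (jt t)%:R * s /\ T - (jt t)%:R * s <= t + s.
Proof. by move=> tT; have [h1 h2] := jt_itv tT; move: h1 h2; split; lra. Qed.

Lemma jt_anti t t' : t <= t' -> (jt t' <= jt t)%N.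
Proof. by move=> tt; apply: le_truncn; rewrite ler_pM2r ?invr_gt0//; lra. Qed.

Lemma jt_nat j : jt (T - j%:R * s) = j.
Proof. by rewrite /jt (_ : (T - (T - j%:R * s)) / s = j%:R) ?natrK//; field; rewrite gt_eqF. Qed.

Lemma time_le i j : (i <= j)%N -> 1 <= T - j%:R * s -> 1 <= T - i%:R * s.
Proof.
move=> ij h; have : i%:R * s <= j%:R * s by rewrite ler_pM2r// ler_nat.
by move: h; lra.
Qed.

(** Bounds the H^1 speed of the scheme: [cF 1 B] for Phi, 1 for the step error. *)
Definition C1 : R := cF 1 B + 1.
Lemma C1_ge0 : 0 <= C1.
Proof.
have B0 : 0 <= B := le_trans ler01 B1.
by rewrite /C1 /cF; apply: addr_ge0 => //; apply: addr_ge0 => //; repeat (apply: mulr_ge0 => //).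
Qed.

Lemma step_HK j : 1 <= T - j.+1%:R * s -> HK 1 (s * C1) (vv j.+1 - vv j).
Proof.
move=> h; have h0 := time_le (leqnSn j) h.
have cj := hcs h0; have cj1 := hcs h; have cP := cs_Phi cj.
have -> : vv j.+1 - vv j = (vv j.+1 - vv j + cst s * Phi (vv j)) + (- (cst s * Phi (vv j))) by rewrite addrK.
have hP : HK 1 (cF 1 B) (Phi (vv j)) by apply: HK_Phi => //; exact: hB.
apply: (HK_le (leqnn 1) _ (HK_add _ _ (hstep h) (HK_opp _ (HK_scale0 cP (ltW s0) hP)))).
- have se : s * eps <= s by rewrite -[leRHS]mulr1 ler_wpM2l// ltW.
  by rewrite /C1 [s * (cF 1 B + 1)]mulrDr mulr1 addrC lerD2l.
- by apply: csD; [exact: csB|exact: csZ].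
- by apply: csN; exact: csZ.
- by exact: csZ.
Qed.

Lemma steps_HK i d : 1 <= T - (i + d)%:R * s -> HK 1 (d%:R * (s * C1)) (vv (i + d) - vv i).
Proof.
elim: d => [|d ih] h.
  rewrite addn0 subrr mul0r => k _; rewrite dn_zero /nm /nn mulr0 (_ : ii 0 = 0) ?sqrtr0//.
  have := @iiD R 0 0 (@cs0 R) (@cs0 R); rewrite addr0 => z; lra.
rewrite addnS in h *; have h0 := time_le (leqnSn _) h; have ci := hcs (time_le (leq_addr d i) h0).
have c1 := hcs h0; have c2 := hcs h.
have -> : vv (i + d).+1 - vv i = (vv (i + d).+1 - vv (i + d)) + (vv (i + d) - vv i) by rewrite addrA subrK.
rewrite -natr1 mulrDl mul1r addrC; apply: HK_add; [exact: csB|exact: csB|exact: step_HK|exact: ih].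
Qed.

Lemma steps_pointwise i d x (P M : R) : 1 <= T - (i + d)%:R * s -> (forall k, (i <= k)%N -> (k < i + d)%N -> `|Phi (vv k) x - P| <= M) ->
  `|vv i x - vv (i + d) x - d%:R * s * P| <= d%:R * s * (M + 2 * eps).
Proof.
elim: d => [|d ih] h hM; first by rewrite addn0 subrr !mul0r subr0 normr0.
rewrite addnS in h hM *; have h0 := time_le (leqnSn _) h; have c1 := hcs h0; have c2 := hcs h.
have cP := cs_Phi c1.
have e := HK1_sup x (csD (csB c2 c1) (csZ s cP)) (hstep h).
rewrite -[(_ - _ + _) x]/(vv (i + d).+1 x - vv (i + d) x + s * Phi (vv (i + d)) x) in e.
have a := ih h0 (fun k k1 k2 => hM k k1 (ltnW k2)).
have b := hM (i + d)%N (leq_addr d i) (ltnSn _).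
have b' : `|s * (Phi (vv (i + d)) x - P)| <= s * M by rewrite normrM gtr0_norm// ler_wpM2l// ltW.
rewrite -natr1; have -> : vv i x - vv (i + d).+1 x - (d%:R + 1) * s * P = (vv i x - vv (i + d) x - d%:R * s * P) - (vv (i + d).+1 x - vv (i + d) x + s * Phi (vv (i + d)) x) + s * (Phi (vv (i + d)) x - P) by ring.
apply: (le_trans (ler_normD _ _)); apply: (le_trans (lerD (ler_normB _ _) b')).
by apply: (le_trans (lerD (lerD a e) (lexx (s * M)))); rewrite le_eqVlt; apply/orP; left; apply/eqP; ring.
Qed.

(** The extra [s] is one grid step: the interpolant is piecewise constant, and two close times may
    lie on either side of a jump. *)
Lemma family_HK t t' : 1 <= t -> t <= t' -> t' <= T -> HK 1 ((t' - t + s) * C1) (interpolant t' - interpolant t).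
Proof.
move=> t1 tt tT; have tT' : t <= T := le_trans tt tT.
have [a1 a2] := jt_itv tT'; have [b1 b2] := jt_itv tT; have jj := jt_anti tt.
have h1 : 1 <= T - (jt t)%:R * s by move: a1 t1; lra.
have e : jt t = (jt t' + (jt t - jt t'))%N by rewrite subnKC.
rewrite e in h1; have := steps_HK h1; rewrite -e in h1 * => h.
have c1 : cs (vv (jt t)) := hcs h1; have c2 : cs (vv (jt t')) := hcs (time_le jj h1).
have -> : interpolant t' - interpolant t = - (vv (jt t) - vv (jt t')) by rewrite /interpolant opprB.
apply: (HK_le (leqnn 1) _ (HK_opp (csB c1 c2) h)).
rewrite mulrA; apply: ler_wpM2r; first exact: C1_ge0.
by rewrite natrB// mulrBl; move: a1 a2 b1 b2; lra.
Qed.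

(** The integrated equation in discrete form, with the flux frozen at the earlier time [t]. The
    bound [M] on its variation will come from equicontinuity in time. *)
Lemma family_step t t' x (M C : R) : 1 <= t -> t <= t' -> t' <= T -> 0 <= M ->
  (forall tau, t <= tau -> tau <= t' + s -> tau <= T -> `|Phi (interpolant tau) x - Phi (interpolant t) x| <= M) ->
  `|Phi (interpolant t) x| <= C ->
  `|interpolant t' x - interpolant t x - (t' - t) * Phi (interpolant t) x| <= (t' - t + s) * (M + 2 * eps) + s * C.
Proof.
move=> t1 tt tT M0 hM hC; have tT' : t <= T := le_trans tt tT.
have [a1 a2] := jt_itv tT'; have [b1 b2] := jt_itv tT; have jj := jt_anti tt.
have h1 : 1 <= T - (jt t)%:R * s by move: a1 t1; lra.
pose d := (jt t - jt t')%N; have e : jt t = (jt t' + d)%N by rewrite subnKC.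
have h2 := h1; rewrite e in h2; set P := Phi (interpolant t) x in hM hC *.
have hk k : (jt t' <= k)%N -> (k < jt t' + d)%N -> `|Phi (vv k) x - P| <= M.
  move=> k1 k2; rewrite -{1}(jt_nat k).
  have k3 : k%:R * s <= (jt t)%:R * s by rewrite ler_pM2r// ler_nat e ltnW.
  have k4 : (jt t')%:R * s <= k%:R * s by rewrite ler_pM2r// ler_nat.
  have k5 : 0 <= k%:R * s by rewrite mulr_ge0// ltW.
  by apply: hM; move: k3 k4 k5 a1 a2 b1 b2; lra.
have := steps_pointwise h2 hk; rewrite -e => h.
have ds1 : d%:R * s <= t' - t + s by rewrite /d natrB// mulrBl; move: a1 a2 b1 b2; lra.
have ds2 : `|d%:R * s - (t' - t)| <= s.
  by rewrite /d natrB// mulrBl ler_norml; apply/andP; move: a1 a2 b1 b2; split; lra.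
rewrite (_ : _ - _ - _ = (vv (jt t') x - vv (jt t) x - d%:R * s * P) + (d%:R * s - (t' - t)) * P); last by rewrite /interpolant; ring.
apply: (le_trans (ler_normD _ _)); apply: lerD; last by rewrite normrM; apply: ler_pM.
apply: (le_trans h); apply: ler_wpM2r => //.
by apply: addr_ge0 => //; apply: mulr_ge0 => //; exact: ltW.
Qed.

End family.

(* One member of the approximating family: a step function of time built on the Euler scheme. *)
Record family_bounds (K k4 B N m : R) (V : R -> R -> R) (T s eps : R) (W : R -> R -> R) : Prop := FamilyBounds {
  fb_s0 : 0 < s; fb_s1 : s <= eps;
  fb_HK : forall t, 1 <= t -> t <= T -> cs (W t) /\ HK 4 B (W t);
  fb_V : forall t, 1 <= t -> t <= T -> exists tau, [/\ t <= tau, tau <= t + s,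
    nm (W t - V tau) <= K * (m * bt tau ^+ 7) & nm (dx (W t - V tau)) <= k4 * (N * m)];
  fb_time : forall t t', 1 <= t -> t <= t' -> t' <= T -> HK 1 ((t' - t + s) * C1 B) (W t' - W t);
  fb_step : forall t t' x (M C : R), 1 <= t -> t <= t' -> t' <= T -> 0 <= M ->
    (forall tau, t <= tau -> tau <= t' + s -> tau <= T -> `|Phi (W tau) x - Phi (W t) x| <= M) -> `|Phi (W t) x| <= C ->
    `|W t' x - W t x - (t' - t) * Phi (W t) x| <= (t' - t + s) * (M + 2 * eps) + s * C }.

Theorem approx_family (c : R) : 0 <= c -> exists K k4 e0, [/\ 0 < K, 0 <= k4 & 0 < e0] /\
  forall N rN m e CN V Vt, Vdata c N rN m e CN V Vt -> e <= e0 ->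
  exists B, 1 <= B /\ forall T eps, 1 <= T -> 0 < eps -> eps <= 1 -> exists s W, family_bounds K k4 B N m V T s eps W.
Proof.
move=> c0; have [K [k4 [e0 [h0 h]]]] := approx c0; exists K, k4, e0; split => // N rN m e CN V Vt VD ee.
have [B [B1 hB]] := h _ _ _ _ _ _ _ VD ee; exists B; split => // T eps T1 eps0 eps1.
have [s [vv [s0 se v0 hv hstep]]] := hB T eps T1 eps0.
exists s, (interpolant T s vv).
have s1 : s <= 1 := le_trans se eps1.
have hcs j : 1 <= T - j%:R * s -> cs (vv j) by move=> /hv[].
have hHK j : 1 <= T - j%:R * s -> HK 4 B (vv j) by move=> /hv[].
have ok t : 1 <= t -> t <= T -> 1 <= T - (jt T s t)%:R * s.
  by move=> t1 tT; have [a1 _] := jt_time s0 tT; exact: le_trans t1 a1.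
split => //.
- by move=> t t1 tT; split; [exact: hcs (ok t t1 tT)|exact: hHK (ok t t1 tT)].
- move=> t t1 tT; have [a1 a2] := jt_time s0 tT; have [_ b1 b2 _] := hv _ (ok t t1 tT).
  by exists (T - (jt T s t)%:R * s).
- by move=> t t' t1 tt tT; apply: (family_HK (eps := eps)).
- by move=> t t' x M C t1 tt tT M0 hM hC; exact: (family_step s0 eps0 hcs hstep).
Qed.

End discrete_family.

(** * Limits along an ultrafilter *)

Section ultralimits.
Context {R : realType}.
Implicit Types (f g : R -> R) (x y t : R).

(** One ultrafilter makes the approximations and their derivatives converge at every (x, t) at once,
    where a subsequence would need a diagonal argument and a dense set. *)
Lemma ultra_bounded_cvg (U : set_system nat) (u : nat -> R) (M : R) : UltraFilter U -> (\forall n \near U, `|u n| <= M) ->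
  cvg (u n @[n --> U]).
Proof.
move=> uU hM; have hA : (u n @[n --> U]) `[- M, M]%classic.
  by apply: filterS hM => n; rewrite /= in_itv/= ler_norml.
have [p [_ hp]] := @segment_compact R (- M) M (u n @[n --> U]) _ hA.
apply/cvg_ex; exists (p : R) => B hB; have [//|hC] := in_ultra_setVsetC (u @^-1` B) uU.
have hC' : (u n @[n --> U]) (~` B) by exact: hC.
by have [z [nz Bz]] := hp _ _ hC' hB.
Qed.

Lemma is_derive_modulus f x (l : R) :
  (forall d, 0 < d -> exists r, 0 < r /\ forall y, `|y - x| < r -> `|f y - f x - (y - x) * l| <= d * `|y - x|) -> is_derive x 1 f l.
Proof.
move=> h; have c : h0^-1 *: ((f \o shift x) (h0 *: (1 : R)) - f x) @[h0 --> 0^'] --> l.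
  apply/cvgrPdist_le => d d0; have [r [r0 hr]] := h d d0.
  exists r => //= y /=; rewrite sub0r normrN => yr y0.
  have -> : y *: (1 : R) = y by rewrite /GRing.scale/= mulr1.
  have := hr (y + x); rewrite addrK => /(_ yr) hy.
  rewrite /= -[_ *: _]/(y^-1 * (f (y + x) - f x)).
  have -> : l - y^-1 * (f (y + x) - f x) = - (y^-1 * (f (y + x) - f x - y * l)) by field.
  rewrite normrN normrM normfV mulrC ler_pdivrMr ?normr_gt0//.
by split; [apply/cvg_ex; exists l|exact: cvg_lim].
Qed.

Lemma sqrtr_sqr_ge0 x : 0 <= x -> Num.sqrt (x ^+ 2) = x.
Proof. by move=> x0; rewrite sqrtr_sqr ger0_norm. Qed.

Definition holder f (L : R) := forall x y, `|f x - f y| <= L * Num.sqrt `|x - y|.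

Lemma holder_continuous f L : holder f L -> continuous f.
Proof.
move=> h x; apply/cvgrPdist_le => d d0.
have L0 : 0 <= L by have := h 1 0; rewrite subr0 normr1 sqrtr1 mulr1; apply: le_trans.
pose e := (d / (L + 1)) ^+ 2; have e0 : 0 < e by rewrite exprn_gt0// divr_gt0//; lra.
exists e => //= y /= xy; apply: (le_trans (h x y)).
have se : Num.sqrt `|x - y| <= d / (L + 1).
  have de : 0 <= d / (L + 1) by rewrite divr_ge0 ?(ltW d0)//; lra.
  by rewrite -(sqrtr_sqr_ge0 de) ler_wsqrtr// ltW.
apply: (le_trans (ler_wpM2l L0 se)); rewrite mulrA ler_pdivrMr; last by lra.
by rewrite mulrC; apply: ler_wpM2l; [exact: ltW|lra].
Qed.

(** Dominated convergence is about sequences and does not apply along an ultrafilter. A common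
    Hoelder bound and compactness of [-r, r] make the convergence uniform there instead. *)
Lemma L2_limit (U : set_system nat) (f : nat -> R -> R) g (L A r : R) : ProperFilter U -> 0 < r ->
  (\forall n \near U, holder (f n) L) -> (forall x, f n x @[n --> U] --> g x) ->
  (\forall n \near U, In (- r) r (fun x => f n x ^+ 2) <= A) -> In (- r) r (fun x => g x ^+ 2) <= A.
Proof.
move=> pU r0 hL hg hA.
have hgL : holder g L.
  move=> x y; have c : `|f n x - f n y| @[n --> U] --> `|g x - g y| by apply: cvg_norm; apply: cvgB; exact: hg.
  by apply: (cvgr_to_le c); apply: filterS hL => n; exact.
have mg := continuous_mb (holder_continuous hgL); have mg2 := mb_sqr mg.
have L0 : 0 <= L by have := hgL 1 0; rewrite subr0 normr1 sqrtr1 mulr1; apply: le_trans.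
have ab : - r <= r by lra.
have [G hG] := mg.2 r; have G0 : 0 <= G by apply: le_trans (hG 0 _) => //; rewrite normr0 ltW.
apply/ler_addgt0Pr => e e0.
(* On [-r, r] the squares differ by at most d (2 G + d) with d <= 1, and the length is 2 r. *)
pose d := Num.min 1 (e / ((2 * G + 1) * (2 * r))).
have d0 : 0 < d by rewrite lt_min ltr01 divr_gt0// mulr_gt0//; lra.
have d1 : d <= 1 by rewrite ge_min lexx.
have de : d * ((2 * G + 1) * (2 * r)) <= e.
  by rewrite -ler_pdivlMr ?ge_min ?lexx ?orbT// mulr_gt0//; lra.
have unif : \forall n \near U, `[- r, r]%classic `<=` (fun x => `|f n x - g x| <= d).
  have /compact_near_coveringP nc := @segment_compact R (- r) r.
  apply: (nc nat U (fun n x => `|f n x - g x| <= d) _) => x _.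
  pose q := (d / (4 * (L + 1))) ^+ 2; have q0 : 0 < q by rewrite exprn_gt0// divr_gt0//; lra.
  have h1 : \forall n \near U, `|f n x - g x| <= d / 2.
    have d2 : 0 < d / 2 by lra.
    have hgx := hg x; move/cvgrPdist_le : hgx => /(_ _ d2) hgx.
    by apply: (filterS _ hgx) => n /=; rewrite distrC.
  have h2 : \forall y \near x, `|x - y| < q by exact: nbhsx_ballx.
  exists ([set y : R | `|x - y| < q], [set n | `|f n x - g x| <= d / 2 /\ holder (f n) L]); first by split => //; exact: filterI.
  move=> [y n] /= [yq [hn hnL]].
  have se : L * Num.sqrt `|x - y| <= d / 4.
    have de0 : 0 <= d / (4 * (L + 1)) by rewrite divr_ge0 ?(ltW d0)//; lra.
    have : Num.sqrt `|x - y| <= d / (4 * (L + 1)) by rewrite -(sqrtr_sqr_ge0 de0) ler_wsqrtr// ltW.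
    move=> h; apply: (le_trans (ler_wpM2l L0 h)).
    rewrite (_ : d / (4 * (L + 1)) = d / 4 / (L + 1)); last by field; rewrite gt_eqF//; lra.
    rewrite mulrA ler_pdivrMr; last by lra.
    by rewrite mulrC; apply: ler_wpM2l; lra.
  have a1 := le_trans (hnL x y) se; have a2 := le_trans (hgL x y) se.
  have -> : f n y - g y = - (f n x - f n y) + (f n x - g x) + (g x - g y) by ring.
  apply: (le_trans (ler_normD _ _)); apply: (le_trans (lerD (ler_normD _ _) (lexx _))); rewrite normrN; lra.
have [n [hn hn2 hn3]] : exists n, [/\ `[- r, r]%classic `<=` (fun x => `|f n x - g x| <= d), In (- r) r (fun x => f n x ^+ 2) <= A & holder (f n) L].
  have [n [[a b] c]] := @filter_ex _ _ pU _ (filterI (filterI unif hA) hL).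
  by exists n.
have mf2 := mb_sqr (continuous_mb (holder_continuous hn3)).
apply: (@le_trans _ _ (In (- r) r (fun x => f n x ^+ 2 + d * (2 * G + 1)))).
  apply: In_le => //; first by apply: mbD => //; exact: mbC.
  move=> x hx; have dx := hn x hx; have gx : `|g x| <= G by apply: hG; rewrite ler_norml.
  move: dx gx; rewrite !ler_norml => /andP[u1 u2] /andP[v1 v2]; move: (f n x) (g x) u1 u2 v1 v2 => a b u1 u2 v1 v2.
  have s1 : 0 <= (d - (b - a)) * (2 * G + d - (b + a)) + (d + (b - a)) * (2 * G + d + (b + a)).
    by apply: addr_ge0; apply: mulr_ge0; lra.
  have s2 : 0 <= (d - (b - a)) * (2 * G + d + (b + a)) by apply: mulr_ge0; lra.
  have s3 : 0 <= (d + (b - a)) * (2 * G + d - (b + a)) by apply: mulr_ge0; lra.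
  have s4 : d * d <= d * 1 by apply: ler_wpM2l; lra.
  have e2 : (d - (b - a)) * (2 * G + d + (b + a)) + (d + (b - a)) * (2 * G + d - (b + a)) = 2 * (2 * G * d + d * d) - 2 * (b ^+ 2 - a ^+ 2) by ring.
  move: s2 s3 s4 e2; move: ((d - (b - a)) * (2 * G + d + (b + a))) ((d + (b - a)) * (2 * G + d - (b + a))) => p1 p2 s2 s3 s4 e2.
  rewrite (_ : d * (2 * G + 1) = 2 * G * d + d); last by ring.
  move: s4 e2; move: (d * d) (b ^+ 2) (a ^+ 2) (2 * G * d) => w1 w2 w3 w4; lra.
rewrite In_D//; last exact: mbC.
rewrite In_cst//; apply: lerD => //; apply: le_trans de; rewrite le_eqVlt; apply/orP; left; apply/eqP; ring.
Qed.

End ultralimits.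

(** * Equicontinuity and the equation in the limit *)

Section limit.
Context {R : realType}.
Implicit Types (f g : R -> R) (x y t : R).

Lemma HK_norm_le K (B : R) g x j : cs g -> HK K.+1 B g -> (j <= K)%N -> `|dn j g x| <= 2 * B.
Proof.
move=> cg h jK; have B0 := HK_ge0 h.
rewrite -(@ler_pXn2r _ 2%N) ?nnegrE ?mulr_ge0// real_normK ?num_real//.
exact: (HK_sup4 x cg h jK).
Qed.

Lemma HK_holder K (B : R) g j : cs g -> HK K.+1 B g -> (j <= K)%N -> holder (dn j g) B.
Proof.
move=> cg h jK x y; rewrite mulrC; apply: (le_trans (holder_nm y x (cs_dn j cg))).
by apply: ler_wpM2l; rewrite ?sqrtr_ge0// -dnS; exact: h.
Qed.

Lemma holder_taylor (f g : R -> R) (L : R) x y : (forall x : R, is_derive x 1 f (g x)) -> holder g L ->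
  `|f y - f x - (y - x) * g x| <= L * Num.sqrt `|y - x| * `|y - x|.
Proof.
move=> fg hg; have L0 : 0 <= L by have := hg 1 0; rewrite subr0 normr1 sqrtr1 mulr1; apply: le_trans.
have key (a b z : R) : a <= b -> z = a \/ z = b -> `|f b - f a - (b - a) * g z| <= L * Num.sqrt `|b - a| * `|b - a|.
  move=> ab hz; have [c [/andP[ac cb] ->]] := mvt fg ab.
  rewrite (mulrC _ (b - a)) -mulrBr normrM mulrC; apply: ler_wpM2r => //.
  apply: (le_trans (hg c z)); apply: ler_wpM2l => //; apply: ler_wsqrtr.
  rewrite (ger0_norm (_ : 0 <= b - a)) ?subr_ge0//.
  by case: hz => ->; rewrite ler_norml; apply/andP; split; lra.
have [xy|yx] := leP x y; first by apply: key => //; left.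
have := @key y x x (ltW yx) (or_intror erefl).
rewrite (distrC x y) -[X in X <= _ -> _]normrN => h; apply: le_trans h; rewrite le_eqVlt; apply/orP; left; apply/eqP.
by rewrite (_ : - (f x - f y - (x - y) * g x) = f y - f x - (y - x) * g x)//; ring.
Qed.

Lemma flux_var (a b a1 b1 a3 b3 B d : R) : `|a3 - b3| <= d -> `|a1 - b1| <= d -> `|a - b| <= d ->
  `|b1| <= B -> `|b| <= B -> `|a| <= B ->
  `|(- a3 + 6 * (a ^+ 2 * a1)) - (- b3 + 6 * (b ^+ 2 * b1))| <= d * (1 + 18 * B ^+ 2).
Proof.
move=> h3 h1 h0 g1 g0 f0.
have B0 : 0 <= B by exact: le_trans f0.
have -> : - a3 + 6 * (a ^+ 2 * a1) - (- b3 + 6 * (b ^+ 2 * b1)) = - (a3 - b3) + 6 * (a * a * (a1 - b1) + (a - b) * (a + b) * b1) by ring.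
apply: (le_trans (ler_normD _ _)); rewrite normrN normrM (ger0_norm (_ : 0 <= 6))//.
have h4 : `|a * a * (a1 - b1)| <= B * B * d.
  by rewrite !normrM; apply: ler_pM => //; apply: ler_pM.
have h5 : `|(a - b) * (a + b) * b1| <= d * (B + B) * B.
  rewrite !normrM; apply: ler_pM => //; apply: ler_pM => //.
  by apply: (le_trans (ler_normD _ _)); exact: lerD.
have h6 := le_trans (ler_normD _ _) (lerD h4 h5).
rewrite (_ : d * (1 + 18 * B ^+ 2) = d + 6 * (B * B * d + d * (B + B) * B)); last by ring.
by apply: lerD => //; apply: ler_wpM2l.
Qed.

Lemma Phi_var f g x (B d : R) : (forall k, (k <= 3)%N -> `|dn k f x| <= B) ->
  (forall k, (k <= 3)%N -> `|dn k g x| <= B) -> (forall k, (k <= 3)%N -> `|dn k f x - dn k g x| <= d) ->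
  `|Phi f x - Phi g x| <= d * (1 + 18 * B ^+ 2).
Proof.
move=> hf hg hd.
have f0 : `|f x| <= B := hf 0%N isT.
have g0 : `|g x| <= B := hg 0%N isT; have g1 : `|dx g x| <= B := hg 1%N isT.
have h0 : `|f x - g x| <= d := hd 0%N isT; have h1 : `|dx f x - dx g x| <= d := hd 1%N isT.
have h3 : `|dx (dx (dx f)) x - dx (dx (dx g)) x| <= d := hd 3%N isT.
exact: flux_var.
Qed.

Context (K k4 B N m CN : R) (V : R -> R -> R) (W : nat -> R -> R -> R) (s : nat -> R) (U : set_system nat).
Context (uU : UltraFilter U) (Uoo : \oo `<=` U) (B1 : 1 <= B) (K0 : 0 < K) (k40 : 0 <= k4) (N0 : 0 < N) (m0 : 0 < m).
Context (hW : forall n, family_bounds K k4 B N m V n.+1%:R (s n) (n.+1%:R)^-1 (W n)).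
Context (cV : forall t, 1 <= t -> cs (V t)) (hV : forall t, 1 <= t -> HK 2 CN (V t)).
Context (hVt : forall t tau, 1 <= t -> t <= tau -> tau <= t + 1 -> HK 1 (CN * (tau - t)) (V tau - V t)).

Lemma near_T t : \forall n \near U, t <= n.+1%:R.
Proof.
apply: Uoo; exists (Num.truncn t).+1 => // n /= hn.
apply: (@le_trans _ _ (Num.truncn t).+1%:R); first exact/ltW/truncnS_gt.
by rewrite ler_nat; apply: leq_trans hn _.
Qed.

Lemma near_eps (d : R) : 0 < d -> \forall n \near U, (n.+1%:R)^-1 <= d.
Proof.
move=> d0; apply: filterS (near_T d^-1) => n h.
by rewrite -(invrK d) lef_pV2// posrE ?invr_gt0.
Qed.

Lemma near_s (d : R) : 0 < d -> \forall n \near U, s n <= d.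
Proof. by move=> d0; apply: filterS (near_eps d0) => n; apply: le_trans; exact: (fb_s1 (hW n)). Qed.

Lemma W_ok t : 1 <= t -> \forall n \near U, cs (W n t) /\ HK 4 B (W n t).
Proof. by move=> t1; apply: filterS (near_T t) => n h; exact: (fb_HK (hW n)). Qed.

Definition vl k t x : R := lim (dn k (W n t) x @[n --> U]).

Lemma vl_cvg k t x : 1 <= t -> (k <= 3)%N -> dn k (W n t) x @[n --> U] --> vl k t x.
Proof.
move=> t1 k3; apply: (@ultra_bounded_cvg _ _ _ (2 * B)) => //.
by apply: filterS (W_ok t1) => n [c h]; exact: (HK_norm_le x c h).
Qed.

Lemma vl_holder k t : 1 <= t -> (k <= 3)%N -> holder (vl k t) B.
Proof.
move=> t1 k3 x y; apply: (cvgr_to_le (cvg_norm (cvgB (vl_cvg (x := x) t1 k3) (vl_cvg (x := y) t1 k3)))).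
by apply: filterS (W_ok t1) => n [c h]; exact: (HK_holder c h).
Qed.

(** A first-order expansion with Hoelder remainder survives pointwise limits; it identifies the
    limits of the derivatives as derivatives of the limit. *)
Lemma vl_taylor k t x y : 1 <= t -> (k <= 2)%N ->
  `|vl k t y - vl k t x - (y - x) * vl k.+1 t x| <= B * Num.sqrt `|y - x| * `|y - x|.
Proof.
move=> t1 k2; have k3 : (k <= 3)%N by apply: leq_trans k2 _.
have c : dn k (W n t) y - dn k (W n t) x - (y - x) * dn k.+1 (W n t) x @[n --> U] --> vl k t y - vl k t x - (y - x) * vl k.+1 t x.
  by apply: cvgB; [apply: cvgB; exact: vl_cvg|apply: cvgZr; exact: vl_cvg].
apply: (cvgr_to_le (cvg_norm c)); apply: filterS (W_ok t1) => n [cw h].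
apply: holder_taylor; last exact: (HK_holder cw h).
by move=> z; rewrite dnS; apply: dble_is_derive; apply: cs_dble; exact: cs_dn.
Qed.

Lemma vl_dx k t x : 1 <= t -> (k <= 2)%N -> is_derive x 1 (vl k t) (vl k.+1 t x).
Proof.
move=> t1 k2; apply: is_derive_modulus => d d0.
pose e := (d / B) ^+ 2; have e0 : 0 < e by rewrite exprn_gt0// divr_gt0//; have := B1; lra.
exists e; split => // y hy; apply: (le_trans (vl_taylor x y t1 k2)); apply: ler_wpM2r => //.
have dB : 0 <= d / B by rewrite divr_ge0 ?(ltW d0)//; have := B1; lra.
have h : Num.sqrt `|y - x| <= d / B by rewrite -(sqrtr_sqr_ge0 dB) ler_wsqrtr// ltW.
have B0 : 0 < B by have := B1; lra.
by rewrite mulrC -ler_pdivlMr.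
Qed.

Lemma W_time (d : R) : 0 < d -> exists r, 0 < r /\ forall t t', 1 <= t -> t <= t' -> t' <= t + r ->
  forall n, s n <= r -> t' <= n.+1%:R -> forall k x, (k <= 3)%N -> `|dn k (W n t') x - dn k (W n t) x| <= d.
Proof.
move=> d0; have B2 : 1 <= 2 * B by have := B1; lra.
have [q [q0 hq]] := interp B2 d0.
have C0 : 0 <= C1 B by apply: C1_ge0.
pose r := q / (2 * (C1 B + 1)); have r0 : 0 < r by rewrite divr_gt0//; lra.
exists r; split => // t t' t1 tt tr n sn tn k x k3.
have [cw hw] := fb_HK (hW n) t1 (le_trans tt tn).
have [cw' hw'] := fb_HK (hW n) (le_trans t1 tt) tn.
have := hq (W n t' - W n t) (csB cw' cw) _ _ k x k3; rewrite dn_add ?dn_opp//; last exact: csN.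
apply.
  rewrite (_ : 2 * B = B + B); last by ring.
  by apply: HK_add => //; [exact: csN|exact: HK_opp].
apply: (HK_le (leqnn 1) _ (fb_time (hW n) t1 tt tn)).
have h : t' - t + s n <= 2 * r by lra.
apply: (le_trans (ler_wpM2r C0 h)); rewrite /r.
rewrite (_ : 2 * (q / (2 * (C1 B + 1))) * C1 B = q * C1 B / (C1 B + 1)); last by field; apply/eqP; lra.
rewrite ler_pdivrMr; last by lra.
by apply: ler_wpM2l; [exact: ltW|lra].
Qed.

Lemma vl_time (d : R) : 0 < d -> exists r, 0 < r /\ forall t t', 1 <= t -> 1 <= t' -> `|t' - t| <= r ->
  forall k x, (k <= 3)%N -> `|vl k t' x - vl k t x| <= d.
Proof.
move=> d0; have [r [r0 hr]] := W_time d0; exists r; split => //.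
have key t t' k x : 1 <= t -> t <= t' -> t' <= t + r -> (k <= 3)%N -> `|vl k t' x - vl k t x| <= d.
  move=> t1 tt tr k3; have t1' := le_trans t1 tt.
  apply: (cvgr_to_le (cvg_norm (cvgB (vl_cvg (x := x) t1' k3) (vl_cvg (x := x) t1 k3)))).
  by apply: filterS (filterI (near_s r0) (near_T t')) => n [h1 h2]; exact: (hr t t').
move=> t t' t1 t1' h k x k3; have [tt|tt] := leP t t'.
  by apply: key => //; move: h; rewrite ler_norml => /andP[]; lra.
by rewrite distrC; apply: key => //; [exact: ltW|move: h; rewrite ler_norml => /andP[]; lra].
Qed.

Definition pl t x : R := - vl 3 t x + 6 * (vl 0 t x ^+ 2 * vl 1 t x).

Lemma Phi_cvg t x : 1 <= t -> Phi (W n t) x @[n --> U] --> pl t x.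
Proof.
move=> t1; rewrite /Phi /pl; apply: cvgD; first by apply: cvgN; exact: (vl_cvg (k := 3) t1).
by apply: cvgZr; apply: cvgM; [apply: cvgM; exact: (vl_cvg (k := 0) t1)|exact: (vl_cvg (k := 1) t1)].
Qed.

Lemma W_Phi (d : R) : 0 < d -> exists r, 0 < r /\ forall t t', 1 <= t -> t <= t' -> t' <= t + r ->
  forall n, s n <= r -> t' <= n.+1%:R -> forall x, `|Phi (W n t') x - Phi (W n t) x| <= d.
Proof.
move=> d0; pose q := 1 + 18 * (2 * B) ^+ 2.
have q1 : 1 <= q by rewrite /q lerDl mulr_ge0// sqr_ge0.
have q0 : 0 < q by lra.
pose e := d / q; have e0 : 0 < e by rewrite divr_gt0.
have [r [r0 hr]] := W_time e0; exists r; split => // t t' t1 tt tr n sn tn x.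
have [cw hw] := fb_HK (hW n) t1 (le_trans tt tn).
have [cw' hw'] := fb_HK (hW n) (le_trans t1 tt) tn.
apply: (le_trans (@Phi_var (W n t') (W n t) x (2 * B) e _ _ _)).
- by move=> k k3; exact: (HK_norm_le x cw' hw').
- by move=> k k3; exact: (HK_norm_le x cw hw).
- by move=> k k3; exact: hr.
by rewrite -/q -ler_pdivlMr.
Qed.

(** The second bound is [fb_step] in the limit, where the mesh terms disappear. It is one-sided,
    with base point at the earlier time. *)
Lemma pl_time (d : R) : 0 < d -> exists r, 0 < r /\ forall t t', 1 <= t -> t <= t' -> t' <= t + r ->
  forall x, `|pl t' x - pl t x| <= d /\ `|vl 0 t' x - vl 0 t x - (t' - t) * pl t x| <= d * (t' - t).
Proof.
move=> d0; have [r [r0 hr]] := W_Phi d0; pose q := r / 2; have q0 : 0 < q by rewrite /q; lra.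
exists q; split => // t t' t1 tt tr x; have t1' := le_trans t1 tt.
split.
  apply: (cvgr_to_le (cvg_norm (cvgB (Phi_cvg (x := x) t1') (Phi_cvg (x := x) t1)))).
  apply: filterS (filterI (near_s r0) (near_T t')) => n [h1 h2]; apply: (hr t t') => //.
  by move: tr; rewrite /q; lra.
pose C := 2 * B + 6 * ((2 * B) ^+ 2 * (2 * B)).
have C0 : 0 <= C by rewrite /C; have := B1 => ?; apply: addr_ge0; [lra|apply: mulr_ge0 => //; apply: mulr_ge0; [exact: sqr_ge0|lra]].
have c : W n t' x - W n t x - (t' - t) * Phi (W n t) x @[n --> U] --> vl 0 t' x - vl 0 t x - (t' - t) * pl t x.
  apply: cvgB; last by apply: cvgZr; exact: Phi_cvg.
  by apply: cvgB; [exact: (vl_cvg (k := 0) t1')|exact: (vl_cvg (k := 0) t1)].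
apply/ler_addgt0Pr => e e0; apply: (cvgr_to_le (cvg_norm c)).
pose D := 2 * (t' - t + 1) + d + 2 + C; have D0 : 0 < D by rewrite /D; lra.
pose z := Num.min 1 (Num.min q (e / D)); have z0 : 0 < z by rewrite !lt_min ltr01 q0 divr_gt0.
have z1 : z <= 1 by rewrite ge_min lexx.
have zq : z <= q by rewrite !ge_min lexx orbT.
have ze : z * D <= e by rewrite -ler_pdivlMr// !ge_min lexx !orbT.
apply: filterS (filterI (filterI (near_s z0) (near_eps z0)) (near_T t')) => n [[h1 h3] h2].
have [cw hw] := fb_HK (hW n) t1 (le_trans tt h2).
have PC : `|Phi (W n t) x| <= C.
  have a0 := HK_norm_le x cw hw (isT : (0 <= 3)%N); have a1 := HK_norm_le x cw hw (isT : (1 <= 3)%N); have a3 := HK_norm_le x cw hw (isT : (3 <= 3)%N).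
  rewrite /Phi; ptw; apply: (le_trans (ler_normD _ _)); rewrite normrN; apply: lerD => //.
  rewrite normrM (ger0_norm (_ : 0 <= 6))//; apply: ler_wpM2l => //; rewrite normrM normrX.
  by apply: ler_pM => //; rewrite ler_pXn2r// nnegrE//; have := B1; lra.
have hM : forall tau, t <= tau -> tau <= t' + s n -> tau <= n.+1%:R -> `|Phi (W n tau) x - Phi (W n t) x| <= d.
  move=> tau h4 h5 h6; apply: (hr t tau) => //; last by move: zq h1; rewrite /q; lra.
  by move: tr h5 zq h1; rewrite /q; lra.
apply: (le_trans (fb_step (hW n) t1 tt h2 (ltW d0) hM PC)).
have s0 := ltW (fb_s0 (hW n)); have i0 : 0 <= (n.+1%:R)^-1 :> R by rewrite invr_ge0.
move: s0 i0 h1 h3; move: (s n) (n.+1%:R^-1 : R) => a b s0 i0 h1 h3.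
have e1 : a * C <= z * C by apply: ler_wpM2r.
have e2 : a * d <= z * d by apply: ler_wpM2r => //; exact: ltW.
have e3 : (t' - t + a) * b <= (t' - t + 1) * z by apply: ler_pM => //; lra.
have -> : (t' - t + a) * (d + 2 * b) + a * C = d * (t' - t) + (a * d + 2 * ((t' - t + a) * b) + a * C) by ring.
apply: lerD => //; apply: le_trans ze; rewrite (_ : z * D = z * d + 2 * ((t' - t + 1) * z) + z * C + 2 * z); last by rewrite /D; ring.
move: e1 e2 e3; move: (a * C) (z * C) (a * d) (z * d) ((t' - t + a) * b) ((t' - t + 1) * z) => a1 a2 a3 a4 a5 a6 e1 e2 e3.
by clear -e1 e2 e3 z0; lra.
Qed.

Lemma vl_dt t x : 1 < t -> is_derive t 1 (fun t => vl 0 t x) (pl t x).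
Proof.
move=> t1; apply: is_derive_modulus => d d0; have d2 : 0 < d / 2 by lra.
have [r [r0 hr]] := pl_time d2.
exists (Num.min r (t - 1)); split; first by rewrite lt_min r0 subr_gt0.
move=> u; rewrite lt_min => /andP[h1 h2]; have [tu|ut] := leP t u.
  rewrite (ger0_norm (_ : 0 <= u - t)) ?subr_ge0//.
  have ur : u <= t + r by move: h1; rewrite ger0_norm ?subr_ge0//; lra.
  have [_ h] := hr t u (ltW t1) tu ur x; apply: (le_trans h).
  by apply: ler_wpM2r; rewrite ?subr_ge0//; lra.
move: h1 h2; rewrite ltr0_norm ?subr_lt0// => h1 h2.
have u1 : 1 <= u by lra.
have [h3 h4] := hr u t u1 (ltW ut) ltac:(lra) x.
(* To the left of t the expansion is based at [u], and the flux is carried from [u] to t by its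
   continuity in time. *)
rewrite (_ : vl 0 u x - vl 0 t x - (u - t) * pl t x = - (vl 0 t x - vl 0 u x - (t - u) * pl u x) + (t - u) * (pl t x - pl u x)); last by ring.
apply: (le_trans (ler_normD _ _)); rewrite normrN normrM (ger0_norm (_ : 0 <= t - u)); last by lra.
have h5 : (t - u) * `|pl t x - pl u x| <= (t - u) * (d / 2) by apply: ler_wpM2l => //; lra.
apply: (le_trans (lerD h4 h5)); by lra.
Qed.

(** Continuity in t is uniform in x, and the Hoelder bound gives continuity in x. *)
Lemma vl_joint k t x : 1 < t -> (k <= 3)%N -> {for (x, t), continuous (fun p : R * R => vl k p.2 p.1)}.
Proof.
move=> t1 k3; apply/cvgrPdist_le => d d0 /=; have d2 : 0 < d / 2 by lra.
have [r [r0 hr]] := vl_time d2.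
have c := holder_continuous (vl_holder (ltW t1) k3).
have := c x; move/cvgrPdist_le => /(_ _ d2) hx.
have ht : \forall u \near t, `|t - u| < Num.min r (t - 1).
  by apply: nbhsx_ballx; rewrite lt_min r0 subr_gt0.
exists ([set y | `|vl k t x - vl k t y| <= d / 2], [set u | `|t - u| < Num.min r (t - 1)]) => //.
move=> [y u] /= [hy]; rewrite lt_min => /andP[u1 u2].
have u0 : 1 <= u by move: u2; rewrite ltr_norml => /andP[]; lra.
have := hr u t u0 (ltW t1) (ltW u1) k y k3 => h.
rewrite (_ : vl k t x - vl k u y = (vl k t x - vl k t y) + (vl k t y - vl k u y)); last by ring.
by apply: (le_trans (ler_normD _ _)); lra.
Qed.

Lemma vl_L2 k t r : 1 <= t -> (k <= 1)%N -> 0 < r -> In (- r) r (fun x => vl k t x ^+ 2) <= B ^+ 2.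
Proof.
move=> t1 k1 r0; have k3 : (k <= 3)%N by apply: leq_trans k1 _.
apply: (@L2_limit _ U (fun n => dn k (W n t)) (vl k t) B) => //.
- by apply: filterS (W_ok t1) => n [c h]; exact: (HK_holder c h).
- by move=> x; exact: vl_cvg.
apply: filterS (W_ok t1) => n [c h]; apply: (le_trans (In_nn r (cs_dn k c))).
rewrite -nm2 ler_pXn2r ?nnegrE ?nm_ge0//; last by have := B1; lra.
by apply: h; apply: leq_trans k3 _.
Qed.

Lemma vl_L2_time k t t' r : 1 <= t -> t < t' -> (k <= 1)%N -> 0 < r ->
  In (- r) r (fun x => (vl k t' x - vl k t x) ^+ 2) <= (2 * (t' - t) * C1 B) ^+ 2.
Proof.
move=> t1 tt k1 r0; have k3 : (k <= 3)%N by apply: leq_trans k1 _.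
have t1' : 1 <= t' by lra.
apply: (@L2_limit _ U (fun n => dn k (W n t' - W n t)) (fun x => vl k t' x - vl k t x) (B + B)) => //.
- apply: filterS (filterI (W_ok t1) (W_ok t1')) => n [[c h] [c' h']].
  apply: (HK_holder (K := 3)) => //; first exact: csB.
  by apply: HK_add => //; [exact: csN|exact: HK_opp].
- move=> x; apply: (@cvg_trans _ ((dn k (W n t') x - dn k (W n t) x) @[n --> U])); last by apply: cvgB; exact: vl_cvg.
  apply: near_eq_cvg; apply: filterS (filterI (W_ok t1) (W_ok t1')) => n [[c h] [c' h']].
  by rewrite dn_add ?dn_opp//; exact: csN.
have st : 0 < t' - t by rewrite subr_gt0.
apply: filterS (filterI (near_s st) (near_T t')) => n [h1 h2].
have [c h] := fb_HK (hW n) t1 (le_trans (ltW tt) h2).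
have [c' h'] := fb_HK (hW n) t1' h2.
have C0 : 0 <= C1 B by exact: C1_ge0.
apply: (le_trans (In_nn r (cs_dn k (csB c' c)))).
rewrite -nm2 ler_pXn2r ?nnegrE ?nm_ge0//; last by apply: mulr_ge0 => //; lra.
apply: (le_trans (fb_time (hW n) t1 (ltW tt) h2 k1)); apply: ler_wpM2r => //; lra.
Qed.

(** [fb_V] compares with V at a nearby grid time tau >= t; V moves by O(tau - t), and the weight at
    tau is below the one at t. *)
Lemma near_V t (d : R) : 1 <= t -> 0 < d -> \forall n \near U,
  [/\ cs (W n t), HK 4 B (W n t), nm (W n t - V t) <= K * (m * bt t ^+ 7) + d & nm (dx (W n t - V t)) <= k4 * (N * m) + d].
Proof.
move=> t1 d0; have CN0 : 0 <= CN := HK_ge0 (hV t1).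
pose z := Num.min 1 (d / (CN + 1)); have z0 : 0 < z by rewrite lt_min ltr01 divr_gt0//; lra.
have zd : CN * z <= d.
  have : (CN + 1) * z <= d by rewrite mulrC -ler_pdivlMr ?ge_min ?lexx ?orbT//; lra.
  by move: z0; lra.
apply: filterS (filterI (near_s z0) (near_T t)) => n [h1 h2].
have [c h] := fb_HK (hW n) t1 h2; split => //.
all: have [tau [u1 u2 u3 u4]] := fb_V (hW n) t1 h2; have tau1 := le_trans t1 u1.
all: have tz : tau <= t + z by lra.
all: have z1 : z <= 1 by rewrite ge_min lexx.
all: have hh := hVt t1 u1 (le_trans tz (lerD (lexx _) z1)).
all: have CNz : CN * (tau - t) <= d by apply: le_trans zd; apply: ler_wpM2l => //; lra.
all: have -> : W n t - V t = (W n t - V tau) + (V tau - V t) by apply/funext => x; ptw; ring.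
all: have c1 := csB c (cV tau1); have c2 := csB (cV tau1) (cV t1).
  apply: (le_trans (nmD c1 c2)); apply: lerD; last exact: le_trans (hh 0%N isT) CNz.
  apply: (le_trans u3); apply: ler_wpM2l; first exact: ltW.
  apply: ler_wpM2l; first exact: ltW.
  have t0 : 0 < t by lra.
  have tau0 : 0 < tau by lra.
  by apply: lerXn2r; rewrite ?nnegrE ?(ltW (bt_gt0 _))// bt_anti.
rewrite dx_add//; apply: (le_trans (nmD (cs_der c1) (cs_der c2))); apply: lerD => //; exact: le_trans (hh 1%N isT) CNz.
Qed.

Lemma vl_L2_V t r : 1 <= t -> 0 < r ->
  In (- r) r (fun x => (vl 0 t x - V t x) ^+ 2) <= (2 * (K * (m * bt t ^+ 7))) ^+ 2.
Proof.
move=> t1 r0; have t0 : 0 < t by lra.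
(* Any positive slack would do; taking the bound itself gives the factor 2. *)
pose d := K * (m * bt t ^+ 7); have d0 : 0 < d by apply: mulr_gt0 => //; apply: mulr_gt0 => //; rewrite exprn_gt0// bt_gt0.
apply: (@L2_limit _ U (fun n => W n t - V t) (fun x => vl 0 t x - V t x) (B + CN)) => //.
- apply: filterS (W_ok t1) => n [c h]; apply: (@HK_holder 1 _ _ 0) => //; first exact: csB (cV t1).
  by apply: HK_add => //; [exact: csN (cV t1)|exact: (HK_le _ (lexx B) h)|apply: HK_opp; [exact: cV|exact: hV]].
- by move=> x; apply: cvgB; [exact: (vl_cvg (k := 0) t1)|exact: cvg_cst].
apply: filterS (near_V t1 d0) => n [c _ h _]; apply: (le_trans (In_nn r (csB c (cV t1)))).
rewrite -nm2 -/d ler_pXn2r ?nnegrE ?nm_ge0//; last by lra.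
by apply: (le_trans h); rewrite -/d; lra.
Qed.

Lemma vl_L2_dV t r : 1 <= t -> 0 < r ->
  In (- r) r (fun x => (vl 1 t x - dx (V t) x) ^+ 2) <= ((k4 + 1) * (N * m)) ^+ 2.
Proof.
move=> t1 r0; pose d := N * m; have d0 : 0 < d by exact: mulr_gt0.
apply: (@L2_limit _ U (fun n => dx (W n t - V t)) (fun x => vl 1 t x - dx (V t) x) (B + CN)) => //.
- apply: filterS (W_ok t1) => n [c h]; apply: (@HK_holder 1 _ _ 1) => //; first exact: csB (cV t1).
  by apply: HK_add => //; [exact: csN (cV t1)|exact: (HK_le _ (lexx B) h)|apply: HK_opp; [exact: cV|exact: hV]].
- move=> x; apply: (@cvg_trans _ ((dx (W n t) x - dx (V t) x) @[n --> U])); last by apply: cvgB; [exact: (vl_cvg (k := 1) t1)|exact: cvg_cst].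
  apply: near_eq_cvg; apply: filterS (W_ok t1) => n [c h].
  by rewrite dx_add ?dx_opp//; [exact: cV|exact: csN (cV t1)].
apply: filterS (near_V t1 d0) => n [c _ _ h]; apply: (le_trans (In_nn r (cs_der (csB c (cV t1))))).
rewrite -nm2 -/d ler_pXn2r ?nnegrE ?nm_ge0//; last by have := k40 => ?; apply: mulr_ge0; lra.
by apply: (le_trans h); rewrite -/d mulrDl mul1r.
Qed.

End limit.

(** * The exact solution *)

#[local] Opaque spd good pgood p_main p_third.

Section solution.
Context {R : realType}.
Implicit Types (f g : R -> R) (x y t r : R).

Lemma Hs_norm_ge0 (q : R) f : (0 <= Hs_norm q f)%E.
Proof. by apply: le_ereal_inf_tmp => _ [a [b [_ ->]]]; exact: poweR_ge0. Qed.

Lemma cvge0_near {T : Type} (F : set_system T) (u : T -> \bar R) : Filter F -> (forall a, (0 <= u a)%E) ->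
  (forall e, 0 < e -> \forall a \near F, (u a <= e%:E)%E) -> u a @[a --> F] --> 0%E.
Proof.
move=> FF u0 h; apply/fine_cvgP; split.
  by apply: filterS (h 1 ltr01) => x hx; rewrite ge0_fin_numE//; exact: le_lt_trans hx (ltry 1).
apply/cvgrPdist_le => e e0; apply: filterS (h e e0) => x hx.
rewrite sub0r normrN /= ger0_norm ?fine_ge0//; move: hx (u0 x); case: (u x) => [q| |]//.
Qed.

Section field.
Context (v : nat -> R -> R -> R) (B C : R).
Context (vdx : forall k t x, 1 <= t -> (k <= 2)%N -> is_derive x 1 (v k t) (v k.+1 t x))
  (vdt : forall t x, 1 < t -> is_derive t 1 (fun t => v 0 t x) (- v 3 t x + 6 * (v 0 t x ^+ 2 * v 1 t x)))
  (vc : forall k t x, 1 < t -> (k <= 3)%N -> {for (x, t), continuous (fun p : R * R => v k p.2 p.1)})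
  (vL2 : forall k t r, 1 <= t -> (k <= 1)%N -> 0 < r -> In (- r) r (fun x => v k t x ^+ 2) <= B ^+ 2)
  (vL2t : forall k t t' r, 1 <= t -> t < t' -> (k <= 1)%N -> 0 < r -> In (- r) r (fun x => (v k t' x - v k t x) ^+ 2) <= (C * (t' - t)) ^+ 2)
  (C0 : 0 <= C).

Lemma field_dn k t : 1 <= t -> (k <= 3)%N -> derive1n k (v 0 t) = v k t.
Proof.
move=> t1; elim: k => // k IH k3; rewrite derive1nS IH; last exact: ltnW.
by apply/funext => x; rewrite derive1E; have h := @vdx k t x t1 k3; exact: derive_val.
Qed.

Lemma field_L2t k t t' r : 1 <= t -> 1 <= t' -> (k <= 1)%N -> 0 < r ->
  In (- r) r (fun x => (v k t' x - v k t x) ^+ 2) <= (C * `|t' - t|) ^+ 2.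
Proof.
move=> t1 t1' k1 r0; have [tt|tt|<-] := ltgtP t t'.
- by rewrite ger0_norm ?subr_ge0 ?(ltW tt)//; exact: vL2t.
- rewrite ltr0_norm ?subr_lt0// opprB; apply: le_trans (vL2t t1' tt k1 r0).
  by rewrite le_eqVlt; apply/orP; left; apply/eqP; congr In; apply/funext => x; ring.
rewrite subrr normr0 mulr0 (_ : (fun x => _) = fun=> 0); last by apply/funext => x; rewrite subrr expr0n.
by rewrite In_cst ?mul0r ?expr0n//; lra.
Qed.

Lemma field_cont k t : 1 <= t -> (k <= 2)%N -> continuous (v k t).
Proof. by move=> t1 k2; apply: (@is_derive_cont _ _ (v k.+1 t)) => x; exact: vdx. Qed.

(** Lipschitz in time in H^1, and [Hs_le] with p = 1 passes to H^(1/4). *)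
Lemma field_Hs_t t t' : 1 <= t -> 1 <= t' -> (Hs_norm 4^-1 (fun x => (v 0 t' x - v 0 t x)%R) <= (4 * (C * `|t' - t|))%:E)%E.
Proof.
move=> t1 t1'; pose q := C * `|t' - t|; have q0 : 0 <= q by exact: mulr_ge0.
apply: (@Hs_le R _ (fun x => v 1 t' x - v 1 t x) (q ^+ 2) (q ^+ 2) _ 1) => //.
- move=> x; have h1 := @vdx 0 t x t1 isT; have h2 := @vdx 0 t' x t1' isT; exact: is_deriveB.
- by move=> x; apply: cvgB; exact: field_cont.
- by move=> r r0; exact: field_L2t.
- by move=> r r0; exact: field_L2t.
- by rewrite mulr_ge0.
rewrite -/q expr1n divr1 mul1r (_ : (4 * q) ^+ 2 = 16 * q ^+ 2); last by ring.
by have := sqr_ge0 q; move: (q ^+ 2) => z; lra.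
Qed.

(** The fields live on t >= 1, so that every t >= T is interior in time: derivatives are two-sided,
    and continuity at t = T comes with joint continuity. *)
Theorem field_solution (T : R) : 1 < T -> mkdv_solution 4^-1 T (fun x t => v 0 t x).
Proof.
move=> T1; have eN k t : 1 <= t -> (k <= 3)%N -> derive1n k ((fun x t => v 0 t x) ^~ t) = v k t by exact: field_dn.
have edt t x : 1 < t -> derive1 (fun t => v 0 t x) t = - v 3 t x + 6 * (v 0 t x ^+ 2 * v 1 t x).
  by move=> t1; rewrite derive1E; have h := @vdt t x t1; exact: derive_val.
have nearT x t : 1 < t -> \forall p \near ((x, t) : R * R), 1 < p.2.
  move=> t1; have h : \forall u \near t, 1 < u by exact: lt_nbhsr.
  by exists (setT, [set u | 1 < u]) => //=; [split => //; exact: filterT|case=> a b [_ /= ?]].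
split.
- apply: continuous_in_subspaceT => -[x t]; rewrite inE/= => hT; apply: vc => //; exact: lt_le_trans hT.
- move=> x t tT; have t1 : 1 < t by exact: lt_trans tT.
  split.
  + move=> k k3; rewrite eN ?(ltW t1)//; last exact: ltnW.
    by have h := @vdx k t x (ltW t1) k3; exact: ex_derive.
  + by have h := @vdt t x t1; exact: ex_derive.
  + move=> k k3; suff : derive1n k (v 0 p.2) p.1 @[p --> (x, t)] --> derive1n k (v 0 t) x by [].
    rewrite (eN k t (ltW t1) k3).
    apply: (@cvg_trans _ (v k p.2 p.1 @[p --> (x, t)])); last exact: (vc t1 k3).
    by apply: near_eq_cvg; apply: filterS (nearT x t t1) => p hp; rewrite eN// ltW.
  + suff : derive1 (fun t => v 0 t p.1) p.2 @[p --> (x, t)] --> derive1 (fun t => v 0 t x) t by [].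
    rewrite edt//.
    apply: (@cvg_trans _ ((- v 3 p.2 p.1 + 6 * (v 0 p.2 p.1 ^+ 2 * v 1 p.2 p.1)) @[p --> (x, t)])).
      by apply: near_eq_cvg; apply: filterS (nearT x t t1) => p hp; rewrite edt.
    have c3 : v 3 p.2 p.1 @[p --> (x, t)] --> v 3 t x by exact: (@vc 3 t x t1 isT).
    have c1 : v 1 p.2 p.1 @[p --> (x, t)] --> v 1 t x by exact: (@vc 1 t x t1 isT).
    have c0 : v 0 p.2 p.1 @[p --> (x, t)] --> v 0 t x by exact: (@vc 0 t x t1 isT).
    have c : - v 3 p.2 p.1 + 6 * (v 0 p.2 p.1 ^+ 2 * v 1 p.2 p.1) @[p --> (x, t)] --> (- v 3 t x + 6 * (v 0 t x ^+ 2 * v 1 t x) : R).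
      apply: cvgD; first exact: cvgN.
      apply: cvgM; first exact: cvg_cst.
      by apply: cvgM => //; exact: cvgM.
    exact: c.
- move=> x t tT; have t1 : 1 < t by exact: lt_trans tT.
  by rewrite edt// !eN ?(ltW t1)//; ring.
move=> t0 tT; have t1 : 1 <= t0 by lra.
split.
  apply: (@le_lt_trans _ _ (4 * (1 + B ^+ 2))%:E); last exact: ltry.
  apply: (@Hs_le R _ (v 1 t0) (B ^+ 2) (B ^+ 2) _ 1) => //.
  - by move=> x; exact: (@vdx 0 t0 x t1 isT).
  - exact: field_cont.
  - by move=> r r0; exact: (@vL2 0 t0 r t1 isT r0).
  - by move=> r r0; exact: (@vL2 1 t0 r t1 isT r0).
  - by rewrite mulr_ge0// addr_ge0// sqr_ge0.
  - rewrite expr1n divr1 mul1r; have := sqr_ge0 B; move: (B ^+ 2) => z z0.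
    have := sqr_ge0 z; rewrite (_ : (4 * (1 + z)) ^+ 2 = 16 * (1 + 2 * z + z ^+ 2)); last by ring.
    by move: (z ^+ 2) => y y0; lra.
apply: cvge0_near => [|e e0]; first by move=> t; exact: Hs_norm_ge0.
have D0 : 0 < 4 * (C + 1) by have := C0; lra.
have h : \forall t \near t0, `|t0 - t| < e / (4 * (C + 1)) by apply: nbhsx_ballx; exact: divr_gt0.
rewrite /prop_near1 /within /=; apply: filterS h => t ht; rewrite /= in_itv/= andbT => Tt.
have t1' : 1 <= t by lra.
apply: (le_trans (field_Hs_t t1 t1')); rewrite lee_fin distrC.
move: ht; rewrite ltr_pdivlMr// => ht; apply: le_trans (ltW ht).
have := normr_ge0 (t0 - t); move: (`|t0 - t|) => z z0.
rewrite (_ : z * (4 * (C + 1)) = 4 * (C * z) + 4 * z); last by ring.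
by rewrite lerDl mulr_ge0.
Qed.
End field.

End solution.

(** * The limit solution compared with v^[w] *)

Section assembly.
Context {R : realType}.
Implicit Types (f g : R -> R) (x y t r : R).

Lemma supp_bound (w : R -> R) : compactly_supported w -> exists Z, 1 <= Z /\ forall y, Z < `|y| -> w y = 0.
Proof.
move=> /compact_bounded [M [_ hM]]; exists (Num.max 1 (M + 1)); split; first by rewrite le_max lexx.
move=> y hy; apply/eqP; apply/negPn/negP => wy.
have M1 : M < Num.max 1 (M + 1) by rewrite lt_max; apply/orP; right; lra.
have cy : closure [set x | w x != 0] y by exact: subset_closure.
by have := hM _ M1 y cy; rewrite /= leNgt hy.
Qed.

Lemma bt4 t : 0 < t -> bt t ^+ 4 = t `^ (- 2^-1).
Proof. by move=> t0; rewrite /bt -powR_mulrn ?powR_ge0// -powRrM; congr (_ `^ _); field. Qed.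

Lemma approximate_time (c N rN m e CN : R) V Vt t tau : Vdata c N rN m e CN V Vt -> 1 <= t -> t <= tau -> tau <= t + 1 ->
  HK 1 (2 * CN * (tau - t)) (V tau - V t).
Proof.
move=> VD t1 tt ht; have CN1 := vd_CN VD; have tau1 := le_trans t1 tt.
have [e0|ne] := eqVneq tau t.
  move=> j _; rewrite e0 !subrr mulr0 dn_zero (_ : nm _ = 0)//; exact: nm_zero.
have tl : t < tau by rewrite lt_def ne.
set s := tau - t; have s0 : 0 < s by rewrite subr_gt0.
have s1 : s <= 1 by rewrite /s; lra.
have es : tau - s = t by rewrite /s; ring.
have := @vd_taylor _ _ _ _ _ _ _ _ _ VD tau s; rewrite s0 s1 es => /(_ isT t1) h.
have c0 t' : 1 <= t' -> cs (V t') by move=> h'; exact: (vb_cs (vd_bound VD h')).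
have cV := c0 _ t1; have cT := c0 _ tau1; have cW := vd_cst VD tau1.
have -> : V tau - V t = cst s * Vt tau - (V t - V tau + cst s * Vt tau) by apply/funext => x; ptw; ring.
have c1 : cs (cst s * Vt tau) by exact: csZ.
have c2 : cs (V t - V tau + cst s * Vt tau) by apply: csD => //; exact: csB.
apply: (HK_le (leqnn 1) (B := s * CN + CN * s ^+ 2)).
  have : s ^+ 2 <= s by rewrite expr2; nra.
  by move=> ss; rewrite (_ : 2 * CN * s = s * CN + CN * s); [apply: lerD => //; apply: ler_wpM2l => //; lra|ring].
apply: HK_add => //; first exact: csN.
  have := @HK_scale _ 1 _ s _ cW (HK_le (isT : (1 <= 4)%N) (lexx CN) (vd_Vt VD tau1)).
  by rewrite gtr0_norm.
by apply: HK_opp => //; exact: (HK_le (isT : (1 <= 4)%N) (lexx _) h).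
Qed.

Lemma In_sum_sqr (r : R) f g (A B : R) : 0 < r -> mb f -> mb g -> In (- r) r (fun x => f x ^+ 2) <= A -> In (- r) r (fun x => g x ^+ 2) <= B ->
  In (- r) r (fun x => (f x + g x) ^+ 2) <= 2 * A + 2 * B.
Proof.
move=> r0 mf mg hA hB; have mf2 := mb_sqr mf; have mg2 := mb_sqr mg.
apply: (@le_trans _ _ (In (- r) r (fun x => 2 * f x ^+ 2 + 2 * g x ^+ 2))).
  apply: In_le => [||x _].
  - by apply: mb_sqr; exact: mbD.
  - by apply: mbD; apply: mbM => //; exact: mbC.
  - by have := sqr_ge0 (f x - g x); rewrite sqrrB sqrrD; move: (f x ^+ 2) (g x ^+ 2) (f x * g x) => a b d; lra.
rewrite In_D ?In_Z//; try by apply: mbM => //; exact: mbC.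
by apply: lerD; apply: ler_wpM2l.
Qed.

(** With p = n / b^3 the main L^2 contribution is of order e^2 b^11 and that of the gradient e^2
    b^9, both within the wanted e^2 b^8. The gradient of the difference therefore needs no decay. *)
Lemma Hs_diff (n e b K1 K2 : R) f g : 1 <= n -> 0 < e -> 0 < b -> b <= 1 -> 0 <= K1 -> 0 <= K2 ->
  (forall x : R, is_derive x 1 f (g x)) -> continuous g ->
  (forall r, 0 < r -> In (- r) r (fun x => f x ^+ 2) <= K1 * (e ^+ 2 / n * b ^+ 14)) ->
  (forall r, 0 < r -> In (- r) r (fun x => g x ^+ 2) <= K2 * (n ^+ 3 * e ^+ 2)) ->
  (Hs_norm 4^-1 f <= ((5 * (2 * K1 + K2) + 1) * e * b ^+ 4)%:E)%E.
Proof.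
move=> n1 e0 b0 b1 K10 K20 df cg hf hg; have n0 : 0 < n by lra.
have b3 : 0 < b ^+ 3 by rewrite exprn_gt0.
apply: (Hs_le df cg hf hg (p := n / b ^+ 3)).
- exact: divr_gt0.
- by rewrite !mulr_ge0 ?exprn_ge0 ?(ltW e0) ?(ltW b0)//; lra.
have e1 : n / b ^+ 3 * (K1 * (e ^+ 2 / n * b ^+ 14)) = K1 * (e ^+ 2 * b ^+ 8 * b ^+ 3).
  by field; rewrite !gt_eqF.
have e2 : (K1 * (e ^+ 2 / n * b ^+ 14) + K2 * (n ^+ 3 * e ^+ 2)) / (n / b ^+ 3) ^+ 3 =
  K1 * (e ^+ 2 * b ^+ 8 * (b ^+ 15 / n ^+ 4)) + K2 * (e ^+ 2 * b ^+ 8 * b).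
  by field; rewrite !gt_eqF.
rewrite e1 e2 (_ : (_ * e * b ^+ 4) ^+ 2 = (5 * (2 * K1 + K2) + 1) ^+ 2 * (e ^+ 2 * b ^+ 8)); last by ring.
have u0 : 0 <= e ^+ 2 * b ^+ 8 by rewrite mulr_ge0 ?sqr_ge0// exprn_ge0// ltW.
have h1 : b ^+ 3 <= 1 by rewrite exprn_ile1// ltW.
have h2 : b ^+ 15 / n ^+ 4 <= 1.
  rewrite ler_pdivrMr ?exprn_gt0// mul1r; apply: (@le_trans _ _ 1); last by rewrite exprn_ege1.
  by rewrite exprn_ile1// ltW.
move: u0 h1 h2; move: (e ^+ 2 * b ^+ 8) (b ^+ 3) (b ^+ 15 / n ^+ 4) => u b' c' u0 h1 h2.
have i1 : K1 * (u * b') <= K1 * u by apply: ler_wpM2l => //; rewrite ler_piMr.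
have i2 : K1 * (u * c') <= K1 * u by apply: ler_wpM2l => //; rewrite ler_piMr.
have i3 : K2 * (u * b) <= K2 * u by apply: ler_wpM2l => //; rewrite ler_piMr.
apply: (@le_trans _ _ (5 * (2 * K1 + K2) * u)).
  rewrite (_ : 5 * (2 * K1 + K2) * u = 5 * (K1 * u + (K1 * u + K2 * u))); last by ring.
  by apply: ler_wpM2l => //; lra.
apply: ler_wpM2r => //; have z0 : 0 <= 5 * (2 * K1 + K2) by lra.
move: z0; move: (5 * (2 * K1 + K2)) => z z0.
by rewrite sqrrD1 -mulr_natl; have := sqr_ge0 z; lra.
Qed.

Lemma limit_solution (c K k4 B N rN m e CN : R) V Vt : Vdata c N rN m e CN V Vt -> 1 <= B -> 0 < K -> 0 <= k4 ->
  (forall T eps, 1 <= T -> 0 < eps -> eps <= 1 -> exists s W, family_bounds K k4 B N m V T s eps W) ->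
  exists v : nat -> R -> R -> R, [/\ mkdv_solution 4^-1 2 (fun x t => v 0 t x),
    forall t x, 1 <= t -> is_derive x 1 (v 0 t) (v 1 t x), forall t, 1 <= t -> continuous (v 1 t),
    forall t r, 1 <= t -> 0 < r -> In (- r) r (fun x => (v 0 t x - V t x) ^+ 2) <= (2 * (K * (m * bt t ^+ 7))) ^+ 2
  & forall t r, 1 <= t -> 0 < r -> In (- r) r (fun x => (v 1 t x - dx (V t) x) ^+ 2) <= ((k4 + 1) * (N * m)) ^+ 2].
Proof.
move=> VD B1 K0 k40 hF.
have hall n : exists a : R * (R -> R -> R), family_bounds K k4 B N m V n.+1%:R a.1 n.+1%:R^-1 a.2.
  have [||| s [W h]] := hF n.+1%:R n.+1%:R^-1.
  - by rewrite ler1n.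
  - by rewrite invr_gt0.
  - by rewrite invf_le1// ler1n.
  by exists (s, W).
have [a ha] := choice hall.
have [U [uU Uoo]] := ultraFilterLemma (eventually_filter : ProperFilter \oo).
have [N1 _ _ m0 _ _ _ _ _] := vd_scales VD ltr01 (lexx 1); have N0 : 0 < N by lra.
have CN1 := vd_CN VD.
have cV t : 1 <= t -> cs (V t) by move=> t1; exact: (vb_cs (vd_bound VD t1)).
have hV t : 1 <= t -> HK 2 (2 * CN) (V t).
  by move=> t1; apply: (HK_le (isT : (2 <= 8)%N) _ (vd_V8 VD t1)); lra.
have hVt t tau : 1 <= t -> t <= tau -> tau <= t + 1 -> HK 1 (2 * CN * (tau - t)) (V tau - V t) by exact: (approximate_time VD).
pose v k t x := vl (fun n => (a n).2) U k t x; exists v.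
have vdx k t x : 1 <= t -> (k <= 2)%N -> is_derive x 1 (v k t) (v k.+1 t x) by exact: (vl_dx uU Uoo B1 ha).
have C0 : 0 <= 2 * C1 B by apply: mulr_ge0 => //; exact: C1_ge0.
have vdt t x : 1 < t -> is_derive t 1 (fun t => v 0 t x) (- v 3 t x + 6 * (v 0 t x ^+ 2 * v 1 t x)) by exact: (vl_dt uU Uoo B1 ha).
have vc k t x : 1 < t -> (k <= 3)%N -> {for (x, t), continuous (fun p : R * R => v k p.2 p.1)} by exact: (vl_joint uU Uoo B1 ha).
have vL2 k t r : 1 <= t -> (k <= 1)%N -> 0 < r -> In (- r) r (fun x => v k t x ^+ 2) <= B ^+ 2 by exact: (vl_L2 uU Uoo B1 ha).
have vL2t k t t' r : 1 <= t -> t < t' -> (k <= 1)%N -> 0 < r -> In (- r) r (fun x => (v k t' x - v k t x) ^+ 2) <= (2 * C1 B * (t' - t)) ^+ 2.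
  by rewrite (_ : 2 * C1 B * (t' - t) = 2 * (t' - t) * C1 B); [exact: (vl_L2_time uU Uoo B1 ha)|ring].
split.
- exact: (@field_solution R v B (2 * C1 B) vdx vdt vc vL2 vL2t C0 2 (ltr1n R 2)).
- by move=> t x t1; exact: vdx.
- by move=> t t1; exact: (@field_cont R v vdx 1 t t1 isT).
- by move=> t r; exact: (vl_L2_V uU Uoo K0 m0 ha cV hV hVt).
by move=> t r; exact: (vl_L2_dV uU Uoo K0 k40 N0 m0 ha cV hV hVt).
Qed.

End assembly.

Theorem theorem11 (R : realType) (w : R -> R)
    (w_smooth : smooth w) (w_supp : compactly_supported w) :
  exists eps0 N0 C : R, [/\ 0 < eps0, 0 < N0, 0 < C &
    forall eps N : R, 0 < eps -> eps < eps0 -> N0 < N ->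
    exists v : R -> R -> R,
      mkdv_solution 4^-1 2 v /\
      forall t : R, 2 <= t ->
      [/\ (Hs_norm 4^-1 (fun x => mkdv_approx w eps N x t) <= (C * eps)%:E)%E,
          (exists y : R, w y != 0) ->
          (eps%:E <= C%:E * Hs_norm 4^-1 (fun x => mkdv_approx w eps N x t))%E
        & (Hs_norm 4^-1 (fun x => (v x t - mkdv_approx w eps N x t)%R)
           <= (C * eps * t `^ (- 2^-1))%:E)%E]].
Proof.
have [Z [Z1 hw]] := supp_bound w_supp.
have [c [c0 hV]] := approximate_Vdata w_smooth Z1 hw.
have [K [k4 [e0 [[K0 k40 e00] hF]]]] := approx_family c0.
have [C1 [C10 hC1]] := main_Hs_le w_smooth Z1 hw.
(* For w = 0 no lower bound is claimed, and [C2] and [n1] are arbitrary. *)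
have [C2 [n1 [C20 n11 hC2]]] : exists C2 n1 : R, [/\ 0 < C2, 1 <= n1 & (exists y, w y != 0) ->
    forall n e t, env Z n e -> n1 <= n -> 1 <= t -> ((C2 * e)%:E <= Hs_norm 4^-1 (main_f w n e t))%E].
  have [hy|hy] := pselect (exists y, w y != 0); last by exists 1, 1.
  by have [C2 [n1 [h1 h2 h3]]] := main_Hs_ge w_smooth Z1 hw hy; exists C2, n1.
have [C3 [C30 hC3]] := cEV_nm w_smooth Z1 hw (a := 2) (k := 16) good_third.
(* From (a + b)^2 <= 2 a^2 + 2 b^2 for v - V and the third harmonic V - v^[w]; 8 K^2 is twice the
   square of 2 K. *)
pose K1 := 8 * K ^+ 2 + 2 * C3 ^+ 2; pose K2 := 2 * (k4 + 1) ^+ 2 + 2 * C3 ^+ 2.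
have K10 : 0 <= K1 by apply: addr_ge0; apply: mulr_ge0 => //; exact: sqr_ge0.
have K20 : 0 <= K2 by apply: addr_ge0; apply: mulr_ge0 => //; exact: sqr_ge0.
pose C4 := 5 * (2 * K1 + K2) + 1; have C40 : 0 < C4 by rewrite /C4; lra.
have C20' : 0 < C2^-1 by rewrite invr_gt0.
(* The square makes the root of N at least Z + 1 + n1, so that both [env] and the lower bound
   apply. *)
exists (Num.min 1 e0), ((Z + 1 + n1) ^+ 2), (C1 + C2^-1 + C4); split.
- by rewrite lt_min ltr01.
- by rewrite exprn_gt0//; lra.
- by apply: addr_gt0 => //; exact: addr_gt0.
move=> e N e_gt0; rewrite lt_min => /andP[e1 ee0] hN.
pose n := Num.sqrt N; have hn : Z + 1 + n1 <= n.
  by rewrite -(sqrtr_sqr_ge0 (_ : 0 <= Z + 1 + n1)); [apply: ler_wsqrtr; exact: ltW|lra].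
have E : env Z n e by split; lra.
have n0 : 0 < n by lra.
have [CN VD] := hV n e E; have [B [B1 hB]] := hF _ _ _ _ _ _ _ VD (ltW ee0).
have [v [hsol vdx vc vL2 vL2d]] := limit_solution VD B1 K0 k40 hB.
exists (fun x t => v 0 t x); split => // t t2; have t1 : 1 <= t by lra.
have t0 : 0 < t by lra.
have -> : (fun x => mkdv_approx w e N x t) = main_f w n e t by exact: (mkdv_approxE hw E t1).
split.
- apply: (le_trans (hC1 n e t E t1)); rewrite lee_fin; apply: ler_wpM2r; first exact: ltW.
  by rewrite -addrA lerDl addr_ge0// ltW.
- move=> hy; have nn1 : n1 <= n by lra.
  have h := hC2 hy n e t E nn1 t1.
  have C20e : (0 <= C2^-1%:E :> \bar R)%E by rewrite lee_fin ltW.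
  have h1 := lee_wpmul2l C20e h.
  have ee : e%:E = (C2^-1%:E * (C2 * e)%:E)%E by rewrite -EFinM mulrA mulVf ?mul1r// gt_eqF.
  rewrite ee; apply: (le_trans h1); apply: lee_wpmul2r; first exact: Hs_norm_ge0.
  by rewrite lee_fin addrAC lerDr addr_ge0// ltW.
have em t' : mkdv_approx w e N t' t = main_f w n e t t' by have := congr1 (@^~ t') (mkdv_approxE hw E t1).
have -> : (fun x => v 0 t x - mkdv_approx w e N x t) = (fun x => v 0 t x - main_f w n e t x) by apply/funext => x; rewrite em.
have cm := main_cs w_smooth Z1 hw E t0; have cV : cs (app_V w n e t) by exact: (vb_cs (vd_bound VD t1)).
have b0 := bt_gt0 t0; have b1 := bt_le1 t1.
have s0 : 0 < Num.sqrt n by rewrite sqrtr_gt0.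
have m2 : (e / Num.sqrt n) ^+ 2 = e ^+ 2 / n by rewrite expr_div_n sqr_sqrtr// ltW.
have m0 : 0 <= e / Num.sqrt n by apply: divr_ge0; exact: ltW.
apply: (@le_trans _ _ (C4 * e * bt t ^+ 4)%:E); last first.
  rewrite lee_fin bt4//; apply: ler_wpM2r; first exact: powR_ge0.
  by apply: ler_wpM2r; [exact: ltW|rewrite lerDr addr_ge0// ltW].
have c3 := csB cV cm; have [h1 h2] := hC3 n e t E t1.
rewrite -app_V_main in h1; rewrite -app_V_main in h2.
have n1' : 1 <= n by lra.
have [d0 d1] := dd_bounds E.
have dd1 : dd n ^+ 2 <= 1 by rewrite exprn_ile1// ltW.
have bb : bq t ^+ 16 = bt t ^+ 8 by rewrite (_ : 16%N = (2 * 8)%N)// exprM bq2.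
have bl k : bt t ^+ k <= 1 by rewrite exprn_ile1// ltW.
have b7 : bt t ^+ 8 <= bt t ^+ 7 by rewrite exprS ler_piMl// exprn_ge0// ltW.
have b80 : 0 <= bt t ^+ 8 by rewrite exprn_ge0// ltW.
(* The third harmonic has a decay b^8 in L^2, from weight 16, faster than the b^7 of v - V; it does
   not limit the rate. *)
have g1 : nm (app_V w n e t - main_f w n e t) <= C3 * (bt t ^+ 7 * (e / Num.sqrt n)).
  apply: (le_trans h1); apply: ler_wpM2l => //; apply: ler_wpM2r => //; rewrite bb.
  by apply: le_trans b7; rewrite ler_piMl.
have g2 : nm (dx (app_V w n e t - main_f w n e t)) <= C3 * (n ^+ 2 * (e / Num.sqrt n)).
  apply: (le_trans h2); apply: ler_wpM2l => //; rewrite ler_piMl//; first by apply: mulr_ge0 => //; exact: sqr_ge0.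
  rewrite bb; apply: le_trans (bl 8%N); by rewrite ler_piMl.
have b70 : 0 <= bt t ^+ 7 by rewrite exprn_ge0// ltW.
have mv : mb (fun x => v 0 t x - app_V w n e t x).
  apply: continuous_mb => x; apply: cvgB; last exact: cs_cont cV x.
  by apply: (@is_derive_cont _ _ (v 1 t)) => y; exact: vdx.
have mv1 : mb (fun x => v 1 t x - dx (app_V w n e t) x).
  by apply: continuous_mb => x; apply: cvgB; [exact: vc|exact: cs_cont (cs_der cV) x].
apply: (@Hs_diff R n e (bt t) K1 K2 _ (fun x => v 1 t x - dx (main_f w n e t) x)) => //.
- move=> x; have i1 := vdx t x t1; have i2 := dble_is_derive x (cs_dble cm); exact: is_deriveB.
- by move=> x; apply: cvgB; [exact: vc|exact: cs_cont (cs_der cm) x].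
- move=> r r0.
  have -> : (fun x => (v 0 t x - main_f w n e t x) ^+ 2) = (fun x => ((v 0 t x - app_V w n e t x) + (app_V w n e t - main_f w n e t) x) ^+ 2).
    by apply/funext => x; congr (_ ^+ 2); ptw; ring.
  apply: (le_trans (In_sum_sqr r0 mv (continuous_mb (cs_cont c3)) (vL2 t r t1 r0) (le_trans (In_nn r c3) _))).
    rewrite -nm2; apply: lerXn2r g1; rewrite nnegrE; [exact: nm_ge0|].
    by apply: mulr_ge0 => //; exact: mulr_ge0.
  rewrite -m2 /K1; move: (e / Num.sqrt n) (bt t) => a b; rewrite le_eqVlt; apply/orP; left; apply/eqP; ring.
move=> r r0.
have -> : (fun x => (v 1 t x - dx (main_f w n e t) x) ^+ 2) = (fun x => ((v 1 t x - dx (app_V w n e t) x) + dx (app_V w n e t - main_f w n e t) x) ^+ 2).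
  apply/funext => x; congr (_ ^+ 2); rewrite dx_add ?dx_opp//; last exact: csN.
  by ptw; ring.
apply: (le_trans (In_sum_sqr r0 mv1 (continuous_mb (cs_cont (cs_der c3))) (vL2d t r t1 r0) (le_trans (In_nn r (cs_der c3)) _))).
  rewrite -nm2; apply: lerXn2r g2; rewrite nnegrE; [exact: nm_ge0|].
  by apply: mulr_ge0 => //; apply: mulr_ge0 => //; exact: sqr_ge0.
have -> : n ^+ 3 * e ^+ 2 = n ^+ 4 * (e / Num.sqrt n) ^+ 2 by rewrite m2; field; rewrite gt_eqF.
rewrite /K2; move: (e / Num.sqrt n) => a; rewrite le_eqVlt; apply/orP; left; apply/eqP; ring.
Qed.
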